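(* Let $f$ be a holomorphic cusp form of weight $\kappa$ or a Maass cusp form of Laplace eigenvalue $\frac14+\mu^2$ for $SL(2,\mathbb{Z})$, and denote by $\lambda_f(n)$ its $n$-th Hecke eigenvalue. Let $\theta$ be a real number such that $\lambda_f(n)\ll n^{\theta+\varepsilon}$ for any $\varepsilon>0$ (and all $n\ge1$). Then for $X>1$ and any $\varepsilon>0$, we have $$ \sum_{n\leq X}\lambda_f(n+h)\,r(n)\ll_{f,\varepsilon} X^{1-\frac{1-4\theta}{8}+\varepsilon} $$ uniformly for integers $1\leq h\leq X$ (i.e. the implied constant depends only on $f$ and $\varepsilon$, not on $X$ or $h$).
   Context: $r(n)=\#\{(n_1,n_2)\in\mathbb{Z}^2:n_1^2+n_2^2=n\}$; the sum is over integers $1\le n\le X$. The form $f$ is a Hecke eigenform, and its Hecke eigenvalues are normalized in the standard analytic way, so that the Ramanujan–Petersson conjecture reads $\lambda_f(n)\ll n^{\varepsilon}$: in the holomorphic case $f$ is, up to a constant multiple, $\sum_{n\ge1}\lambda_f(n)n^{(\kappa-1)/2}e(nz)$ with $\lambda_f(1)=1$ and $e(x)=e^{2\pi i x}$; in the Maass case (weight $0$) $T_nf=\lambda_f(n)f$ with $(T_nf)(z)=n^{-1/2}\sum_{ad=n}\sum_{b \bmod d}f\left(\frac{az+b}{d}\right)$. *)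

(* Defs.v *)
From Stdlib Require Import Reals ZArith List FinFun Lra Lia.
From Coquelicot Require Import Coquelicot.

(** Stdlib reals with Coquelicot's complex numbers.  Functions on the upper
    half-plane are total functions [C -> C]; only their values at [z] with
    [0 < Im z] are ever used, and derivatives are only taken at such points. *)

Definition upper (z : C) : Prop := 0 < Im z.

(** e(z) = exp(2 pi i z), which Coquelicot does not provide. *)
Definition e2pi (z : C) : C :=
  (RtoC (exp (- (2 * PI * Im z)))
   * (cos (2 * PI * Re z), sin (2 * PI * Re z)))%C.

(** Weight 0 is invariance under SL(2,Z). *)
Definition modular (kappa : nat) (f : C -> C) : Prop :=
  forall a b c d : Z, (a * d - b * c)%Z = 1%Z ->
  forall z : C, upper z ->
    f ((RtoC (IZR a) * z + RtoC (IZR b)) / (RtoC (IZR c) * z + RtoC (IZR d)))%C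
    = (Cpow (RtoC (IZR c) * z + RtoC (IZR d)) kappa * f z)%C.

Definition nonzero_on_upper (f : C -> C) : Prop :=
  exists z : C, upper z /\ f z <> RtoC 0.

(** The n-th Hecke operator of weight kappa in the analytic normalization,
      n^((kappa-1)/2) sum_(ad = n) d^(-kappa) sum_(b mod d) f((az+b)/d),
    whose factor in front of the inner sum is n^(-1/2) for kappa = 0.  On a
    weight kappa form sum_m a(m) m^((kappa-1)/2) e(mz), the first normalized
    coefficient of its image is a(n). *)
Definition hecke (kappa n : nat) (f : C -> C) (z : C) : C :=
  (RtoC (Rpower (INR n) ((INR kappa - 1) / 2)) *
   sum_n_m (fun d : nat =>
     if Nat.eqb (n mod d) 0 then
       RtoC (/ INR d ^ kappa) *
       sum_n_m (fun b : nat =>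
         f ((RtoC (INR (n / d)) * z + RtoC (INR b)) / RtoC (INR d)))
         0 (d - 1)
     else RtoC 0) 1 n)%C.

Definition hecke_eigen (kappa : nat) (f : C -> C) (lam : nat -> C) : Prop :=
  forall n : nat, (1 <= n)%nat ->
  forall z : C, upper z -> hecke kappa n f z = (lam n * f z)%C.

Definition holomorphic_cusp_form (kappa : nat) (f : C -> C) : Prop :=
  (forall z : C, upper z -> ex_derive (K := C_AbsRing) (V := C_NormedModule) f z)
  /\ modular kappa f
  /\ exists a : nat -> C, forall z : C, upper z ->
       is_series (K := C_AbsRing) (V := C_NormedModule)
         (fun m : nat => (a (S m) * e2pi (RtoC (INR (S m)) * z))%C) (f z).

(** [f] is, up to a constant multiple,
    sum_(n >= 1) lam(n) n^((kappa-1)/2) e(nz) with lam(1) = 1. *)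
Definition normalized_expansion (kappa : nat) (f : C -> C) (lam : nat -> C)
  : Prop :=
  lam 1%nat = RtoC 1 /\
  exists c : C, forall z : C, upper z ->
    is_series (K := C_AbsRing) (V := C_NormedModule)
      (fun m : nat =>
         (c * (lam (S m) * RtoC (Rpower (INR (S m)) ((INR kappa - 1) / 2))
               * e2pi (RtoC (INR (S m)) * z)))%C) (f z).

Definition holomorphic_hecke_cusp_form
  (kappa : nat) (f : C -> C) (lam : nat -> C) : Prop :=
  holomorphic_cusp_form kappa f /\ nonzero_on_upper f /\
  hecke_eigen kappa f lam /\ normalized_expansion kappa f lam.

(** C^infinity in the real coordinates (x, y) of z = x + iy. *)
Definition smooth_on_upper (f : C -> C) : Prop :=
  forall (k : nat) (x y : R), 0 < y ->
    ex_diff_n (fun u v => Re (f (u, v))) k x y /\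
    ex_diff_n (fun u v => Im (f (u, v))) k x y.

Definition euclid_laplacian (g : R -> R -> R) (x y : R) : R :=
  Derive_n (fun u => g u y) 2 x + Derive_n (fun v => g x v) 2 y.

(** - y^2 (d^2/dx^2 + d^2/dy^2), acting on real and imaginary parts. *)
Definition hyp_laplacian (f : C -> C) (z : C) : C :=
  let (x, y) := z in
  (- y ^ 2 * euclid_laplacian (fun u v => Re (f (u, v))) x y,
   - y ^ 2 * euclid_laplacian (fun u v => Im (f (u, v))) x y).

Definition moderate_growth (f : C -> C) : Prop :=
  exists (N : nat) (A : R), forall x y : R, 1 <= y ->
    Cmod (f (x, y)) <= A * y ^ N.

(** The spectral parameter [mu] is allowed to be any complex number. *)
Definition maass_cusp_form (mu : C) (f : C -> C) : Prop :=
  smooth_on_upper f /\ modular 0 f /\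
  (forall z : C, upper z ->
     hyp_laplacian f z = ((RtoC (1 / 4) + mu * mu) * f z)%C) /\
  moderate_growth f /\
  (forall y : R, 0 < y ->
     is_RInt (V := C_R_NormedModule) (fun x => f (x, y)) 0 1 (RtoC 0)).

Definition maass_hecke_cusp_form
  (mu : C) (f : C -> C) (lam : nat -> C) : Prop :=
  maass_cusp_form mu f /\ nonzero_on_upper f /\ hecke_eigen 0 f lam.

(** The list is exhaustive, since n1^2 + n2^2 = n forces |n1|, |n2| <= n;
    see [two_squares_spec]. *)
Definition two_squares (n : nat) : list (Z * Z) :=
  let box := map (fun k => (Z.of_nat k - Z.of_nat n)%Z) (seq 0 (2 * n + 1)) in
  filter (fun p => (fst p * fst p + snd p * snd p =? Z.of_nat n)%Z)
         (list_prod box box).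

Definition r2 (n : nat) : nat := length (two_squares n).

Lemma two_squares_spec (n : nat) :
  NoDup (two_squares n) /\
  forall n1 n2 : Z,
    In (n1, n2) (two_squares n) <-> (n1 * n1 + n2 * n2)%Z = Z.of_nat n.
Proof.
  assert (Hprod : forall (l l' : list Z), NoDup l -> NoDup l' ->
                  NoDup (list_prod l l')).
  { intros l l' Hl Hl'. induction Hl as [|a l Ha _ IH]; simpl; [constructor|].
    apply NoDup_app; auto.
    - apply Injective_map_NoDup; auto. intros u v E; congruence.
    - intros [u v] H1 H2. apply in_map_iff in H1. destruct H1 as [w [E _]].
      apply in_prod_iff in H2. injection E as -> ->. tauto. }
  unfold two_squares. split.
  - apply NoDup_filter, Hprod;
      (apply Injective_map_NoDup; [intros u v E; lia | apply seq_NoDup]).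
  - assert (Hbox : forall m : Z, (m * m <= Z.of_nat n)%Z ->
      In m (map (fun k => (Z.of_nat k - Z.of_nat n)%Z) (seq 0 (2 * n + 1)))).
    { intros m Hm. apply in_map_iff. exists (Z.to_nat (m + Z.of_nat n)).
      rewrite in_seq. assert (- Z.of_nat n <= m <= Z.of_nat n)%Z by nia.
      split; lia. }
    intros n1 n2. rewrite filter_In, in_prod_iff. simpl. rewrite Z.eqb_eq.
    split; [tauto | intros E; repeat split; try apply Hbox; nia].
Qed.

Definition eigenvalue_bound (lam : nat -> C) (theta : R) : Prop :=
  forall eps : R, 0 < eps ->
  exists A : R, forall n : nat, (1 <= n)%nat ->
    Cmod (lam n) <= A * Rpower (INR n) (theta + eps).

(** Sum over integers 1 <= n <= X, for X >= 0 ([Int_part] is the floor). *)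
Definition shifted_sum (lam : nat -> C) (X : R) (h : nat) : C :=
  sum_n_m (fun n : nat => (lam (n + h)%nat * RtoC (INR (r2 n)))%C)
          1 (Z.to_nat (Int_part X)).

(* Main.v *)
(** Jacobi's formula r(n) = 4 sum_(d | n) chi_4(d) and Dirichlet's hyperbola
    method reduce the sum to sums of lam(n) over arithmetic progressions whose
    modulus q is at most 4 sqrt X. On the horizontal line of height about 1/n the
    Fourier coefficients of the form detect lam(n); an additive character modulo q
    moves the line to the cusps a/c with c | q, and modularity turns the sum over a
    into Kloosterman sums, for which Weil's bound gives square-root cancellation
    (away from the primes dividing h or dividing c twice, whose contribution is
    small on average over q). Smoothing the ends of the progression over an
    interval of length Y costs Y X^theta / q by the assumed bound on lam, and the
    total X^(7/4 + eps) / Y + Y X^(theta + eps) is balanced by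
    Y = X^(7/8 - theta/2).

    Weil's bound is proved by Stepanov's method, applied to the curves
    y^p - y = a x + b / x. The coefficients satisfy lam(n) << n^(1/2) by Bessel's
    inequality, so only exponents theta <= 1/2 matter. *)

(* The exponent 7/4 is 1 + (3/2)(1/2). By modularity a fraction of denominator c brings the factor
   |c z|, and the sum over its numerators a Kloosterman sum of size about sqrt c. A progression
   modulo q thus costs X / (q Y) times the sum of c^(3/2) over c | q; summed over q <= Q this is
   about X Q^(3/2) / Y, and Q has the order of sqrt X.

   Uniformity in h rests on the shape of the residues: they are h modulo d, or j m + h modulo 4 m
   with j = 1 or 3, so that an odd prime dividing both the residue and the modulus divides h.

   Stepanov's method bounds the number of points from one side only. This suffices because
   Kloosterman sums are real: in even degree the power sum of each twist enters the point count with
   a sign for which the upper bound 2 p^m always holds, so one pair of real roots that is too large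
   already pushes the count below its lower bound, whatever the other twists do. *)
Require Defs.
From Stdlib Require Reals Lra Lia Psatz ZArith List.
From Coquelicot Require Coquelicot.
From HB Require structures.
From mathcomp Require all_boot all_order all_algebra all_field.
From mathcomp Require ring lra zify ssrZ complex Rstruct.

(** * Stepanov's method for the curves y^p - y = a x + b / x *)

Module Stepanov.
Import all_boot all_order all_algebra all_field.
Import mathcomp.algebra_tactics.ring mathcomp.algebra_tactics.lra zify.
Set Implicit Arguments. Unset Strict Implicit. Unset Printing Implicit Defensive.
Import GRing.Theory.
Local Open Scope ring_scope.

(** The coefficient matrix has more rows than columns, hence a nonzero left kernel: this count of
    unknowns supplies the auxiliary polynomial of Stepanov's method. *)
Lemma poly_lindep (K : fieldType) (I : finType) (v : I -> {poly K}) (E : nat) :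
  (forall i, (size (v i) <= E)%N) -> (E < #|I|)%N ->
  exists c : I -> K, (exists i, c i != 0) /\ \sum_i c i *: v i = 0.
Proof.
move=> sv lt_E.
pose M : 'M[K]_(#|I|, E) := \matrix_i poly_rV (v (enum_val i)).
have : kermx M != 0.
  rewrite -mxrank_eq0 mxrank_ker subn_eq0 -ltnNge.
  exact: leq_ltn_trans (rank_leq_col M) lt_E.
case/rowV0Pn => u /sub_kermxP uM u0.
exists (fun i => u 0 (enum_rank i)); split.
  have [j uj] : exists j, u 0 j != 0.
    apply/existsP; rewrite -negb_forall; apply: contra u0 => /forallP u0.
    by apply/eqP/rowP => j; rewrite mxE; apply/eqP; apply: u0.
  by exists (enum_val j); rewrite enum_valK.
apply/polyP => k; rewrite coef0 coef_sum.
case: (ltnP k E) => kE; last first.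
  rewrite big1 // => i _; rewrite coefZ nth_default ?mulr0 //.
  exact: leq_trans (sv i) kE.
have /(congr1 (fun w : 'rV_E => w 0 (Ordinal kE))) := uM.
rewrite !mxE => E0; rewrite -[RHS]E0.
rewrite (reindex_onto (@enum_val I I) enum_rank) /=; last by move=> i _; rewrite enum_rankK.
rewrite big_mkcond /=; apply: eq_bigr => j _.
by rewrite enum_valK eqxx coefZ !mxE.
Qed.

Section Bombieri.
Variables (K : closedFieldType) (p : nat) (pcharK : p \in [pchar K]).

Lemma frobD k (x y : K) : (x + y) ^+ (p ^ k) = x ^+ (p ^ k) + y ^+ (p ^ k).
Proof.
apply: exprDn_pchar; rewrite pnatX pnatE ?(pcharf_prime pcharK) //.
by rewrite pcharK orTb.
Qed.

Lemma prime_p : prime p. Proof. exact: pcharf_prime pcharK. Qed.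

Lemma expp_gt0 k : (0 < p ^ k)%N. Proof. by rewrite expn_gt0 prime_gt0 ?prime_p. Qed.

Lemma frob_sum k (I : finType) (F : I -> K) :
  (\sum_i F i) ^+ (p ^ k) = \sum_i F i ^+ (p ^ k).
Proof.
apply: (big_morph (fun x => x ^+ (p ^ k))); first exact: frobD.
by rewrite expr0n gtn_eqF // expp_gt0.
Qed.

Lemma root_exists (n : nat) (a : K) : (0 < n)%N -> exists x : K, x ^+ n == a.
Proof.
move=> n0; have /closed_rootP[x] : size ('X^n - a%:P : {poly K}) != 1.
  by rewrite size_XnsubC // eqSS -lt0n.
by rewrite rootE !hornerE subr_eq0; exists x.
Qed.

Lemma root_fun (n : nat) : (0 < n)%N -> exists r : K -> K, forall a, r a ^+ n = a.
Proof.
move=> n0; exists (fun a => xchoose (root_exists a n0)) => a.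
exact/eqP/(xchooseP (root_exists a n0)).
Qed.

(** The degree is recorded through two digits in base q because the lower one separates the two
    parts of the polynomial [G] in [bombieri_squares]. *)
Lemma size_sparse (q : nat) (m n : nat) (d : 'I_m * 'I_n -> K) :
  let P := \sum_i d i *: 'X^(i.2 + i.1 * q) in
  P != 0 -> exists i : 'I_m * 'I_n, size P = (i.2 + i.1 * q).+1.
Proof.
move=> P P0; have : lead_coef P != 0 by rewrite lead_coef_eq0.
rewrite lead_coefE /P coef_sum.
have [/existsP[i /eqP Hi] _ | Hn] :=
  boolP [exists i : 'I_m * 'I_n, (size P).-1 == i.2 + i.1 * q]%N.
  exists i; by rewrite -Hi prednK // size_poly_gt0.
rewrite big1 ?eqxx // => i _; rewrite coefZ coefXn.
move: Hn; rewrite negb_exists => /forallP/(_ i)/negbTE ->.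
by rewrite mulr0.
Qed.

(** As n <= q, the exponent determines its two digits, so no two monomials can cancel. *)
Lemma sparse_eq0 (q : nat) (m n : nat) (d : 'I_m * 'I_n -> K) : (n <= q)%N ->
  \sum_i d i *: 'X^(i.2 + i.1 * q) = 0 -> forall i, d i = 0.
Proof.
move=> nq P0 i; have := congr1 (fun P : {poly K} => P`_(i.2 + i.1 * q)) P0.
rewrite /= coef0 coef_sum (bigD1 i) //= coefZ coefXn eqxx mulr1.
rewrite big1 ?addr0 // => j jNi; rewrite coefZ coefXn; case: eqP; last by rewrite mulr0.
case: i j jNi => [a u] [b w] /= /eqP jNi E; case: jNi.
have u_q : (u < q)%N by apply: leq_trans nq.
have w_q : (w < q)%N by apply: leq_trans nq.
have q0 : (0 < q)%N by lia.
congr (_, _); apply: val_inj => /=.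
  have := congr1 (fun t => t %/ q)%N E.
  by rewrite /= !(addnC (_ : 'I_n) (_ * _)%N) !divnMDl // !divn_small ?addn0.
have := congr1 (fun t => t %% q)%N E.
by rewrite /= !(addnC (_ : 'I_n) (_ * _)%N) !modnMDl !modn_small.
Qed.

(* Stepanov's method in Bombieri's form, with q = p^k = 2e+1. Counting unknowns
    gives a nontrivial relation sum_a A_a^q X^a + h^(e+1) sum_a D_a^q X^a = 0;
    since h(x)^((q^2-1)/2) = h(x)^((q-1)(e+1)) = 1 on [s], the polynomial
    G = sum_a A_a X^(aq) + h^(e+1) sum_a D_a X^(aq) vanishes on [s]. It is
    nonzero because the exponents of its two parts differ modulo q. *)
Lemma bombieri_squares (k e g : nat) (h : {poly K}) (s : seq K) :
  (p ^ k = e.*2.+1)%N -> (g.*2.+1 < e)%N -> size h = g.*2.+2 -> uniq s ->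
  {in s, forall x, x ^+ (p ^ k * p ^ k) = x /\ h.[x] ^+ ((p ^ k * p ^ k).-1./2) = 1} ->
  (size s < (e + g + 1) * p ^ k)%N.
Proof.
set q := (p ^ k)%N => qE lt_ge sh us sP.
have q_gt0 : (0 < q)%N by rewrite qE.
have h0 : h != 0 by rewrite -size_poly_eq0 sh.
have sizeH : size (h ^+ e.+1) = (g * q + (g + e + 1)).+1.
  by rewrite -[LHS]prednK ?size_poly_gt0 ?expf_neq0 // size_exp sh /= qE; congr _.+1; nia.
have H0 : h ^+ e.+1 != 0 by rewrite expf_neq0.
(* With q = 2e + 1 there are (e+g+1) e + (e+1)(e-g) = 2e^2 + 2e - g unknowns against e q + g + 1 =
   2e^2 + e + g + 1 coefficients; the hypothesis 2g + 1 < e is exactly what makes the former exceed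
   the latter. *)
pose I := ('I_(e + g + 1) * 'I_e + 'I_e.+1 * 'I_(e - g))%type.
pose v (i : I) : {poly K} := match i with
  | inl i => 'X^(i.2 * q + i.1) | inr i => h ^+ e.+1 * 'X^(i.2 * q + i.1) end.
have [] := @poly_lindep K I v (e * q + g + 1).
- case=> [[a i]|[a i]] /=; rewrite ?size_polyXn ?size_mulXn // ?sizeH.
  + by have := ltn_ord a; have := ltn_ord i; rewrite qE; nia.
  + by have := ltn_ord a; have := ltn_ord i; rewrite qE; nia.
- by rewrite card_sum !card_prod !card_ord qE; nia.
move=> c [[i0 c_i0] cv0].
(* [r] extracts q-th roots, so that the coefficients of [cv0] are q-th powers of those of [P1] and
   [P2]. The two base q digits of the exponents are exchanged there; the q-th power undoes this on
   [s], where x^(q^2) = x. *)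
have [r rE] := root_fun q_gt0.
pose P1 := \sum_i r (c (inl i)) *: 'X^(i.2 + i.1 * q) : {poly K}.
pose P2 := \sum_i r (c (inr i)) *: 'X^(i.2 + i.1 * q) : {poly K}.
pose G := P1 + h ^+ e.+1 * P2.
have sP1 : (size P1 <= (e + g + 1) * q)%N.
  apply: leq_trans (size_sum _ _ _) _; apply/bigmax_leqP => -[a i] _ /=.
  apply: leq_trans (size_scale_leq _ _) _; rewrite size_polyXn.
  by have := ltn_ord a; have := ltn_ord i; rewrite qE; nia.
have sP2 : (size P2 <= e * q + (e - g))%N.
  apply: leq_trans (size_sum _ _ _) _; apply/bigmax_leqP => -[a i] _ /=.
  apply: leq_trans (size_scale_leq _ _) _; rewrite size_polyXn.
  by have := ltn_ord a; have := ltn_ord i; rewrite qE; nia.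
have sG : (size G <= (e + g + 1) * q)%N.
  apply: leq_trans (size_polyD _ _) _; rewrite geq_max sP1 /=.
  apply: leq_trans (size_polyMleq _ _) _; rewrite sizeH qE.
  by rewrite qE in sP2; nia.
have G0 : G != 0.
  apply/eqP => G0.
  have [P20|P20] := eqVneq P2 0.
    have P10 : P1 = 0 by move: G0; rewrite /G P20 mulr0 addr0.
    case: i0 c_i0 => i /eqP; apply.
      by rewrite -[LHS]rE (sparse_eq0 _ P10) ?expr0n -?lt0n ?gtn_eqF // qE; lia.
    by rewrite -[LHS]rE (sparse_eq0 _ P20) ?expr0n -?lt0n ?gtn_eqF // qE; lia.
  have EP : P1 = - (h ^+ e.+1 * P2) by apply/eqP; rewrite -addr_eq0 -/G G0.
  have P10 : P1 != 0 by rewrite EP oppr_eq0 mulf_neq0.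
  have [[a i] /= E1] := size_sparse P10.
  have [[b j] /= E2] := size_sparse P20.
  have := congr1 (fun P : {poly K} => size P) EP.
  rewrite /= size_polyN size_mul // sizeH E2 E1.
  have := ltn_ord i; have := ltn_ord j => lj li /= [E].
  have {}E : (a * q + i = (b + g) * q + (j + (g + e + 1)))%N by lia.
  have := congr1 (fun t => t %% q)%N E.
  by rewrite /= !modnMDl !modn_small; lia.
have Groot x : x \in s -> root G x.
  move=> /sP [xq hx]; apply/rootP/eqP.
  suff : G.[x] ^+ q = 0 by move/eqP; rewrite expf_eq0 q_gt0.
  have xE (a i : nat) : (x ^+ (i + a * q)) ^+ q = x ^+ (i * q + a).
    by rewrite -exprM mulnDl -mulnA (mulnC a) [LHS]exprD [x ^+ (_ * a)]exprM xq -exprD.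
  have hq : (h.[x] ^+ e.+1) ^+ q = h.[x] ^+ e.+1.
    have -> : (h.[x] ^+ e.+1) ^+ q = h.[x] ^+ ((q * q).-1./2 + e.+1).
      by rewrite -exprM; congr (_ ^+ _); rewrite qE; nia.
    by rewrite exprD hx mul1r.
  rewrite /G hornerD hornerM horner_exp !horner_sum frobD exprMn hq !frob_sum.
  have := congr1 (fun P : {poly K} => P.[x]) cv0.
  rewrite /= horner0 horner_sum big_sumType /= => E.
  rewrite -[RHS]E; congr (_ + _); rewrite ?mulr_sumr; apply: eq_bigr => -[a i] _ /=.
    by rewrite !hornerE exprMn rE xE.
  by rewrite !hornerE exprMn rE xE mulrA [_ * c _]mulrC.
apply: leq_trans (max_poly_roots G0 _ us) sG.
by apply/allP => x xs; apply: Groot.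
Qed.

(* The copy of the field with p^n elements inside [K]. *)
Definition fixed_seq n : seq K :=
  sval (closed_field_poly_normal ('X^(p ^ n) - 'X : {poly K})).

Lemma fixed_seqP n : (0 < n)%N ->
  [/\ uniq (fixed_seq n), size (fixed_seq n) = (p ^ n)%N &
      forall x, (x \in fixed_seq n) = (x ^+ (p ^ n) == x)].
Proof.
rewrite /fixed_seq; case: closed_field_poly_normal => E /= PE.
move=> n0; set q := (p ^ n)%N.
have q1 : (1 < q)%N by rewrite -(expn0 p) ltn_exp2l // prime_gt1 ?prime_p.
pose P : {poly K} := 'X^q - 'X.
have sP : size P = q.+1.
  by rewrite size_polyDl ?size_polyXn // size_polyN size_polyX.
have P0 : P != 0 by rewrite -size_poly_eq0 sP.
have lP : lead_coef P = 1.
  by rewrite lead_coefDl ?size_polyN ?size_polyX ?size_polyXn // lead_coefXn.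
rewrite -/q -/P lP scale1r in PE; split.
- rewrite -separable_prod_XsubC -PE separable_poly.unlock derivB derivXn derivX.
  have -> : 'X^(q.-1) *+ q = 0 :> {poly K}.
    rewrite -mulr_natr -[q%:R](rmorph_nat (@polyC K)); have -> : q%:R = 0 :> K.
      by apply/eqP; rewrite -(dvdn_pcharf pcharK) /q -(prednK n0) expnS dvdn_mulr.
    by rewrite rmorph0 mulr0.
  by rewrite sub0r -scaleN1r coprimepZr ?oppr_eq0 ?oner_eq0 // coprimep1.
- by apply/eqP; rewrite -eqSS -(size_prod_XsubC E id) -PE sP.
- by move=> x; rewrite -root_prod_XsubC -PE rootE !hornerE subr_eq0.
Qed.

Lemma frobB k (x y : K) : (x - y) ^+ (p ^ k) = x ^+ (p ^ k) - y ^+ (p ^ k).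
Proof.
apply/eqP; rewrite eq_sym subr_eq -frobD addrNK eqxx //.
Qed.

Lemma frob1D (x y : K) : (x + y) ^+ p = x ^+ p + y ^+ p.
Proof. by have := frobD 1 x y; rewrite expn1. Qed.

Lemma expr_half_fixed (q : nat) (x : K) : odd q -> x ^+ q = x ->
  [|| x == 0, x ^+ q.-1./2 == 1 | x ^+ q.-1./2 == -1].
Proof.
case: q => // q /= oq; rewrite exprS => E; have [->//|x0] := eqVneq x 0.
rewrite -eqf_sqr expr1n -exprM muln2 halfK (negbTE oq) subn0 /=.
by rewrite -subr_eq0 -(mulrI_eq0 _ (mulfI x0)) mulrBr mulr1 E subrr.
Qed.

Lemma nat_frob (m : nat) : (m%:R : K) ^+ p = m%:R.
Proof. by rewrite -(pFrobenius_autE pcharK) pFrobenius_aut_nat. Qed.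

Lemma fixed_pow (x : K) k : x ^+ p = x -> x ^+ (p ^ k) = x.
Proof. by move=> xp; elim: k => [|k IH]; rewrite ?expn0 ?expr1 // expnS exprM xp. Qed.

(** Frobenius sends y0 to y0 + e0 and e0 to e0 or -e0. Two steps therefore add an element w of F_p,
    and p times two steps add p w = 0. This is why the extensions used have degree 2 p k. *)
Lemma twist_root (a b e0 y0 : K) (k : nat) : odd p -> a ^+ p = a -> b ^+ p = b ->
  e0 ^+ 2 = 4%:R * a * b -> y0 ^+ p - y0 = e0 -> y0 ^+ (p ^ (2 * (p * k))) = y0.
Proof.
move=> op ap bp e2 y0E.
have e4 : (e0 ^+ p) ^+ 2 = e0 ^+ 2.
  by rewrite exprAC e2 !exprMn ap bp nat_frob.
have [w_p] : exists2 w, w ^+ p = w & y0 ^+ (p ^ 2) = y0 + w.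
  exists (e0 + e0 ^+ p).
    rewrite frob1D addrC; congr (_ + _); move/eqP: e4; rewrite eqf_sqr.
    case/orP => /eqP E; first by rewrite E E.
    by rewrite E exprNn -signr_odd op expr1 mulN1r E opprK.
  have yp : y0 ^+ p = y0 + e0 by rewrite -y0E addrC subrK.
  by rewrite expnS expn1 exprM yp frob1D yp addrA.
move=> wp y2; have Hj j : y0 ^+ (p ^ (2 * j)) = y0 + w_p *+ j.
  elim: j => [|j IH]; first by rewrite muln0 expn0 expr1 addr0.
  rewrite mulnS addnC expnD exprM IH frobD y2 -addrA mulrS; congr (_ + _).
  by rewrite fixed_pow // -mulr_natr exprMn nat_frob wp.
by rewrite Hj -[w_p *+ _]mulr_natr natrM (pcharf0 pcharK) mul0r mulr0 addr0.
Qed.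

Lemma count_arith (r q0 q N c0 c1 c2 : nat) : (0 < r)%N -> (0 < q0)%N ->
  (q = c0 + c1 + c2 -> c0 <= 2 * r -> 2 * c2 <= q + (2 * r - 1) * q0 + 2 ->
   2 * c1 <= N -> q <= N + (6 * r + 2) * q0)%N.
Proof.
move=> r0 q00 qE L0 L2 L1; have : (r <= r * q0)%N by rewrite leq_pmulr.
by move: L2; rewrite mulnBl mulnDl; lia.
Qed.

(* Solvability in x is governed by the discriminant (y^p - y)^2 - 4ab. The
    substitution y = y0 + 1/t with y0^p - y0 = e0 and e0^2 = 4ab turns it, up to
    squares, into a polynomial in t of odd degree 2p - 1, and bombieri_squares
    applied to a nonsquare multiple of it bounds the number of unsolvable y. *)
Lemma count_pairs (a b : K) (k : nat) (E : seq K) (q0 := (p ^ (p * k))%N) :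
  odd p -> a ^+ p = a -> b ^+ p = b -> a != 0 -> b != 0 ->
  (4 * p < q0)%N -> uniq E -> size E = (q0 * q0)%N ->
  (forall x, (x \in E) = (x ^+ (q0 * q0) == x)) ->
  (q0 * q0 <= \sum_(y <- E) count (fun x : K => (x != 0) && (y ^+ p - y == a * x + b / x))%R E
     + (6 * p + 2) * q0)%N.
Proof.
move=> op ap bp a0 b0 q0_big uE sE EP; set q := (q0 * q0)%N in sE EP *.
have p_gt0 : (0 < p)%N by rewrite prime_gt0 ?prime_p.
have oq0 : odd q0 by rewrite oddX op orbT.
have oq : odd q by rewrite oddM oq0.
have q_gt0 : (0 < q)%N by rewrite odd_gt0.
have q1E : (2 * q.-1./2 = q.-1)%N.
  by rewrite mul2n even_halfK // -subn1 oddB // oq.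
have qE : q = (p ^ (2 * (p * k)))%N by rewrite /q -expnD addnn mul2n.
have two0 : 2%:R != 0 :> K.
  by rewrite -(dvdn_pcharf pcharK) gtnNdvd // odd_prime_gt2 // prime_p.
have four0 : 4%:R != 0 :> K by rewrite (natrM _ 2 2) mulf_neq0.
have qD (x y : K) : (x + y) ^+ q = x ^+ q + y ^+ q by rewrite qE frobD.
have qB (x y : K) : (x - y) ^+ q = x ^+ q - y ^+ q by rewrite qE frobB.
have aq : a ^+ q = a by rewrite qE fixed_pow.
have bq : b ^+ q = b by rewrite qE fixed_pow.
have natq m : (m%:R : K) ^+ q = m%:R by rewrite qE fixed_pow // nat_frob.
pose D (y : K) : K := (y ^+ p - y) ^+ 2 - 4%:R * a * b.
have Dq (y : K) : y ^+ q = y -> D y ^+ q = D y.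
  by move=> yq; rewrite /D qB [X in X - _]exprAC qB [X in (X - _) ^+ 2]exprAC yq !exprMn aq bq natq.
pose chi (y : K) : K := D y ^+ q.-1./2.
have [e0 /eqP e2] := root_exists (4%:R * a * b) (isT : (0 < 2)%N).
have e00 : e0 != 0.
  rewrite -sqrf_eq0 e2 !mulf_neq0 // (natrM _ 2 2) mulf_neq0 //.
have [y0 /eqP y0E] : exists y0 : K, y0 ^+ p - y0 == e0.
  have sP : size ('X^p - 'X - e0%:P : {poly K}) = p.+1.
    by rewrite -addrA size_polyDl ?size_polyXn // -opprD size_polyN size_XaddC ltnS prime_gt1 // prime_p.
  have /closed_rootP[x] : size ('X^p - 'X - e0%:P : {poly K}) != 1 by rewrite sP eqSS -lt0n.
  by rewrite rootE !hornerE subr_eq0; exists x.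
have y0q : y0 ^+ q = y0 by rewrite qE; apply: twist_root e2 y0E.
have q12 : (0 < q.-1./2)%N by rewrite half_gt0; nia.
(* [nu] plays the nonsquare: it turns the value -1 of the quadratic character [chi] into the 1
   required by [bombieri_squares]. *)
have [nu /eqP nuE] := root_exists (-1 : K) q12.
have nu0 : nu != 0.
  by apply/eqP => n0; move/eqP: nuE; rewrite n0 expr0n gtn_eqF // eq_sym oppr_eq0 oner_eq0.
have splitE : (q = count (fun y : K => D y == 0)%R E + count (fun y : K => chi y == 1)%R E
       + count (fun y : K => chi y == -1)%R E)%N.
  rewrite -sE; have : all (fun y => y ^+ q == y) E by apply/allP => y; rewrite EP.
  have q1Nq1 : (1 == -1 :> K) = false by rewrite -subr_eq0 opprK -(natrD _ 1 1) (negbTE two0).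
  clear uE sE EP; elim: E => //= y E IH /andP[/eqP yq /IH ->].
  have := expr_half_fixed oq (Dq _ yq); rewrite -/(chi y).
  have [D0|D0] := eqVneq (D y) 0.
    by rewrite /chi D0 expr0n gtn_eqF // !(eq_sym 0) oner_eq0 oppr_eq0 oner_eq0 /= !add0n add1n !addSn.
  case: (eqVneq (chi y) 1) => [->|_] /=; rewrite ?q1Nq1 //=.
    by rewrite !add0n add1n addnS addSn.
  by move=> -> /=; rewrite !add0n add1n addnS.
have zeroE : (count (fun y : K => D y == 0)%R E <= 2 * p)%N.
  pose P : {poly K} := ('X^p - 'X) ^+ 2 - (4%:R * a * b)%:P.
  have sX : size ('X^p - 'X : {poly K}) = p.+1.
    by rewrite size_polyDl ?size_polyXn // size_polyN size_polyX ltnS prime_gt1 // prime_p.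
  have sP : size P = (2 * p).+1.
    have sX2 : size (('X^p - 'X : {poly K}) ^+ 2) = (2 * p).+1.
      by rewrite -[LHS]prednK ?size_poly_gt0 ?expf_neq0 -?size_poly_eq0 ?size_exp ?sX // mulnC.
    rewrite size_polyDl ?sX2 // size_polyN (leq_ltn_trans (size_polyC_leq1 _)) //; lia.
  have P0 : P != 0 by rewrite -size_poly_eq0 sP.
  rewrite -size_filter -ltnS -sP max_poly_roots ?filter_uniq //.
  by apply/allP => y; rewrite mem_filter rootE !hornerE => /andP[].
have minusE : (2 * count (fun y : K => chi y == -1)%R E <= q + (2 * p - 1) * q0 + 2)%N.
  pose h : {poly K} := nu *: ((1 - 'X^(p.-1)) * ((2%:R * e0) *: 'X^p + (1 - 'X^(p.-1)))).
  pose e := q0./2; pose g := p.-1.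
  have q0E : q0 = e.*2.+1 by rewrite -{1}(odd_double_half q0) oq0.
  have s1 : size (1 - 'X^(p.-1) : {poly K}) = p.
    by rewrite -opprB size_polyN size_XnsubC ?prednK // -ltnS prednK // prime_gt1 // prime_p.
  have s2 : size ((2%:R * e0) *: 'X^p + (1 - 'X^(p.-1)) : {poly K}) = p.+1.
    by rewrite size_polyDl ?s1 ?size_scale ?mulf_neq0 ?size_polyXn.
  have sh : size h = g.*2.+2.
    rewrite size_scale // size_mul -?size_poly_eq0 ?s1 ?s2 //; last by rewrite -lt0n.
    by move: p_gt0; rewrite /g; clear; lia.
  pose f y := (y - y0)^-1.
  (* y0 does not correspond to any t in y = y0 + 1/t. Dropping it loses at most one element, which
     the strict inequality of [bombieri_squares] absorbs. *)
  pose s := [seq f y | y <- rem y0 (filter (fun y : K => chi y == -1)%R E)].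
  have us : uniq s.
    rewrite map_inj_uniq ?rem_uniq ?filter_uniq // => x y /invr_inj /addIr //.
  have := @bombieri_squares (p * k) e g h s q0E _ sh us; rewrite -/q0 -/q.
  have -> : (g.*2.+1 < e)%N by move: q0_big q0E p_gt0; rewrite /g; clear; lia.
  have H x : x \in s -> x ^+ q = x /\ h.[x] ^+ q.-1./2 = 1.
    move/mapP => [y]; rewrite mem_rem_uniq ?filter_uniq // !inE mem_filter EP.
    case/and3P => yy0 /eqP chiy /eqP yq ->.
    have t0 : y - y0 != 0 by rewrite subr_eq0.
    have tq : f y ^+ q = f y by rewrite /f exprVn qB yq y0q.
    split=> //.
    have yE : y = y0 + (f y)^-1 by rewrite /f invrK addrC subrK.
    have f0 : f y != 0 by rewrite invr_eq0.
    have hE x' : h.[x'] = nu * ((1 - x' ^+ p.-1) * (2%:R * e0 * x' ^+ p + (1 - x' ^+ p.-1))).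
      by rewrite !hornerE.
    have -> : h.[f y] = nu * D y * (f y ^+ p) ^+ 2.
      rewrite hE -[RHS]mulrA; congr (_ * _).
      have -> : D y = (e0 + (f y ^+ p)^-1 - (f y)^-1) ^+ 2 - e0 ^+ 2.
        by rewrite /D e2 {1 2}yE frob1D exprVn -y0E; congr (_ ^+ 2 - _); ring.
      have -> : f y ^+ p = f y * f y ^+ p.-1 by rewrite -exprS prednK.
      have f0' : f y ^+ p.-1 != 0 by rewrite expf_neq0.
      by field; rewrite f0 f0'.
    rewrite !exprMn nuE -/(chi y) chiy mulrNN mul1r mul1r.
    rewrite -!exprM -exprD addnn -mul2n mulnCA q1E mulnC exprM.
    have -> : f y ^+ q.-1 = 1; last by rewrite expr1n.
    by apply: (mulfI f0); rewrite -exprS prednK ?tq ?mulr1.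
  move=> /(_ isT H); rewrite size_map.
  have : (count (fun y : K => chi y == -1)%R E <= (size (rem y0 (filter (fun y : K => chi y == -1)%R E))).+1)%N.
    rewrite -size_filter; case: (boolP (y0 \in filter (fun y : K => chi y == -1)%R E)) => [Hy|/rem_id ->//].
    by rewrite size_rem // leqSpred.
  have E1 : (2 * (e + g + 1) = q0 + (2 * p - 1))%N by move: p_gt0 q0E; rewrite /g; clear; lia.
  have : (2 * ((e + g + 1) * q0) = q + (2 * p - 1) * q0)%N by rewrite mulnA E1 mulnDl.
  move=> E2 L1 L2; rewrite -E2; apply: leq_trans (leq_addr _ _).
  by rewrite leq_mul2l /= (leq_trans L1).
have oneE : (2 * count (fun y : K => chi y == 1)%R E <=
  \sum_(y <- E) count (fun x : K => (x != 0) && (y ^+ p - y == a * x + b / x))%R E)%N.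
  rewrite -sum1_count big_distrr /= big_mkcond /= big_seq [X in (_ <= X)%N]big_seq.
  apply: leq_sum => y; rewrite EP => /eqP yq; case: eqP => // chiy.
  have [s /eqP s2] := root_exists (D y) (isT : (0 < 2)%N).
  have s0 : s != 0.
    rewrite -sqrf_eq0 s2; apply: contra_eq_neq chiy => D0.
    by rewrite /chi D0 expr0n gtn_eqF // eq_sym oner_neq0.
  have sq : s ^+ q = s.
    rewrite -(prednK q_gt0) exprS -q1E.
    by rewrite exprM s2 -/(chi y) chiy mulr1.
  pose u := y ^+ p - y.
  have uq : u ^+ q = u by rewrite /u qB exprAC yq.
  (* These x are the roots of a x^2 - u x + b, whose discriminant is [D y]; two distinct roots give
     the factor 2 in [oneE]. *)
  have root_ok (t : K) : t ^+ 2 = D y -> t ^+ q = t ->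
      let x := (u + t) / (2%:R * a) in
      (x \in E) && ((x != 0) && (y ^+ p - y == a * x + b / x)).
    move=> t2 tq /=; rewrite EP exprMn qD uq tq exprVn exprMn natq aq eqxx /=.
    have ut : (u + t) * (u - t) = 4%:R * a * b.
      have -> : (u + t) * (u - t) = u ^+ 2 - t ^+ 2 by ring.
      by rewrite t2 /D -/u; ring.
    have [ut0 _] : u + t != 0 /\ u - t != 0.
      apply/andP; rewrite -negb_or -mulf_eq0 ut.
      by rewrite !mulf_neq0 // (natrM _ 2 2) mulf_neq0.
    rewrite mulf_neq0 ?invr_eq0 ?mulf_neq0 //= -/u.
    apply/eqP; have -> : b = (u + t) * (u - t) / (4%:R * a).
      by rewrite ut; field; rewrite ?a0 ?two0 ?four0.
    by field; rewrite ?a0 ?two0 ?four0 ?ut0.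
  have /andP[x1E x1P] := root_ok s s2 sq.
  have /andP[x2E x2P] : let x := (u + - s) / (2%:R * a) in
      (x \in E) && ((x != 0) && (y ^+ p - y == a * x + b / x)).
    by apply: root_ok; rewrite ?sqrrN // -[- s]sub0r qB sq expr0n gtn_eqF.
  rewrite muln1 -size_filter.
  apply: (@uniq_leq_size _ [:: (u + s) / (2%:R * a); (u - s) / (2%:R * a)]).
    rewrite /= inE andbT; apply/eqP => /mulIf; rewrite invr_eq0 mulf_neq0 // => /(_ isT) /addrI /eqP.
    by rewrite -subr_eq0 opprK -mulr2n -mulr_natl mulf_eq0 (negbTE two0) (negbTE s0).
  by move=> x; rewrite !inE mem_filter => /orP[] /eqP ->; apply/andP; split.
have q0_gt0 : (0 < q0)%N by rewrite odd_gt0.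
exact: count_arith p_gt0 q0_gt0 splitE zeroE minusE oneE.
Qed.

End Bombieri.
End Stepanov.

(** * Monic polynomials over F_p and Frobenius orbits of their roots *)

Module Newton.
Import all_boot all_order all_algebra all_field.
Import mathcomp.algebra_tactics.ring mathcomp.algebra_tactics.lra zify.
Import Stepanov.
Set Implicit Arguments. Unset Strict Implicit. Unset Printing Implicit Defensive.
Import GRing.Theory.
Local Open Scope ring_scope.

Section SymmetricCoefs.
Variable F : fieldType.
Implicit Types g h : {poly F}.

(* For monic [g], the sum of the roots and the sum of their inverses. *)
Definition rsum g : F := - ('X * g)`_(size g).-1.
Definition rsumV g : F := - (g`_1 / g`_0).

Lemma monic_split g : g \is monic ->
  exists2 r : {poly F}, g = 'X^((size g).-1) + r & (size r <= (size g).-1)%N.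
Proof.
move=> mg; exists (g - 'X^((size g).-1)); first by rewrite addrC subrK.
apply/leq_sizeP => j; rewrite leq_eqVlt coefB coefXn => /orP[/eqP <-|ltj].
  by rewrite eqxx -lead_coefE (monicP mg) subrr.
by rewrite gtn_eqF // subr0 nth_default //; case: size ltj.
Qed.

Lemma rsumM g h : g \is monic -> h \is monic -> rsum (g * h) = rsum g + rsum h.
Proof.
move=> mg mh; rewrite /rsum -opprD; congr (- _).
have g0 := monic_neq0 mg; have h0 := monic_neq0 mh.
have [r gE sr] := monic_split mg; have [t hE st] := monic_split mh.
rewrite size_mul //; have := size_poly_gt0 g; have := size_poly_gt0 h.
rewrite g0 h0 => + /esym; move: gE hE sr st.
case: (size g) => // m; case: (size h) => // n /= -> -> sr st _ _.
rewrite addnS /=.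
have -> : 'X * (('X^m + r) * ('X^n + t)) =
  'X^((m + n).+1) + 'X * r * 'X^n + 'X * t * 'X^m + 'X * (r * t) :> {poly F}.
  by rewrite exprS exprD; ring.
have c0 (k l : nat) (u : {poly F}) : (k < l)%N -> ('X^l + u)`_k = u`_k.
  by move=> lt_kl; rewrite coefD coefXn ltn_eqF // add0r.
rewrite !mulrDr -!exprS !c0 // !coefD coefXn ltn_eqF // add0r !coefMXn.
have -> : (m + n < n)%N = false by lia.
have -> : (m + n < m)%N = false by lia.
rewrite addnK addKn [X in _ + X = _]nth_default ?addr0 //.
have [->|rt0] := eqVneq (r * t) 0; first by rewrite mulr0 size_poly0.
have := rt0; rewrite mulf_eq0 negb_or -!size_poly_gt0 => /andP[r0 t0].
by have := size_polyMleq r t => L; rewrite mulrC size_mulX // (leq_ltn_trans L) // prednK ?addn_gt0 ?r0 ?leq_add.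
Qed.

Lemma rsumVM g h : g`_0 != 0 -> h`_0 != 0 -> rsumV (g * h) = rsumV g + rsumV h.
Proof.
move=> g0 h0; rewrite /rsumV -opprD; congr (- _).
rewrite !coefM !big_ord_recr !big_ord0 /= !add0r /bump /= ?subn0 ?subnn.
by field; rewrite g0 h0.
Qed.

Lemma rsum_XsubC x : rsum ('X - x%:P) = x.
Proof. by rewrite /rsum size_XsubC /= coefXM /= coefB coefX coefC /= sub0r opprK. Qed.

Lemma rsumV_XsubC x : rsumV ('X - x%:P) = x^-1.
Proof.
by rewrite /rsumV !coefB !coefX !coefC /= subr0 sub0r mul1r invrN opprK.
Qed.

Lemma rsum_prod (s : seq F) : rsum (\prod_(x <- s) ('X - x%:P)) = \sum_(x <- s) x.
Proof.
elim: s => [|x s IH]; last first.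
  by rewrite !big_cons rsumM ?monicXsubC ?monic_prod_XsubC // IH rsum_XsubC.
by rewrite !big_nil /rsum size_poly1 coefXM oppr0.
Qed.

Lemma rsumV_prod (s : seq F) : 0 \notin s ->
  rsumV (\prod_(x <- s) ('X - x%:P)) = \sum_(x <- s) x^-1.
Proof.
elim: s => [|x s IH]; first by rewrite !big_nil /rsumV !coefC mul0r oppr0.
rewrite inE negb_or eq_sym => /andP[x0 s0].
rewrite !big_cons rsumVM ?IH ?rsumV_XsubC //; first by rewrite coefB coefX coefC sub0r oppr_eq0.
by rewrite -horner_coef0 -rootE root_prod_XsubC.
Qed.
End SymmetricCoefs.

Lemma rsum_map (F L : fieldType) (f : {rmorphism F -> L}) g :
  f (rsum g) = rsum (map_poly f g).
Proof. by rewrite /rsum rmorphN /= size_map_poly -coef_map rmorphM /= map_polyX. Qed.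

Lemma rsumV_map (F L : fieldType) (f : {rmorphism F -> L}) g :
  f (rsumV g) = rsumV (map_poly f g).
Proof. by rewrite /rsumV rmorphN rmorphM fmorphV !coef_map. Qed.

Section Monics.
Variable F : finFieldType.

(** Row vectors give the monic polynomials of degree d a finite type, over which sums can be formed
    and reindexed. *)
Definition mon d (v : 'rV[F]_d) : {poly F} := 'X^d + rVpoly v.

Lemma size_mon d (v : 'rV[F]_d) : size (mon v) = d.+1.
Proof. by rewrite size_polyDl size_polyXn // ltnS size_poly. Qed.

Lemma mon_monic d (v : 'rV[F]_d) : mon v \is monic.
Proof. by rewrite monicE lead_coefDl ?lead_coefXn // size_polyXn ltnS size_poly. Qed.

Lemma monK d (v : 'rV[F]_d) : poly_rV (mon v - 'X^d) = v.
Proof. by rewrite /mon addrC addKr rVpolyK. Qed.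

Lemma mon_polyK d (g : {poly F}) : g \is monic -> size g = d.+1 ->
  mon (poly_rV (g - 'X^d) : 'rV[F]_d) = g.
Proof.
move=> mg sg; have [r gE] := monic_split mg; rewrite sg /= in gE *.
move=> sr; have -> : g - 'X^d = r by rewrite gE [_ + r]addrC addrK.
by rewrite /mon poly_rV_K.
Qed.

Lemma sum_dvd_mon (R : nmodType) (f : {poly F} -> R) d m (Q : {poly F}) :
  Q \is monic -> size Q = m.+1 -> (m <= d)%N ->
  \sum_(v : 'rV[F]_d | Q %| mon v) f (mon v) = \sum_(v : 'rV[F]_(d - m)) f (Q * mon v).
Proof.
move=> mQ sQ md.
have sM (v : 'rV[F]_(d - m)) : size (Q * mon v) = d.+1.
  by rewrite size_Mmonic ?mon_monic ?monic_neq0 // sQ size_mon addSn /= addnS subnKC.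
have mM (v : 'rV[F]_(d - m)) : Q * mon v \is monic by rewrite monicMr ?mon_monic.
rewrite (reindex_onto (fun v : 'rV[F]_(d - m) => poly_rV (Q * mon v - 'X^d) : 'rV[F]_d)
  (fun v => poly_rV (mon v %/ Q - 'X^(d - m)))) /=.
  apply: eq_big => [v|v _]; last by rewrite mon_polyK.
  by rewrite mon_polyK // dvdp_mulr //= mulKp ?monic_neq0 // monK eqxx.
move=> v /divpK; rewrite mulrC => vE.
have mq : mon v %/ Q \is monic.
  by have := mon_monic v; rewrite -{1}vE monicMl.
rewrite mon_polyK // ?vE ?monK //.
have := size_Mmonic (monic_neq0 mQ) mq; rewrite vE sQ size_mon; lia.
Qed.
End Monics.

Section Newton.
Variables (p : nat) (pr_p : prime p) (K : closedFieldType) (inF : {rmorphism 'F_p -> K}).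

Lemma pchar_closure : p \in [pchar K].
Proof. exact: (rmorph_pchar inF (pchar_Fp pr_p)). Qed.
Let pcharK := pchar_closure.

Lemma Fp_frob (a : 'F_p) : a ^+ p = a.
Proof. by have := expf_card a; rewrite card_Fp. Qed.

Lemma frob_inF (a : 'F_p) k : inF a ^+ (p ^ k) = inF a.
Proof. by apply: (fixed_pow k); rewrite -rmorphXn Fp_frob. Qed.

Lemma fixed_inF (c : K) : c ^+ p = c -> exists a, inF a = c.
Proof.
move=> cp; have [/mapP[a _ ->]|cN] := boolP (c \in [seq inF a | a <- enum 'F_p]).
  by exists a.
have p1 := prime_gt1 pr_p.
have sP : size ('X^p - 'X : {poly K}) = p.+1.
  by rewrite size_polyDl ?size_polyXn // size_polyN size_polyX.
have P0 : ('X^p - 'X : {poly K}) != 0 by rewrite -size_poly_eq0 sP.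
have aP : all (root ('X^p - 'X)) (c :: [seq inF a | a <- enum 'F_p]).
  rewrite /= rootE !hornerE cp subrr eqxx /=.
  by apply/allP => _ /mapP[a _ ->]; rewrite rootE !hornerE -rmorphXn Fp_frob subrr.
have := max_poly_roots P0 aP; rewrite sP /= size_map -cardE card_Fp // ltnn cN.
rewrite map_inj_uniq ?enum_uniq //; last exact: fmorph_inj.
by move=> /(_ isT).
Qed.

(** Traces are computed in K, whereas the additive character is defined on F_p; [preF] pulls them
    back. The default 0 is irrelevant on the image of [inF]. *)
Definition preF (c : K) : 'F_p := odflt 0 [pick a | inF a == c].

Lemma preFK a : preF (inF a) = a.
Proof.
rewrite /preF; case: pickP => [b /eqP /fmorph_inj //|/(_ a)].
by rewrite eqxx.
Qed.

Lemma inFK c : c ^+ p = c -> inF (preF c) = c.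
Proof. by case/fixed_inF => a <-; rewrite preFK. Qed.

Lemma inF_poly (P : {poly K}) : (forall i, P`_i ^+ p = P`_i) ->
  exists Q : {poly 'F_p}, map_poly inF Q = P.
Proof.
move=> HP; exists (\poly_(i < size P) preF P`_i); apply/polyP => i.
rewrite coef_map /= coef_poly; case: ltnP => iP; first by rewrite inFK.
by rewrite rmorph0 nth_default.
Qed.

Lemma frob_inj k : injective (fun x : K => x ^+ (p ^ k)).
Proof.
move=> x y /= E; apply/eqP; rewrite -subr_eq0.
have : (x - y) ^+ (p ^ k) == 0 by rewrite (frobB pcharK) E subrr.
by rewrite expf_eq0 => /andP[].
Qed.

Definition orb (x : K) e := [seq x ^+ (p ^ i) | i <- iota 0 e].

Lemma frob_degree (x : K) n : (0 < n)%N -> x ^+ (p ^ n) = x ->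
  exists e, [/\ (0 < e)%N, forall m, (x ^+ (p ^ m) == x) = (e %| m)%N & uniq (orb x e)].
Proof.
move=> n0 xn; have ex : exists e, (0 < e)%N && (x ^+ (p ^ e) == x) by exists n; rewrite n0 xn /=.
case: (ex_minnP ex) => e /andP[e0 /eqP xe] emin.
have xme m : x ^+ (p ^ (m * e)) = x.
  by elim: m => [|m IH]; rewrite ?expn0 ?expr1 // mulSn expnD exprM xe.
have H m : (x ^+ (p ^ m) == x) = (e %| m)%N.
  rewrite {1}(divn_eq m e) expnD exprM xme /dvdn.
  apply/eqP/eqP => [xm|->]; last by rewrite expn0 expr1.
  apply/eqP; rewrite -leqn0 leqNgt; apply/negP => m0.
  by have := emin (m %% e)%N; rewrite m0 xm eqxx leqNgt ltn_mod e0 => /(_ isT).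
exists e; split=> //; rewrite map_inj_in_uniq ?iota_uniq //.
suff W i j : (i <= j)%N -> (j < e)%N -> x ^+ (p ^ i) = x ^+ (p ^ j) -> i = j.
  move=> i j; rewrite !mem_iota !add0n /= => ie je E.
  by case/orP: (leq_total i j) => ij; [apply: W|apply/esym/W].
move=> ij je; rewrite -(subnKC ij) expnD [x ^+ (_ * _)]exprM exprAC => /frob_inj /esym /eqP.
rewrite H => /dvdn_leq; case: (posnP (j - i)%N) => [->|ji /(_ isT)]; first by rewrite addn0.
lia.
Qed.

Lemma prod_frob (s : seq K) :
  map_poly (fun c => c ^+ p) (\prod_(x <- s) ('X - x%:P)) = \prod_(x <- s) ('X - (x ^+ p)%:P).
Proof.
have E q : map_poly (fun c : K => c ^+ p) q = map_poly (pFrobenius_aut pcharK) q by [].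
rewrite E rmorph_prod; apply: eq_bigr => x _.
by rewrite rmorphB /= map_polyX map_polyC.
Qed.

(** P is the minimal polynomial of x: Frobenius permutes the orbit cyclically, so it fixes the
    coefficients of the product. *)
Lemma orbit_poly (x : K) n : (0 < n)%N -> x ^+ (p ^ n) = x ->
  exists e (P : {poly 'F_p}),
  [/\ (0 < e)%N, forall m, (x ^+ (p ^ m) == x) = (e %| m)%N, uniq (orb x e),
      P \is monic & map_poly inF P = \prod_(y <- orb x e) ('X - y%:P)].
Proof.
move=> n0 xn; have [e [e0 eP ue]] := frob_degree n0 xn.
have pe : perm_eq [seq y ^+ p | y <- orb x e] (orb x e).
  have -> : [seq y ^+ p | y <- orb x e] = [seq x ^+ (p ^ i) | i <- iota 1 e].
    by rewrite /orb (iotaDl 1 0) -!map_comp; apply: eq_map => j /=; rewrite -exprM -expnSr.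
  have xe : x ^+ (p ^ e) = x by apply/eqP; rewrite eP.
  rewrite /orb; case: e e0 xe {eP ue} => // e _ xe.
  rewrite -{1}(addn1 e) iotaD map_cat /= perm_sym -cat1s perm_catC add1n.
  by rewrite xe expn0 expr1.
have [P PE] : exists P : {poly 'F_p}, map_poly inF P = \prod_(y <- orb x e) ('X - y%:P).
  apply: inF_poly => i; set Q := \prod_(y <- _) _.
  have -> : Q`_i ^+ p = (map_poly (fun c => c ^+ p) Q)`_i.
    by rewrite coef_map_id0 // expr0n gtn_eqF ?prime_gt0.
  by rewrite prod_frob -(big_map (fun y => y ^+ p) xpredT (fun y => 'X - y%:P)) (perm_big _ pe).
exists e, P; split=> //.
by rewrite -(map_monic inF) PE monic_prod_XsubC.
Qed.

(** This replaces unique factorisation over F_p: the exponent of the irreducible factor P in g is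
    read off as the multiplicity of the single root x. *)
Lemma orbit_dvd (x : K) n e (P g : {poly 'F_p}) : (0 < n)%N -> x ^+ (p ^ n) = x ->
  (0 < e)%N -> uniq (orb x e) -> map_poly inF P = \prod_(y <- orb x e) ('X - y%:P) ->
  g != 0 -> forall k, (P ^+ k %| g) = (k <= mup x (map_poly inF g))%N.
Proof.
move=> n0 xn e0 ue PE; have P0 : P != 0.
  by rewrite -(map_poly_eq0 inF) PE monic_neq0 ?monic_prod_XsubC.
have mP : mup x (map_poly inF P) = 1%N.
  rewrite PE mu_prod_XsubC count_uniq_mem // /orb -(prednK e0) /=.
  by rewrite expn0 expr1 inE eqxx.
move=> g0 k; elim: k g g0 => [|k IH] g g0; first by rewrite expr0 dvd1p.
have [/dvdpP[h gE]|PNg] := boolP (P %| g).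
  have h0 : h != 0 by apply: contraNneq g0 => h0; rewrite gE h0 mul0r.
  rewrite gE exprSr dvdp_mul2r // IH // rmorphM /= mupM ?map_poly_eq0 // mP addn1.
  by rewrite ltnS.
have -> : (P ^+ k.+1 %| g) = false.
  by apply: contraNF PNg; apply: dvdp_trans; rewrite exprS dvdp_mulr.
apply/esym/negbTE; rewrite -leqNgt; apply: leq_trans (leq0n k).
rewrite leqn0; apply/eqP/mupNroot; apply: contra PNg => gx.
rewrite -(dvdp_map inF) PE uniq_roots_dvdp ?uniq_rootsE //.
apply/allP => _ /mapP[i _ ->]; have := gx; rewrite !rootE => /eqP gx0.
have : (map_poly inF g).[x] ^+ (p ^ i) = 0.
  by rewrite gx0 expr0n gtn_eqF // (expp_gt0 pcharK).
move=> <-; rewrite !horner_coef (frob_sum pcharK) size_map_poly; apply/eqP/eq_bigr => j _.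
by rewrite coef_map exprMn frob_inF exprAC.
Qed.
End Newton.
End Newton.

(** * The L-function of a Kloosterman sum modulo p *)

Module KloostermanL.
Import all_boot all_order all_algebra all_field.
Import mathcomp.algebra_tactics.ring mathcomp.algebra_tactics.lra zify.
Import Stepanov Newton.
Set Implicit Arguments. Unset Strict Implicit. Unset Printing Implicit Defensive.
Import GRing.Theory.
Local Open Scope ring_scope.

Lemma sum_nat_pick (V : nmodType) (F : nat -> V) m n i : (m <= i < n)%N ->
  \sum_(m <= j < n | j == i) F j = F i.
Proof.
move=> Hi; rewrite -big_filter (filter_pred1_uniq (iota_uniq _ _)) ?big_seq1 //.
by rewrite mem_index_iota.
Qed.

Section Lfunction.
Variables (p : nat) (pr_p : prime p) (K : closedFieldType) (inF : {rmorphism 'F_p -> K}).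
Variables (R : idomainType) (psi : 'F_p -> R).
Hypotheses (psiD : {morph psi : x y / x + y >-> x * y}) (psi0 : psi 0 = 1).
Hypothesis psi_neq1 : forall c : 'F_p, c != 0 -> psi c != 1.
Let pcharK := pchar_closure pr_p inF.
Local Notation preF := (preF inF).
Local Notation frob_inF := (frob_inF pr_p inF).

Lemma psiMn c k : psi (c *+ k) = psi c ^+ k.
Proof. by elim: k => [|k IH]; rewrite ?mulr0n ?psi0 ?expr0 // mulrS psiD IH exprS. Qed.

Lemma sum_psi c : \sum_x psi (c * x) = if c == 0 then p%:R else 0.
Proof.
case: eqP => [->|/eqP c0].
  rewrite (eq_bigr (fun=> 1)) => [|x _]; last by rewrite mul0r psi0.
  by rewrite sumr_const; congr (_ *+ _); exact: (card_Fp pr_p).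
have E : \sum_x psi (c * x) = psi c * \sum_x psi (c * x).
  rewrite {1}(reindex_inj (addIr 1)) /= mulr_sumr; apply: eq_bigr => x _.
  by rewrite mulrDr mulr1 psiD mulrC.
apply/eqP; move/eqP: E; rewrite -{1}[\sum_x _]mul1r -subr_eq0 -mulrBl mulf_eq0.
by rewrite subr_eq0 eq_sym (negbTE (psi_neq1 c0)).
Qed.

Variables a b : 'F_p.

(* The sum over monic [g] of [eta g] T^(deg g) is 1 + S T + p T^2 with S the
    Kloosterman sum ([etaS1], [etaS2], [etaS_ge3]); [newton] is the logarithmic
    derivative of its Euler product, proved by counting roots with multiplicity. *)
Definition eta (g : {poly 'F_p}) : R :=
  if g`_0 == 0 then 0 else psi (a * rsum g + b * rsumV g).

Lemma etaM g h : g \is monic -> h \is monic -> eta (g * h) = eta g * eta h.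
Proof.
move=> mg mh; rewrite /eta {1}coefM big_ord1 subnn mulf_eq0.
case: eqP => [_|/eqP g0] /=; first by rewrite mul0r.
case: eqP => [_|/eqP h0] /=; first by rewrite mulr0.
by rewrite rsumM // rsumVM // -psiD; congr psi; ring.
Qed.

Lemma eta1 : eta 1 = 1.
Proof.
by rewrite /eta coef1 oner_eq0 /rsum /rsumV size_poly1 coefXM !coef1 oppr0 mul0r oppr0
  !mulr0 addr0 psi0.
Qed.

Lemma etaX g k : g \is monic -> eta (g ^+ k) = eta g ^+ k.
Proof.
move=> mg; elim: k => [|k IH]; first by rewrite !expr0 eta1.
by rewrite !exprS etaM ?monic_exp // IH.
Qed.

Definition etaS d : R := \sum_(v : 'rV['F_p]_d) eta (mon v).
Definition klS : R := \sum_(x : 'F_p | x != 0) psi (a * x + b / x).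

Lemma etaS0 : etaS 0 = 1.
Proof.
rewrite /etaS (big_pred1 0) => [|v]; last by apply/esym/eqP/rowP => -[].
by rewrite /mon linear0 addr0 expr0 eta1.
Qed.

Lemma coef_mon d (v : 'rV['F_p]_d) (i : 'I_d) : (mon v)`_i = v 0 i.
Proof. by rewrite /mon coefD coefXn ltn_eqF // add0r coef_rVpoly_ord. Qed.

Lemma eta_mon d (v : 'rV['F_p]_d.+2) :
  eta (mon v) = if v 0 ord0 == 0 then 0
    else psi (- (a * v 0 ord_max) - b * (v 0 (lift ord0 ord0) / v 0 ord0)).
Proof.
rewrite /eta /rsum /rsumV size_mon coefXM /= -!(coef_mon v) /= /bump /= !mulrN.
by [].
Qed.

Lemma etaS1 : etaS 1 = klS.
Proof.
rewrite /etaS /klS big_mkcond [RHS]big_mkcond /=.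
rewrite (reindex (fun c : 'F_p => const_mx (- c) : 'rV_1)) /=; last first.
  exists (fun v => - v 0 0) => [c _|v _]; first by rewrite mxE opprK.
  by apply/rowP => i; rewrite mxE opprK ord1.
apply: eq_bigr => c _.
rewrite /eta /rsum /rsumV size_mon coefXM /= -[0%N]/(val (0 : 'I_1)) coef_mon mxE oppr_eq0.
case: eqP => //= _; rewrite opprK; congr (psi (_ + _ * _)).
by rewrite /mon coefD coefXn /= nth_default ?size_poly // addr0 div1r invrN opprK.
Qed.

(** For X^2 + w X + u the value of [eta] is psi (- (a + b / u) w). The sum over w vanishes unless a
    + b / u = 0, that is u = - b / a, where it equals p. *)
Lemma etaS2 : a != 0 -> b != 0 -> etaS 2 = p%:R.
Proof.
move=> a0 b0; rewrite /etaS.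
rewrite (reindex (fun u : 'F_p * 'F_p => \row_(i < 2) (if i == ord0 then u.1 else u.2))) /=; last first.
  exists (fun v : 'rV_2 => (v 0 ord0, v 0 ord_max)) => [[u w] _|v _]; first by rewrite !mxE.
  by apply/rowP => i; rewrite mxE; case: i => -[|[|//]] Hi /=; congr (v 0 _); apply: val_inj.
rewrite (eq_bigr (fun u : 'F_p * 'F_p => if u.1 == 0 then 0 else psi (- (a + b / u.1) * u.2))); last first.
  move=> [u w] _; rewrite eta_mon !mxE /=; case: eqP => // _; congr psi; ring.
rewrite -(pair_bigA _ (fun u w => if u == 0 then 0 else psi (- (a + b / u) * w))) /=.
have u0 : - b / a != 0 by rewrite mulf_neq0 ?invr_eq0 ?oppr_eq0.
rewrite (bigD1 (- b / a)) //= [X in _ + X]big1 ?addr0 => [|u ub].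
  rewrite (negbTE u0) sum_psi; have -> : a + b / (- b / a) = 0 by field; rewrite ?oppr_eq0 ?a0 ?b0.
  by rewrite oppr0 eqxx.
have [_|un0] := eqVneq u 0; first by rewrite big1.
rewrite sum_psi oppr_eq0; case: eqP => // E; case/eqP: ub.
by have -> : u = - b / a; first by apply: (mulfI a0); move: E => /(congr1 (fun t => t * u));
  rewrite mulrDl divfK // mul0r => /eqP; rewrite addr_eq0 => /eqP ->; field.
Qed.

(** From degree 3 on, the sum of the roots is a coefficient distinct from the two lowest ones, which
    determine the sum of the inverses. Translating it by 1 multiplies the whole sum by psi (- a),
    which is not 1. *)
Lemma etaS_ge3 d : a != 0 -> etaS d.+3 = 0.
Proof.
move=> a0; pose D : 'rV['F_p]_d.+3 := delta_mx 0 ord_max.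
have E : etaS d.+3 = psi (- a) * etaS d.+3.
  rewrite {1}/etaS (reindex_inj (addIr D)) /= mulr_sumr; apply: eq_bigr => v _.
  rewrite !eta_mon !mxE !eqxx /= !addr0; case: eqP => _; first by rewrite mulr0.
  by rewrite -psiD; congr psi; ring.
apply/eqP; move/eqP: E; rewrite -{1}[etaS _]mul1r -subr_eq0 -mulrBl mulf_eq0.
by rewrite subr_eq0 eq_sym (negbTE (psi_neq1 _)) // oppr_eq0.
Qed.

Definition frob_tr n (u : K) : K := \sum_(0 <= i < n) u ^+ (p ^ i).
Definition kl_arg (x : K) : K := inF a * x + inF b / x.

Definition klS_ext n : R :=
  \sum_(x <- fixed_seq K p n | x != 0) psi (preF (frob_tr n (kl_arg x))).

Lemma frob_tr_mul e k (x : K) : x ^+ (p ^ e) = x ->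
  frob_tr (k * e) x = k%:R * frob_tr e x.
Proof.
move=> xe; elim: k => [|k IH]; first by rewrite mul0n /frob_tr big_geq // mul0r.
rewrite mulSn addnC /frob_tr (@big_cat_nat _ _ _ (k * e)%N) ?leq_addr //= -/(frob_tr _ x) IH.
rewrite -addn1 natrD mulrDl mul1r; congr (_ + _).
rewrite -{1}[(k * e)%N]add0n big_addn addnC addnK; apply: eq_bigr => i _.
have xk j : x ^+ (p ^ (j * e)) = x.
  by elim: j => [|j IHj]; rewrite ?expn0 ?expr1 // mulSn expnD exprM xe.
by rewrite addnC expnD exprM xk.
Qed.

Lemma frob_tr_arg n x : frob_tr n (kl_arg x) = inF a * frob_tr n x + inF b * frob_tr n x^-1.
Proof.
rewrite /frob_tr /kl_arg !mulr_sumr -big_split /=; apply: eq_bigr => i _.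
by rewrite (frobD pcharK) !exprMn !frob_inF.
Qed.

(** The multiplicity of x in g is the number of k >= 1 with P^k | g, where P is the minimal
    polynomial of x, of degree e. Writing g = P^k g' splits off eta(P)^k, which for x <> 0 is psi of
    the trace taken over k e Frobenius steps; the degrees n = k e are those for which x lies in the
    field with p^n elements. *)
Lemma newton_point d (x : K) N : (0 < N)%N -> x ^+ (p ^ N) = x ->
  \sum_(v : 'rV['F_p]_d) eta (mon v) * (mup x (map_poly inF (mon v)))%:R =
  \sum_(1 <= n < d.+1 | x ^+ (p ^ n) == x)
     (if x == 0 then 0 else psi (preF (frob_tr n (kl_arg x)))) * etaS (d - n).
Proof.
move=> N0 xN; have [e [P [e0 eP ue mP PE]]] := orbit_poly pr_p inF N0 xN.
have sP : size P = e.+1.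
  by rewrite -(size_map_poly inF) PE size_prod_XsubC size_map size_iota.
have xe : x ^+ (p ^ e) = x by apply/eqP; rewrite eP.
have mon0 (v : 'rV['F_p]_d) : mon v != 0 by rewrite monic_neq0 ?mon_monic.
have mupE (v : 'rV['F_p]_d) : ((mup x (map_poly inF (mon v)))%:R : R) =
    \sum_(1 <= k < d.+1) (P ^+ k %| mon v)%R%:R.
  have mu_le : (mup x (map_poly inF (mon v)) <= d)%N.
    have : (('X - x%:P) ^+ mup x (map_poly inF (mon v)) %| map_poly inF (mon v)).
      by rewrite -mup_geq ?map_poly_eq0.
    move/dvdp_leq; rewrite map_poly_eq0 mon0 size_map_poly size_mon => /(_ isT).
    by rewrite size_exp_XsubC.
  rewrite (eq_bigr (fun k => (k <= mup x (map_poly inF (mon v)))%N%:R)) => [|k _]; last first.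
    by rewrite (orbit_dvd pr_p N0 xN e0 ue PE (mon0 v)).
  move: mu_le; set mu := mup _ _ => mu_le.
  rewrite (@big_cat_nat _ _ _ mu.+1) //= [X in _ + X]big_nat_cond [X in _ + X]big1 ?addr0.
    rewrite big_nat_cond (eq_bigr (fun=> 1)) => [|k /andP[/andP[_]]]; last by rewrite ltnS => ->.
    by rewrite -big_nat_cond big_const_nat subSS subn0 iter_addr_0.
  by move=> k /andP[/andP[lt_mu _] _]; rewrite leqNgt lt_mu.
under eq_bigr => v _ do rewrite mupE mulr_sumr.
rewrite exchange_big /=.
have etaP : eta P = if x == 0 then 0 else psi (a * rsum P + b * rsumV P).
  rewrite /eta; congr (if _ then _ else _).
  rewrite -(fmorph_eq0 inF) -coef_map -horner_coef0 PE -rootE root_prod_XsubC.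
  apply/mapP/eqP => [[i _ /esym/eqP]|->]; first by rewrite expf_eq0 => /andP[_ /eqP].
  by exists 0%N; rewrite ?mem_iota // expn0 expr1.
have etaPk k : (0 < k)%N -> eta P ^+ k =
    if x == 0 then 0 else psi (preF (frob_tr (k * e) (kl_arg x))).
  move=> k0; rewrite etaP; case: eqP => [_|/eqP x0]; first by rewrite expr0n gtn_eqF.
  have xVe : x^-1 ^+ (p ^ e) = x^-1 by rewrite exprVn xe.
  rewrite -psiMn frob_tr_arg !frob_tr_mul //; congr psi.
  apply: (fmorph_inj inF); rewrite inFK //.
    rewrite rmorphMn rmorphD !rmorphM /= rsum_map rsumV_map PE rsum_prod rsumV_prod; last first.
      apply/mapP => -[i _ /esym/eqP]; rewrite expf_eq0 (negbTE x0) andbF //.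
    rewrite !big_map /frob_tr /index_iota subn0 -mulr_natl mulrDr.
    congr (_ + _); rewrite mulrCA //; congr (_ * (_ * _)).
    by apply: eq_bigr => i _; rewrite exprVn.
  have H (y : K) : y ^+ (p ^ e) = y -> frob_tr e y ^+ p = frob_tr e y.
    move=> ye; have {1 2}-> : frob_tr e y = \sum_(i < e) y ^+ (p ^ i) by rewrite /frob_tr big_mkord.
    have := frob_sum pcharK 1 (fun i : 'I_e => y ^+ (p ^ i)); rewrite expn1 => ->.
    case: e e0 ye {eP ue PE sP xe xVe} => // e _ ye.
    rewrite big_ord_recr big_ord_recl /= addrC -exprM -expnSr ye expn0 expr1; congr (_ + _).
    by apply: eq_bigr => i _; rewrite -exprM -expnSr.
  have F1 (c : 'F_p) : inF c ^+ p = inF c by rewrite -rmorphXn Fp_frob.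
  have := frobD pcharK 1; rewrite expn1 => ->.
  by rewrite !exprMn (H _ xe) (H _ xVe) !F1 (nat_frob pcharK).
have inner k : (0 < k)%N ->
   \sum_(v : 'rV['F_p]_d) eta (mon v) * (P ^+ k %| mon v)%R%:R =
   \sum_(1 <= n < d.+1 | (n == k * e)%N) eta P ^+ k * etaS (d - n).
  move=> k0; transitivity (\sum_(v : 'rV['F_p]_d | P ^+ k %| mon v) eta (mon v)).
    by rewrite [RHS]big_mkcond; apply: eq_bigr => v _; case: (_ %| _); rewrite ?mulr1 ?mulr0.
  have mPk : P ^+ k \is monic by rewrite monic_exp.
  have sPk : size (P ^+ k) = (k * e).+1.
    by rewrite -[LHS]prednK ?size_poly_gt0 ?monic_neq0 // size_exp sP mulnC.
  have [le_d|lt_d] := leqP (k * e) d.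
    rewrite (sum_dvd_mon _ mPk sPk le_d) sum_nat_pick.
    + by rewrite /etaS mulr_sumr; apply: eq_bigr => v _; rewrite etaM ?mon_monic // etaX.
    + by rewrite ltnS le_d muln_gt0 k0 e0.
  rewrite big1 => [|v /dvdp_leq]; last by rewrite mon0 sPk size_mon ltnS leqNgt lt_d => /(_ isT).
  rewrite big_nat_cond big1 // => n /andP[/andP[_ nd] /eqP nE]; move: nd.
  by rewrite nE ltnS leqNgt lt_d.
rewrite big_nat_cond; under eq_bigr => k /andP[/andP[k0 _] _] do rewrite inner //.
rewrite -big_nat_cond (exchange_big_dep_nat predT) //= [RHS]big_mkcond /=.
rewrite big_nat_cond [RHS]big_nat_cond; apply: eq_bigr => n /andP[/andP[n0 nd] _].
rewrite eP; case: ifP => [/dvdnP[k nE]|eNn].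
  have k0 : (0 < k)%N by case: k nE n0 => [->|].
  rewrite (eq_bigl (fun j => j == k)); last by move=> j; rewrite nE eqn_pmul2r //= eq_sym.
  rewrite sum_nat_pick; first by rewrite etaPk // -nE.
  by rewrite k0 (leq_trans _ nd) // ltnS nE leq_pmulr.
rewrite big1 // => k /eqP nE; by rewrite nE dvdn_mull in eNn.
Qed.

Lemma root_frob (g : {poly 'F_p}) (x : K) i :
  root (map_poly inF g) x -> root (map_poly inF g) (x ^+ (p ^ i)).
Proof.
rewrite !rootE => /eqP gx0.
have : (map_poly inF g).[x] ^+ (p ^ i) = 0.
  by rewrite gx0 expr0n gtn_eqF // (expp_gt0 pcharK).
move=> <-; rewrite !horner_coef (frob_sum pcharK) size_map_poly; apply/eqP/eq_bigr => j _.
by rewrite coef_map exprMn frob_inF exprAC.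
Qed.

(** Among the first d + 1 conjugates of x, all of them roots of g, two coincide; so x is fixed by
    the j-th power of Frobenius for some 1 <= j <= d, and j divides d!. One field thus contains the
    roots of all polynomials of degree d. *)
Lemma root_fixed (g : {poly 'F_p}) d (x : K) : size g = d.+1 ->
  root (map_poly inF g) x -> x ^+ (p ^ d`!) = x.
Proof.
move=> sg gx; have g0 : map_poly inF g != 0 by rewrite map_poly_eq0 -size_poly_eq0 sg.
have : ~~ uniq (orb p x d.+1).
  apply/negP => u; have := max_poly_roots g0 _ u.
  rewrite size_map_poly sg size_map size_iota ltnn => H.
  by suff /H : all (root (map_poly inF g)) (orb p x d.+1); first by []; apply/allP => _ /mapP[i _ ->];
    apply: root_frob.
case/(uniqPn 0) => i [j]; rewrite size_map size_iota => -[ij jd].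
rewrite !(nth_map 0%N) ?size_iota ?(ltn_trans ij) // !nth_iota ?(ltn_trans ij) // !add0n.
rewrite -{1}(subnKC (ltnW ij)) expnD mulnC [x ^+ (_ * _)]exprM => E.
have {}E : x ^+ (p ^ (j - i)) = x.
  by apply/esym; apply: (@frob_inj p pr_p K inF i) => /=; rewrite E.
have /dvdnP[m ->] : (j - i %| d`!)%N by apply: dvdn_fact; lia.
by elim: m => [|m IH]; rewrite ?mul0n ?expn0 ?expr1 // mulSn expnD exprM E.
Qed.

Lemma total_mup d (v : 'rV['F_p]_d) :
  (\sum_(x <- fixed_seq K p d`!) mup x (map_poly inF (mon v)) = d)%N.
Proof.
have [uE _ EP] := fixed_seqP pcharK (fact_gt0 d).
have [r rE] := closed_field_poly_normal (map_poly inF (mon v)).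
have mm : map_poly inF (mon v) \is monic by rewrite map_monic mon_monic.
rewrite (monicP mm) scale1r in rE.
have sr : size r = d.
  by apply/eqP; rewrite -eqSS -(size_prod_XsubC r id) -rE size_map_poly size_mon.
have rZ y : y \in r -> y \in fixed_seq K p d`!.
  move=> yr; rewrite EP; apply/eqP/(root_fixed (size_mon v)).
  by rewrite rE root_prod_XsubC.
rewrite rE -[RHS]sr; under eq_bigr => x _ do rewrite mu_prod_XsubC.
elim: r rZ {rE sr} => [|y r IH] rZ; first by rewrite big1.
rewrite /= big_split /= IH => [|z zr]; last by apply: rZ; rewrite inE zr orbT.
rewrite -addn1 addnC; congr (_ + _)%N.
rewrite (bigD1_seq y) ?rZ ?inE ?eqxx //= big1 ?addn0 // => z.
by rewrite eq_sym => /negbTE ->.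
Qed.

Lemma newton d : d%:R * etaS d = \sum_(1 <= n < d.+1) klS_ext n * etaS (d - n).
Proof.
have [uE _ EP] := fixed_seqP pcharK (fact_gt0 d).
rewrite /etaS mulr_sumr.
transitivity (\sum_(x <- fixed_seq K p d`!)
    \sum_(v : 'rV['F_p]_d) eta (mon v) * (mup x (map_poly inF (mon v)))%:R).
  rewrite exchange_big /=; apply: eq_bigr => v _.
  by rewrite -mulr_sumr -natr_sum total_mup mulrC.
rewrite big_seq; under eq_bigr => x xE.
  rewrite (@newton_point d x d`!) ?fact_gt0 //; last by apply/eqP; rewrite -EP.
  over.
rewrite -big_seq.
rewrite (exchange_big_dep predT) //=.
rewrite big_nat_cond [RHS]big_nat_cond; apply: eq_bigr => n /andP[/andP[n0 nd] _].
rewrite -mulr_suml; congr (_ * _); rewrite /klS_ext.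
have [uEn _ EnP] := fixed_seqP pcharK n0.
rewrite -big_filter (perm_big (fixed_seq K p n)); last first.
  apply: uniq_perm; rewrite ?filter_uniq // => x; rewrite mem_filter EnP EP.
  case: (x ^+ (p ^ n) =P x) => [xn|//].
  have -> : x ^+ (p ^ d`!) = x; last by rewrite eqxx.
  have /dvdnP[m ->] : (n %| d`!)%N by apply: dvdn_fact; rewrite n0.
  by elim: m => [|m IH]; rewrite ?mul0n ?expn0 ?expr1 // mulSn expnD exprM xn.
by rewrite [RHS]big_mkcond; apply: eq_bigr => x _; case: eqP.
Qed.

Lemma klS_ext_rec : a != 0 -> b != 0 ->
  [/\ klS_ext 1 = klS, klS_ext 2 = p%:R *+ 2 - klS ^+ 2 &
   forall n, klS_ext n.+3 = - (klS * klS_ext n.+2) - p%:R * klS_ext n.+1].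
Proof.
move=> a0 b0; have E1 : klS_ext 1 = klS.
  by have := newton 1; rewrite big_nat1 mul1r etaS1 subnn etaS0 mulr1.
split=> //.
  have := newton 2; rewrite 2?big_nat_recr //= big_geq // add0r subnn etaS0 etaS1 etaS2 // mulr1.
  by rewrite E1 mulr_natl => ->; rewrite -expr2 addrAC subrr add0r.
move=> n; have := newton n.+3; rewrite etaS_ge3 // mulr0 3?big_nat_recr //= subnn.
have -> : (n.+3 - n.+2 = 1)%N by lia.
have -> : (n.+3 - n.+1 = 2)%N by lia.
rewrite etaS0 etaS1 etaS2 // mulr1 big_nat_cond big1 => [|i].
  by rewrite add0r => /esym/eqP; rewrite addrC addr_eq0 opprD => /eqP ->; ring.
move=> /andP[/andP[i0 ni] _]; have -> : (n.+3 - i = (n - i).+3)%N by lia.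
by rewrite etaS_ge3 // mulr0.
Qed.
End Lfunction.
End KloostermanL.

(** * Weil's bound for Kloosterman sums modulo an odd prime *)

Module WeilBound.
Import all_boot all_order all_algebra all_field.
Import mathcomp.algebra_tactics.ring mathcomp.algebra_tactics.lra zify.
Import mathcomp.real_closed.complex.
Import Stepanov Newton KloostermanL.
Set Implicit Arguments. Unset Strict Implicit. Unset Printing Implicit Defensive.
Import Order.TTheory GRing.Theory Num.Theory.
Local Open Scope ring_scope.

Section RealRecurrence.
Variables (R : realFieldType) (P s : R).
Hypothesis P0 : 0 < P.

(* The opposite of the n-th power sum of the two roots of T^2 + s T + P. *)
Fixpoint kl_seq n : R :=
  if n is n1.+1 then if n1 is n2.+1 then - (s * kl_seq n1) - P * kl_seq n2 else s else - 2%:R.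

Lemma kl_seq_even m :
  kl_seq (2 * m.+2) = (s ^+ 2 - 2%:R * P) * kl_seq (2 * m.+1) - P ^+ 2 * kl_seq (2 * m).
Proof.
have -> : (2 * m.+2 = (2 * m).+4)%N by lia.
have -> : (2 * m.+1 = (2 * m).+2)%N by lia.
have E n : kl_seq n.+2 = - (s * kl_seq n.+1) - P * kl_seq n by [].
rewrite !E; ring.
Qed.

(** For real roots u, v this is the power mean inequality u^(2m) + v^(2m) >= 2 ((u + v) / 2)^(2m).
    The roots need not lie in R, so the induction uses the recurrence alone: it shows that
    consecutive even terms grow by a factor at least s^2 / 4. *)
Lemma kl_seq_large m : 4%:R * P <= s ^+ 2 ->
  2%:R * (s ^+ 2 / 4%:R) ^+ m <= - kl_seq (2 * m).
Proof.
move=> le_s; set t := s ^+ 2 in le_s *.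
have t0 : 0 < t by apply: lt_le_trans le_s; rewrite mulr_gt0.
suff [H _] : 2%:R * (t / 4%:R) ^+ m <= - kl_seq (2 * m) /\
    (t / 4%:R) * - kl_seq (2 * m) <= - kl_seq (2 * m.+1) by [].
elim: m => [|m [IH1 IH2]].
  by rewrite muln0 expr0 /= -expr2 -/t; split; lra.
have pos : 0 < - kl_seq (2 * m.+1).
  apply: lt_le_trans IH2; rewrite mulr_gt0 ?divr_gt0 //.
  by apply: lt_le_trans IH1; rewrite mulr_gt0 ?exprn_gt0 ?divr_gt0.
split; first by rewrite exprS; nra.
rewrite kl_seq_even -/t; set v := kl_seq (2 * m.+1) in IH2 pos *; set u := kl_seq _ in IH1 IH2 *.
have : t * (- u) <= 4%:R * (- v) by lra.
move=> Hu; have : P ^+ 2 * (t * - u) <= P ^+ 2 * (4%:R * - v) by rewrite ler_wpM2l ?sqr_ge0.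
move=> Hu2; rewrite -(ler_pM2l t0).
have : 0 <= (3%:R * t + 4%:R * P) * (t - 4%:R * P) * (- v).
  apply: mulr_ge0; last exact: ltW.
  by apply: mulr_ge0; rewrite ?subr_ge0 // addr_ge0 // mulr_ge0 // ltW.
by move: Hu2; rewrite !expr2 => Hu2; nra.
Qed.

(** For real roots the term is negative. For conjugate ones a quadratic form in two consecutive even
    terms is multiplied by P^2 at each step, and since it is positive definite it bounds each single
    term. It degenerates at s = 0, where the terms are computed directly. *)
Lemma kl_seq_small m : kl_seq (2 * m) <= 2%:R * P ^+ m.
Proof.
have Pm k : 0 < P ^+ k by rewrite exprn_gt0.
have [le_s|lt_s] := leP (4%:R * P) (s ^+ 2).
  have := kl_seq_large m le_s; have : 0 <= (s ^+ 2 / 4%:R) ^+ m.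
    by rewrite exprn_ge0 ?divr_ge0 ?sqr_ge0.
  by have := Pm m; lra.
set c := s ^+ 2 - 2%:R * P.
have [s0|s0] := eqVneq s 0.
  suff [-> _] : kl_seq (2 * m) = - 2%:R * (- P) ^+ m /\ kl_seq (2 * m.+1) = - 2%:R * (- P) ^+ m.+1.
    have : - P ^+ m <= (- P) ^+ m.
      rewrite exprNn -signr_odd; case: (odd m); first by rewrite expr1 mulN1r.
      by rewrite expr0 mul1r; have := Pm m; lra.
    lra.
  elim: m => [|m [IH1 IH2]]; first by rewrite muln0 muln1 /= s0 expr0 expr1; split; ring.
  by split=> //; rewrite kl_seq_even IH1 IH2 s0 !exprS; ring.
have inv k : kl_seq (2 * k.+1) ^+ 2 - c * kl_seq (2 * k.+1) * kl_seq (2 * k) +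
    P ^+ 2 * kl_seq (2 * k) ^+ 2 = (P ^+ k) ^+ 2 * (4%:R * P ^+ 2 - c ^+ 2).
  elim: k => [|k IH]; first by rewrite muln0 muln1 /= /c expr0; ring.
  have -> : (P ^+ k.+1) ^+ 2 * (4%:R * P ^+ 2 - c ^+ 2) =
    P ^+ 2 * ((P ^+ k) ^+ 2 * (4%:R * P ^+ 2 - c ^+ 2)) by rewrite [P ^+ k.+1]exprS; ring.
  by rewrite -IH kl_seq_even -/c; ring.
have s2 : 0 < s ^+ 2 by rewrite exprn_even_gt0.
have c2 : 0 < 4%:R * P ^+ 2 - c ^+ 2.
  have -> : 4%:R * P ^+ 2 - c ^+ 2 = s ^+ 2 * (4%:R * P - s ^+ 2) by rewrite /c; ring.
  by rewrite mulr_gt0 // subr_gt0.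
have : kl_seq (2 * m) ^+ 2 <= (2%:R * P ^+ m) ^+ 2.
  rewrite -(ler_pM2r c2); have E := inv m.
  have : 0 <= (2%:R * kl_seq (2 * m.+1) - c * kl_seq (2 * m)) ^+ 2 by rewrite sqr_ge0.
  have -> : (2%:R * kl_seq (2 * m.+1) - c * kl_seq (2 * m)) ^+ 2 =
    4%:R * (kl_seq (2 * m.+1) ^+ 2 - c * kl_seq (2 * m.+1) * kl_seq (2 * m) +
    P ^+ 2 * kl_seq (2 * m) ^+ 2) - kl_seq (2 * m) ^+ 2 * (4%:R * P ^+ 2 - c ^+ 2) by ring.
  by rewrite E subr_ge0 => /le_trans; apply; rewrite exprMn; apply/eqW || (rewrite -subr_ge0; nra).
have := Pm m; set x := kl_seq _; set y := P ^+ m => y0; nra.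
Qed.
End RealRecurrence.

Section WeilBound.
Variables (p : nat) (pr_p : prime p) (R : rcfType) (z : R[i]).
Hypotheses (op : odd p) (pz : p.-primitive_root z).
Hypothesis arch : forall x : R, exists n : nat, x < n%:R.

Definition zpsi (c : 'F_p) : R[i] := z ^+ c.

Lemma zpsiD : {morph zpsi : x y / x + y >-> x * y}.
Proof.
move=> x y; rewrite /zpsi -exprD; apply/eqP; rewrite (eq_prim_root_expr pz) /=.
have H m : (m %% (Zp_trunc (pdiv p)).+2 = m %% p)%N by congr modn; exact: Fp_cast.
by rewrite (H (x + y)%N) modn_mod.
Qed.

Lemma zpsi0 : zpsi 0 = 1. Proof. by rewrite /zpsi expr0. Qed.

Lemma zpsi_neq1 (c : 'F_p) : c != 0 -> zpsi c != 1.
Proof.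
rewrite /zpsi -(prim_order_dvd pz) => c0; rewrite gtnNdvd ?lt0n //.
by have := ltn_ord c; have E := Fp_cast pr_p; rewrite {2}E.
Qed.

Lemma conj_zpsi c : (zpsi c)^* = zpsi (- c).
Proof.
have zpsi_u : zpsi c * zpsi (- c) = 1 by rewrite -zpsiD subrr zpsi0.
have n1 : `|zpsi c| = 1.
  have : `|zpsi c| ^+ p == 1.
    by rewrite -normrX /zpsi exprAC (prim_expr_order pz) expr1n normr1.
  by rewrite pexpr_eq1 ?prime_gt0 // ?normr_ge0 // => /eqP.
apply: (@mulfI _ (zpsi c)); first by rewrite -normr_eq0 n1 oner_neq0.
by rewrite zpsi_u -normCK n1 expr1n.
Qed.

Local Notation S a b := (klS zpsi a b).

Lemma klS_real a b : exists s : R, S a b = s%:C%C.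
Proof.
have : S a b \is Num.real.
  apply/CrealP; rewrite /klS rmorph_sum (reindex_inj (@oppr_inj 'F_p)) /=.
  apply: eq_big => [x|x _]; first by rewrite oppr_eq0.
  by rewrite conj_zpsi; congr zpsi; rewrite invrN; ring.
by case/complex_realP => s; exists s.
Qed.

Variables (K : closedFieldType) (inF : {rmorphism 'F_p -> K}).
Let pcharK := pchar_closure pr_p inF.
Let zsum_psi := sum_psi pr_p zpsiD zpsi0 zpsi_neq1.

Lemma klS_ext_seq a b s n : a != 0 -> b != 0 -> S a b = s%:C%C -> (0 < n)%N ->
  klS_ext inF zpsi a b n = (kl_seq p%:R s n)%:C%C.
Proof.
move=> a0 b0 sE; have [E1 E2 E3] := klS_ext_rec pr_p inF zpsiD zpsi0 zpsi_neq1 a0 b0.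
rewrite sE in E1 E2 E3.
have pC : (p%:R : R[i]) = (p%:R : R)%:C%C by rewrite rmorph_nat.
case: n => // n _; elim/ltn_ind: n => -[|[|n]] IH; first exact: E1.
  by rewrite E2 /= pC -rmorphXn -rmorphMn -rmorphB; congr (_%:C)%C; ring.
by rewrite E3 !IH // pC -!rmorphM -rmorphN -rmorphB.
Qed.

Lemma frob_tr_fixed n (u : K) : u ^+ (p ^ n) = u -> frob_tr p n u ^+ p = frob_tr p n u.
Proof.
move=> ue; have {1 2}-> : frob_tr p n u = \sum_(i < n) u ^+ (p ^ i).
  by rewrite /frob_tr big_mkord.
have := frob_sum pcharK 1 (fun i : 'I_n => u ^+ (p ^ i)); rewrite expn1 => ->.
case: n ue => [_|n ue]; first by rewrite !big_ord0.
rewrite big_ord_recr big_ord_recl /= addrC -exprM -expnSr ue expn0 expr1; congr (_ + _).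
by apply: eq_bigr => i _; rewrite -exprM -expnSr.
Qed.

Lemma kl_arg_fixed a b n (x : K) : x ^+ (p ^ n) = x -> kl_arg inF a b x ^+ (p ^ n) = kl_arg inF a b x.
Proof.
move=> xn; rewrite /kl_arg (frobD pcharK) !exprMn exprVn !(frob_inF pr_p) xn //.
Qed.

Definition trace0 a b n := [seq x <- fixed_seq K p n |
  (x != 0) && (preF inF (frob_tr p n (kl_arg inF a b x)) == 0)].

(** Orthogonality over the twists (j a, j b) detects the x whose trace vanishes and counts each of
    them p times. *)
Lemma sum_klS_ext a b n : (0 < n)%N ->
  \sum_j klS_ext inF zpsi (j * a) (j * b) n = (p * size (trace0 a b n))%:R.
Proof.
move=> n0; have [_ _ EP] := fixed_seqP pcharK n0.
rewrite /klS_ext exchange_big /= -sum1_size big_filter big_distrr /= natr_sum.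
rewrite big_mkcondr /= big_seq_cond [RHS]big_seq_cond; apply: eq_bigr => x /andP[].
rewrite EP => /eqP xn x0; set t := preF _ _.
rewrite (eq_bigr (fun j => zpsi (t * j))) => [|j _].
  by rewrite zsum_psi; case: eqP => _; rewrite ?muln1.
congr zpsi; apply: (fmorph_inj inF); rewrite inFK //.
  rewrite rmorphM /t inFK ?frob_tr_fixed ?kl_arg_fixed //.
  rewrite /frob_tr mulr_suml; apply: eq_bigr => i _.
  have -> : kl_arg inF (j * a) (j * b) x = inF j * kl_arg inF a b x.
    by rewrite /kl_arg !rmorphM; ring.
  by rewrite exprMn (frob_inF pr_p) mulrC.
by rewrite frob_tr_fixed // kl_arg_fixed.
Qed.

(** The easy half of additive Hilbert 90: y^p - y = u makes the trace of u telescope to 0, and for a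
    given u there are at most p such y. *)
Lemma pairs_le_trace0 a b n (E := fixed_seq K p n) : (0 < n)%N ->
  (\sum_(y <- E) count (fun x : K => (x != 0) && (y ^+ p - y == inF a * x + inF b / x))%R E
   <= p * size (trace0 a b n))%N.
Proof.
move=> n0; have [uE _ EP] := fixed_seqP pcharK n0.
have -> : (\sum_(y <- E) count (fun x : K => (x != 0) && (y ^+ p - y == inF a * x + inF b / x))%R E =
   \sum_(x <- E) count (fun y : K => (x != 0) && (y ^+ p - y == inF a * x + inF b / x))%R E)%N.
  under eq_bigr => y _ do rewrite -sum1_count big_mkcond.
  under [in RHS]eq_bigr => x _ do rewrite -sum1_count big_mkcond.
  by rewrite exchange_big.
rewrite -sum1_size big_filter big_distrr /= [leqRHS]big_mkcond /=.
rewrite big_seq [leqRHS]big_seq.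
apply: leq_sum => x; rewrite -/E EP => /eqP xn; rewrite -/(kl_arg inF a b x); set u := kl_arg _ _ _ _.
have [x0|x0] /= := eqVneq x 0; first by rewrite count_pred0.
rewrite muln1 -size_filter; case: eqP => [_|t0].
  pose P : {poly K} := 'X^p - 'X - u%:P.
  have sP : size P = p.+1.
    by rewrite /P -addrA size_polyDl ?size_polyXn // -opprD size_polyN size_XaddC ltnS prime_gt1.
  have P0 : P != 0 by rewrite -size_poly_eq0 sP.
  rewrite -ltnS -sP max_poly_roots ?filter_uniq //.
  by apply/allP => y; rewrite mem_filter rootE !hornerE subr_eq0 => /andP[].
rewrite leqn0 size_eq0; apply/eqP; rewrite -(filter_pred0 E); apply: eq_in_filter => y.
rewrite EP => /eqP yn /=; apply/eqP => yu; apply: t0.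
have -> : frob_tr p n u = 0.
  rewrite /frob_tr -yu; under eq_bigr => i _ do rewrite (frobB pcharK) -exprM -expnS.
  by rewrite telescope_sumr // yn expn0 expr1 subrr.
by apply: (fmorph_inj inF); rewrite rmorph0 inFK // expr0n gtn_eqF // prime_gt0.
Qed.

Lemma bernoulli (x : R) n : 0 <= x -> 1 + n%:R * x <= (1 + x) ^+ n.
Proof.
move=> x0; elim: n => [|n IH]; first by rewrite mul0r addr0 expr0.
rewrite exprS -natr1; have : 0 <= n%:R :> R by rewrite ler0n.
by move=> n0; nra.
Qed.

(* If s^2 > 4p the two roots are real, so that their even power sums are positive
    and too large for the point count [count_pairs] in large degree. *)
Lemma weil_real a b (s : R) : a != 0 -> b != 0 -> S a b = s%:C%C -> s ^+ 2 <= 4%:R * p%:R.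
Proof.
move=> a0 b0 sE; rewrite leNgt; apply/negP => lt_s.
have p3 : (3 <= p)%N by rewrite odd_prime_gt2.
have p0 : 0 < p%:R :> R by rewrite ltr0n prime_gt0.
pose sj j := complex.Re (S (j * a) (j * b)).
have sjE j : S (j * a) (j * b) = (sj j)%:C%C.
  by have [t tE] := klS_real (j * a) (j * b); rewrite /sj tE.
have main k : (0 < k)%N ->
    2%:R * (s ^+ 2 / 4%:R) ^+ (p * k) <= (8 * p + 2)%:R * p%:R ^+ (p * k).
  move=> k0; set m := (p * k)%N; have m3 : (3 <= m)%N by rewrite /m; nia.
  have m0 : (0 < 2 * m)%N by lia.
  have := sum_klS_ext a b m0; have := pairs_le_trace0 a b m0.
  set N := (p * size _)%N; set q0 := (p ^ m)%N.
  have qE : (p ^ (2 * m) = q0 * q0)%N by rewrite mul2n -addnn expnD.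
  have [uE szE EP] := fixed_seqP pcharK m0; rewrite qE in szE EP.
  have q0_big : (4 * p < q0)%N.
    have : (p ^ 3 <= q0)%N by rewrite leq_exp2l // prime_gt1.
    by rewrite !expnS expn0; nia.
  have iF (c : 'F_p) : inF c ^+ p = inF c by rewrite -rmorphXn (Fp_frob pr_p).
  have iF0 (c : 'F_p) : c != 0 -> inF c != 0 by rewrite fmorph_eq0.
  have := count_pairs pcharK op (iF a) (iF b) (iF0 _ a0) (iF0 _ b0) q0_big uE szE EP.
  move=> le1 le2; rewrite (bigD1 0) //= !mul0r.
  (* The twist j = 0 is the main term q - 1 of the point count, so the lower bound for the count
     becomes a lower bound for the sum over the other twists. *)
  have -> : klS_ext inF zpsi 0 0 (2 * m) = (q0 * q0).-1%:R.
    rewrite /klS_ext (eq_bigr (fun=> 1)) => [|x _].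
      rewrite big_const_seq iter_addr_0; congr (_ *+ _).
      rewrite -szE -(count_predC (pred1 0)) count_uniq_mem // EP expr0n gtn_eqF ?muln_gt0 ?expn_gt0 ?prime_gt0 //.
      by rewrite eqxx.
    have -> : frob_tr p (2 * m) (kl_arg inF 0 0 x) = 0.
      rewrite /frob_tr big1 // => i _; rewrite /kl_arg rmorph0 !mul0r addr0 expr0n gtn_eqF //.
      by rewrite expn_gt0 prime_gt0.
    by rewrite -(rmorph0 inF) preFK zpsi0.
  rewrite (eq_bigr (fun j => (kl_seq p%:R (sj j) (2 * m))%:C%C)) => [|j j0]; last first.
    by rewrite (klS_ext_seq _ _ (sjE j)) ?mulf_neq0.
  rewrite -(rmorph_nat (real_complex R) (q0 * q0).-1) -(rmorph_nat (real_complex R) N).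
  rewrite -[\sum_(_ | _) _](rmorph_sum (real_complex R)) -rmorphD => /(fmorph_inj _) E.
  have {}E : - ((6 * p + 2) * q0)%:R <= \sum_(j | j != 0) kl_seq p%:R (sj j) (2 * m).
    have : (q0 * q0 <= N + (6 * p + 2) * q0)%N.
      by apply: leq_trans le1 _; rewrite leq_add2r.
    rewrite -(ler_nat R) natrD -E => L.
    have : (q0 * q0).-1%:R <= (q0 * q0)%:R :> R by rewrite ler_nat leq_pred.
    by lra.
  have s1 : sj 1 = s by rewrite /sj !mul1r sE.
  (* The twist j = 1 is the one assumed too large, hence very negative in [kl_seq]; all others are
     bounded above by [kl_seq_small] and cannot compensate it. *)
  have := kl_seq_large p0 m (ltW lt_s); rewrite -/m => L1.
  move: E; rewrite (bigD1 1) ?oner_neq0 //= s1.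
  have : \sum_(i | (i != 0) && (i != 1)) kl_seq p%:R (sj i) (2 * m) <=
      \sum_(i : 'F_p) 2%:R * p%:R ^+ m.
    rewrite [X in X <= _]big_mkcond; apply: ler_sum => j _; case: ifP => _.
      exact: kl_seq_small.
    by rewrite mulr_ge0 // exprn_ge0 // ler0n.
  rewrite sumr_const; have -> : #|'F_p| = p by exact: card_Fp.
  have -> : ((6 * p + 2) * q0)%:R = (6%:R * p%:R + 2%:R) * p%:R ^+ m :> R.
    by rewrite natrM natrD natrM natrX.
  have -> : (8 * p + 2)%:R = 8%:R * p%:R + 2%:R :> R by rewrite natrD natrM.
  rewrite -[(2%:R * _) *+ p]mulr_natr => L2 L3; apply: le_trans L1 _.
  by move: L2 L3; set y := p%:R ^+ m; set t := p%:R; nra.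
(* [main] says that (1 + r)^m stays below the constant (8p + 2) / 2 for all multiples m of p, which
   Bernoulli's inequality refutes. *)
pose r := s ^+ 2 / (4%:R * p%:R) - 1.
have r0 : 0 < r by rewrite subr_gt0 ltr_pdivlMr ?mul1r // mulr_gt0.
have [n nP] := arch ((8 * p + 2)%:R / r).
have := main n.+1 isT; set m := (p * n.+1)%N.
have -> : s ^+ 2 / 4%:R = (1 + r) * p%:R.
  by rewrite /r addrC subrK; field; rewrite gt_eqF.
rewrite exprMn mulrA ler_pM2r ?exprn_gt0 //.
have := bernoulli m (ltW r0); move: nP; rewrite ltr_pdivrMr // => nP B L.
have : n%:R * r <= m%:R * r by rewrite ler_pM2r // ler_nat (leq_trans (leqnSn n)) // leq_pmull // prime_gt0.
by lra.
Qed.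
End WeilBound.
End WeilBound.

(** * Kloosterman sums to composite moduli *)

Module KloostermanSums.
Import Reals.
Import all_boot all_order all_algebra all_field.
Import mathcomp.algebra_tactics.ring mathcomp.algebra_tactics.lra zify.
Import mathcomp.real_closed.complex.
Import Rstruct.
Import KloostermanL WeilBound.
Set Implicit Arguments. Unset Strict Implicit. Unset Printing Implicit Defensive.
Import Order.TTheory GRing.Theory Num.Theory.
Local Open Scope ring_scope.

Section Kloosterman.

Definition E (t : R) : R[i] := (cos (2%:R * PI * t)%R +i* sin (2%:R * PI * t)%R)%C.
Arguments E t%_ring_scope.

Lemma ED s t : E (s + t) = E s * E t.
Proof.
rewrite /E mulrDr cos_plus sin_plus; apply/eqP; rewrite eq_complex /=.
by rewrite !RplusE !RminusE !RmultE eqxx /= addrC.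
Qed.

Lemma E0 : E 0 = 1.
Proof. by rewrite /E mulr0 cos_0 sin_0. Qed.

Lemma two_R : 2%:R = IZR 2 :> R.
Proof. by rewrite -INRE. Qed.

Lemma E1 : E 1 = 1.
Proof. by rewrite /E mulr1 two_R -RmultE cos_2PI sin_2PI. Qed.

Lemma EMn t (n : nat) : E (n%:R * t) = E t ^+ n.
Proof.
elim: n => [|n IH]; first by rewrite mul0r E0 expr0.
by rewrite -natr1 mulrDl mul1r ED IH exprSr.
Qed.

Lemma E_nat n : E n%:R = 1.
Proof. by rewrite -[n%:R]mulr1 EMn E1 expr1n. Qed.

Lemma normE t : `|E t| = 1.
Proof.
rewrite /E normc_def /=.
have -> : cos (2%:R * PI * t) ^+ 2 + sin (2%:R * PI * t) ^+ 2 = 1 :> R.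
  by have := sin2_cos2 (2%:R * PI * t); rewrite /Rsqr RplusE !RmultE -!expr2 addrC.
by rewrite sqrtr1.
Qed.

Definition Ec (c k : nat) : R[i] := E (k%:R / c%:R).

Lemma EcD c k l : Ec c (k + l) = Ec c k * Ec c l.
Proof. by rewrite /Ec natrD mulrDl ED. Qed.

Lemma Ec_mod (c k : nat) : (0 < c)%N -> Ec c (k %% c) = Ec c k.
Proof.
move=> c0; have cn : c%:R != 0 :> R by rewrite pnatr_eq0 -lt0n.
by rewrite {2}(divn_eq k c) EcD {2}/Ec natrM mulfK // E_nat mul1r.
Qed.

Lemma Ec_eqmod (c k l : nat) : (0 < c)%N -> (k = l %[mod c])%N -> Ec c k = Ec c l.
Proof. by move=> c0 kl; rewrite -Ec_mod // kl Ec_mod. Qed.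

(* For each unit x modulo c, y runs over its single inverse. *)
Definition kl (r m c : nat) : R[i] :=
  \sum_(0 <= x < c) \sum_(0 <= y < c | (x * y == 1 %[mod c])%N) Ec c (r * x + m * y).

Lemma inv_unique (c x y y' : nat) : (y < c)%N -> (y' < c)%N ->
  (x * y = 1 %[mod c])%N -> (x * y' = 1 %[mod c])%N -> y = y'.
Proof.
move=> yc y'c xy xy'.
have : (y = y' %[mod c])%N; last by rewrite (modn_small yc) (modn_small y'c).
rewrite -[y in LHS]mul1n -modnMml -xy' modnMml -[y' in RHS]mul1n -[RHS]modnMml -xy modnMml.
by rewrite mulnAC.
Qed.

Lemma kl_trivial r m c : `|kl r m c| <= c%:R.
Proof.
rewrite /kl (le_trans (ler_norm_sum _ _ _)) //.
rewrite -[c in X in _ <= X]subn0 -[X in _ <= X]mulr1 mulr_natl -sumr_const_nat.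
apply: ler_sum => x _; case: (boolP (has (fun y => (x * y == 1 %[mod c])%N) (index_iota 0 c))); last first.
  move=> /hasPn H; rewrite big_seq_cond big1 ?normr0 // => y /andP[yc]; rewrite (negbTE (H y yc)) //.
case/hasP => y; rewrite mem_index_iota => /= yc /eqP xy.
rewrite big_nat_cond (eq_bigl (fun j => j == y)).
  by rewrite -[index_iota _ _]/(index_iota 0 c) sum_nat_pick // normE.
move=> j; apply/idP/eqP => [/andP[/andP[_ jc] /eqP xj]|->]; last by rewrite yc xy eqxx.
exact: inv_unique jc yc xj xy.
Qed.

Lemma kl_coprime_bij (a b u v : nat) : (0 < a)%N -> (0 < b)%N -> coprime a b ->
  coprime u a -> coprime v b ->
  exists f : 'I_a * 'I_b -> 'I_(a * b),
    bijective f /\ forall w, (f w = u * w.1 * b + v * w.2 * a %[mod a * b])%N.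
Proof.
move=> a0 b0 ab ua vb; have ab0 : (0 < a * b)%N by rewrite muln_gt0 a0.
pose f (w : 'I_a * 'I_b) := Ordinal (ltn_pmod (u * w.1 * b + v * w.2 * a) ab0).
exists f; split; last by move=> w; rewrite /= modn_mod.
apply: inj_card_bij; last by rewrite card_prod !card_ord.
have H (a' b' u' v' : nat) (i j : 'I_a') (k l : nat) : coprime a' b' -> coprime u' a' ->
    (u' * i * b' + v' * k * a' = u' * j * b' + v' * l * a' %[mod a'])%N -> i = j.
  move=> ab' ua'; rewrite !modnMDr_id || rewrite -!(modnDmr _ (_ * a')%N) !modnMl !addn0.
  move=> /eqP E1; apply/val_inj; wlog: i j E1 / (i <= j)%N => [W|ij].
    by case/orP: (leq_total i j) => ij; [apply: W | apply/esym/W; rewrite // eq_sym].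
  rewrite eq_sym eqn_mod_dvd ?leq_mul // in E1.
  rewrite -mulnBl -mulnBr Gauss_dvdl // Gauss_dvdr 1?coprime_sym // in E1.
  have := dvdn_leq _ E1; case: (posnP (j - i)) => [/eqP|ji /(_ isT)]; first by rewrite subn_eq0 => *; apply/eqP; rewrite eqn_leq ij.
  by have := ltn_ord j; lia.
move=> [i k] [j l] /(congr1 val) /= E1.
have Ea : (u * i * b + v * k * a = u * j * b + v * l * a %[mod a])%N.
  by rewrite -(modn_dvdm _ (dvdn_mulr b (dvdnn a))) E1 modn_dvdm ?dvdn_mulr.
have Eb : (v * k * a + u * i * b = v * l * a + u * j * b %[mod b])%N.
  by rewrite addnC -(modn_dvdm _ (dvdn_mull a (dvdnn b))) E1 modn_dvdm ?dvdn_mull // addnC.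
by rewrite (H _ _ _ _ _ _ _ _ ab ua Ea) (H _ _ _ _ _ _ _ _ _ vb Eb) // coprime_sym.
Qed.

Lemma EcMr (a b u : nat) : (0 < b)%N -> Ec (a * b) (u * b) = Ec a u.
Proof.
move=> b0; rewrite /Ec !natrM; congr E.
by rewrite -mulf_div divff ?mulr1 // pnatr_eq0 -lt0n.
Qed.

Lemma inv_mod_helper (a b s x y X Y : nat) : (s * b = 1 %[mod a])%N ->
  ((x * b + X * a) * (s ^ 2 * y * b + Y * a) = x * y %[mod a])%N.
Proof.
move=> E2; have -> : ((x * b + X * a) * (s ^ 2 * y * b + Y * a) =
   (X * (s ^ 2 * y * b) + x * b * Y + X * Y * a) * a + x * y * ((s * b) * (s * b)))%N.
  by rewrite -mulnn; ring.
have E3 : ((s * b) * (s * b) = 1 %[mod a])%N by rewrite -modnMml E2 modnMml mul1n.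
by rewrite modnMDl -modnMmr E3 modnMmr muln1.
Qed.

(** Chinese remainders with x = x1 b + x2 a and y = b'^2 y1 b + a'^2 y2 a, where b' inverts b modulo
    a and a' inverts a modulo b: then x y is x1 y1 modulo a and x2 y2 modulo b. All twists are put
    on m, so that r, on which the coprimality conditions are imposed, is the same in both
    factors. *)
Lemma kl_mul (r m a b : nat) : (0 < a)%N -> (0 < b)%N -> coprime a b ->
  exists s t, kl r m (a * b) = kl r (m * s) a * kl r (m * t) b.
Proof.
move=> a0 b0 ab; have ab0 : (0 < a * b)%N by rewrite muln_gt0 a0.
have inv (k l : nat) : (0 < k)%N -> (0 < l)%N -> coprime k l -> exists s : nat, (s * k = 1 %[mod l])%N.
  move=> k0 l0 kl'; case: (egcdnP l k0) => s t E' _; exists s; rewrite E' (eqP kl') //.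
  by rewrite modnMDl.
have [b' Eb'] : exists s : nat, (s * b = 1 %[mod a])%N by apply: inv; rewrite // coprime_sym.
have [a' Ea'] : exists s : nat, (s * a = 1 %[mod b])%N by apply: inv.
have cop (s k l : nat) : (0 < l)%N -> (s * k = 1 %[mod l])%N -> coprime s l.
  move=> l0 E'; apply/eqP/eqP; rewrite -dvdn1.
  have d1 := dvdn_gcdl s l; have d2 := dvdn_gcdr s l.
  have : (gcdn s l %| (s * k) %% l)%N by rewrite /dvdn modn_dvdm // -/(dvdn _ _) dvdn_mulr.
  by rewrite E' /dvdn modn_dvdm.
exists (b' ^ 2)%N, (a' ^ 2)%N.
have [f [bij_f fE]] := kl_coprime_bij a0 b0 ab (coprime1n a) (coprime1n b).
have [g [bij_g gE]] : exists f : 'I_a * 'I_b -> 'I_(a * b),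
    bijective f /\ forall w, (f w = b' ^ 2 * w.1 * b + a' ^ 2 * w.2 * a %[mod a * b])%N.
  by apply: kl_coprime_bij; rewrite ?coprimeXl //; [apply: cop Eb' | apply: cop Ea'].
rewrite /kl !big_mkord.
under eq_bigr do rewrite big_mkord.
under [X in _ = X * _]eq_bigr do rewrite big_mkord.
under [X in _ = _ * X]eq_bigr do rewrite big_mkord.
rewrite big_distrlr /= pair_bigA /= (reindex f) /=; last exact: onW_bij.
apply: eq_bigr => -[x1 x2] _; rewrite (reindex g) /=; last exact: onW_bij.
rewrite big_distrlr /= [RHS]pair_big /=; apply: eq_big => [[y1 y2]|[y1 y2] _] /=.
  rewrite -modnMml -modnMmr fE gE modnMml modnMmr /=.
  rewrite chinese_remainder //; congr (_ && _).
    by rewrite -(@inv_mod_helper a b b' x1 y1 (1 * x2) (a' ^ 2 * y2)) ?mul1n.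
  rewrite -(@inv_mod_helper b a a' x2 y2 (1 * x1) (b' ^ 2 * y1)) ?mul1n //.
  by rewrite [(x1 * b + _)%N]addnC [(b' ^ 2 * y1 * b + _)%N]addnC.
rewrite -[in X in _ = X * _](EcMr _ _ b0) -[in X in _ = _ * X](EcMr _ _ a0) [(b * a)%N]mulnC -EcD.
apply: Ec_eqmod => //.
rewrite -modnDm -[(r * f _ %% _)%N]modnMmr -[(m * g _ %% _)%N]modnMmr fE gE !modnMmr modnDm /=.
by congr modn; ring.
Qed.

(** If p divides m the sum is a complete character sum without its term at 0, that is -1. Otherwise
    [weil_real] applies over an algebraic closure of F_p. *)
Lemma kl_prime (p r m : nat) : prime p -> (2 < p)%N -> ~~ (p %| r)%N ->
  `|kl r m p| ^+ 2 <= (4 * p)%:R.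
Proof.
move=> pr_p p2 pr.
have p_gt0 := prime_gt0 pr_p; have op : odd p by case: (even_prime pr_p) p2 => [->|].
have FpE := Fp_cast pr_p.
have sumF (G : nat -> R[i]) : \sum_(x : 'F_p) G x = \sum_(0 <= x < p) G x.
  by rewrite big_mkord -[in RHS]FpE.
have modF (k : nat) : ((k%:R : 'F_p) : nat) = (k %% p)%N by rewrite val_Fp_nat.
have valF (x : 'F_p) : (x : nat)%:R = x by rewrite natr_Zp.
have eqF (k l : nat) : ((k%:R : 'F_p) == l%:R) = (k == l %[mod p])%N.
  by rewrite -val_eqE /= !modF.
have EcF (k : nat) (t : 'F_p) : k%:R = t -> Ec p k = Ec p t.
  by move=> kt; apply: Ec_eqmod => //; apply/eqP; rewrite -eqF valF kt.
have klE : kl r m p = \sum_(x : 'F_p | x != 0) Ec p ((r%:R * x + m%:R / x)%R : 'F_p).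
  rewrite /kl -(sumF (fun x => \sum_(0 <= y < p | (x * y == 1 %[mod p])%N) Ec p (r * x + m * y))).
  rewrite [RHS]big_mkcond; apply: eq_bigr => x _.
  rewrite big_mkcond -(sumF (fun y => if (x * y == 1 %[mod p])%N then Ec p (r * x + m * y) else 0)) -big_mkcond.
  rewrite (eq_bigl (fun y => x * y == 1 :> 'F_p)); last first.
    by move=> y; rewrite -eqF natrM !valF.
  have [->|x0] := eqVneq x 0.
    by rewrite big1 // => y; rewrite mul0r eq_sym oner_eq0.
  rewrite (big_pred1 x^-1) => [|y].
    by apply: EcF; rewrite natrD !natrM !valF.
  by apply/eqP/eqP => [xy|->]; [apply: (mulfI x0); rewrite xy divff | rewrite divff].
have r0 : r%:R != 0 :> 'F_p by rewrite -(dvdn_pcharf (pchar_Fp pr_p)).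
have z1 : Ec p 1 != 1.
  rewrite /Ec /E eq_complex /= negb_and; apply/orP; right.
  apply/eqP => s0; have PI0 : 0 < PI :> R by apply/RltP; exact: PI_RGT_0.
  have p3 : 3%:R <= p%:R :> R by rewrite ler_nat.
  have pp : 0 < p%:R :> R by rewrite ltr0n.
  have L1 : 0 < 2%:R * PI * (1%:R / p%:R) :> R by apply: mulr_gt0; [apply: mulr_gt0 | apply: divr_gt0].
  have L2 : 2%:R * PI * (1%:R / p%:R) < PI :> R.
    by rewrite mulrA ltr_pdivrMr // mulr1 mulrC ltr_pM2l //; lra.
  have := sin_gt_0 _ (elimT RltP L1) (elimT RltP L2); rewrite s0 => H.
  by have := Rlt_irrefl _ H.
have zp : Ec p 1 ^+ p = 1.
  by rewrite /Ec -EMn mulrCA divff ?mulr1 ?E1 // pnatr_eq0 -lt0n.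
have [l pz lp] := prim_order_exists p_gt0 zp.
have {lp} lE : l = p.
  case/primeP: pr_p => _ /(_ _ lp) /orP[/eqP l1|/eqP //].
  by have := prim_expr_order pz; rewrite l1 expr1 => z1'; rewrite z1' eqxx in z1.
rewrite {}lE in pz.
have EcE (x : 'F_p) : Ec p x = zpsi (Ec p 1) x.
  by rewrite /zpsi /Ec -EMn mul1r.
have [m0|m0] := eqVneq (m%:R : 'F_p) 0.
  have : \sum_(x : 'F_p) zpsi (Ec p 1) (r%:R * x) = 0.
    rewrite (sum_psi pr_p (zpsiD pr_p pz) (@zpsi0 p _ _) (zpsi_neq1 pr_p pz)) (negbTE r0) //.
  rewrite (bigD1 0) //= mulr0 zpsi0 => /eqP; rewrite addrC addr_eq0 => /eqP E2.
  have -> : kl r m p = -1.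
    by rewrite klE -E2; apply: eq_bigr => x _; rewrite m0 mul0r addr0 EcE.
  by rewrite normrN1 expr1n -[1]/(1%:R) ler_nat; lia.
have arch (x : R) : exists n : nat, x < n%:R.
  by have [n nP] := INR_unbounded x; exists n; rewrite -INRE; apply/RltP.
have [K [inF _]] := countable_algebraic_closure 'F_p.
have [s sE] := klS_real pr_p pz r%:R m%:R.
have klS_E : kl r m p = (s%:C)%C.
  by rewrite klE -sE /klS; apply: eq_bigr => x _; rewrite EcE.
have := weil_real pr_p op pz arch inF r0 m0 sE.
rewrite klS_E => s2; rewrite normc_def /= expr0n /= addr0 sqrtr_sqr -rmorphXn /= real_normK ?num_real //.
by rewrite natrM -!(rmorph_nat (real_complex R)) -rmorphM lecR.
Qed.
End Kloosterman.

(** * Divisor bounds and Kloosterman sums on average over the modulus *)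

Section DivisorBounds.

Definition pw (n : nat) (e : R) : R := Rpower n%:R e.

Lemma pw_gt0 n e : 0 < pw n e. Proof. by apply/RltP; exact: exp_pos. Qed.

Lemma pwM m n e : (0 < m)%N -> (0 < n)%N -> pw (m * n) e = pw m e * pw n e.
Proof.
by move=> m0 n0; rewrite /pw natrM -!RmultE Rpower_mult_distr //; apply/RltP; rewrite ltr0n.
Qed.

Lemma pw1 e : pw 1 e = 1.
Proof. by rewrite /pw /Rpower ln_1 Rmult_0_r exp_0. Qed.

Lemma pwX m k e : (0 < m)%N -> pw (m ^ k) e = pw m e ^+ k.
Proof.
move=> m0; elim: k => [|k IH]; first by rewrite expn0 expr0 pw1.
by rewrite expnS exprS pwM ?IH // expn_gt0 m0.
Qed.

Lemma pw_le m n e : 0 <= e -> (0 < m)%N -> (m <= n)%N -> pw m e <= pw n e.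
Proof.
move=> e0 m0 mn; apply/RleP; apply: Rle_Rpower_l; first by apply/RleP.
by split; [apply/RltP; rewrite ltr0n | apply/RleP; rewrite ler_nat].
Qed.

Lemma pw_ge1 n e : 0 <= e -> (0 < n)%N -> 1 <= pw n e.
Proof. by move=> e0 n0; rewrite -(pw1 e) pw_le. Qed.

Lemma divisors_prime_pow p e m : prime p -> (0 < m)%N ->
  (size (divisors (p ^ e * m)) <= e.+1 * size (divisors m))%N.
Proof.
move=> pr_p m0; have pe0 : (0 < p ^ e)%N by rewrite expn_gt0 prime_gt0.
have -> : (e.+1 * size (divisors m) =
  size [seq p ^ i * d | i <- iota 0 e.+1, d <- divisors m])%N by rewrite size_allpairs size_iota.
apply: uniq_leq_size (divisors_uniq _) _ => d; rewrite -dvdn_divisors ?muln_gt0 ?pe0 // => dn.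
have d0 : (0 < d)%N by apply: dvdn_gt0 dn; rewrite muln_gt0 pe0.
have dE : d = (gcdn d (p ^ e) * (d %/ gcdn d (p ^ e)))%N by rewrite mulnC divnK // dvdn_gcdl.
have /(dvdn_pfactor _ _ pr_p)[i ie iE] := dvdn_gcdr d (p ^ e).
apply/allpairsP; exists (i, d %/ gcdn d (p ^ e))%N; split; last by rewrite /= -iE -dE.
  by rewrite mem_iota /= add0n ltnS.
rewrite /= -dvdn_divisors // -(@Gauss_dvdr _ (p ^ e %/ gcdn d (p ^ e))).
  rewrite -(dvdn_pmul2l (p := gcdn d (p ^ e))) ?gcdn_gt0 ?d0 // mulnA.
  by rewrite -dE [(gcdn _ _ * (_ %/ _))%N]mulnC divnK ?dvdn_gcdr.
rewrite /coprime -(eqn_pmul2l (m := gcdn d (p ^ e))) ?gcdn_gt0 ?d0 // muln_gcdr.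
have E2 : (gcdn d (p ^ e) * (p ^ e %/ gcdn d (p ^ e)) = p ^ e)%N by rewrite mulnC divnK // dvdn_gcdr.
by rewrite -dE E2 muln1.
Qed.

Lemma divisors_prime_mul p m : prime p -> ~~ (p %| m)%N -> (0 < m)%N ->
  (2 * size (divisors m) <= size (divisors (p * m)))%N.
Proof.
move=> pr_p pm m0; have p0 := prime_gt0 pr_p.
have -> : (2 * size (divisors m) = size (divisors m ++ [seq p * d | d <- divisors m]))%N.
  by rewrite size_cat size_map addnn mul2n.
apply: uniq_leq_size.
  rewrite cat_uniq divisors_uniq map_inj_uniq ?divisors_uniq ?andbT /=; last first.
    by move=> i j /eqP; rewrite eqn_pmul2l // => /eqP.
  apply/hasPn => _ /mapP[d _ ->] /=; rewrite -dvdn_divisors //.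
  by apply: contra pm; apply: dvdn_trans; rewrite dvdn_mulr.
move=> d; rewrite mem_cat -!dvdn_divisors ?muln_gt0 ?p0 // => /orP[dm|/mapP[d' ]].
  exact: dvdn_mull.
by rewrite -dvdn_divisors // => d'm ->; rewrite dvdn_pmul2l.
Qed.

(** Prime by prime: when p^e >= 2, the factor k + 1 is at most 2^k <= p^(k e); each of the finitely
    many smaller primes costs at most one constant [C1]. *)
Lemma divisor_bound (e : R) : 0 < e -> exists C : R, 0 < C /\
  forall n, (0 < n)%N -> (size (divisors n))%:R <= C * pw n e.
Proof.
move=> e0; pose x := pw 2 e - 1.
have x0 : 0 < x.
  by rewrite subr_gt0 -(pw1 e); apply/RltP; apply: Rlt_Rpower_l; rewrite ?ltr0n ?ltr_nat //;
    [apply/RltP | split; apply/RltP; rewrite ?ltr0n ?ltr_nat].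
(* With 1 + x = 2^e this constant gives k + 1 <= C1 (1 + k x) <= C1 (1 + x)^k <= C1 p^(k e), by
   Bernoulli's inequality. *)
pose C1 := 1 + x^-1; have C11 : 1 <= C1 by rewrite lerDl invr_ge0 ltW.
have [P0 P0P] : exists P0 : nat, forall p, (P0 <= p)%N -> (0 < p)%N -> 2%:R <= pw p e.
  pose w : R := e^-1; have we : w * e = 1 by rewrite mulVf // gt_eqF.
  have [N NP] := INR_unbounded (Rpower 2%:R w).
  exists N => p Np p0.
  have -> : 2%:R = Rpower (Rpower 2%:R w) e :> R.
    by rewrite Rpower_mult RmultE we Rpower_1 //; apply/RltP; rewrite ltr0n.
  apply/RleP; apply: Rle_Rpower_l; first by apply/RleP; exact: ltW.
  split; first exact: exp_pos.
  apply/RleP; apply: le_trans (_ : N%:R <= _); last by rewrite ler_nat.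
  by rewrite -[N%:R]INRE; apply/RleP; left; exact: NP.
pose small := [seq p <- iota 0 P0 | prime p].
suff main n : (0 < n)%N -> (size (divisors n))%:R <=
    C1 ^+ count (fun p => p %| n)%N small * pw n e.
  exists (C1 ^+ size small); split=> [|n n0]; first by rewrite exprn_gt0 // (lt_le_trans ltr01).
  apply: le_trans (main n n0) _; rewrite ler_pM2r ?pw_gt0 //.
  by rewrite ler_weXn2l // count_size.
elim/ltn_ind: n => n IH n0.
have [n1|n1] := leqP n 1.
  have -> : n = 1%N by lia.
  by rewrite pw1 mulr1 exprn_ege1.
set p := pdiv n; have pr_p : prime p by apply: pdiv_prime.
have [m pm nE] := pfactor_coprime pr_p n0; set k := logn p n in nE.
have k0 : (0 < k)%N by rewrite logn_gt0 pi_pdiv.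
have m0 : (0 < m)%N by move: n0; rewrite nE muln_gt0 => /andP[].
have p1 := prime_gt1 pr_p; have p0 := prime_gt0 pr_p.
have pNm : ~~ (p %| m)%N by rewrite -prime_coprime.
have mn : (m < n)%N by rewrite nE ltn_Pmulr // -(exp1n k) ltn_exp2r.
have IHm := IH m mn m0.
rewrite nE mulnC pwM ?expn_gt0 ?p0 // pwX //.
apply: le_trans (_ : (k.+1 * size (divisors m))%:R <= _).
  by rewrite ler_nat divisors_prime_pow.
have dvdE q : prime q -> (q %| p ^ k * m)%N = (q == p) || (q %| m)%N.
  by move=> pr_q; rewrite Euclid_dvdM // Euclid_dvdX // k0 andbT dvdn_prime2.
have cntE : count (fun q => q %| p ^ k * m)%N small =
    (count (pred1 p) small + count (fun q => q %| m)%N small)%N.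
  have := count_predUI (pred1 p) (fun q => q %| m)%N small.
  have -> : count (predI (pred1 p) (fun q => q %| m)%N) small = 0%N.
    apply/eqP; rewrite -leqn0 leqNgt -has_count; apply/hasPn => q _ /=.
    by apply/negP => /andP[/eqP ->]; apply/negP.
  rewrite addn0 => <-; apply: eq_in_count => q; rewrite mem_filter => /andP[pr_q _] /=.
  by rewrite dvdE.
rewrite cntE exprD natrM.
have pk : k.+1%:R <= C1 ^+ count (pred1 p) small * pw p e ^+ k.
  rewrite count_uniq_mem ?filter_uniq ?iota_uniq // mem_filter pr_p mem_iota add0n /=.
  case: ltnP => [_|P0p]; last first.
    rewrite expr0 mul1r; apply: le_trans (_ : 2%:R ^+ k <= _).
      by rewrite -natrX ler_nat ltn_expl.
    by apply: lerXn2r; rewrite ?nnegrE ?ler0n ?(ltW (pw_gt0 _ _)) // P0P.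
  rewrite expr1; apply: le_trans (_ : C1 * (1 + x) ^+ k <= _).
    apply: le_trans (_ : C1 * (1 + k%:R * x) <= _).
      rewrite /C1 mulrDr mulr1 mulrDl mul1r mulrCA mulVf ?gt_eqF // mulr1 -natr1.
      have : 0 <= k%:R * x by rewrite mulr_ge0 ?ler0n ?ltW.
      have : 0 <= x^-1 by rewrite invr_ge0 ltW.
      by lra.
    by rewrite ler_pM2l ?bernoulli ?ltW // (lt_le_trans ltr01).
  rewrite ler_pM2l ?(lt_le_trans ltr01) // /x addrC subrK.
  by apply: lerXn2r; rewrite ?nnegrE ?(ltW (pw_gt0 _ _)) // pw_le // ltW.
apply: le_trans (_ : (C1 ^+ count (pred1 p) small * pw p e ^+ k) *
   (C1 ^+ count (fun q => q %| m)%N small * pw m e) <= _).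
  by apply: ler_pM; rewrite ?ler0n.
by rewrite le_eqVlt; apply/orP; left; apply/eqP; ring.
Qed.

(** The primes that divide c exactly once and do not divide h are peeled off one at a time; they are
    those at which square-root cancellation will be used. *)
Lemma split_good (h c : nat) : (0 < c)%N -> exists (ps : seq nat) b,
  [/\ c = (\prod_(p <- ps) p * b)%N, uniq ps & all prime ps] /\
  (forall p, p \in ps -> coprime p b /\ ~~ (p %| h)%N) /\
  (forall p, prime p -> (p %| b)%N -> (p ^ 2 %| b)%N || (p %| h)%N).
Proof.
elim/ltn_ind: c => c IH c0.
have [/hasP[p]|/hasPn H] := boolP (has (fun p => ~~ (p ^ 2 %| c)%N && ~~ (p %| h)%N) (primes c)); last first.
  exists [::], c; rewrite big_nil mul1n; split=> //; split=> // p pr_p pc.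
  have : p \in primes c by rewrite mem_primes pr_p c0.
  by move/H; rewrite -negb_or negbK.
rewrite mem_primes => /and3P[pr_p _ pc] /andP[p2c ph].
have p0 := prime_gt0 pr_p; have p1 := prime_gt1 pr_p.
have cE : c = (p * (c %/ p))%N by rewrite mulnC divnK.
have m0 : (0 < c %/ p)%N by rewrite divn_gt0 // dvdn_leq.
have pm : ~~ (p %| c %/ p)%N by apply: contra p2c => H; rewrite cE expnS expn1 dvdn_pmul2l.
have [ps [b [[mE ups aps] [H1 H2]]]] := IH _ (ltn_Pdiv p1 c0) m0.
exists (p :: ps), b; split; last split => //.
- split=> //=; first by rewrite big_cons -mulnA -mE.
    rewrite ups andbT; apply: contra pm => pps; rewrite mE dvdn_mulr //.
    by rewrite (big_rem p pps) /= dvdn_mulr.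
  by rewrite pr_p.
move=> q; rewrite inE => /orP[/eqP ->|/H1 //]; split=> //.
by rewrite prime_coprime //; apply: contra pm => H; rewrite mE dvdn_mull.
Qed.

(** An even exponent 2f of p in b gives p^f to k. An odd exponent 2f + 1 leaves one more p: it goes
    to g if p | h, and otherwise to l, which is possible because p^2 | b forces f >= 1, so that l
    still divides k. *)
Lemma split_full (h b : nat) : (0 < b)%N -> (0 < h)%N ->
  (forall p, prime p -> (p %| b)%N -> (p ^ 2 %| b)%N || (p %| h)%N) ->
  exists k l g, [/\ b = (k ^ 2 * l * g)%N, (l %| k)%N & (g %| h)%N].
Proof.
move=> + h0; elim/ltn_ind: b => b IH b0 bP.
have [b1|b1] := leqP b 1.
  by exists 1%N, 1%N, 1%N; split; rewrite ?dvd1n //; lia.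
set p := pdiv b; have pr_p : prime p by apply: pdiv_prime.
have [m pm bE] := pfactor_coprime pr_p b0; set e := logn p b in bE.
have e0 : (0 < e)%N by rewrite logn_gt0 pi_pdiv.
have m0 : (0 < m)%N by move: b0; rewrite bE muln_gt0 => /andP[].
have p1 := prime_gt1 pr_p; have p0 := prime_gt0 pr_p.
have mb : (m < b)%N by rewrite bE ltn_Pmulr // -(exp1n e) ltn_exp2r.
have mP q : prime q -> (q %| m)%N -> (q ^ 2 %| m)%N || (q %| h)%N.
  move=> pr_q qm; have := bP q pr_q; rewrite bE dvdn_mulr // => /(_ isT).
  rewrite Gauss_dvdl //; rewrite coprimeXl // coprimeXr // prime_coprime //.
  apply/negP => qp; have : q = p by apply/eqP; rewrite -dvdn_prime2.
  by move=> E2; move: pm; rewrite -E2 prime_coprime // qm.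
have [k [l [g [mE lk gh]]]] := IH m mb m0 mP.
have pg : coprime g p.
  by rewrite coprime_sym; apply: coprime_dvdr pm; rewrite mE dvdn_mull.
have eE := odd_double_half e.
case oe: (odd e) eE => /= eE; last first.
  exists (k * p ^ e./2)%N, l, g; split=> //; last by rewrite dvdn_mulr.
  by rewrite bE mE -{1}eE add0n -muln2 expnM expnMn; ring.
have [ph|pNh] := boolP (p %| h)%N.
  exists (k * p ^ e./2)%N, l, (g * p)%N; split=> //; first 2 last.
  - by rewrite Gauss_dvd // gh.
  - by rewrite bE mE -{1}eE expnD expn1 -muln2 expnM expnMn; ring.
  - by rewrite dvdn_mulr.
have e3 : (0 < e./2)%N.
  have := bP p pr_p; rewrite pdiv_dvd (negbTE pNh) orbF => /(_ isT) p2.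
  by rewrite half_gt0 -pfactor_dvdn.
exists (k * p ^ e./2)%N, (l * p)%N, g; split=> //.
  by rewrite bE mE -{1}eE expnD expn1 -muln2 expnM expnMn; ring.
by apply: dvdn_mul => //; rewrite dvdn_exp.
Qed.

Lemma pow2_size_divisors (ps : seq nat) : uniq ps -> all prime ps ->
  (2 ^ size ps <= size (divisors (\prod_(p <- ps) p)))%N.
Proof.
elim: ps => [|p ps IH] /=; first by rewrite big_nil.
move=> /andP[pps ups] /andP[pr_p aps]; rewrite big_cons expnS.
have P0 : (0 < \prod_(q <- ps) q)%N.
  by rewrite big_seq prodn_cond_gt0 // => q qps; rewrite prime_gt0 //; move/allP: aps; apply.
apply: leq_trans (divisors_prime_mul pr_p _ P0); first by rewrite leq_mul2l IH.
apply: contra pps; move: (aps); elim: (ps) => [|q s IHs] /=.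
  by rewrite big_nil dvdn1 => _ /eqP p1; rewrite p1 in pr_p.
move=> /andP[pr_q aps']; rewrite big_cons Euclid_dvdM // dvdn_prime2 // inE.
by case/orP => [->//|/IHs -> //]; rewrite orbT.
Qed.

Lemma kl_split (r m : nat) (ps : seq nat) b : uniq ps -> all prime ps -> (0 < b)%N ->
  (forall p, p \in ps -> coprime p b /\ ((2 < p)%N -> ~~ (p %| r)%N)) ->
  `|kl r m (\prod_(p <- ps) p * b)| ^+ 2 <= (4 ^ size ps * (\prod_(p <- ps) p * b ^ 2))%:R.
Proof.
elim: ps m => [|p ps IH] m /=.
  move=> _ _ _ _; rewrite big_nil !mul1n natrX.
  by apply: lerXn2r; rewrite ?nnegrE ?ler0n // kl_trivial.
move=> /andP[pps ups] /andP[pr_p aps] b0 H.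
have P0 : (0 < \prod_(q <- ps) q)%N.
  by rewrite big_seq prodn_cond_gt0 // => q qps; rewrite prime_gt0 //; move/allP: aps; apply.
have [cpb pr] := H p (mem_head _ _).
have cop : coprime p (\prod_(q <- ps) q * b).
  rewrite coprimeMr cpb andbT; move: pps (aps); elim: (ps) => [|q s IHs] /=.
    by rewrite big_nil coprimen1.
  rewrite inE negb_or big_cons coprimeMr => /andP[pq ps'] /andP[pr_q aps'].
  by rewrite IHs // andbT prime_coprime // dvdn_prime2.
rewrite big_cons -mulnA.
have Q0 : (0 < \prod_(q <- ps) q * b)%N by rewrite muln_gt0 P0.
have [s [t ->]] := kl_mul r m (prime_gt0 pr_p) Q0 cop.
rewrite normrM exprMn expnS.
have -> : (4 * 4 ^ size ps * (p * \prod_(q <- ps) q * b ^ 2) =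
  (4 * p) * (4 ^ size ps * (\prod_(q <- ps) q * b ^ 2)))%N by ring.
rewrite natrM; apply: ler_pM; rewrite ?exprn_ge0 //.
  (* At p = 2 the trivial bound suffices, as p^2 <= 4 p. *)
  case: (ltnP 2 p) => p2; first by apply: kl_prime => //; apply: pr.
  apply: le_trans (_ : (p%:R : R[i]) ^+ 2 <= _).
    by apply: lerXn2r; rewrite ?nnegrE ?ler0n // kl_trivial.
  by rewrite -natrX ler_nat expnS expn1 leq_mul2r; apply/orP; right; lia.
apply: IH => // q qps; have [? ?] := H q (mem_behead (s := p :: ps) qps) => //.
Qed.

(* A majorant of sqrt b, where c = s b with s squarefree, prime to b h, and
    every prime of b not dividing h occurring in b at least twice; such a b is
    k^2 l g with l | k and g | h. Weil's bound is used modulo s, the trivial one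
    modulo b. *)
Definition kl_weight (h c : nat) : R :=
  \sum_(1 <= k < c.+1) \sum_(l <- divisors k) \sum_(g <- divisors h)
    (if (k ^ 2 * l * g %| c)%N then k%:R * Num.sqrt (l * g)%:R else 0).

Lemma kl_bound (e : R) : 0 < e -> exists C : R, 0 < C /\
  forall h c r m : nat, (0 < h)%N -> (0 < c)%N ->
  (forall p, prime p -> (2 < p)%N -> (p %| c)%N -> ~~ (p %| h)%N -> ~~ (p %| r)%N) ->
  `|kl r m c| <= (C * pw c e * Num.sqrt c%:R * kl_weight h c)%:C%C.
Proof.
move=> e0; have [C [C0 CP]] := divisor_bound e0; exists C; split=> // h c r m h0 c0 Hr.
have [ps [b [[cE ups aps] [H1 H2]]]] := split_good h c0.
have b0 : (0 < b)%N by move: c0; rewrite cE muln_gt0 => /andP[].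
have P0 : (0 < \prod_(q <- ps) q)%N by move: c0; rewrite cE muln_gt0 => /andP[].
have [k [l [g [bE lk gh]]]] := split_full b0 h0 H2.
have k0 : (0 < k)%N by rewrite lt0n; apply: contraTneq b0 => k0; rewrite bE k0.
have W : Num.sqrt b%:R <= kl_weight h c.
  have bc : (b %| c)%N by rewrite cE dvdn_mull.
  have kc : (k <= c)%N.
    apply: dvdn_leq => //; apply: dvdn_trans bc; rewrite bE -mulnA expnS -mulnA.
    by rewrite dvdn_mulr.
  rewrite /kl_weight (bigD1_seq k) ?mem_index_iota ?iota_uniq ?k0 ?ltnS //=.
  rewrite (bigD1_seq l) ?divisors_uniq -?dvdn_divisors //=.
  rewrite (bigD1_seq g) ?divisors_uniq -?dvdn_divisors //= -bE bc -!addrA.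
  have -> : Num.sqrt b%:R = k%:R * Num.sqrt (l * g)%:R :> R.
    by rewrite bE -mulnA natrM natrX sqrtrM ?sqr_ge0 // sqrtr_sqr ger0_norm ?ler0n.
  rewrite lerDl; have T k' l' g' : 0 <= (if (k' ^ 2 * l' * g' %| c)%N then k'%:R * Num.sqrt (l' * g')%:R else 0 : R).
    by case: ifP => // _; rewrite mulr_ge0 ?ler0n ?sqrtr_ge0.
  by rewrite !addr_ge0 // sumr_ge0 // => *; rewrite ?sumr_ge0 // => *; rewrite sumr_ge0.
have H3 p : p \in ps -> coprime p b /\ ((2 < p)%N -> ~~ (p %| r)%N).
  move=> pps; have [cpb ph] := H1 p pps; split=> // p2.
  have pr_p : prime p by move/allP: aps; apply.
  by apply: Hr => //; rewrite cE dvdn_mulr // (big_rem p pps) /= dvdn_mulr.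
have := kl_split m ups aps b0 H3; rewrite -cE => L.
have nc : `|kl r m c| = (complex.Re `|kl r m c|)%:C%C by rewrite RRe_real ?normr_real.
set v := complex.Re _ in nc; rewrite nc in L *; rewrite lecR.
have v0 : 0 <= v by rewrite -lecR -nc normr_ge0.
rewrite -rmorphXn -(rmorph_nat (real_complex R)) lecR in L.
have {}L : v <= (2 ^ size ps)%:R * Num.sqrt c%:R * Num.sqrt b%:R.
  rewrite -(@ler_pXn2r _ 2) ?nnegrE ?mulr_ge0 ?ler0n ?sqrtr_ge0 //.
  rewrite !exprMn !sqr_sqrtr ?ler0n // -natrX -!natrM.
  apply: le_trans L _; rewrite ler_nat; apply/eq_leq.
  by rewrite cE (_ : 4 ^ size ps = (2 ^ size ps) ^ 2)%N; [ring | rewrite -expnM mulnC expnM].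
apply: le_trans L _.
have S2 : (2 ^ size ps)%:R <= C * pw c e.
  apply: le_trans (_ : (size (divisors (\prod_(p <- ps) p)))%:R <= _).
    by rewrite ler_nat pow2_size_divisors.
  apply: le_trans (CP _ P0) _; rewrite ler_pM2l // pw_le ?ltW //.
  by rewrite cE leq_pmulr.
apply: ler_pM; rewrite ?mulr_ge0 ?ler0n ?sqrtr_ge0 //.
by rewrite ler_wpM2r ?sqrtr_ge0.
Qed.

Lemma harmonic_le (e : R) : 0 < e -> exists C : R, 0 < C /\
  forall D, (0 < D)%N -> \sum_(1 <= k < D.+1) k%:R^-1 <= C * pw D e.
Proof.
move=> e0; exists (1 + e^-1); split; first by rewrite addr_gt0 ?invr_gt0.
have lnle D : (0 < D)%N -> \sum_(1 <= k < D.+1) k%:R^-1 <= 1 + ln D%:R.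
  elim: D => // -[|D] IH _; first by rewrite big_nat1 invr1 ln_1 addr0.
  rewrite big_nat_recr //=; apply: le_trans (lerD (IH isT) (lexx _)) _.
  rewrite -addrA lerD2l; have D0 : 0 < (D.+1%:R : R) by rewrite ltr0n.
  have D1 : 0 < (D.+2%:R : R) by rewrite ltr0n.
  have : ln (D.+1%:R / D.+2%:R) <= D.+1%:R / D.+2%:R - 1.
    have q0 : 0 < D.+1%:R / D.+2%:R :> R by rewrite divr_gt0.
    rewrite lerBrDl; apply/RleP; have := exp_ineq1_le (ln (D.+1%:R / D.+2%:R)).
    by rewrite exp_ln //; apply/RltP.
  have -> : ln (D.+1%:R / D.+2%:R) = ln D.+1%:R - ln D.+2%:R.
    rewrite /Rdiv ln_mult ?ln_Rinv //; try exact/RltP.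
    exact/Rinv_0_lt_compat/RltP.
  have -> : D.+1%:R / D.+2%:R - 1 = - (D.+2%:R^-1) :> R.
    have uE : D.+2%:R = D.+1%:R + 1 :> R by rewrite natr1.
    have u1 : D.+2%:R != 0 :> R by rewrite gt_eqF.
    by rewrite -[X in _ - X](mulfV u1) -mulrBl {1}uE opprD addrA subrr sub0r mulN1r.
  by move: (ln D.+1%:R) (ln D.+2%:R) (D.+2%:R^-1) => u v i; lra.
move=> D D0; apply: le_trans (lnle D D0) _.
have : 1 + e * ln D%:R <= pw D e by apply/RleP; exact: exp_ineq1_le.
have pw1' := pw_ge1 (ltW e0) D0; move=> L.
rewrite mulrDl mul1r; apply: lerD => //.
by rewrite -(ler_pM2l e0) mulrA mulfV ?gt_eqF // mul1r; lra.
Qed.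

(** At most D / (k^2 l g) of the c are divisible by k^2 l g, against the weight k sqrt(l g); at most
    D / k remains. The sums over l and g then cost divisor functions of k and h, and the one over k
    a logarithm. *)
Lemma kl_weight_sum (e : R) : 0 < e -> exists C : R, 0 < C /\
  forall h D : nat, (0 < h)%N -> (0 < D)%N ->
  \sum_(1 <= c < D.+1) kl_weight h c <= C * D%:R * pw h e * pw D (e + e).
Proof.
move=> e0; have [C [C0 CP]] := divisor_bound e0; have [B [B0 BP]] := harmonic_le e0.
exists (C * (C * B)); split=> [|h D h0 D0]; first by rewrite !mulr_gt0.
have kw_le c : (0 < c <= D)%N -> kl_weight h c <=
    \sum_(1 <= k < D.+1) \sum_(l <- divisors k) \sum_(g <- divisors h)
    (if (k ^ 2 * l * g %| c)%N then k%:R * Num.sqrt (l * g)%:R else 0).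
  move=> /andP[c0 cD]; rewrite [leRHS](@big_cat_nat _ _ _ c.+1) //= lerDl.
  by rewrite sumr_ge0 // => k _; rewrite sumr_ge0 // => l _; rewrite sumr_ge0 // => g _;
    case: ifP => // _; rewrite mulr_ge0 ?ler0n ?sqrtr_ge0.
apply: le_trans (_ : \sum_(1 <= c < D.+1) \sum_(1 <= k < D.+1) \sum_(l <- divisors k)
    \sum_(g <- divisors h) (if (k ^ 2 * l * g %| c)%N then k%:R * Num.sqrt (l * g)%:R else 0) <= _).
  by rewrite big_nat_cond [leRHS]big_nat_cond; apply: ler_sum => c /andP[Hc _]; apply: kw_le.
have inner k l g : (0 < k)%N -> (0 < l)%N -> (0 < g)%N ->
    \sum_(1 <= c < D.+1) (if (k ^ 2 * l * g %| c)%N then k%:R * Num.sqrt (l * g)%:R else 0 : R)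
    <= D%:R * k%:R^-1.
  move=> k0 l0 g0; rewrite -big_mkcond /=.
  set b := (k ^ 2 * l * g)%N; have b0 : (0 < b)%N by rewrite /b !muln_gt0 k0 l0 g0.
  have cnt : (count (fun c => b %| c)%N (index_iota 1 D.+1) <= D %/ b)%N.
    have -> : (D %/ b = size [seq (b * j)%N | j <- iota 1 (D %/ b)])%N by rewrite size_map size_iota.
    rewrite -size_filter; apply: uniq_leq_size; first by rewrite filter_uniq // iota_uniq.
    move=> c; rewrite mem_filter mem_index_iota => /andP[/dvdnP[j ->] /andP[c0 cD]].
    apply/mapP; exists j; last by rewrite mulnC.
    have j0 : (0 < j)%N by case: (j) c0.
    by rewrite mem_iota add1n ltnS j0 leq_divRL.
  rewrite -big_filter big_const_seq count_predT size_filter iter_addr_0.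
  rewrite -[_ *+ count _ _]mulr_natr; apply: le_trans (_ : k%:R * Num.sqrt (l * g)%:R * (D %/ b)%:R <= _).
    by rewrite ler_wpM2l ?mulr_ge0 ?ler0n ?sqrtr_ge0 // ler_nat.
  have k1 : 0 < k%:R :> R by rewrite ltr0n.
  have b1 : 0 < b%:R :> R by rewrite ltr0n.
  have Db : (D %/ b)%:R <= D%:R / b%:R :> R.
    by rewrite ler_pdivlMr // -natrM ler_nat leq_divM.
  apply: le_trans (_ : k%:R * Num.sqrt (l * g)%:R * (D%:R / b%:R) <= _).
    by rewrite ler_wpM2l ?mulr_ge0 ?ler0n ?sqrtr_ge0.
  have lg0 : 0 < (l * g)%:R :> R by rewrite ltr0n muln_gt0 l0.
  have lg1' : 1 <= (l * g)%:R :> R by rewrite ler1n muln_gt0 l0.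
  have lg1 : 1 <= Num.sqrt (l * g)%:R :> R by rewrite -[leLHS]sqrtr1; apply: ler_wsqrtr.
  have -> : b%:R = k%:R ^+ 2 * Num.sqrt (l * g)%:R ^+ 2 :> R.
    by rewrite sqr_sqrtr ?ltW // -natrX -natrM mulnA.
  have s0 : 0 < Num.sqrt (l * g)%:R :> R by apply: lt_le_trans lg1.
  have -> : k%:R * Num.sqrt (l * g)%:R * (D%:R / (k%:R ^+ 2 * Num.sqrt (l * g)%:R ^+ 2)) =
     D%:R * k%:R^-1 * (Num.sqrt (l * g)%:R)^-1 :> R by field; rewrite !gt_eqF.
  by rewrite ler_piMr ?mulr_ge0 ?ler0n ?invr_ge0 ?ler0n // invf_le1.
rewrite exchange_big /=.
apply: le_trans (_ : \sum_(1 <= k < D.+1) (C * pw h e) * (C * pw D e) * (D%:R * k%:R^-1) <= _).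
  rewrite big_nat_cond [leRHS]big_nat_cond; apply: ler_sum => k /andP[/andP[k0 kD] _].
  rewrite exchange_big /=.
  apply: le_trans (_ : \sum_(l <- divisors k) (C * pw h e) * (D%:R * k%:R^-1) <= _).
    rewrite big_seq [leRHS]big_seq; apply: ler_sum => l; rewrite -dvdn_divisors // => lk.
    have l0 := dvdn_gt0 k0 lk; rewrite exchange_big /=.
    apply: le_trans (_ : \sum_(g <- divisors h) (D%:R * k%:R^-1) <= _).
      rewrite big_seq [leRHS]big_seq; apply: ler_sum => g; rewrite -dvdn_divisors // => gh.
      by apply: inner => //; apply: dvdn_gt0 gh.
    rewrite big_const_seq count_predT iter_addr_0 -[_ *+ size _]mulr_natl.
    by rewrite ler_wpM2r ?CP ?mulr_ge0 ?ler0n ?invr_ge0 ?ler0n.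
  rewrite big_const_seq count_predT iter_addr_0 -[_ *+ size _]mulr_natl mulrCA -mulrA.
  rewrite ler_wpM2l ?mulr_ge0 ?(ltW C0) ?(ltW (pw_gt0 _ _)) //.
  rewrite ler_wpM2r ?mulr_ge0 ?ler0n ?invr_ge0 ?ler0n //.
  by apply: le_trans (CP k k0) _; rewrite ler_pM2l // pw_le // ltW.
rewrite -mulr_sumr -mulr_sumr; have BD := BP D D0.
have -> : pw D (e + e) = pw D e * pw D e by rewrite /pw Rpower_plus.
apply: le_trans (_ : C * pw h e * (C * pw D e) * (D%:R * (B * pw D e)) <= _).
  by rewrite ler_wpM2l ?mulr_ge0 ?(ltW (pw_gt0 _ _)) ?(ltW C0) // ler_wpM2l ?ler0n.
by rewrite le_eqVlt; apply/orP; left; apply/eqP; ring.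
Qed.
End DivisorBounds.
End KloostermanSums.

(** * Fourier series of periodic complex functions *)

Module Fourier.
Import Reals Lra Lia Psatz ZArith Coquelicot.
Import ssreflect ssrfun ssrbool eqtype ssrnat seq choice fintype bigop div prime.
Import zify ssrZ.
Import HB.structures.
Set Implicit Arguments. Unset Strict Implicit. Unset Printing Implicit Defensive.
Open Scope R_scope.

HB.instance Definition _ := Monoid.isComLaw.Build R 0 Rplus
  (fun x y z => esym (Rplus_assoc x y z)) Rplus_comm Rplus_0_l.
HB.instance Definition _ := Monoid.isMulLaw.Build R 0 Rmult Rmult_0_l Rmult_0_r.
HB.instance Definition _ := Monoid.isAddLaw.Build R Rmult Rplus
  Rmult_plus_distr_r Rmult_plus_distr_l.
HB.instance Definition _ := Monoid.isComLaw.Build C (RtoC 0) Cplus Cplus_assoc Cplus_comm Cplus_0_l.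
HB.instance Definition _ := Monoid.isMulLaw.Build C (RtoC 0) Cmult Cmult_0_l Cmult_0_r.
HB.instance Definition _ := Monoid.isAddLaw.Build C Cmult Cplus
  Cmult_plus_distr_r Cmult_plus_distr_l.

Notation "\rsum_ ( i <- r | P ) F" := (\big[Rplus/0%R]_(i <- r | P%B) F%R)
  (at level 41, F at level 41, i, r at level 50).
Notation "\rsum_ ( i <- r ) F" := (\big[Rplus/0%R]_(i <- r) F%R)
  (at level 41, F at level 41, i, r at level 50).
Notation "\rsum_ ( m <= i < n | P ) F" := (\big[Rplus/0%R]_(m <= i < n | P%B) F%R)
  (at level 41, F at level 41, i, m, n at level 50).
Notation "\rsum_ ( m <= i < n ) F" := (\big[Rplus/0%R]_(m <= i < n) F%R)
  (at level 41, F at level 41, i, m, n at level 50).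
Notation "\csum_ ( i <- r | P ) F" := (\big[Cplus/RtoC 0]_(i <- r | P%B) F%C)
  (at level 41, F at level 41, i, r at level 50).
Notation "\csum_ ( i <- r ) F" := (\big[Cplus/RtoC 0]_(i <- r) F%C)
  (at level 41, F at level 41, i, r at level 50).
Notation "\csum_ ( m <= i < n | P ) F" := (\big[Cplus/RtoC 0]_(m <= i < n | P%B) F%C)
  (at level 41, F at level 41, i, m, n at level 50).
Notation "\csum_ ( m <= i < n ) F" := (\big[Cplus/RtoC 0]_(m <= i < n) F%C)
  (at level 41, F at level 41, i, m, n at level 50).

Section Sums.
Variable I : Type.
Implicit Types (r : seq I) (P : pred I).

Lemma Cmod_sum r P (F : I -> C) : Cmod (\csum_(i <- r | P i) F i) <= \rsum_(i <- r | P i) Cmod (F i).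
Proof.
elim: r => [|i r IH]; first by rewrite !big_nil Cmod_0; right.
rewrite !big_cons; case: (P i) => //.
by apply: Rle_trans (Cmod_triangle _ _) _; apply: Rplus_le_compat_l.
Qed.

Lemma rsum_le r P (F G : I -> R) : (forall i, P i -> F i <= G i) ->
  \rsum_(i <- r | P i) F i <= \rsum_(i <- r | P i) G i.
Proof.
move=> H; elim: r => [|i r IH]; first by rewrite !big_nil; right.
rewrite !big_cons; case Pi: (P i) => //.
by apply: Rplus_le_compat => //; apply: H.
Qed.

Lemma rsum_ge0 r P (F : I -> R) : (forall i, P i -> 0 <= F i) -> 0 <= \rsum_(i <- r | P i) F i.
Proof.
move=> H; elim: r => [|i r IH]; first by rewrite !big_nil; right.
by rewrite !big_cons; case Pi: (P i) => //; apply: Rplus_le_le_0_compat => //; apply: H.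
Qed.

Lemma rsum_scal r P (c : R) (F : I -> R) : \rsum_(i <- r | P i) (c * F i) = c * \rsum_(i <- r | P i) F i.
Proof. by rewrite big_distrr. Qed.

Lemma csum_scal r P (c : C) (F : I -> C) : (\csum_(i <- r | P i) (c * F i) = c * \csum_(i <- r | P i) F i)%C.
Proof. by rewrite big_distrr. Qed.

Lemma rsum_const r P (c : R) : \rsum_(i <- r | P i) c = INR (count P r) * c.
Proof.
elim: r => [|i r IH]; first by rewrite big_nil /=; ring.
by rewrite big_cons /=; case: (P i); rewrite IH ?plus_INR /= ?add0n ?S_INR; ring.
Qed.

Lemma rsum_filter_le r P (F : I -> R) : (forall i, 0 <= F i) ->
  \rsum_(i <- r | P i) F i <= \rsum_(i <- r) F i.
Proof.
move=> H; elim: r => [|i r IH]; first by rewrite !big_nil; right.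
by rewrite !big_cons; case: (P i); have := H i; lra.
Qed.

End Sums.

Lemma sum_n_m_big (F : nat -> C) m n : sum_n_m F m n = \csum_(m <= i < n.+1) F i.
Proof.
elim: n => [|n IH].
  case: m => [|m]; last by rewrite big_geq // sum_n_m_zero //; apply/ltP.
  by rewrite sum_n_n big_nat1.
have [mn|mn] := leqP m n.+1; last first.
  by rewrite big_geq // sum_n_m_zero //; apply/ltP.
by rewrite big_nat_recr //= -IH sum_n_Sm //; apply/leP.
Qed.

Definition ec (t : R) : C := (cos (2 * PI * t), sin (2 * PI * t)).

Lemma C_eq (a b : C) : Re a = Re b -> Im a = Im b -> a = b.
Proof. by case: a b => ? ? [? ?] /= -> ->. Qed.

Lemma ec_plus s t : ec (s + t) = (ec s * ec t)%C.
Proof.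
rewrite /ec; have -> : 2 * PI * (s + t) = 2 * PI * s + 2 * PI * t by ring.
by rewrite cos_plus sin_plus; apply: C_eq => /=; ring.
Qed.

Lemma ec_0 : ec 0 = RtoC 1.
Proof. by rewrite /ec Rmult_0_r cos_0 sin_0. Qed.

Lemma Cmod_ec t : Cmod (ec t) = 1.
Proof.
rewrite /Cmod /ec /=; rewrite -[RHS]sqrt_1; congr sqrt.
by have := sin2_cos2 (2 * PI * t); rewrite /Rsqr; lra.
Qed.

Lemma ec_opp t : ec (- t) = Cconj (ec t).
Proof.
rewrite /ec; have -> : 2 * PI * - t = - (2 * PI * t) by ring.
by rewrite cos_neg sin_neg.
Qed.

Lemma ec_1 : ec 1 = RtoC 1.
Proof. by rewrite /ec Rmult_1_r cos_2PI sin_2PI. Qed.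

Lemma ec_INR n : ec (INR n) = RtoC 1.
Proof. by elim: n => [|n IH]; rewrite ?ec_0 // S_INR ec_plus IH ec_1 Cmult_1_l. Qed.

Lemma ec_IZR k : ec (IZR k) = RtoC 1.
Proof.
case: (Z.le_ge_cases 0 k) => Hk.
  by rewrite -(Z2Nat.id k Hk) -INR_IZR_INZ ec_INR.
have -> : IZR k = - IZR (- k) by rewrite opp_IZR; ring.
rewrite ec_opp -(Z2Nat.id (- k)); last by lia.
by rewrite -INR_IZR_INZ ec_INR; apply: C_eq => /=; ring.
Qed.

Lemma ec_per t k : ec (t + IZR k) = ec t.
Proof. by rewrite ec_plus ec_IZR Cmult_1_r. Qed.

(** Continuity, like the integral [CI] below, is taken separately on real and imaginary parts, so
    that the calculus of real functions applies. *)
Definition Cc (f : R -> C) (z : R) :=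
  continuous (fun t => Re (f t)) z /\ continuous (fun t => Im (f t)) z.

Lemma cont_mult (f g : R -> R) z : continuous f z -> continuous g z -> continuous (fun t => f t * g t) z.
Proof. by move=> *; apply: (continuous_mult (K := R_AbsRing)). Qed.

Lemma cont_plus (f g : R -> R) z : continuous f z -> continuous g z -> continuous (fun t => f t + g t) z.
Proof. by move=> *; apply: (continuous_plus (V := R_NormedModule)). Qed.

Lemma cont_opp (f : R -> R) z : continuous f z -> continuous (fun t => - f t) z.
Proof. by move=> *; apply: (continuous_opp (V := R_NormedModule)). Qed.

Lemma cont_const (c z : R) : continuous (fun _ => c) z.
Proof. exact: continuous_const. Qed.

Lemma Cc_const c z : Cc (fun _ => c) z.
Proof. by split; apply: cont_const. Qed.

Lemma Cc_plus f g z : Cc f z -> Cc g z -> Cc (fun t => f t + g t)%C z.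
Proof. by move=> [f1 f2] [g1 g2]; split; apply: cont_plus. Qed.

Lemma Cc_mult f g z : Cc f z -> Cc g z -> Cc (fun t => f t * g t)%C z.
Proof.
move=> [f1 f2] [g1 g2]; split.
  by apply: cont_plus; [apply: cont_mult | apply: cont_opp; apply: cont_mult].
by apply: cont_plus; apply: cont_mult.
Qed.

Lemma Cc_minus f g z : Cc f z -> Cc g z -> Cc (fun t => f t - g t)%C z.
Proof.
move=> [f1 f2] [g1 g2]; split; apply: cont_plus => //; exact: cont_opp.
Qed.

Lemma Cc_sum (I : Type) (r : seq I) (P : pred I) (F : I -> R -> C) z :
  (forall i, P i -> Cc (F i) z) -> Cc (fun t => \csum_(i <- r | P i) F i t) z.
Proof.
move=> H; elim: r => [|i r IH].
  by split; apply: (continuous_ext (fun _ => 0)) => [t|]; rewrite ?big_nil //; apply: cont_const.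
case Pi: (P i); last first.
  case: IH => IH1 IH2; split.
    by apply: continuous_ext IH1 => t; rewrite big_cons Pi.
  by apply: continuous_ext IH2 => t; rewrite big_cons Pi.
case: (Cc_plus (H i Pi) IH) => H1 H2; split.
  by apply: continuous_ext H1 => t; rewrite big_cons Pi.
by apply: continuous_ext H2 => t; rewrite big_cons Pi.
Qed.

Lemma Cc_affine f u v z : Cc f (u * z + v) -> Cc (fun t => f (u * t + v)) z.
Proof.
have H : continuous (fun t => u * t + v) z.
  by apply: cont_plus; [apply: cont_mult; [exact: cont_const | exact: continuous_id] | exact: cont_const].
move=> [f1 f2]; split.
  exact: (continuous_comp (fun t => u * t + v) (fun s => Re (f s)) z H f1).
exact: (continuous_comp (fun t => u * t + v) (fun s => Im (f s)) z H f2).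
Qed.

Lemma Cc_ext f g z : (forall t, f t = g t) -> Cc f z -> Cc g z.
Proof. by move=> H [f1 f2]; split; [apply: continuous_ext f1|apply: continuous_ext f2] => t; rewrite H. Qed.

Lemma Cc_ec z : Cc ec z.
Proof.
split; apply: (ex_derive_continuous (K := R_AbsRing) (V := R_NormedModule)).
  by rewrite /ec /=; auto_derive.
by rewrite /ec /=; auto_derive.
Qed.

Lemma Cc_ecM k z : Cc (fun x => ec (k * x)) z.
Proof.
by apply: (Cc_ext (f := fun t => ec (k * t + 0))) => [t|]; [rewrite Rplus_0_r | apply: Cc_affine; apply: Cc_ec].
Qed.

Definition CI (f : R -> C) (a b : R) : C :=
  (RInt (fun t => Re (f t)) a b, RInt (fun t => Im (f t)) a b).

Definition Con (f : R -> C) (a b : R) := forall z, a <= z <= b -> Cc f z.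

Section Integral.
Variables a b : R.
Hypothesis ab : a <= b.

Lemma cont_ex (f : R -> R) : (forall z, a <= z <= b -> continuous f z) -> ex_RInt f a b.
Proof. by move=> H; apply: ex_RInt_continuous => z; rewrite Rmin_left // Rmax_right //; apply: H. Qed.

Lemma CI_ext f g : (forall x, a <= x <= b -> f x = g x) -> CI f a b = CI g a b.
Proof.
move=> H; apply: C_eq; apply: RInt_ext => x; rewrite Rmin_left // Rmax_right // => Hx;
  by rewrite H //; lra.
Qed.

Lemma CI_plus f g : Con f a b -> Con g a b -> CI (fun x => f x + g x)%C a b = (CI f a b + CI g a b)%C.
Proof.
move=> cf cg; apply: C_eq => /=.
  by apply: (RInt_plus (V := R_CompleteNormedModule)); apply: cont_ex => z /[dup] /cf [? ?] /cg [].
by apply: (RInt_plus (V := R_CompleteNormedModule)); apply: cont_ex => z /[dup] /cf [? ?] /cg [].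
Qed.

Lemma CI_scal (c : C) f : Con f a b -> CI (fun x => c * f x)%C a b = (c * CI f a b)%C.
Proof.
move=> cf.
have e1 : ex_RInt (fun t => Re (f t)) a b by apply: cont_ex => z /cf [].
have e2 : ex_RInt (fun t => Im (f t)) a b by apply: cont_ex => z /cf [].
have S (k : R) g : ex_RInt g a b -> RInt (fun t => k * g t) a b = k * RInt g a b.
  by move=> eg; apply: (RInt_scal (V := R_CompleteNormedModule)).
have ES (k : R) g : ex_RInt g a b -> ex_RInt (fun t => k * g t) a b.
  by move=> eg; apply: (ex_RInt_scal (V := R_NormedModule)).
apply: C_eq => /=.
  rewrite -!S //; apply: (RInt_minus (V := R_CompleteNormedModule)); exact: ES.
rewrite -!S //; apply: (RInt_plus (V := R_CompleteNormedModule)); exact: ES.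
Qed.

Lemma CI_sum (I : Type) (r : seq I) (P : pred I) (F : I -> R -> C) :
  (forall i, P i -> Con (F i) a b) ->
  CI (fun x => \csum_(i <- r | P i) F i x) a b = \csum_(i <- r | P i) CI (F i) a b.
Proof.
move=> H; elim: r => [|i r IH].
  rewrite big_nil; apply: C_eq => /=.
    rewrite (RInt_ext _ (fun _ => 0)) => [|x _]; last by rewrite big_nil.
    by rewrite RInt_const scal_zero_r.
  rewrite (RInt_ext _ (fun _ => 0)) => [|x _]; last by rewrite big_nil.
  by rewrite RInt_const scal_zero_r.
rewrite big_cons -IH; case Pi: (P i); last by apply: CI_ext => x _; rewrite big_cons Pi.
rewrite -CI_plus; first by apply: CI_ext => x _; rewrite big_cons Pi.
  exact: H.
by move=> z Hz; apply: Cc_sum => j Pj; apply: H.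
Qed.

Lemma CI_const c : CI (fun _ => c) a b = (RtoC (b - a) * c)%C.
Proof. by case: c => c1 c2; rewrite /CI !RInt_const /scal /= /mult /=; apply: C_eq => /=; ring. Qed.

Lemma CI_norm f g : Con f a b -> (forall x, a <= x <= b -> continuous g x) ->
  (forall x, a <= x <= b -> Cmod (f x) <= g x) -> Cmod (CI f a b) <= RInt g a b.
Proof.
move=> cf cg H.
have e1 : ex_RInt (fun t => Re (f t)) a b by apply: cont_ex => z /cf [].
have e2 : ex_RInt (fun t => Im (f t)) a b by apply: cont_ex => z /cf [].
have nE (z : C_R_NormedModule) : norm z = Cmod z.
  rewrite /norm /= /prod_norm /Cmod; congr sqrt.
  by rewrite /norm /= /abs /= !Rmult_1_r -!Rabs_mult !Rabs_pos_eq //; apply: Rle_0_sqr.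
rewrite -nE; apply: (@norm_RInt_le C_R_NormedModule f g a b (CI f a b) (RInt g a b) ab).
- by move=> x Hx; rewrite nE; apply: H.
- by apply: is_RInt_fct_extend_pair; apply: RInt_correct.
- by apply: RInt_correct; apply: cont_ex.
Qed.
End Integral.

Lemma CI_Chasles f a b c : a <= b -> b <= c -> Con f a c -> (CI f a b + CI f b c = CI f a c)%C.
Proof.
move=> ab bc cf; apply: C_eq => /=; apply: (RInt_Chasles (V := R_CompleteNormedModule));
  apply: cont_ex => // z Hz; have [] := cf z; lra || done.
Qed.

Lemma CI_affine f u v a b : a <= b -> 0 < u -> Con f (u * a + v) (u * b + v) ->
  (RtoC u * CI (fun x => f (u * x + v)%R) a b)%C = CI f (u * a + v) (u * b + v).
Proof.
move=> ab u0 cf.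
have uab : u * a + v <= u * b + v by nra.
have e1 : ex_RInt (fun t => Re (f t)) (u * a + v) (u * b + v) by apply: cont_ex => // z /cf [].
have e2 : ex_RInt (fun t => Im (f t)) (u * a + v) (u * b + v) by apply: cont_ex => // z /cf [].
have cA z : a <= z <= b -> Cc (fun x => f (u * x + v)) z.
  by move=> Hz; apply: Cc_affine; apply: cf; nra.
have S g : ex_RInt g a b -> u * RInt g a b = RInt (fun t => u * g t) a b.
  by move=> eg; symmetry; apply: (RInt_scal (V := R_CompleteNormedModule)).
apply: C_eq => /=; rewrite Rmult_0_l ?Rminus_0_r ?Rplus_0_r S.
- by rewrite -(RInt_comp_lin (V := R_CompleteNormedModule)).
- by apply: cont_ex => // z /cA [].
- by rewrite -(RInt_comp_lin (V := R_CompleteNormedModule)).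
- by apply: cont_ex => // z /cA [].
Qed.

Lemma CI_periodic f a b : (forall x, Cc f x) -> (forall x, f (x + 1) = f x) ->
  CI f a (a + 1) = CI f b (b + 1).
Proof.
move=> cf pf.
have cR (g : R -> R) x y : (forall z, continuous g z) -> ex_RInt g x y.
  by move=> cg; apply: ex_RInt_continuous => z _; apply: cg.
have H (g : R -> R) : (forall z, continuous g z) -> (forall x, g (x + 1) = g x) ->
    RInt g a (a + 1) = RInt g b (b + 1).
  move=> cg pg.
  have E1 : RInt g (a + 1) (b + 1) = RInt g a b.
    rewrite -[LHS](_ : RInt g (1 * a + 1) (1 * b + 1) = _); last by rewrite !Rmult_1_l.
    rewrite -RInt_comp_lin; last exact: cR.
    by apply: RInt_ext => x _; rewrite /scal /= /mult /= !Rmult_1_l pg.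
  have C1 := RInt_Chasles g a b (b + 1) (cR g a b cg) (cR g b (b + 1) cg).
  have C2 := RInt_Chasles g a (a + 1) (b + 1) (cR g a (a + 1) cg) (cR g (a + 1) (b + 1) cg).
  by move: C1 C2; rewrite /plus /= E1; lra.
apply: C_eq; apply: H => [z|x]; [by case: (cf z) | by rewrite pf | by case: (cf z) | by rewrite pf].
Qed.

Definition fc (G : R -> C) (m : Z) : C := CI (fun x => G x * ec (- IZR m * x))%C (- (1/2)) (1/2).

Lemma half_le : - (1/2) <= 1/2. Proof. lra. Qed.

Lemma Con_all f a b : (forall x, Cc f x) -> Con f a b.
Proof. by move=> H z _. Qed.

Lemma CI_shift f s : (forall x, Cc f x) -> (forall x, f (x + 1) = f x) ->
  CI (fun x => f (x + s)) (- (1/2)) (1/2) = CI f (- (1/2)) (1/2).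
Proof.
move=> cf pf.
have := @CI_affine f 1 s (- (1/2)) (1/2) half_le Rlt_0_1 (Con_all cf).
have -> : 1 * (1/2) + s = (1 * - (1/2) + s) + 1 by lra.
rewrite (CI_periodic (1 * - (1/2) + s) (- (1/2)) cf pf) Cmult_1_l.
have -> : - (1/2) + 1 = 1/2 by lra.
move=> <-; apply: CI_ext => [|x _]; [exact: half_le | by rewrite Rmult_1_l].
Qed.

(** For k <> 0 a translation by half a period, 1 / (2k), multiplies the integrand by -1. *)
Lemma int_ec k : CI (fun x => ec (IZR k * x)) (- (1/2)) (1/2) = if Z.eqb k 0 then RtoC 1 else RtoC 0.
Proof.
case: Z.eqb_spec => [->|k0].
  rewrite (CI_ext half_le (g := fun _ => RtoC 1)) => [|x _]; last by rewrite Rmult_0_l ec_0.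
  by rewrite CI_const; apply: C_eq => /=; field.
have kR : IZR k <> 0 by apply: not_0_IZR.
set f := fun x => ec (IZR k * x); set I := CI _ _ _.
have cf x : Cc f x by apply: Cc_ecM.
have E : I = (RtoC (-1) * I)%C.
  rewrite -(CI_scal half_le); last exact: Con_all.
  rewrite /I -(@CI_shift f (1 / (2 * IZR k))) //; last first.
    by move=> x; rewrite /f -[RHS](ec_per _ k); congr ec; ring.
  apply: CI_ext => [|x _]; first exact: half_le.
  rewrite /f; have -> : IZR k * (x + 1 / (2 * IZR k)) = IZR k * x + 1/2 by field.
  rewrite ec_plus Cmult_comm; congr Cmult; rewrite /ec.
  have -> : 2 * PI * (1 / 2) = PI by field.
  by rewrite cos_PI sin_PI.
have E1 : Re I = - Re I by rewrite {1}E /=; ring.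
have E2 : Im I = - Im I by rewrite {1}E /=; ring.
by move: E1 E2; case: (I) => u v /= E1 E2; apply: C_eq => /=; lra.
Qed.

Lemma fc_ec (k m : Z) : fc (fun x => ec (IZR k * x)) m = if Z.eqb k m then RtoC 1 else RtoC 0.
Proof.
rewrite /fc; have := int_ec (k - m).
have -> : Z.eqb (k - m) 0 = Z.eqb k m.
  by case: (Z.eqb_spec (k - m) 0); case: Z.eqb_spec => //; lia.
move=> <-; apply: CI_ext => [|x _]; first exact: half_le.
by rewrite -ec_plus minus_IZR; congr ec; ring.
Qed.

Lemma Cc_conj f z : Cc f z -> Cc (fun t => Cconj (f t)) z.
Proof. by move=> [f1 f2]; split => //; apply: cont_opp. Qed.

Lemma CI_conj f a b : a <= b -> Con f a b -> CI (fun t => Cconj (f t)) a b = Cconj (CI f a b).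
Proof.
move=> ab cf; apply: C_eq => //=.
by apply: (RInt_opp (V := R_CompleteNormedModule)); apply: cont_ex => // z /cf [].
Qed.

Lemma Con_mult f g a b : Con f a b -> Con g a b -> Con (fun x => f x * g x)%C a b.
Proof. by move=> cf cg z Hz; apply: Cc_mult; [apply: cf | apply: cg]. Qed.

Lemma Con_ec k a b : Con (fun x => ec (k * x)) a b.
Proof. by move=> z _; apply: Cc_ecM. Qed.

Lemma CconjM a b : Cconj (a * b) = (Cconj a * Cconj b)%C.
Proof. by apply: C_eq => /=; ring. Qed.

Lemma Cmod2 a : Cmod a ^ 2 = Re a ^ 2 + Im a ^ 2.
Proof. by rewrite /Cmod pow2_sqrt //; have := pow2_ge_0 (fst a); have := pow2_ge_0 (snd a); rewrite /Re /Im; lra. Qed.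

Lemma CmulConj a : (a * Cconj a)%C = RtoC (Cmod a ^ 2).
Proof. by rewrite Cmod2; case: a => u v; apply: C_eq => /=; ring. Qed.

Ltac rring := match goal with |- @eq _ ?a ?b => change (@eq R a b); ring end.

Lemma CI_R h a b : CI (fun x => RtoC (h x)) a b = RtoC (RInt h a b).
Proof. by apply: C_eq => //=; rewrite RInt_const scal_zero_r. Qed.

Lemma Con_abs2 f a b : Con f a b -> forall x, a <= x <= b -> continuous (fun x => Cmod (f x) ^ 2) x.
Proof.
move=> cf x /cf [f1 f2]; apply: (continuous_ext (fun x => Re (f x) * Re (f x) + Im (f x) * Im (f x))).
  by move=> t; rewrite Cmod2; rring.
by apply: cont_plus; apply: cont_mult.
Qed.

Lemma bessel (G : R -> C) (r : seq Z) : Con G (- (1/2)) (1/2) -> uniq r ->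
  \rsum_(m <- r) Cmod (fc G m) ^ 2 <= RInt (fun x => Cmod (G x) ^ 2) (- (1/2)) (1/2).
Proof.
move=> cG ur; set a := - (1/2); set b := 1/2; have ab : a <= b := half_le.
pose P x := \csum_(m <- r) (fc G m * ec (IZR m * x)).
have cP : Con P a b.
  by move=> z _; apply: Cc_sum => m _; apply: Cc_mult; [exact: Cc_const | exact: Cc_ecM].
pose D x := (G x - P x)%C.
have cD : Con D a b by move=> z Hz; apply: Cc_minus; [apply: cG | apply: cP].
have cC f : Con f a b -> Con (fun x => Cconj (f x)) a b by move=> cf z /cf; apply: Cc_conj.
have fcP m : m \in r -> fc P m = fc G m.
  move=> mr; have O k : CI (fun x => ec (IZR k * x) * ec (- IZR m * x))%C a b =
      if Z.eqb k m then RtoC 1 else RtoC 0 := fc_ec k m.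
  rewrite {1}/fc (CI_ext (g := fun x => \csum_(k <- r) (fc G k * (ec (IZR k * x) * ec (- IZR m * x)))) ab).
    rewrite CI_sum // => [|k _].
      rewrite (bigD1_seq m) //= big1 => [|k km].
        by rewrite CI_scal // ?O ?Z.eqb_refl /fc ?Cplus_0_r ?Cmult_1_r //; apply: Con_mult; exact: Con_ec.
      rewrite CI_scal // ?O; last by apply: Con_mult; exact: Con_ec.
      case: Z.eqb_spec => [E|_]; last by rewrite Cmult_0_r.
      by rewrite E eqxx in km.
    by apply: Con_mult; [move=> z _; exact: Cc_const | apply: Con_mult; exact: Con_ec].
  by move=> x _; rewrite /P big_distrl /=; apply: eq_bigr => k _; rewrite Cmult_assoc.
have fcD m : m \in r -> fc D m = RtoC 0.
  move=> mr; have -> : fc D m = (fc G m + RtoC (-1) * fc P m)%C.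
    rewrite /fc -CI_scal //; last by apply: Con_mult => //; exact: Con_ec.
    rewrite -CI_plus //; last 2 first.
    - by apply: Con_mult => //; exact: Con_ec.
    - by move=> z Hz; apply: Cc_mult; [exact: Cc_const | apply: Cc_mult; [apply: cP | apply: Cc_ecM]].
    apply: CI_ext => // x _; rewrite /D; ring.
  by rewrite fcP //; ring.
have DP : CI (fun x => D x * Cconj (P x))%C a b = RtoC 0.
  rewrite (CI_ext (g := fun x => \csum_(k <- r) (Cconj (fc G k) * (D x * ec (- IZR k * x)))) ab).
    rewrite CI_sum // => [|k _]; last first.
      by apply: Con_mult; [move=> z _; exact: Cc_const | apply: Con_mult => //; exact: Con_ec].
    rewrite big_seq big1 // => k kr; rewrite CI_scal //; last by apply: Con_mult => //; exact: Con_ec.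
    by rewrite -/(fc D k) fcD // Cmult_0_r.
  move=> x _; rewrite /P (big_morph Cconj (id1 := RtoC 0) (op1 := Cplus)); last 2 first.
  - by move=> u v; apply: C_eq => /=; ring.
  - by apply: C_eq => /=; ring.
  rewrite big_distrr /=; apply: eq_bigr => k _; rewrite CconjM -ec_opp.
  have -> : - (IZR k * x) = - IZR k * x by ring.
  ring.
have PG : CI (fun x => P x * Cconj (G x))%C a b = RtoC (\rsum_(m <- r) Cmod (fc G m) ^ 2).
  rewrite (CI_ext (g := fun x => \csum_(k <- r) (fc G k * (ec (IZR k * x) * Cconj (G x)))) ab).
    rewrite CI_sum // => [|k _]; last first.
      by apply: Con_mult; [move=> z _; exact: Cc_const | apply: Con_mult; [exact: Con_ec | exact: cC]].
    rewrite (big_morph RtoC (id1 := RtoC 0) (op1 := Cplus) RtoC_plus) //; apply: eq_bigr => k _.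
    rewrite CI_scal //; last by apply: Con_mult; [exact: Con_ec | exact: cC].
    rewrite -CmulConj; congr Cmult; rewrite /fc -CI_conj //; last by apply: Con_mult => //; exact: Con_ec.
    apply: CI_ext => // x _; rewrite CconjM -ec_opp Cmult_comm; congr (_ * ec _)%C; ring.
  by move=> x _; rewrite /P big_distrl /=; apply: eq_bigr => k _; rewrite Cmult_assoc.
have GG : CI (fun x => G x * Cconj (G x))%C a b = RtoC (RInt (fun x => Cmod (G x) ^ 2) a b).
  by rewrite -CI_R; apply: CI_ext => // x _; rewrite CmulConj.
have DD : CI (fun x => D x * Cconj (D x))%C a b =
   RtoC (RInt (fun x => Cmod (G x) ^ 2) a b - \rsum_(m <- r) Cmod (fc G m) ^ 2).
  have -> : RtoC (RInt (fun x => Cmod (G x) ^ 2) a b - \rsum_(m <- r) Cmod (fc G m) ^ 2) =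
     (CI (fun x => G x * Cconj (G x))%C a b + (RtoC (-1) * CI (fun x => P x * Cconj (G x))%C a b +
        RtoC (-1) * CI (fun x => D x * Cconj (P x))%C a b))%C.
    by rewrite GG PG DP; apply: C_eq => /=; ring.
  rewrite -!CI_scal; try (by []) ; try (by apply: Con_mult => //; apply: cC).
  have cS f : Con f a b -> Con (fun x => RtoC (-1) * f x)%C a b.
    by move=> cf; apply: Con_mult => // z _; exact: Cc_const.
  have cPG := Con_mult cP (cC _ cG); have cDP := Con_mult cD (cC _ cP).
  have cGG := Con_mult cG (cC _ cG).
  rewrite -!CI_plus //; try (by apply: cS).
    by apply: CI_ext => // x _; rewrite /D; apply: C_eq => /=; ring.
  by move=> z Hz; apply: Cc_plus; apply: cS.
have : CI (fun x => D x * Cconj (D x))%C a b = RtoC (RInt (fun x => Cmod (D x) ^ 2) a b).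
  by rewrite -CI_R; apply: CI_ext => // x _; rewrite CmulConj.
rewrite DD => /RtoC_inj E.
have : 0 <= RInt (fun x => Cmod (D x) ^ 2) a b.
  apply: RInt_ge_0 => //; first by apply: cont_ex => //; exact: Con_abs2.
  by move=> x _; apply: pow2_ge_0.
by rewrite -E; lra.
Qed.

Definition conv (u : nat -> C) (l : C) :=
  forall e, 0 < e -> exists N : nat, forall n, (N <= n)%N -> Cmod (u n - l) <= e.

Lemma conv_ext u v l : (forall n, u n = v n) -> conv u l -> conv v l.
Proof. by move=> H cu e /cu [N HN]; exists N => n /HN; rewrite H. Qed.

Lemma conv_const l : conv (fun _ => l) l.
Proof. by move=> e e0; exists 0%N => n _; rewrite (_ : l - l = RtoC 0)%C ?Cmod_0; [lra | ring]. Qed.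

Lemma conv_plus u v a b : conv u a -> conv v b -> conv (fun n => u n + v n)%C (a + b)%C.
Proof.
move=> cu cv e e0; have e2 : 0 < e / 2 by lra.
have [N HN] := cu _ e2; have [M HM] := cv _ e2; exists (maxn N M) => n; rewrite geq_max => /andP [/HN H1 /HM H2].
rewrite (_ : u n + v n - (a + b) = (u n - a) + (v n - b))%C; last by ring.
by apply: Rle_trans (Cmod_triangle _ _) _; lra.
Qed.

Lemma conv_scal c u a : conv u a -> conv (fun n => c * u n)%C (c * a)%C.
Proof.
move=> cu e e0; have c0 := Cmod_ge_0 c.
have e2 : 0 < e / (Cmod c + 1) by apply: Rdiv_lt_0_compat; lra.
have [N HN] := cu _ e2; exists N => n /HN H.
rewrite (_ : c * u n - c * a = c * (u n - a))%C; last by ring.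
rewrite Cmod_mult; apply: Rle_trans (Rmult_le_compat_l _ _ _ c0 H) _.
apply: (Rle_trans _ ((Cmod c + 1) * (e / (Cmod c + 1)))); last by right; field; lra.
by apply: Rmult_le_compat_r; lra.
Qed.

Lemma conv_sum (I : Type) (r : seq I) (P : pred I) (u : I -> nat -> C) (l : I -> C) :
  (forall i, P i -> conv (u i) (l i)) ->
  conv (fun n => \csum_(i <- r | P i) u i n) (\csum_(i <- r | P i) l i).
Proof.
move=> H; elim: r => [|i r IH].
  by apply: (conv_ext (u := fun _ => RtoC 0)) => [n|]; rewrite big_nil //; apply: conv_const.
case Pi: (P i).
  apply: (conv_ext (u := fun n => (u i n + \csum_(i <- r | P i) u i n)%C)) => [n|]; first by rewrite big_cons Pi.
  by rewrite big_cons Pi; apply: conv_plus => //; apply: H.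
by apply: (conv_ext (u := fun n => \csum_(i <- r | P i) u i n)) => [n|]; rewrite big_cons Pi.
Qed.

Lemma conv_bound u l B : conv u l -> (forall n, Cmod (u n) <= B) -> Cmod l <= B.
Proof.
move=> cu H; apply: Rnot_lt_le => lB.
have e0 : 0 < (Cmod l - B) / 2 by lra.
have [N /(_ N (leqnn N)) HN] := cu _ e0.
have := Cmod_triangle (u N) (RtoC (-1) * (u N - l))%C.
rewrite (_ : u N + RtoC (-1) * (u N - l) = l)%C; last by ring.
by rewrite Cmod_mult Cmod_R Rabs_Ropp Rabs_R1; have := H N; lra.
Qed.

Lemma conv_unique u a b : conv u a -> conv u b -> a = b.
Proof.
move=> ca cb; have H : conv (fun _ => RtoC 0) (a + RtoC (-1) * b)%C.
  apply: (conv_ext (u := fun n => (u n + RtoC (-1) * u n)%C)) => [n|]; first by ring.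
  by apply: conv_plus => //; apply: conv_scal.
have : Cmod (a + RtoC (-1) * b)%C <= 0 by apply: conv_bound H _ => n; rewrite Cmod_0; right.
move=> h; have /Cmod_eq_0 E : Cmod (a + RtoC (-1) * b)%C = 0 by have := Cmod_ge_0 (a + RtoC (-1) * b)%C; lra.
by apply: (eq_trans (y := ((a + RtoC (-1) * b) + b)%C)); [ring | rewrite E; ring].
Qed.

(** By [bessel] the squared moduli along distinct frequencies have bounded partial sums, so they
    tend to 0. *)
Lemma riemann_lebesgue G (k : nat -> Z) : Con G (- (1/2)) (1/2) -> injective k ->
  conv (fun n => fc G (k n)) (RtoC 0).
Proof.
move=> cG ik; set B := RInt (fun x => Cmod (G x) ^ 2) (- (1/2)) (1/2).
pose a n := Cmod (fc G (k n)) ^ 2.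
have a0 n : 0 <= a n by apply: pow2_ge_0.
have Sb n : sum_n a n <= B.
  have -> : sum_n a n = \rsum_(0 <= i < n.+1) a i.
    elim: n => [|n IH]; first by rewrite sum_O big_nat1.
    by rewrite sum_Sn IH [RHS]big_nat_recr.
  have := bessel cG (r := [seq k i | i <- iota 0 n.+1]); rewrite map_inj_uniq // iota_uniq => /(_ isT).
  by rewrite big_map /index_iota subn0.
have [l Hl] : ex_finite_lim_seq (sum_n a).
  apply: (ex_finite_lim_seq_incr _ B) => // n; rewrite sum_Sn.
  by have := a0 n.+1; rewrite /plus /=; lra.
have /ex_series_lim_0 /is_lim_seq_spec L : ex_series a by exists l.
move=> e e0; have e2 : 0 < e ^ 2 by nra.
have [N HN] := L (mkposreal _ e2); exists N => n /leP /HN /=.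
rewrite Rminus_0_r Rabs_pos_eq // (_ : fc G (k n) - 0 = fc G (k n))%C; last by ring.
by rewrite /a => H; have := Cmod_ge_0 (fc G (k n)); nra.
Qed.

Definition slope (f : R -> R) (l : R) (x : R) : R :=
  if Req_EM_T x 0 then l else (f x - f 0) / x.

Lemma slope0 f l : slope f l 0 = l.
Proof. by rewrite /slope; case: Req_EM_T. Qed.

Lemma slopeN f l x : x <> 0 -> slope f l x = (f x - f 0) / x.
Proof. by rewrite /slope; case: Req_EM_T. Qed.

Lemma slopeE f l x : x * slope f l x = f x - f 0.
Proof. case: (Req_EM_T x 0) => [->|n]; [rewrite slope0; ring | by rewrite slopeN //; field]. Qed.

Lemma slope_cont0 f l : is_derive f 0 l -> continuous (slope f l) 0.
Proof.
move=> /is_derive_Reals H; apply/continuity_pt_filterlim => e e0.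
have [d Hd] := H e e0; exists d; split; first exact: cond_pos.
move=> x [[_ x0]]; rewrite /dist /= /R_dist Rminus_0_r => xd.
rewrite slope0 slopeN; last by apply: not_eq_sym.
by have := Hd x (not_eq_sym x0) xd; rewrite Rplus_0_l.
Qed.

Lemma slope_cont f l x : x <> 0 -> continuous f x -> continuous (slope f l) x.
Proof.
move=> x0 cf; apply: (continuous_ext_loc _ (fun x => (f x - f 0) * / x)).
  exists (mkposreal _ (Rabs_pos_lt _ x0)) => y; rewrite /ball /= /AbsRing_ball /= /abs /minus /plus /opp /= => yx.
  rewrite slopeN // => y0.
  by move: yx; rewrite y0 Rplus_0_l Rabs_Ropp; lra.
apply: cont_mult; first by apply: cont_plus => //; apply: cont_const.
exact: continuous_Rinv.
Qed.

Lemma Cc_inv f z : Cc f z -> f z <> RtoC 0 -> Cc (fun t => / f t)%C z.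
Proof.
move=> [f1 f2] fz.
have c1 : continuous (fun t => / (Re (f t) ^ 2 + Im (f t) ^ 2)) z.
  apply: continuous_Rinv_comp.
    apply: (continuous_ext (fun t => Re (f t) * Re (f t) + Im (f t) * Im (f t))); first by move=> t; rring.
    by apply: cont_plus; apply: cont_mult.
  by move=> E; apply: fz; apply: C_eq => /=; move: E; rewrite /Re /Im; nra.
split; first by apply: cont_mult.
by apply: cont_mult => //; apply: cont_opp.
Qed.

(** Translation by x0 multiplies the m-th coefficient by ec (m x0), and multiplication of g by ec x
    - 1 replaces it by the difference of two consecutive coefficients of g. *)
Lemma fc_telescope G g x0 m : (forall x, Cc G x) -> (forall x, G (x + 1) = G x) ->
  Con g (- (1/2)) (1/2) ->
  (forall x, - (1/2) <= x <= 1/2 -> G (x + x0) = (G x0 + (ec x - 1) * g x)%C) ->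
  (fc G m * ec (IZR m * x0))%C = ((if Z.eqb m 0 then G x0 else 0) + (fc g (m - 1) - fc g m))%C.
Proof.
move=> cG pG cg H.
have -> : (fc G m * ec (IZR m * x0))%C = fc (fun x => G (x + x0)) m.
  rewrite /fc Cmult_comm -(CI_scal half_le); last by apply: Con_mult; [exact: Con_all | exact: Con_ec].
  rewrite -(@CI_shift (fun x => ec (IZR m * x0) * (G x * ec (- IZR m * x)))%C x0).
  - apply: CI_ext => [|x _]; first exact: half_le.
    have -> : - IZR m * (x + x0) = - IZR m * x + - (IZR m * x0) by ring.
    rewrite ec_plus (_ : forall a b c d : C, a * (b * (c * d)) = (b * c) * (a * d))%C; last by move=> *; ring.
    by rewrite -ec_plus Rplus_opp_r ec_0 Cmult_1_r.
  - by move=> x; apply: Cc_mult; [exact: Cc_const | apply: Cc_mult; [exact: cG | exact: Cc_ecM]].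
  - move=> x; rewrite pG; congr (_ * (_ * _))%C; rewrite -[RHS](ec_per _ (- m)); congr ec.
    by rewrite opp_IZR; ring.
have ce k : Con (fun x => g x * ec (- IZR k * x))%C (- (1/2)) (1/2) by apply: Con_mult => //; exact: Con_ec.
have c0 (c : C) k : Con (fun x => c * ec (k * x))%C (- (1/2)) (1/2).
  by move=> z _; apply: Cc_mult; [exact: Cc_const | exact: Cc_ecM].
have -> : (if Z.eqb m 0 then G x0 else 0)%C = CI (fun x => G x0 * ec (- IZR m * x))%C (- (1/2)) (1/2).
  rewrite (CI_scal half_le); last exact: Con_ec.
  rewrite -opp_IZR int_ec; case: (Z.eqb_spec m 0) => [->|n] /=; first by ring.
  by case: Z.eqb_spec => [E|_]; [lia | ring].
have cm k : Con (fun x => RtoC (-1) * (g x * ec (- IZR k * x)))%C (- (1/2)) (1/2).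
  by move=> z Hz; apply: Cc_mult; [exact: Cc_const | exact: ce].
have -> : (fc g (m - 1) - fc g m = fc g (m - 1) + RtoC (-1) * fc g m)%C by ring.
rewrite /fc -(CI_scal half_le) // -!(CI_plus half_le) //; last first.
  by move=> z Hz; apply: Cc_plus; [exact: ce | exact: cm].
apply: CI_ext => [|x Hx]; first exact: half_le.
rewrite H // minus_IZR; have -> : - (IZR m - 1) * x = - IZR m * x + x by ring.
by rewrite ec_plus; ring.
Qed.

Definition symsum (F : Z -> C) (N : nat) : C :=
  (F 0%Z + \csum_(1 <= n < N.+1) (F (Z.of_nat n) + F (- Z.of_nat n)%Z))%C.

Lemma symsum0 F : symsum F 0 = F 0%Z.
Proof. by rewrite /symsum big_nil Cplus_0_r. Qed.

Lemma symsumS F N : symsum F N.+1 = (symsum F N + (F (Z.of_nat N.+1) + F (- Z.of_nat N.+1)%Z))%C.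
Proof. by rewrite /symsum (@big_nat_recr _ _ _ N.+1) // /= Cplus_assoc. Qed.

Lemma ec_neq1 x : - (1/2) <= x <= 1/2 -> x <> 0 -> ec x <> RtoC 1.
Proof.
move=> Hx x0 E; have := congr1 Re E; rewrite /ec /=.
have -> : 2 * PI * x = 2 * (PI * x) by ring.
rewrite cos_2a_sin => H; have P := PI_RGT_0.
have S y : 0 < y <= 1/2 -> 0 < sin (PI * y) by move=> Hy; apply: sin_gt_0; nra.
case: (Rtotal_order x 0) => [L|[//|L]].
  have Hy : 0 < - x <= 1/2 by lra.
  have := S _ Hy; have -> : PI * - x = - (PI * x) by ring.
  rewrite sin_neg => s0; have : 0 < sin (PI * x) * sin (PI * x) by nra.
  by lra.
by have Hy : 0 < x <= 1/2; [lra | have := S _ Hy; nra].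
Qed.

(* Chernoff's proof: the Fourier coefficients of G telescope, because
    (G - G x0) / (ec (x - x0) - 1) is continuous, and Riemann-Lebesgue applies. *)
Lemma fourier_pointwise G x0 : (forall x, Cc G x) -> (forall x, G (x + 1) = G x) ->
  ex_derive (fun x => Re (G x)) x0 -> ex_derive (fun x => Im (G x)) x0 ->
  conv (symsum (fun m => fc G m * ec (IZR m * x0))%C) (G x0).
Proof.
move=> cG pG [l1 d1] [l2 d2].
pose H x := G (x + x0).
have sh (f : R -> R) l : is_derive f x0 l -> is_derive (fun x => f (x + x0)) 0 l.
  move=> d; have := is_derive_comp f (fun x => x + x0) 0 l 1.
  rewrite Rplus_0_l /scal /= /mult /= Rmult_1_l; apply => //.
  by auto_derive.
pose sG x : C := (slope (fun x => Re (H x)) l1 x, slope (fun x => Im (H x)) l2 x).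
pose se x : C := (slope (fun x => Re (ec x)) 0 x, slope (fun x => Im (ec x)) (2 * PI) x).
have cH z : Cc H z.
  by apply: (Cc_ext (f := fun t => G (1 * t + x0))) => [t|]; [rewrite Rmult_1_l | apply: Cc_affine; apply: cG].
have csG z : Cc sG z.
  case: (Req_EM_T z 0) => [->|z0]; first by split; [exact: (slope_cont0 (sh _ _ d1)) | exact: (slope_cont0 (sh _ _ d2))].
  by have [? ?] := cH z; split; apply: slope_cont.
have cse z : Cc se z.
  case: (Req_EM_T z 0) => [->|z0].
    split; apply: slope_cont0; rewrite /ec /=; auto_derive => //; rewrite Rmult_0_r ?sin_0 ?cos_0; ring.
  by have [? ?] := Cc_ec z; split; apply: slope_cont.
have seE x : (RtoC x * se x = ec x - 1)%C.
  apply: C_eq; rewrite /= Rmult_0_l ?Rminus_0_r ?Rplus_0_r slopeE /ec /= Rmult_0_r ?sin_0 ?cos_0; ring.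
have sGE x : (RtoC x * sG x = H x - H 0)%C.
  by apply: C_eq; rewrite /= Rmult_0_l ?Rminus_0_r ?Rplus_0_r slopeE.
have se0 x : - (1/2) <= x <= 1/2 -> se x <> RtoC 0.
  move=> Hx E; case: (Req_EM_T x 0) => [x0'|xn].
    by move: (congr1 Im E); rewrite /se x0' /= slope0; have := PI_RGT_0; lra.
  apply: (ec_neq1 Hx xn); have := seE x; rewrite E Cmult_0_r => h.
  by apply: (eq_trans (y := ((ec x - 1) + 1)%C)); [ring | rewrite -h; ring].
pose g x := (sG x * / se x)%C.
have cg : Con g (- (1/2)) (1/2) by move=> z Hz; apply: Cc_mult => //; apply: Cc_inv => //; apply: se0.
have E x : - (1/2) <= x <= 1/2 -> G (x + x0) = (G x0 + (ec x - 1) * g x)%C.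
  move=> Hx; rewrite -seE /g.
  have -> : (RtoC x * se x * (sG x * / se x) = RtoC x * sG x)%C by field; apply: se0.
  by rewrite sGE /H Rplus_0_l; ring.
have T := fc_telescope _ cG pG cg E.
apply: (conv_ext (u := fun N => (G x0 + (fc g (- Z.of_nat N.+1) + RtoC (-1) * fc g (Z.of_nat N)))%C)).
  elim=> [|N IH]; first by rewrite symsum0 T /=; ring.
  rewrite symsumS -IH !T.
  have -> : Z.eqb (Z.of_nat N.+1) 0 = false by apply/Z.eqb_spec; lia.
  have -> : Z.eqb (- Z.of_nat N.+1) 0 = false by apply/Z.eqb_spec; lia.
  have -> : (Z.of_nat N.+1 - 1)%Z = Z.of_nat N by lia.
  have -> : (- Z.of_nat N.+1 - 1)%Z = (- Z.of_nat N.+2)%Z by lia.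
  ring.
rewrite -[X in conv _ X](_ : (G x0 + (RtoC 0 + RtoC (-1) * RtoC 0))%C = _); last by ring.
apply: conv_plus; first exact: conv_const.
apply: conv_plus; first by apply: (riemann_lebesgue (k := fun N => (- Z.of_nat N.+1)%Z)) => // i j; lia.
by apply: conv_scal; apply: riemann_lebesgue => // i j; lia.
Qed.
End Fourier.

(** * Sums of Hecke eigenvalues over arithmetic progressions *)

Module ProgressionSums.
Import Reals Lra Lia Psatz ZArith Coquelicot.
Import ssreflect ssrfun ssrbool eqtype ssrnat seq choice fintype bigop div prime.
Import zify ssrZ.
Import Defs.
Import Fourier.
Set Implicit Arguments. Unset Strict Implicit. Unset Printing Implicit Defensive.
Open Scope R_scope.

Definition bf (f : C -> C) (m : Z) (y : R) : C := fc (fun x => f (x, y)) m.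

(* What the estimate needs of a cusp form: [bf f n y] is the n-th Fourier
    coefficient on the line of height y, and Hecke theory expresses it by the first
    one ([n_pos], [n_neg]), so that no Whittaker or Bessel function is needed. *)
Record nice (k : nat) (f : C -> C) (lam : nat -> C) : Prop := Nice {
  n_der : forall x y, 0 < y ->
    ex_derive (fun t => Re (f (t, y))) x /\ ex_derive (fun t => Im (f (t, y))) x;
  n_mod : modular k f;
  n_bd : exists M, forall x y, 0 < y -> Cmod (f (x, y)) * Rpower y (INR k / 2) <= M;
  n_0 : forall y, 0 < y -> bf f 0 y = RtoC 0;
  n_pos : forall n y, (0 < n)%N -> 0 < y ->
    bf f (Z.of_nat n) y = (lam n * RtoC (Rpower (INR n) ((INR k - 1) / 2)) * bf f 1 (INR n * y))%C;
  n_neg : forall n y, (0 < n)%N -> 0 < y ->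
    bf f (- Z.of_nat n) y = (lam n * RtoC (Rpower (INR n) ((INR k - 1) / 2)) * bf f (-1) (INR n * y))%C;
  n_dec : exists C0, forall u, 1 <= u ->
    (Cmod (bf f 1 u) + Cmod (bf f (-1) u)) * Rpower u (INR k / 2) <= C0 / u;
  n_low : exists u0 de w L, [/\ 0 < u0, 0 < de, 0 < w,
    (forall u, u0 <= u <= (1 + de) * u0 -> w <= Cmod (bf f 1 u)) &
    (forall u v, u0 <= u <= (1 + de) * u0 -> u0 <= v <= (1 + de) * u0 ->
       Cmod (bf f 1 u - bf f 1 v) <= L * Rabs (u - v))];
  n_theta : forall t, eigenvalue_bound lam t -> 0 <= t }.

Lemma Rp_gt0 x e : 0 < Rpower x e. Proof. exact: exp_pos. Qed.

Lemma Rp_mul x y e : 0 < x -> 0 < y -> Rpower (x * y) e = Rpower x e * Rpower y e.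
Proof. by move=> *; rewrite Rpower_mult_distr. Qed.

Lemma Rp_1 e : Rpower 1 e = 1.
Proof. by rewrite /Rpower ln_1 Rmult_0_r exp_0. Qed.

Lemma Rp_div x y e : 0 < x -> 0 < y -> Rpower (x / y) e = Rpower x e * Rpower y (- e).
Proof.
move=> x0 y0; rewrite Rp_mul //; last exact: Rinv_0_lt_compat.
by rewrite /Rpower ln_Rinv //; congr (_ * exp _); ring.
Qed.

Lemma Rp_addV x e : Rpower x e * Rpower x (- e) = 1.
Proof. by rewrite -Rpower_plus Rplus_opp_r /Rpower Rmult_0_l exp_0. Qed.

Lemma Rp_half x : 0 < x -> Rpower x (/2) = sqrt x.
Proof. exact: Rpower_sqrt. Qed.

Lemma exp_leq x y : x <= y -> exp x <= exp y.
Proof. by case=> [H|->]; [left; exact: exp_increasing | right]. Qed.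

Lemma Rp_between t T e : 1 <= t <= T -> Rpower T (- Rabs e) <= Rpower t e <= Rpower T (Rabs e).
Proof.
move=> Ht; rewrite /Rpower.
have l0 : 0 <= ln t by rewrite -ln_1; apply: ln_le; lra.
have lT : ln t <= ln T by apply: ln_le; lra.
have H : - (Rabs e) * ln T <= e * ln t <= Rabs e * ln T.
  have A := Rle_abs e; have B := Rle_abs (- e); rewrite Rabs_Ropp in B.
  have P := Rabs_pos e; split; nra.
by split; apply: exp_leq; lra.
Qed.

Lemma INR_pos n : (0 < n)%N -> 0 < INR n.
Proof. by move=> H; apply: lt_0_INR; apply/ltP. Qed.

Lemma INR_ge1 n : (0 < n)%N -> 1 <= INR n.
Proof. by move=> H; apply: (le_INR 1); apply/leP. Qed.

Lemma INR_leq m n : (m <= n)%N -> INR m <= INR n.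
Proof. by move=> H; apply: le_INR; apply/leP. Qed.

Lemma leINR m n : INR m <= INR n -> (m <= n)%N.
Proof. by move=> H; apply/leP; apply: INR_le. Qed.

Section Abel.
Variables (a w : nat -> R) (C0 : R).
Hypothesis Ha : forall N, \rsum_(1 <= n < N.+1) a n <= C0 * INR N.
Hypothesis w0 : forall n, 0 <= w n.
Hypothesis wd : forall n, (0 < n)%N -> w n.+1 <= w n.

(** Summation by parts; the boundary term w(N) (C0 N - sum of a) is nonnegative and is carried along
    in the induction. *)
Lemma abel_major N : \rsum_(1 <= n < N.+1) (a n * w n) <= C0 * \rsum_(1 <= n < N.+1) w n.
Proof.
suff H : \rsum_(1 <= n < N.+1) (a n * w n) <=
    C0 * (\rsum_(1 <= n < N.+1) w n) - w N * (C0 * INR N - \rsum_(1 <= n < N.+1) a n).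
  by apply: Rle_trans H _; have := Ha N; have := w0 N; nra.
elim: N => [|N IH]; first by rewrite !big_nil /=; lra.
rewrite !(@big_nat_recr _ _ _ N.+1) //=.
case: N IH => [|N] IH.
  by rewrite !big_nil /=; lra.
apply: Rle_trans (Rplus_le_compat_r _ _ _ IH) _.
have := wd (ltn0Sn N); have := Ha N.+1; have := w0 N.+2; rewrite !S_INR.
set A := \rsum_(1 <= i < N.+2) a i; set W := \rsum_(1 <= i < N.+2) w i.
by nra.
Qed.
End Abel.

Lemma block_lower de N : 0 < de -> (0 < N)%N -> exists lo : nat,
  [/\ (0 < lo <= N)%N, INR N <= (1 + de) * INR lo & (1 + de) * INR lo.-1 <= INR N].
Proof.
move=> d0 N0.
have ex : exists m, (N == m) || Rle_dec (INR N) ((1 + de) * INR m) by exists N; rewrite eqxx.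
have NP := INR_pos N0.
case: (ex_minnP ex) => lo Hlo min.
have Hlo' : INR N <= (1 + de) * INR lo.
  by case/orP: Hlo => [/eqP <-|]; [nra | case: Rle_dec].
have lN : (lo <= N)%N by apply: min; rewrite eqxx.
case: lo Hlo Hlo' min lN => [|lo] _ H min lN; first by rewrite /= in H; lra.
exists lo.+1; split => //=.
apply: Rnot_lt_le => L.
have : (lo.+1 <= lo)%N by apply: min; apply/orP; right; case: Rle_dec => // n; case: n; lra.
by rewrite ltnn.
Qed.

(** Multiplicatively short intervals: for n in the block and y = u0 / lo, the point n y stays in the
    interval of [n_low], where the first coefficient does not vanish. *)
Definition block (de : R) (lo hi : nat) :=
  (0 < lo)%N /\ forall n, (lo <= n < hi)%N -> INR n <= (1 + de) * INR lo.

Lemma rsum_split (F : nat -> R) a b c : (a <= b <= c)%N ->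
  \rsum_(a <= i < c) F i = \rsum_(a <= i < b) F i + \rsum_(b <= i < c) F i.
Proof. by move=> /andP [? ?]; rewrite (@big_cat_nat _ _ _ b). Qed.

Lemma csum_split (F : nat -> C) a b c : (a <= b <= c)%N ->
  \csum_(a <= i < c) F i = (\csum_(a <= i < b) F i + \csum_(b <= i < c) F i)%C.
Proof. by move=> /andP [? ?]; rewrite (@big_cat_nat _ _ _ b). Qed.

(** The last block starts at about N / (1 + de), the preceding one at about N / (1 + de)^2, and so
    on; (1 + de) / de is the sum of this geometric series. *)
Lemma block_linear de C0 (F : nat -> R) : 0 < de -> 0 <= C0 ->
  (forall lo hi, block de lo hi -> \rsum_(lo <= n < hi) F n <= C0 * INR lo) ->
  forall N, \rsum_(1 <= n < N.+1) F n <= C0 * (1 + de) / de * INR N.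
Proof.
move=> d0 C00 H; elim/ltn_ind => N IH.
case: (posnP N) => [->|N0]; first by rewrite big_nil /=; lra.
have [lo [/andP [l0 lN] H1 H2]] := block_lower d0 N0.
rewrite (@rsum_split _ _ lo); last by lia.
have B : \rsum_(lo <= n < N.+1) F n <= C0 * INR lo.
  by apply: H; split => // n Hn; apply: Rle_trans H1; apply: INR_leq; lia.
have I := IH lo.-1 ltac:(lia); rewrite prednK // in I.
apply: Rle_trans (Rplus_le_compat _ _ _ _ I B) _.
have lR := INR_leq lN.
have N1 : INR lo.-1 <= INR N / (1 + de).
  by apply: (Rmult_le_reg_l (1 + de)); [lra | field_simplify; lra].
have D : 0 <= C0 * (1 + de) / de.
  by apply: Rmult_le_pos; [nra | left; apply: Rinv_0_lt_compat].
apply: Rle_trans (Rplus_le_compat _ _ _ _ (Rmult_le_compat_l _ _ _ D N1) (Rmult_le_compat_l _ _ _ C00 lR)) _.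
by right; field; lra.
Qed.

(** For bounds that do not shrink with the block: up to N there are at most 1 + ln N / ln (1 + de)
    blocks. *)
Lemma block_log de B (F : nat -> C) N : 0 < de -> 0 <= B ->
  (forall lo hi, (hi <= N.+1)%N -> block de lo hi -> Cmod (\csum_(lo <= n < hi) F n) <= B) ->
  (0 < N)%N -> Cmod (\csum_(1 <= n < N.+1) F n) <= B * (1 + ln (INR N) / ln (1 + de)).
Proof.
move=> d0 B0; have ld : 0 < ln (1 + de) by rewrite -ln_1; apply: ln_increasing; lra.
elim/ltn_ind: N => N IH H N0.
have [lo [/andP [l0 lN] H1 H2]] := block_lower d0 N0.
rewrite (@csum_split _ _ lo); last by lia.
apply: Rle_trans (Cmod_triangle _ _) _.
have BB : Cmod (\csum_(lo <= n < N.+1) F n) <= B.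
  by apply: H => //; split => // n Hn; apply: Rle_trans H1; apply: INR_leq; lia.
have lnN : 0 <= ln (INR N) by rewrite -ln_1; apply: ln_le; [lra | exact: INR_ge1].
have i0 := Rinv_0_lt_compat _ ld.
case: (posnP lo.-1) => L1.
  have -> : lo = 1%N by lia.
  rewrite big_geq // Cmod_0; rewrite (_ : lo = 1%N) in BB; last by lia.
  have : 0 <= B * (ln (INR N) / ln (1 + de)) by apply: Rmult_le_pos => //; apply: Rmult_le_pos; lra.
  by lra.
have I := IH lo.-1 ltac:(lia) _ L1; rewrite prednK // in I.
have {}I := I (fun lo' hi Hh => H lo' hi ltac:(lia)).
apply: Rle_trans (Rplus_le_compat _ _ _ _ I BB) _.
have lp := INR_pos L1.
have : ln (INR lo.-1) + ln (1 + de) <= ln (INR N).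
  by rewrite -ln_mult //; [apply: ln_le; nra | lra].
move=> LL; have -> : ln (INR N) / ln (1 + de) = ln (INR lo.-1) / ln (1 + de) + 1 +
    (ln (INR N) - ln (INR lo.-1) - ln (1 + de)) * / ln (1 + de) by field; lra.
have : 0 <= B * ((ln (INR N) - ln (INR lo.-1) - ln (1 + de)) * / ln (1 + de)).
  by apply: Rmult_le_pos => //; apply: Rmult_le_pos; lra.
by lra.
Qed.

(** The function 2 y^(-1/2) atan (sqrt (t y)) is a primitive of 1 / (sqrt t (1 + t y)). Since atan
    stays below PI / 2, the sum in [sqrt_sum] is at most PI / sqrt y. *)
Lemma sqrt_step y n : 0 < y ->
  / sqrt (INR n.+1) / (1 + INR n.+1 * y) <=
  2 / sqrt y * (atan (sqrt (INR n.+1 * y)) - atan (sqrt (INR n * y))).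
Proof.
move=> y0; set a := sqrt (INR n.+1 * y); set b := sqrt (INR n * y).
have n0 := pos_INR n; have n1 : INR n.+1 = INR n + 1 := S_INR n.
have ba : b < a by apply: sqrt_lt_1; rewrite ?n1; nra.
have b0 : 0 <= b by apply: sqrt_pos.
have a2 : a * a = INR n.+1 * y by apply: sqrt_sqrt; rewrite n1; nra.
have b2 : b * b = INR n * y by apply: sqrt_sqrt; nra.
have [c [E [c1 c2]]] : exists c, atan a - atan b = / (1 + c ^ 2) * (a - b) /\ b < c < a.
  by apply: (MVT_cor2 atan (fun c => / (1 + c ^ 2))) => // c _; exact: derivable_pt_lim_atan.
have sy : 0 < sqrt y by apply: sqrt_lt_R0.
have sn : 0 < sqrt (INR n.+1) by apply: sqrt_lt_R0; rewrite n1; lra.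
have aE : a = sqrt (INR n.+1) * sqrt y by rewrite /a sqrt_mult //; rewrite ?n1; lra.
have D : sqrt y / (2 * sqrt (INR n.+1)) <= a - b.
  apply: (Rmult_le_reg_l (2 * a)); first lra.
  have -> : 2 * a * (sqrt y / (2 * sqrt (INR n.+1))) = y.
    rewrite aE -{3}(sqrt_sqrt y); last lra. 
    by field; lra.
  by rewrite n1 in a2; nra.
have c3 : / (1 + a * a) <= / (1 + c ^ 2) by apply: Rinv_le_contravar; nra.
have i0 : 0 < / (1 + a * a) by apply: Rinv_0_lt_compat; nra.
have D0 : 0 <= sqrt y / (2 * sqrt (INR n.+1)).
  by apply: Rmult_le_pos; [lra | left; apply: Rinv_0_lt_compat; lra].
have P : / (1 + a * a) * (sqrt y / (2 * sqrt (INR n.+1))) <= atan a - atan b.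
  by rewrite E; apply: Rmult_le_compat => //; lra.
have q0 : 0 <= 2 / sqrt y by apply: Rmult_le_pos; [lra | left; exact: Rinv_0_lt_compat].
apply: Rle_trans (Rmult_le_compat_l _ _ _ q0 P).
by rewrite -a2; right; field; repeat split; nra.
Qed.

Lemma sqrt_sum y N : 0 < y ->
  \rsum_(1 <= n < N.+1) (/ sqrt (INR n) / (1 + INR n * y)) <= PI / sqrt y.
Proof.
move=> y0; have sy : 0 < sqrt y by apply: sqrt_lt_R0.
suff H : \rsum_(1 <= n < N.+1) (/ sqrt (INR n) / (1 + INR n * y)) <= 2 / sqrt y * atan (sqrt (INR N * y)).
  apply: Rle_trans H _.
  have [_ A] := atan_bound (sqrt (INR N * y)).
  have -> : PI / sqrt y = 2 / sqrt y * (PI / 2) by field; lra.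
  apply: Rmult_le_compat_l; last lra.
  by apply: Rmult_le_pos; [lra | left; exact: Rinv_0_lt_compat].
elim: N => [|N IH].
  by rewrite big_nil Rmult_0_l sqrt_0 atan_0; lra.
rewrite (@big_nat_recr _ _ _ N.+1) //; have := sqrt_step N y0.
move=> S; apply: Rle_trans (Rplus_le_compat _ _ _ _ IH S) _; lra.
Qed.

Lemma one_pow k : Cpow 1 k = RtoC 1.
Proof. by elim: k => //= n ->; rewrite Cmult_1_l. Qed.

Lemma modular_T k f x y : modular k f -> 0 < y -> f (x + 1, y) = f (x, y).
Proof.
move=> mf y0; have := mf 1%Z 1%Z 0%Z 1%Z erefl (x, y) y0.
have -> : ((1 * (x, y) + 1) / (0 * (x, y) + 1))%C = (x + 1, y).
  by apply: C_eq; rewrite /Cdiv /Cinv /=; field.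
move=> ->; have -> : (RtoC 0 * (x, y) + RtoC 1)%C = RtoC 1 by apply: C_eq => /=; ring.
by rewrite one_pow Cmult_1_l.
Qed.

(** * Bounds for the eigenvalues and the Fourier coefficients *)

Section Nice.
Variables (k : nat) (f : C -> C) (lam : nat -> C).
Hypothesis nf : nice k f lam.
Notation b := (bf f).
Notation ex := ((INR k - 1) / 2).

Lemma Cc_F y x : 0 < y -> Cc (fun t => f (t, y)) x.
Proof.
move=> y0; have [d1 d2] := n_der nf x y0.
by split; apply: (ex_derive_continuous (K := R_AbsRing) (V := R_NormedModule)).
Qed.

Lemma b_bd : exists M, 0 <= M /\ forall m y, 0 < y -> Cmod (b m y) * Rpower y (INR k / 2) <= M.
Proof.
have [M HM] := n_bd nf; exists M; split.
  by have := HM 0 1 Rlt_0_1; have := Cmod_ge_0 (f (0, 1)); have := Rp_gt0 1 (INR k / 2); nra.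
move=> m y y0; have p0 := Rp_gt0 y (INR k / 2).
apply: (Rmult_le_reg_r (/ Rpower y (INR k / 2))); first exact: Rinv_0_lt_compat.
rewrite Rmult_assoc Rinv_r ?Rmult_1_r; last lra.
rewrite /bf /fc; apply: Rle_trans (@CI_norm _ _ half_le _ (fun _ => M * / Rpower y (INR k / 2)) _ _ _) _.
- by move=> z _; apply: Cc_mult; [exact: Cc_F | exact: Cc_ecM].
- by move=> *; exact: cont_const.
- move=> x _; rewrite Cmod_mult Cmod_ec Rmult_1_r.
  apply: (Rmult_le_reg_r (Rpower y (INR k / 2))) => //.
  by rewrite Rmult_assoc Rinv_l ?Rmult_1_r; [apply: HM | lra].
by rewrite RInt_const /scal /= /mult /=; lra.
Qed.

Lemma l2_bd : exists M, 0 <= M /\ forall y (r : seq Z), 0 < y -> uniq r ->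
  \rsum_(m <- r) Cmod (b m y) ^ 2 <= M * Rpower y (- INR k).
Proof.
have [M HM] := n_bd nf; exists (M ^ 2); split; first exact: pow2_ge_0.
move=> y r y0 ur.
have cF : Con (fun x => f (x, y)) (- (1/2)) (1/2) by move=> z _; exact: Cc_F.
apply: Rle_trans (bessel cF ur) _.
apply: (Rle_trans _ (RInt (fun _ => M ^ 2 * Rpower y (- INR k)) (- (1/2)) (1/2))).
  apply: RInt_le; first exact: half_le.
  - by apply: cont_ex; [exact: half_le | exact: Con_abs2].
  - exact: ex_RInt_const.
  move=> x _; have H := HM x y y0; have p0 := Rp_gt0 y (INR k / 2).
  have -> : Rpower y (- INR k) = / (Rpower y (INR k / 2) ^ 2).
    by rewrite /= Rmult_1_r -Rpower_plus Rpower_Ropp; congr (/ Rpower _ _); field.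
  have c0 := Cmod_ge_0 (f (x, y)).
  have p2 : 0 < Rpower y (INR k / 2) ^ 2 by apply: pow_lt.
  apply: (Rmult_le_reg_r (Rpower y (INR k / 2) ^ 2)) => //.
  rewrite [X in _ <= X]Rmult_assoc Rinv_l ?Rmult_1_r; last lra.
  by rewrite -Rpow_mult_distr; apply: pow_incr; split => //; nra.
by rewrite RInt_const /scal /= /mult /=; lra.
Qed.

(* Bessel's inequality on the line of height u0 / lo, where [n_low] bounds the
    first coefficient from below. *)
Lemma lam_block : exists C0 de, [/\ 0 <= C0, 0 < de & forall lo hi, block de lo hi ->
  \rsum_(lo <= n < hi) Cmod (lam n) ^ 2 <= C0 * INR lo].
Proof.
have [u0 [de [w [L [u00 d0 w0 Hw _]]]]] := n_low nf.
have [M [M0 HM]] := l2_bd.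
(* Over a block, n^ex is at least c0 lo^ex; the absolute value covers the negative exponent -1/2 of
   weight 0. *)
set c0 := Rpower (1 + de) (- Rabs ex); have c00 : 0 < c0 by exact: Rp_gt0.
have cw : 0 < (c0 * w) ^ 2 by apply: pow_lt; nra.
exists (M * Rpower u0 (- INR k) / (c0 * w) ^ 2), de; split => //.
  apply: Rmult_le_pos; last by left; exact: Rinv_0_lt_compat.
  by apply: Rmult_le_pos => //; left; exact: Rp_gt0.
move=> lo hi [l0 Hb]; have lR := INR_pos l0.
have y0 : 0 < u0 / INR lo by apply: Rdiv_lt_0_compat.
have := HM _ [seq Z.of_nat n | n <- index_iota lo hi] y0.
rewrite map_inj_uniq; last by move=> i j; lia.
rewrite iota_uniq => /(_ isT); rewrite big_map => H.
have le : Rpower (INR lo) (2 * ex) > 0 by exact: Rp_gt0.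
have S : (Rpower (INR lo) (2 * ex) * (c0 * w) ^ 2) * (\rsum_(lo <= n < hi) Cmod (lam n) ^ 2) <=
   \rsum_(lo <= n < hi) Cmod (b (Z.of_nat n) (u0 / INR lo)) ^ 2.
  rewrite -rsum_scal big_seq [X in _ <= X]big_seq; apply: rsum_le => n; rewrite mem_index_iota => Hn.
  have n0 : (0 < n)%N by lia.
  have nR := INR_pos n0; have nl : INR lo <= INR n by apply: INR_leq; lia.
  have Hn' := Hb _ Hn.
  have t1 : 1 <= INR n / INR lo <= 1 + de.
    by split; [apply: (Rmult_le_reg_r (INR lo)) | apply: (Rmult_le_reg_r (INR lo))] => //; field_simplify; lra.
  rewrite (n_pos nf) // !Cmod_mult Cmod_R (Rabs_pos_eq (Rpower _ _)); last by left; exact: Rp_gt0.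
  have nE : Rpower (INR n) ex = Rpower (INR lo) ex * Rpower (INR n / INR lo) ex.
    by rewrite -Rp_mul //; [congr Rpower; field; lra | lra].
  have [B1 _] := Rp_between ex t1.
  have Wn : w <= Cmod (b 1 (INR n * (u0 / INR lo))).
    apply: Hw; have -> : INR n * (u0 / INR lo) = INR n / INR lo * u0 by field; lra.
    by nra.
  rewrite -[c0]/(Rpower (1 + de) (- Rabs ex)) in c00 B1 *.
  rewrite nE; have -> : Rpower (INR lo) (2 * ex) = Rpower (INR lo) ex ^ 2.
    by rewrite /= Rmult_1_r -Rpower_plus; congr Rpower; lra.
  rewrite -!Rpow_mult_distr; apply: pow_incr.
  have l1 := Cmod_ge_0 (lam n); have p1 := Rp_gt0 (INR lo) ex.
  split; first by apply: Rmult_le_pos => //; apply: Rmult_le_pos; [lra | nra].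
  have H3 : Rpower (1 + de) (- Rabs ex) * w <= Rpower (INR n / INR lo) ex * Cmod (b 1 (INR n * (u0 / INR lo))).
    by apply: Rmult_le_compat; lra.
  have : 0 <= Rpower (INR lo) ex * Cmod (lam n) by nra.
  by nra.
apply: (Rmult_le_reg_l (Rpower (INR lo) (2 * ex) * (c0 * w) ^ 2)); first nra.
apply: Rle_trans (Rle_trans _ _ _ S H) _; right.
rewrite Rp_div // Ropp_involutive.
have -> : Rpower (INR lo) (INR k) = Rpower (INR lo) (2 * ex) * INR lo.
  by rewrite -{3}(Rpower_1 (INR lo)) // -Rpower_plus; congr Rpower; field.
by field; split; nra.
Qed.

Lemma lam_sq : exists C0, 0 <= C0 /\ forall n, (0 < n)%N -> Cmod (lam n) ^ 2 <= C0 * INR n.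
Proof.
have [C0 [de [c0 d0 H]]] := lam_block; exists C0; split => // n n0.
have := H n n.+1; rewrite big_nat1; apply; split => // m Hm.
have -> : m = n by lia.
by have := INR_pos n0; nra.
Qed.

Lemma lam_sum : exists C0, 0 <= C0 /\ forall N, \rsum_(1 <= n < N.+1) Cmod (lam n) <= C0 * INR N.
Proof.
have [C0 [de [c0 d0 H]]] := lam_block.
exists ((1 + de + C0) * (1 + de) / de); split.
  by apply: Rmult_le_pos; [nra | left; exact: Rinv_0_lt_compat].
apply: block_linear => //; first lra.
move=> lo hi bl; have [l0 Hb] := bl; have lR := INR_pos l0.
apply: (Rle_trans _ (\rsum_(lo <= n < hi) (1 + Cmod (lam n) ^ 2))).
  by apply: rsum_le => n _; have := Cmod_ge_0 (lam n); nra.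
rewrite big_split /=; have := H _ _ bl => /= Hl.
rewrite rsum_const count_predT size_iota.
have : INR (hi - lo) <= (1 + de) * INR lo.
  case: (leqP hi lo) => hl; first by rewrite (_ : hi - lo = 0)%N /=; [nra | lia].
  have := Hb hi.-1 ltac:(lia) => Q; apply: Rle_trans Q; apply: INR_leq; lia.
by move: Hl; set S := (\rsum_(_ <= _ < _) _); lra.
Qed.

Lemma b_dec : exists C0, 0 <= C0 /\ forall u, 0 < u ->
  (Cmod (b 1 u) + Cmod (b (-1) u)) * Rpower u (INR k / 2) <= C0 / (1 + u).
Proof.
have [M [M0 HM]] := b_bd; have [C1 H1] := n_dec nf.
have C10 : 0 <= C1.
  have := H1 1 (Rle_refl 1); have := Cmod_ge_0 (b 1 1); have := Cmod_ge_0 (b (-1) 1).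
  by have := Rp_gt0 1 (INR k / 2); nra.
exists (4 * M + 2 * C1); split; first lra.
move=> u u0; have i0 : 0 < / (1 + u) by apply: Rinv_0_lt_compat; lra.
case: (Rle_lt_dec 1 u) => Hu.
  apply: Rle_trans (H1 u Hu) _.
  apply: (Rmult_le_reg_r (u * (1 + u))); first nra.
  by have -> : C1 / u * (u * (1 + u)) = C1 * (1 + u); [field; lra |
   have -> : (4 * M + 2 * C1) / (1 + u) * (u * (1 + u)) = (4 * M + 2 * C1) * u; [field; lra | nra]].
have A := HM 1%Z u u0; have B := HM (-1)%Z u u0.
apply: (Rle_trans _ (2 * M)); first lra.
apply: (Rmult_le_reg_r (1 + u)); first lra.
by have -> : (4 * M + 2 * C1) / (1 + u) * (1 + u) = 4 * M + 2 * C1; [field; lra | nra].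
Qed.

(** The eigenvalues are bounded on average by [lam_sum], and the coefficients decay beyond n of size
    1 / y, so the sum of n^(-1/2) up to there contributes y^(-1/2) besides the factor y^(-k/2) of
    the weight. *)
Lemma b_sum : exists C0, 0 <= C0 /\ forall y N, 0 < y ->
  \rsum_(1 <= n < N.+1) (Cmod (b (Z.of_nat n) y) + Cmod (b (- Z.of_nat n) y)) <=
    C0 * Rpower y (- ((INR k + 1) / 2)).
Proof.
have [C1 [C10 H1]] := lam_sum; have [C2 [C20 H2]] := b_dec.
exists (C2 * (C1 * PI)); split; first by have := PI_RGT_0 => P; apply: Rmult_le_pos => //; nra.
move=> y N y0.
apply: (Rle_trans _ (\rsum_(1 <= n < N.+1) (C2 * Rpower y (- (INR k / 2)) *
    (Cmod (lam n) * (/ sqrt (INR n) / (1 + INR n * y)))))).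
  rewrite big_nat [X in _ <= X]big_nat; apply: rsum_le => n /andP [n0 _].
  have nR := INR_pos n0; have ny : 0 < INR n * y by nra.
  rewrite (n_pos nf) // (n_neg nf) // !Cmod_mult Cmod_R (Rabs_pos_eq (Rpower _ _)); last by left; exact: Rp_gt0.
  have := H2 _ ny; set B1 := Cmod (b 1 _); set B2 := Cmod (b (-1) _) => HB.
  have l0 := Cmod_ge_0 (lam n).
  have -> : Rpower (INR n) ex = / sqrt (INR n) * Rpower (INR n) (INR k / 2).
    rewrite -Rp_half // -Rpower_Ropp -Rpower_plus; congr Rpower; lra.
  have -> : Cmod (lam n) * (/ sqrt (INR n) * Rpower (INR n) (INR k / 2)) * B1 +
    Cmod (lam n) * (/ sqrt (INR n) * Rpower (INR n) (INR k / 2)) * B2 =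
    (Cmod (lam n) * / sqrt (INR n) * Rpower y (- (INR k / 2))) * ((B1 + B2) * Rpower (INR n * y) (INR k / 2)).
    rewrite Rp_mul //.
    rewrite (_ : forall a b c d e g : R, a * b * c * (d * (e * g)) = (a * b * (g * c)) * (d * e)); last by move=> *; ring.
    by rewrite Rp_addV; ring.
  have s0 : 0 < / sqrt (INR n) by apply: Rinv_0_lt_compat; apply: sqrt_lt_R0.
  have p0 := Rp_gt0 y (- (INR k / 2)).
  have P : 0 <= Cmod (lam n) * / sqrt (INR n) * Rpower y (- (INR k / 2)).
    by repeat apply: Rmult_le_pos; lra.
  apply: Rle_trans (Rmult_le_compat_l _ _ _ P HB) _.
  by right; rewrite /Rdiv; ring.
rewrite rsum_scal.
have A := abel_major (w := fun n => / sqrt (INR n) / (1 + INR n * y)) H1 _ _ N.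
have sy : 0 < sqrt y by apply: sqrt_lt_R0.
have -> : C2 * (C1 * PI) * Rpower y (- ((INR k + 1) / 2)) =
   C2 * Rpower y (- (INR k / 2)) * (C1 * (PI / sqrt y)).
  have -> : Rpower y (- ((INR k + 1) / 2)) = Rpower y (- (INR k / 2)) * / sqrt y.
    rewrite -Rp_half // -Rpower_Ropp -Rpower_plus; congr Rpower; lra.
  by rewrite /Rdiv; ring.
apply: Rmult_le_compat_l; first by have := Rp_gt0 y (- (INR k / 2)); nra.
have pos n : 0 <= / sqrt (INR n) / (1 + INR n * y).
  have n0 := pos_INR n.
  apply: Rmult_le_pos; last by left; apply: Rinv_0_lt_compat; nra.
  case: n n0 => [|n] n0; first by rewrite /= sqrt_0 Rinv_0; lra.
  by left; apply: Rinv_0_lt_compat; apply: sqrt_lt_R0; apply: INR_pos.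
apply: Rle_trans (A pos _) _; last by apply: Rmult_le_compat_l => //; exact: sqrt_sum.
move=> n n0; have nR := INR_pos n0; rewrite S_INR.
apply: Rmult_le_compat.
- by left; apply: Rinv_0_lt_compat; apply: sqrt_lt_R0; lra.
- by left; apply: Rinv_0_lt_compat; nra.
- by apply: Rinv_le_contravar; [apply: sqrt_lt_R0 | apply: sqrt_le_1_alt; lra].
- by apply: Rinv_le_contravar; nra.
Qed.
End Nice.

Notation pt x y := (x%R, y%R) (only parsing).

Lemma rsum_recr m n (F : nat -> R) : (m <= n)%N ->
  \rsum_(m <= i < n.+1) F i = \rsum_(m <= i < n) F i + F n.
Proof. exact: big_nat_recr. Qed.

Lemma csum_recr m n (F : nat -> C) : (m <= n)%N ->
  \csum_(m <= i < n.+1) F i = (\csum_(m <= i < n) F i + F n)%C.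
Proof. exact: big_nat_recr. Qed.

(** The sum [kl] once more, in the complex numbers in which the forms take their values; [klc_kl]
    identifies the two. *)
Definition klc (r m c : nat) : C :=
  \csum_(0 <= x < c) \csum_(0 <= y < c | (x * y == 1 %[mod c])%N) ec (INR (r * x + m * y) / INR c).

Lemma symsum_sum (I : Type) (s : seq I) (P : pred I) (F : I -> Z -> C) N :
  symsum (fun m => \csum_(i <- s | P i) F i m) N = \csum_(i <- s | P i) symsum (F i) N.
Proof.
elim: N => [|N IH]; first by rewrite symsum0; apply: eq_bigr => i _; rewrite symsum0.
rewrite symsumS IH -!big_split /=; apply: eq_bigr => i _; exact: (esym (symsumS (F i) N)).
Qed.

Lemma symsum_scal c F N : symsum (fun m => c * F m)%C N = (c * symsum F N)%C.
Proof. by elim: N => [|N IH]; [rewrite !symsum0 | rewrite !symsumS IH; ring]. Qed.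

Lemma symsum_ext F G N : (forall m, F m = G m) -> symsum F N = symsum G N.
Proof. by move=> H; elim: N => [|N IH]; [rewrite !symsum0 | rewrite !symsumS IH !H]. Qed.

Lemma symsum_le F N : Cmod (symsum F N) <=
  Cmod (F 0%Z) + \rsum_(1 <= n < N.+1) (Cmod (F (Z.of_nat n)) + Cmod (F (- Z.of_nat n)%Z)).
Proof.
elim: N => [|N IH]; first by rewrite symsum0 big_nil; lra.
rewrite symsumS rsum_recr //.
apply: Rle_trans (Cmod_triangle _ _) _; have := Cmod_triangle (F (Z.of_nat N.+1)) (F (- Z.of_nat N.+1)%Z).
move: IH; lra.
Qed.

Lemma Cmod_pow a n : Cmod (Cpow a n) = Cmod a ^ n.
Proof. by elim: n => [|n IH] /=; rewrite ?Cmod_1 // Cmod_mult IH. Qed.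

Lemma Cmod_conj a : Cmod (Cconj a) = Cmod a.
Proof. by rewrite /Cmod /Cconj /=; congr sqrt; ring. Qed.

Lemma conj_csum (I : Type) (s : seq I) (P : pred I) (F : I -> C) :
  Cconj (\csum_(i <- s | P i) F i) = \csum_(i <- s | P i) Cconj (F i).
Proof.
apply: (big_morph Cconj); first by move=> u v; apply: C_eq => /=; ring.
by apply: C_eq => /=; ring.
Qed.

Lemma ec_Z t s k : t = s + IZR k -> ec t = ec s.
Proof. by move=> ->; rewrite ec_per. Qed.

(** Reducing a possibly negative frequency m modulo c and conjugating turns this sum into [klc]. *)
Lemma klc_Z (r c : nat) (m : Z) Bd : (0 < c)%N -> (forall m', Cmod (klc r m' c) <= Bd) ->
  Cmod (\csum_(0 <= a < c) \csum_(0 <= b < c | (a * b == 1 %[mod c])%N)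
     (ec (- (INR (r * a) / INR c)) * ec (- (IZR m * INR b / INR c)))) <= Bd.
Proof.
move=> c0 H; have cR := INR_pos c0.
have [m' [q Hm]] : exists (m' : nat) (q : Z), m = (Z.of_nat m' + q * Z.of_nat c)%Z.
  exists (Z.to_nat (m mod Z.of_nat c)), (m / Z.of_nat c)%Z.
  have := Z_div_mod_eq_full m (Z.of_nat c); have := Z_mod_lt m (Z.of_nat c); lia.
rewrite -Cmod_conj (_ : Cconj _ = klc r m' c) //.
rewrite conj_csum; apply: eq_bigr => a _; rewrite conj_csum; apply: eq_bigr => b _.
rewrite -ec_plus -ec_opp; apply: (@ec_Z _ _ (q * Z.of_nat b)).
rewrite Hm plus_INR !mult_INR plus_IZR !mult_IZR -!INR_IZR_INZ.
by field; lra.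
Qed.

Section Nice2.
Variables (k : nat) (f : C -> C) (lam : nat -> C).
Hypothesis nf : nice k f lam.
Notation b := (bf f).
Notation ex := ((INR k - 1) / 2).

Lemma fourier_F x y : 0 < y -> conv (symsum (fun m => b m y * ec (IZR m * x))%C) (f (x, y)).
Proof.
move=> y0; have [d1 d2] := n_der nf x y0.
apply: (fourier_pointwise (G := fun x => f (x, y))) => // t.
  exact: (Cc_F nf).
exact: modular_T (n_mod nf) y0.
Qed.

(* Modularity moves the line near the cusp a / c to the cusp at infinity. *)
Lemma transform (a b' c : nat) x y : (0 < c)%N -> 0 < y -> (a * b' == 1 %[mod c])%N ->
  let s := INR c ^ 2 * (x ^ 2 + y ^ 2) in
  f (pt (INR a / INR c + x) y) =
  (Cpow (RtoC (-1) / (RtoC (INR c) * (x, y))) k * f (pt (- (INR b' / INR c) - x / s) (y / s)))%C.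
Proof.
move=> c0 y0 /eqP ab s; have cR := INR_pos c0.
have q0 : 0 < x ^ 2 + y ^ 2 by nra.
have s0 : 0 < s by apply: Rmult_lt_0_compat => //; exact: pow_lt.
have [t Ht] : exists t : Z, (Z.of_nat a * Z.of_nat b' - t * Z.of_nat c = 1)%Z.
  exists (Z.of_nat ((a * b') %/ c) - Z.of_nat (1 %/ c))%Z.
  have := divn_eq (a * b') c; have := divn_eq 1 c; rewrite ab; nia.
have u : upper (- (INR b' / INR c) - x / s, y / s) by rewrite /upper /=; apply: Rdiv_lt_0_compat.
have := n_mod nf Ht u.
have E1 : (RtoC (IZR (Z.of_nat c)) * pt (- (INR b' / INR c) - x / s) (y / s) + RtoC (IZR (Z.of_nat b')))%C =
  (RtoC (-1) / (RtoC (INR c) * (x, y)))%C.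
  rewrite -!INR_IZR_INZ; apply: C_eq; rewrite /Cdiv /Cinv /= /s; field; repeat split; try nra; have s1 := s0; rewrite /s in s1; nra.
rewrite E1 => <-; congr f.
have tR : IZR t = (INR a * INR b' - 1) / INR c.
  have := f_equal IZR Ht; rewrite minus_IZR !mult_IZR -!INR_IZR_INZ => <-.
  by field; lra.
rewrite -!INR_IZR_INZ tR.
have zn : (x, y) <> RtoC 0 by move=> [_ E]; lra.
have cn : RtoC (INR c) <> RtoC 0 by move=> [E]; lra.
have -> : (INR a / INR c + x, y) = (RtoC (INR a) / RtoC (INR c) + (x, y))%C.
  by apply: C_eq; rewrite /Cdiv /Cinv /=; field; lra.
have -> : (- (INR b' / INR c) - x / s, y / s) =
   (- (RtoC (INR b') / RtoC (INR c)) - RtoC 1 / (RtoC (INR c) * RtoC (INR c) * (x, y)))%C.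
  have s2 : 0 < INR c * INR c * s by apply: Rmult_lt_0_compat => //; nra.
  rewrite /s in s0 s2.
  by apply: C_eq; rewrite /Cdiv /Cinv /= /s; field; repeat split; nra.
rewrite (_ : RtoC ((INR a * INR b' - 1) / INR c) = (RtoC (INR a) * RtoC (INR b') - 1) / RtoC (INR c))%C; last first.
  by apply: C_eq; rewrite /Cdiv /Cinv /=; field; lra.
have m1 : RtoC (-1) = (- RtoC 1)%C by apply: C_eq => /=; ring.
rewrite m1; field; repeat split => //.
Qed.

(** With s = |c z|^2, [b_sum] at height y / s gives |c z|^(k+1) y^(-(k+1)/2), and the automorphy
    factor removes |c z|^k: one factor |c z| = c sqrt (x^2 + y^2) remains. The zeroth coefficient
    vanishes, so each remaining frequency meets a Kloosterman sum modulo c, bounded by Bd. *)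
Lemma G_bound : exists C0, 0 <= C0 /\ forall (r c : nat) Bd x y, (0 < c)%N -> 0 < y -> 0 <= Bd ->
  (forall m, Cmod (klc r m c) <= Bd) ->
  Cmod (\csum_(0 <= a < c) \csum_(0 <= b' < c | (a * b' == 1 %[mod c])%N)
     (ec (- (INR (r * a) / INR c)) * f (pt (INR a / INR c + x) y)))
  <= C0 * Bd * (INR c * sqrt (x ^ 2 + y ^ 2)) * Rpower y (- ((INR k + 1) / 2)).
Proof.
have [C0 [C00 HC]] := b_sum nf; exists C0; split => // r c Bd x y c0 y0 B0 HB.
have cR := INR_pos c0.
set s := INR c ^ 2 * (x ^ 2 + y ^ 2).
have q0 : 0 < x ^ 2 + y ^ 2 by nra.
have s0 : 0 < s by apply: Rmult_lt_0_compat => //; exact: pow_lt.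
have ys : 0 < y / s by apply: Rdiv_lt_0_compat.
set J := Cpow (RtoC (-1) / (RtoC (INR c) * (x, y))) k.
pose kap (m : Z) := \csum_(0 <= a < c) \csum_(0 <= b' < c | (a * b' == 1 %[mod c])%N)
     (ec (- (INR (r * a) / INR c)) * ec (- (IZR m * INR b' / INR c))).
pose T (m : Z) := (b m (y / s) * ec (IZR m * (- (x / s))) * kap m)%C.
have -> : \csum_(0 <= a < c) \csum_(0 <= b' < c | (a * b' == 1 %[mod c])%N)
     (ec (- (INR (r * a) / INR c)) * f (pt (INR a / INR c + x) y)) =
   (J * \csum_(0 <= a < c) \csum_(0 <= b' < c | (a * b' == 1 %[mod c])%N)
     (ec (- (INR (r * a) / INR c)) * f (pt (- (INR b' / INR c) - x / s) (y / s))))%C.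
  rewrite -csum_scal; apply: eq_bigr => a _; rewrite -csum_scal; apply: eq_bigr => b' ab.
  by rewrite (transform x c0 y0 ab) -/s -/J; ring.
have cT : conv (symsum T) (\csum_(0 <= a < c) \csum_(0 <= b' < c | (a * b' == 1 %[mod c])%N)
     (ec (- (INR (r * a) / INR c)) * f (pt (- (INR b' / INR c) - x / s) (y / s)))).
  apply: (conv_ext (u := fun N => \csum_(0 <= a < c) \csum_(0 <= b' < c | (a * b' == 1 %[mod c])%N)
     (ec (- (INR (r * a) / INR c)) * symsum (fun m => b m (y / s) * ec (IZR m * (- (INR b' / INR c) - x / s)))%C N))).
    move=> N; rewrite (eq_bigr (fun a => symsum (fun m => \csum_(0 <= b' < c | (a * b' == 1 %[mod c])%N)
      (ec (- (INR (r * a) / INR c)) * (b m (y / s) * ec (IZR m * (- (INR b' / INR c) - x / s))))) N)); last first.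
      move=> a _; rewrite symsum_sum; apply: eq_bigr => b' _; by rewrite symsum_scal.
    rewrite -symsum_sum; apply: symsum_ext => m; rewrite /T /kap -csum_scal; apply: eq_bigr => a _.
    rewrite -csum_scal; apply: eq_bigr => b' _.
    have -> : IZR m * (- (INR b' / INR c) - x / s) = IZR m * - (x / s) + - (IZR m * INR b' / INR c) by field; lra.
    by rewrite ec_plus; ring.
  apply: conv_sum => a _; apply: conv_sum => b' _; apply: conv_scal; exact: fourier_F.
have bT := conv_bound cT.
have pE : Rpower (y / s) (- ((INR k + 1) / 2)) = (INR c * sqrt (x ^ 2 + y ^ 2)) ^ k.+1 * Rpower y (- ((INR k + 1) / 2)).
  have rp : 0 < INR c * sqrt (x ^ 2 + y ^ 2) by apply: Rmult_lt_0_compat => //; exact: sqrt_lt_R0.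
  have sE : s = (INR c * sqrt (x ^ 2 + y ^ 2)) ^ 2 by rewrite Rpow_mult_distr pow2_sqrt //; lra.
  rewrite Rp_div // Ropp_involutive Rmult_comm; congr Rmult.
  rewrite sE -(Rpower_pow k.+1) // -(Rpower_pow 2) // Rpower_mult; congr Rpower; rewrite (S_INR k) /=; field.
rewrite Cmod_mult.
have JE : Cmod J * (INR c * sqrt (x ^ 2 + y ^ 2)) ^ k = 1.
  rewrite /J Cmod_pow -Rpow_mult_distr.
  have zn : (RtoC (INR c) * (x, y))%C <> RtoC 0 by move=> [_ E]; nra.
  rewrite Cmod_div // Cmod_mult !Cmod_R (Rabs_pos_eq (INR c)); last lra.
  rewrite Rabs_Ropp Rabs_R1 /Cmod [fst _]/= [snd _]/=.
  have -> : 1 / (INR c * sqrt (x ^ 2 + y ^ 2)) * (INR c * sqrt (x ^ 2 + y ^ 2)) = 1.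
    by field; split; [apply: Rgt_not_eq; apply: sqrt_lt_R0 | lra].
  exact: pow1.
apply: Rle_trans (Rmult_le_compat_l _ _ (C0 * Rpower (y / s) (- ((INR k + 1) / 2)) * Bd) (Cmod_ge_0 _) _) _; last first.
  right; rewrite pE /=.
  rewrite (_ : forall a b c d e g : R, a * (b * (c * d * e) * g) = (a * d) * (b * g * c * e)); last by move=> *; ring.
  by rewrite JE; ring.
apply: bT => N; apply: Rle_trans (symsum_le _ _) _.
have TE m : Cmod (T m) <= Cmod (b m (y / s)) * Bd.
  rewrite /T !Cmod_mult Cmod_ec Rmult_1_r; apply: Rmult_le_compat_l; first exact: Cmod_ge_0.
  exact: klc_Z.
have T0 : Cmod (T 0%Z) = 0 by rewrite /T (n_0 nf) // !Cmult_0_l Cmod_0.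
rewrite T0 Rplus_0_l.
apply: Rle_trans _ (Rmult_le_compat_r _ _ _ B0 (HC _ N ys)).
rewrite Rmult_comm -rsum_scal; apply: rsum_le => n _.
by have := TE (Z.of_nat n); have := TE (- Z.of_nat n)%Z; lra.
Qed.
End Nice2.

Lemma csum_single (s : seq nat) (P : pred nat) (F : nat -> C) j : uniq s -> j \in s -> P j ->
  (forall i, i \in s -> P i -> i != j -> F i = RtoC 0) -> \csum_(i <- s | P i) F i = F j.
Proof.
move=> us js Pj H; rewrite big_mkcond (bigD1_seq j) //= Pj big_seq_cond big1 ?Cplus_0_r // => i /andP [ir ij].
by case: ifP => // Pi; apply: H.
Qed.

(** A unit has exactly one inverse, so a sum over units may carry the inverse as a second variable;
    modularity places that inverse in the argument of the form. *)
Lemma inv_mod_sum (a c : nat) (z : C) : (0 < c)%N -> coprime a c ->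
  \csum_(0 <= b < c | (a * b == 1 %[mod c])%N) z = z.
Proof.
move=> c0 cop.
have [b0 b0c Hb] : exists2 b0, (b0 < c)%N & (a * b0 == 1 %[mod c])%N.
  case: (posnP a) => [a0|a0].
    by move: cop; rewrite a0 /coprime gcd0n => /eqP ->; exists 0%N.
  case: (egcdnP c a0) => km kn E _; rewrite (eqP cop) in E.
  exists (km %% c)%N; first by rewrite ltn_mod.
  by rewrite modnMmr mulnC E modnMDl.
apply: (csum_single (F := fun _ => z) (j := b0)) => //; first exact: iota_uniq.
  by rewrite mem_index_iota b0c.
move=> b; rewrite mem_index_iota => /andP [_ bc] H /eqP []; move: H => H.
have : (a * b == a * b0 %[mod c])%N by rewrite (eqP H) (eqP Hb).
have Z u v : (u < c)%N -> (c %| u - v)%N -> (u <= v)%N.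
  move=> uc; case: (posnP (u - v)) => [|P]; first by lia.
  by rewrite gtnNdvd //; lia.
case/orP: (leq_total b b0) => L.
  rewrite eq_sym eqn_mod_dvd ?leq_mul2l ?L ?orbT // -mulnBr Gauss_dvdr; last by rewrite coprime_sym.
  by move=> /(Z _ _ b0c) L'; apply/eqP; rewrite eqn_leq L L'.
rewrite eqn_mod_dvd ?leq_mul2l ?L ?orbT // -mulnBr Gauss_dvdr; last by rewrite coprime_sym.
by move=> /(Z _ _ bc) L'; apply/eqP; rewrite eqn_leq L L'.
Qed.

Lemma frac_sum (d : nat) (g : R -> C) : (0 < d)%N ->
  \csum_(0 <= a < d) g (INR a / INR d)%R =
  \csum_(1 <= c < d.+1 | c %| d) \csum_(0 <= a < c | coprime a c) g (INR a / INR c)%R.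
Proof.
move=> d0; have dR := INR_pos d0.
have U (a : nat) : (a < d)%N -> g (INR a / INR d)%R =
    \csum_(1 <= c < d.+1 | c %| d) \csum_(0 <= a' < c | coprime a' c && (a * c == a' * d)%N) g (INR a' / INR c)%R.
  move=> ad; set q := gcdn a d.
  have q0 : (0 < q)%N by rewrite gcdn_gt0 d0 orbT.
  have qd : (q %| d)%N by exact: dvdn_gcdr.
  have qa : (q %| a)%N by exact: dvdn_gcdl.
  have E1 := divnK qd; have E2 := divnK qa.
  have cop : coprime (a %/ q) (d %/ q) by rewrite /coprime -(eqn_pmul2r q0) muln_gcdl E1 E2 mul1n.
  have c0 : (0 < d %/ q)%N by rewrite divn_gt0 // dvdn_leq.
  rewrite (@csum_single _ _ _ (d %/ q)%N) /=; first last.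
  - move=> c _ cd cn.
    rewrite big1 // => a' /andP [cop' /eqP E].
    case/negP: cn; apply/eqP.
    have E' : (a %/ q * c = a' * (d %/ q))%N.
      by apply/eqP; rewrite -(eqn_pmul2r q0) mulnAC E2 E -mulnA E1.
    have D1 : (d %/ q %| c)%N by rewrite -(@Gauss_dvdr _ (a %/ q)%N) 1?coprime_sym // E' dvdn_mull.
    have D2 : (c %| d %/ q)%N by rewrite -(@Gauss_dvdr _ a') 1?coprime_sym // -E' dvdn_mull.
    by apply/eqP; rewrite eqn_dvd D1 D2.
  - by rewrite -{2}E1 dvdn_mulr.
  - by rewrite mem_index_iota c0 ltnS leq_div.
  - exact: iota_uniq.
  rewrite (@csum_single _ _ _ (a %/ q)%N) /=; first last.
  - move=> a' _ /andP [cop' /eqP E] an.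
    case/negP: an; apply/eqP.
    have : (a %/ q * d = a' * d)%N.
      by rewrite -E -{2}E2 -mulnA (mulnC q) E1.
    by move/eqP; rewrite eqn_pmul2r // => /eqP.
  - by rewrite cop /= -{1}E2 -mulnA (mulnC q) E1.
  - by rewrite mem_index_iota /= ltn_divLR // E1.
  - exact: iota_uniq.
  have qR := INR_pos q0; have cR := INR_pos c0.
  congr g; rewrite -{1}E2 -{1}E1 !mult_INR; field; lra.
rewrite big_nat (eq_bigr _ (fun a Ha => U a (proj2 (andP Ha)))) -big_nat exchange_big /=.
rewrite big_nat_cond [RHS]big_nat_cond; apply: eq_bigr => c /andP [/andP [c0 _] cd].
rewrite (exchange_big_dep (fun a' => coprime a' c)) /=; last by move=> a a' _ /andP [].
rewrite big_nat_cond [RHS]big_nat_cond; apply: eq_bigr => a' /andP [/andP [_ a'c] cop].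
apply: (csum_single (F := fun _ => g (INR a' / INR c)%R) (j := (a' * (d %/ c))%N)).
- exact: iota_uniq.
- by rewrite mem_index_iota /= -{2}(divnK cd) mulnC ltn_pmul2l // divn_gt0 // dvdn_leq.
- by rewrite cop -mulnA divnK //=.
move=> a _ /andP [_ /eqP E] an.
by case/negP: an; rewrite -(eqn_pmul2r c0) E -mulnA divnK.
Qed.

Lemma ec_eq1 t : ec t = RtoC 1 -> exists m : Z, t = IZR m.
Proof.
move=> E; have := congr1 Re E; rewrite /ec /=.
have -> : 2 * PI * t = 2 * (PI * t) by ring.
rewrite cos_2a_sin => H.
have s0 : sin (PI * t) = 0 by nra.
have [m Hm] := sin_eq_0_0 _ s0; exists m.
have P := PI_RGT_0; apply: (Rmult_eq_reg_l PI); lra.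
Qed.

Lemma root_sum (d : nat) (q : Z) : (0 < d)%N ->
  \csum_(0 <= a < d) ec (IZR q * (INR a / INR d)) =
  if Z.eqb (q mod Z.of_nat d) 0 then RtoC (INR d) else RtoC 0.
Proof.
move=> d0; have dR := INR_pos d0; have dZ : (0 < Z.of_nat d)%Z by lia.
case: Z.eqb_spec => H.
  rewrite (eq_bigr (fun _ => RtoC 1)) => [|a _]; last first.
    rewrite -(ec_IZR (q / Z.of_nat d * Z.of_nat a)); congr ec.
    have -> : IZR q = IZR (q / Z.of_nat d) * INR d.
      rewrite INR_IZR_INZ -mult_IZR; congr IZR; have := Z_div_mod_eq_full q (Z.of_nat d); lia.
    by rewrite mult_IZR -INR_IZR_INZ; field; lra.
  elim: d {d0 dR dZ H} => [|d IH]; first by rewrite big_nil.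
  by rewrite csum_recr // IH S_INR RtoC_plus.
set S := (\csum_(_ <= _ < _) _).
pose z := ec (IZR q / INR d).
have T N : (z * (\csum_(0 <= a < N) ec (IZR q * (INR a / INR d))) + 1 =
   (\csum_(0 <= a < N) ec (IZR q * (INR a / INR d))) + ec (IZR q * (INR N / INR d)))%C.
  elim: N => [|N IH]; first by rewrite !big_nil /= /Rdiv Rmult_0_l Rmult_0_r ec_0 Cmult_0_r.
  rewrite csum_recr // Cmult_plus_distr_l.
  have -> : (z * ec (IZR q * (INR N / INR d)) = ec (IZR q * (INR N.+1 / INR d)))%C.
    by rewrite -ec_plus; congr ec; rewrite S_INR; field; lra.
  move: IH; set A := (\csum_(_ <= _ < _) _) => IH.
  by rewrite -IH; ring.
have zS : ((z - 1) * S = 0)%C.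
  have := T d; rewrite -/S.
  have -> : ec (IZR q * (INR d / INR d)) = RtoC 1 by rewrite -(ec_IZR q); congr ec; field; lra.
  by move=> h; apply: (eq_trans (y := ((z * S + 1) - S - 1)%C)); [ring | rewrite h; ring].
have zn : (z - 1)%C <> RtoC 0.
  move=> E; have /ec_eq1 [m Hm] : z = RtoC 1 by apply: (eq_trans (y := ((z - 1) + 1)%C)); [ring | rewrite E; ring].
  apply: H; have -> : q = (m * Z.of_nat d)%Z.
    apply: eq_IZR; rewrite mult_IZR -INR_IZR_INZ -Hm; field; lra.
  exact: Z_mod_mult.
by rewrite -(Cmult_1_l S) -(Cinv_l _ zn) -Cmult_assoc zS Cmult_0_r.
Qed.

Lemma fc_shift (G : R -> C) s m : (forall x, Cc G x) -> (forall x, G (x + 1) = G x) ->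
  fc (fun x => G (s + x)) m = (ec (IZR m * s) * fc G m)%C.
Proof.
move=> cG pG; rewrite /fc -(CI_scal half_le); last by apply: Con_mult; [exact: Con_all | exact: Con_ec].
rewrite -(@CI_shift (fun x => ec (IZR m * s) * (G x * ec (- IZR m * x)))%C s).
- apply: CI_ext => [|x _]; first exact: half_le.
  have -> : - IZR m * (x + s) = - IZR m * x + - (IZR m * s) by ring.
  rewrite ec_plus (_ : forall a b c d : C, a * (b * (c * d)) = (b * c) * (a * d))%C; last by move=> *; ring.
  by rewrite -ec_plus Rplus_opp_r ec_0 Cmult_1_r Rplus_comm.
- by move=> x; apply: Cc_mult; [exact: Cc_const | apply: Cc_mult; [exact: cG | exact: Cc_ecM]].
- move=> x; rewrite pG; congr (_ * (_ * _))%C; rewrite -[RHS](ec_per _ (- m)); congr ec.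
  by rewrite opp_IZR; ring.
Qed.

Lemma modZ n r d : (0 < d)%N ->
  Z.eqb ((Z.of_nat n - Z.of_nat r) mod Z.of_nat d) 0 = (n == r %[mod d])%N.
Proof.
move=> d0; apply/idP/idP => [|/eqP H].
  move=> /Z.eqb_eq /Z.mod_divide [|q Hq]; first by lia.
  case/orP: (leq_total r n) => L.
    by rewrite eqn_mod_dvd //; apply/dvdnP; exists (Z.to_nat q); nia.
  by rewrite eq_sym eqn_mod_dvd //; apply/dvdnP; exists (Z.to_nat (- q)); nia.
have -> : (Z.of_nat n - Z.of_nat r)%Z = ((Z.of_nat (n %/ d) - Z.of_nat (r %/ d)) * Z.of_nat d)%Z.
  by have := divn_eq n d; have := divn_eq r d; rewrite H; nia.
by apply/Z.eqb_eq; apply: Z_mod_mult.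
Qed.

Lemma ap_count1 d r P j : (0 < d)%N -> (j <= d)%N -> (count (fun n => n == r %[mod d])%N (iota P j) <= 1)%N.
Proof.
move=> d0 jd; rewrite -size_filter.
have := filter_uniq (fun n => n == r %[mod d])%N (iota_uniq P j).
have M x : x \in [seq n <- iota P j | (n == r %[mod d])%N] -> (x == r %[mod d])%N /\ (P <= x < P + j)%N.
  by rewrite mem_filter mem_iota => /andP [].
case: (filter _ _) M => [|u [|v l]] // M /= /andP [].
have [/eqP Hu Iu] := M u (mem_head _ _).
have [/eqP Hv Iv] : (v == r %[mod d])%N /\ (P <= v < P + j)%N by apply: M; rewrite !inE eqxx orbT.
rewrite inE => /norP [/eqP uv _] _; case: uv.
have Z x y : (x %% d = y %% d)%N -> (x < y + d)%N -> (x <= y)%N.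
  move=> E L; rewrite leqNgt; apply/negP => yx.
  have : (d %| x - y)%N by rewrite -eqn_mod_dvd ?E //; exact: ltnW.
  by move/dvdn_leq; rewrite subn_gt0 yx => /(_ isT) H; move: L; rewrite -ltn_subLR ?(ltnW yx) // ltnNge H.
have Q1 : (u < v + d)%N by clear -Iu Iv jd; lia.
have Q2 : (v < u + d)%N by clear -Iu Iv jd; lia.
by apply/eqP; rewrite eqn_leq (Z _ _ _ Q1) ?(Z _ _ _ Q2) // Hu Hv.
Qed.

Lemma ap_count d r P j : (0 < d)%N ->
  INR (count (fun n => n == r %[mod d])%N (iota P j)) <= INR j / INR d + 1.
Proof.
move=> d0; have dR := INR_pos d0.
suff H : (d * count (fun n => n == r %[mod d])%N (iota P j) <= j + d)%N.
  apply: (Rmult_le_reg_l (INR d)) => //.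
  have -> : INR d * (INR j / INR d + 1) = INR j + INR d by field; lra.
  by rewrite -mult_INR -plus_INR; apply: INR_leq.
elim/ltn_ind: j P => j IH P.
have [jd|jd] := leqP j d.
  by have := ap_count1 r P d0 jd; nia.
have -> : iota P j = iota P d ++ iota (P + d) (j - d) by rewrite -iotaD; congr iota; lia.
by rewrite count_cat; have := ap_count1 r P d0 (leqnn d); have := IH (j - d)%N ltac:(lia) (P + d)%N; nia.
Qed.

Definition geo (N : nat) (x : R) : C := \csum_(0 <= j < N) ec (- INR j * x).

Lemma geo_le N x : Cmod (geo N x) <= INR N.
Proof.
apply: Rle_trans (Cmod_sum _ _ _) _.
rewrite (eq_bigr (fun _ => 1)) => [|i _]; last exact: Cmod_ec.
by rewrite rsum_const count_predT size_iota subn0; lra.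
Qed.

Lemma sin_quarter t : 0 <= t <= PI / 2 -> t / 4 <= sin t.
Proof.
move=> [t0 t1]; have P := PI_RGT_0; have P4 := PI_4.
case: (Rle_lt_dec t (PI / 3)) => Ht; last first.
  have : sin (PI / 6) <= sin t by apply: sin_incr_1; lra.
  by rewrite sin_PI6; lra.
case: t0 => [t0|<-]; last by rewrite sin_0; lra.
have [c [E [c0 c1]]] : exists c, sin t - sin 0 = cos c * (t - 0) /\ 0 < c < t.
  by apply: MVT_cor2 => // c _; exact: derivable_pt_lim_sin.
have : cos (PI / 3) <= cos c by apply: cos_decr_1; lra.
by rewrite cos_PI3; move: E; rewrite sin_0; nra.
Qed.

Lemma chord x : Rabs x <= 1 / 2 -> Rabs x <= Cmod (1 - ec x)%C.
Proof.
move=> Hx; have P0 := Rabs_pos x; have P := PI_RGT_0; have P2 := PI2_1.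
have S : Cmod (1 - ec x)%C ^ 2 = 4 * sin (PI * Rabs x) ^ 2.
  have -> : sin (PI * Rabs x) ^ 2 = sin (PI * x) ^ 2.
    rewrite /Rabs; case: Rcase_abs => // _.
    have -> : PI * - x = - (PI * x) by ring.
    by rewrite sin_neg; ring.
  rewrite Cmod2 /=; have -> : 2 * PI * x = 2 * (PI * x) by ring.
  rewrite cos_2a_sin sin_2a; have := sin2_cos2 (PI * x); rewrite /Rsqr => h.
  have c2 : cos (PI * x) * cos (PI * x) = 1 - sin (PI * x) * sin (PI * x) by lra.
  transitivity (4 * (sin (PI * x) * sin (PI * x)) * (sin (PI * x) * sin (PI * x)) +
     4 * (sin (PI * x) * sin (PI * x)) * (cos (PI * x) * cos (PI * x))); first by ring.
  by rewrite c2; ring.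
have Q : PI * Rabs x / 4 <= sin (PI * Rabs x) by apply: sin_quarter; split; nra.
have C0 := Cmod_ge_0 (1 - ec x)%C.
have : Rabs x ^ 2 <= Cmod (1 - ec x)%C ^ 2.
  rewrite S; have : Rabs x / 2 <= sin (PI * Rabs x) by nra.
  by nra.
by move=> H; apply: Rnot_lt_le => L; nra.
Qed.

Lemma geo_x N x : Rabs x <= 1 / 2 -> Rabs x * Cmod (geo N x) <= 2.
Proof.
move=> Hx.
have T : ((1 - ec (- x)) * geo N x = 1 - ec (- INR N * x))%C.
  rewrite /geo; elim: N => [|N IH].
    by rewrite big_nil /= Ropp_0 Rmult_0_l ec_0; ring.
  rewrite csum_recr // Cmult_plus_distr_l IH.
  have -> : - INR N.+1 * x = - x + - INR N * x by rewrite S_INR; ring.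
  by rewrite ec_plus; ring.
have := chord (x := - x); rewrite Rabs_Ropp => /(_ Hx) H.
apply: Rle_trans (Rmult_le_compat_r _ _ _ (Cmod_ge_0 _) H) _.
rewrite -Cmod_mult T; apply: Rle_trans (Cmod_triangle _ _) _.
by rewrite Cmod_opp Cmod_ec Cmod_1; lra.
Qed.

(** The bounds N and 2 / |x| are merged into one smooth majorant, whose primitive is an arcsinh; see
    [ker_int]. The constant 5 exceeds sqrt 17. *)
Lemma geo_sqrt N x : (0 < N)%N -> Rabs x <= 1 / 2 ->
  Cmod (geo N x) <= 5 * (INR N * / sqrt ((2 * INR N * x) ^ 2 + 1)).
Proof.
move=> N0 Hx; have NR := INR_pos N0.
have q0 : 0 < (2 * INR N * x) ^ 2 + 1 by have := pow2_ge_0 (2 * INR N * x); lra.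
have s0 : 0 < sqrt ((2 * INR N * x) ^ 2 + 1) by apply: sqrt_lt_R0.
apply: (Rmult_le_reg_r (sqrt ((2 * INR N * x) ^ 2 + 1))) => //.
rewrite (Rmult_assoc 5) (Rmult_assoc (INR N)) Rinv_l ?Rmult_1_r; last lra.
have A := geo_le N x; have B := geo_x N Hx; have C0 := Cmod_ge_0 (geo N x).
set D := Cmod _ in A B C0 *.
have S2 : sqrt ((2 * INR N * x) ^ 2 + 1) ^ 2 = (2 * INR N * x) ^ 2 + 1 by rewrite pow2_sqrt //; lra.
have xx : Rabs x ^ 2 = x ^ 2 by rewrite pow2_abs.
have X0 := Rabs_pos x.
have B2 : x ^ 2 * D ^ 2 <= 4.
  rewrite -xx -Rpow_mult_distr; have : 0 <= Rabs x * D by exact: Rmult_le_pos.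
  by move: B; set q := Rabs x * D; nra.
have A2 : D ^ 2 <= INR N ^ 2 by nra.
have : (D * sqrt ((2 * INR N * x) ^ 2 + 1)) ^ 2 <= (5 * INR N) ^ 2.
  rewrite Rpow_mult_distr S2; have : INR N ^ 2 * (x ^ 2 * D ^ 2) <= INR N ^ 2 * 4 by nra.
  by nra.
by move=> H; apply: Rnot_lt_le => L; nra.
Qed.

Lemma arcsinh_opp x : arcsinh (- x) = - arcsinh x.
Proof.
rewrite /arcsinh; have -> : (- x) ^ 2 = x ^ 2 by ring.
have q0 : 0 < x ^ 2 + 1 by nra.
have S2 : sqrt (x ^ 2 + 1) * sqrt (x ^ 2 + 1) = x ^ 2 + 1 by apply: sqrt_sqrt; lra.
have s0 : 0 < sqrt (x ^ 2 + 1) by exact: sqrt_lt_R0.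
have p : 0 < x + sqrt (x ^ 2 + 1) by apply: Rnot_le_lt => L; nra.
have p' : 0 < - x + sqrt (x ^ 2 + 1) by apply: Rnot_le_lt => L; nra.
have : ln ((- x + sqrt (x ^ 2 + 1)) * (x + sqrt (x ^ 2 + 1))) = 0.
  by rewrite -ln_1; congr ln; nra.
by rewrite ln_mult //; lra.
Qed.

Lemma ker_cont Y x : continuous (fun x => Y * / sqrt ((2 * Y * x) ^ 2 + 1)) x.
Proof.
apply: (ex_derive_continuous (K := R_AbsRing) (V := R_NormedModule)).
have q0 : 0 < (2 * Y * x) ^ 2 + 1 by have := pow2_ge_0 (2 * Y * x); lra.
have s0 : 0 < sqrt ((2 * Y * x) ^ 2 + 1) by apply: sqrt_lt_R0.
by auto_derive; rewrite /= in q0 s0 *; repeat split; lra.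
Qed.

Lemma ker_int Y : 1 <= Y -> RInt (fun x => Y * / sqrt ((2 * Y * x) ^ 2 + 1)) (- (1/2)) (1/2) <= 2 + ln Y.
Proof.
move=> Y1.
have D x : is_derive (fun x => / 2 * arcsinh (2 * Y * x)) x (Y * / sqrt ((2 * Y * x) ^ 2 + 1)).
  have H := is_derive_comp arcsinh (fun x => 2 * Y * x) x (/ sqrt ((2 * Y * x) ^ 2 + 1)) (2 * Y).
  have -> : Y * / sqrt ((2 * Y * x) ^ 2 + 1) = scal (/2) (scal (2 * Y) (/ sqrt ((2 * Y * x) ^ 2 + 1))).
    by rewrite /scal /= /mult /=; field; apply: Rgt_not_eq; apply: sqrt_lt_R0; have := pow2_ge_0 (2 * Y * x); rewrite /=; lra.
  apply: (is_derive_scal (fun x => arcsinh (2 * Y * x))); apply: H.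
    by apply/is_derive_Reals; exact: derivable_pt_lim_arcsinh.
  by auto_derive => //; ring.
rewrite (is_RInt_unique _ _ _ _ (is_RInt_derive _ _ _ _ (fun x _ => D x) (fun x _ => @ker_cont Y x))).
rewrite /minus /plus /opp /=.
have -> : 2 * Y * (1 / 2) = Y by field.
have -> : 2 * Y * - (1 / 2) = - Y by field.
rewrite arcsinh_opp /arcsinh.
have S2 : sqrt (Y ^ 2 + 1) * sqrt (Y ^ 2 + 1) = Y ^ 2 + 1 by apply: sqrt_sqrt; nra.
have s0 : 0 < sqrt (Y ^ 2 + 1) by apply: sqrt_lt_R0; nra.
have s1 : sqrt (Y ^ 2 + 1) <= 2 * Y by apply: Rnot_lt_le => L; nra.
have : ln (Y + sqrt (Y ^ 2 + 1)) <= ln (exp 2 * Y).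
  by apply: ln_le; [lra | have := exp_ineq1 2 ltac:(lra); nra].
by rewrite ln_mult ?ln_exp; [lra | exact: exp_pos | lra].
Qed.

Lemma Rp_lip u0 T e : 0 < u0 -> exists Lp, 0 <= Lp /\ forall u v, u0 <= u <= T * u0 -> u0 <= v <= T * u0 ->
  Rabs (Rpower u e - Rpower v e) <= Lp * Rabs (u - v).
Proof.
move=> u00; exists (Rabs e * (Rpower u0 (e - 1) * Rpower T (Rabs (e - 1)))); split.
  by apply: Rmult_le_pos; [exact: Rabs_pos | apply: Rmult_le_pos; left; exact: Rp_gt0].
set Lp := Rabs e * _.
have W u v : u < v -> u0 <= u <= T * u0 -> u0 <= v <= T * u0 ->
    Rabs (Rpower u e - Rpower v e) <= Lp * Rabs (u - v).
  move=> uv Hu Hv.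
  have [c [E [c0 c1]]] : exists c, Rpower v e - Rpower u e = (e * Rpower c (e - 1)) * (v - u) /\ u < c < v.
    by apply: (MVT_cor2 (fun x => Rpower x e) (fun c => e * Rpower c (e - 1))) => // c Hc; apply: derivable_pt_lim_power; lra.
  rewrite Rabs_minus_sym E (Rabs_minus_sym u) !Rabs_mult; apply: Rmult_le_compat_r; first exact: Rabs_pos.
  apply: Rmult_le_compat_l; first exact: Rabs_pos.
  rewrite Rabs_pos_eq; last by left; exact: Rp_gt0.
  have -> : Rpower c (e - 1) = Rpower u0 (e - 1) * Rpower (c / u0) (e - 1).
    by rewrite -Rp_mul //; [congr Rpower; field; lra | apply: Rdiv_lt_0_compat; lra].
  apply: Rmult_le_compat_l; first by left; exact: Rp_gt0.
  have t1 : 1 <= c / u0 <= T.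
    by split; apply: (Rmult_le_reg_r u0) => //; field_simplify; lra.
  by have [] := Rp_between (e - 1) t1.
move=> u v Hu Hv; case: (Rtotal_order u v) => [L|[->|L]]; first exact: W.
  by rewrite !Rminus_diag Rabs_R0 Rmult_0_r; lra.
by rewrite Rabs_minus_sym (Rabs_minus_sym u); apply: W.
Qed.

Section AbelC.
Variables (v be : nat -> C) (lo : nat) (Um : R).
Let U m := \csum_(lo <= n < m) be n.

(** Partial summation with a bound on all partial sums of [be] and on the variation of [v]; here [v]
    will be the inverse of a smooth factor. *)
Lemma abel_C L (vb dv : R) : 0 <= Um -> 0 <= vb -> 0 <= dv ->
  (forall m, (lo <= m <= lo + L)%N -> Cmod (U m) <= Um) ->
  (forall n, (lo <= n < lo + L)%N -> Cmod (v n) <= vb) ->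
  (forall n, (lo <= n)%N -> (n.+1 < lo + L)%N -> Cmod (v n - v n.+1) <= dv) ->
  Cmod (\csum_(lo <= n < lo + L) (v n * be n)) <= Um * (vb + INR L * dv).
Proof.
move=> Um0 vb0 dv0 HU Hv Hd.
have S M : \csum_(lo <= n < lo + M.+1) (v n * be n) =
   (v (lo + M)%N * U (lo + M.+1)%N + \csum_(lo <= n < lo + M) ((v n - v n.+1) * U n.+1))%C.
  elim: M => [|M IH].
    by rewrite !addn1 addn0 /U !csum_recr // !big_geq //; ring.
  rewrite addnS csum_recr ?leq_addr // IH (_ : lo + M.+1 = (lo + M).+1)%N; last by lia.
  rewrite csum_recr ?leq_addr // /U [in RHS]csum_recr; last by lia.
  set A := (\csum_(_ <= _ < _) be _); set B := (\csum_(_ <= _ < _) _); ring.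
case: L HU Hv Hd => [|L] HU Hv Hd.
  by rewrite addn0 big_geq // Cmod_0 Rmult_0_l Rplus_0_r; apply: Rmult_le_pos.
rewrite S; apply: Rle_trans (Cmod_triangle _ _) _.
rewrite Rmult_plus_distr_l; apply: Rplus_le_compat.
  by rewrite Cmod_mult Rmult_comm; apply: Rmult_le_compat; try exact: Cmod_ge_0; [apply: HU | apply: Hv]; lia.
apply: Rle_trans (Cmod_sum _ _ _) _.
apply: (Rle_trans _ (\rsum_(lo <= n < lo + L) (dv * Um))).
  rewrite big_nat [X in _ <= X]big_nat; apply: rsum_le => n Hn.
  by rewrite Cmod_mult; apply: Rmult_le_compat; try exact: Cmod_ge_0; [apply: Hd | apply: HU]; lia.
rewrite rsum_const count_predT size_iota addKn S_INR.
by have := pos_INR L; nra.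
Qed.
End AbelC.

(* By [bWt], the n-th coefficient at height y is lam n * y^(-(k-1)/2) times the
    value of this function at n y. *)
Definition Wtf (k : nat) (f : C -> C) (u : R) : C := (RtoC (Rpower u ((INR k - 1) / 2)) * bf f 1 u)%C.

(** * Cancellation over one block of a progression *)

Section Block.
Variables (k : nat) (f : C -> C) (lam : nat -> C).
Hypothesis nf : nice k f lam.
Notation b := (bf f).
Notation ex := ((INR k - 1) / 2).
Notation Wt := (Wtf k f).

Lemma low2 : exists u0 de w L, [/\ 0 < u0, 0 < de, 0 < w /\ 0 <= L,
    (forall u, u0 <= u <= (1 + de) * u0 -> w <= Cmod (Wt u)) &
    (forall u v, u0 <= u <= (1 + de) * u0 -> u0 <= v <= (1 + de) * u0 ->
       Cmod (Wt u - Wt v) <= L * Rabs (u - v))].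
Proof.
have [u0 [de [w [L [u00 d0 w0 Hw HL]]]]] := n_low nf.
have [M [M0 HM]] := b_bd nf.
have [Lp [Lp0 HLp]] := Rp_lip (1 + de) ex u00.
have B u : u0 <= u <= (1 + de) * u0 ->
    Rpower u0 ex * Rpower (1 + de) (- Rabs ex) <= Rpower u ex <= Rpower u0 ex * Rpower (1 + de) (Rabs ex).
  move=> Hu; have -> : Rpower u ex = Rpower u0 ex * Rpower (u / u0) ex.
    by rewrite -Rp_mul //; [congr Rpower; field; lra | apply: Rdiv_lt_0_compat; lra].
  have t1 : 1 <= u / u0 <= 1 + de.
    by split; apply: (Rmult_le_reg_r u0) => //; field_simplify; lra.
  have [H1 H2] := Rp_between ex t1.
  by split; apply: Rmult_le_compat_l => //; left; exact: Rp_gt0.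
have bB u : u0 <= u -> Cmod (b 1 u) <= M / Rpower u0 (INR k / 2).
  move=> Hu; have p0 := Rp_gt0 u0 (INR k / 2).
  apply: (Rmult_le_reg_r (Rpower u0 (INR k / 2))) => //.
  rewrite /Rdiv Rmult_assoc Rinv_l ?Rmult_1_r; last lra.
  apply: Rle_trans (HM 1%Z u ltac:(lra)); apply: Rmult_le_compat_l; first exact: Cmod_ge_0.
  by apply: Rle_Rpower_l; [have := pos_INR k; lra | lra].
have p1 := Rp_gt0 u0 ex; have p2 := Rp_gt0 (1 + de) (- Rabs ex); have p3 := Rp_gt0 (1 + de) (Rabs ex).
have p4 : 0 <= M / Rpower u0 (INR k / 2).
  by apply: Rmult_le_pos => //; left; apply: Rinv_0_lt_compat; exact: Rp_gt0.
exists u0, de, (Rpower u0 ex * Rpower (1 + de) (- Rabs ex) * w),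
  (Lp * (M / Rpower u0 (INR k / 2)) + Rpower u0 ex * Rpower (1 + de) (Rabs ex) * Rmax L 0); split => //.
- split; first by apply: Rmult_lt_0_compat => //; exact: Rmult_lt_0_compat.
  have h := Rmax_r L 0; apply: Rplus_le_le_0_compat; first by apply: Rmult_le_pos.
  by apply: Rmult_le_pos => //; apply: Rmult_le_pos; lra.
- move=> u Hu; rewrite /Wtf Cmod_mult Cmod_R (Rabs_pos_eq (Rpower u _)); last by left; exact: Rp_gt0.
  apply: Rmult_le_compat; [ | lra | by case: (B u Hu) | exact: Hw].
  by apply: Rmult_le_pos; lra.
move=> u v Hu Hv.
have -> : (Wt u - Wt v = RtoC (Rpower u ex - Rpower v ex) * b 1 u + RtoC (Rpower v ex) * (b 1 u - b 1 v))%C.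
  by rewrite /Wtf RtoC_minus; ring.
apply: Rle_trans (Cmod_triangle _ _) _; rewrite !Cmod_mult !Cmod_R (Rabs_pos_eq (Rpower v _)); last by left; exact: Rp_gt0.
rewrite Rmult_plus_distr_r; apply: Rplus_le_compat.
  rewrite (Rmult_assoc Lp) (Rmult_comm (M / _)) -(Rmult_assoc Lp).
  apply: Rmult_le_compat; [exact: Rabs_pos | exact: Cmod_ge_0 | exact: HLp | by apply: bB; lra].
rewrite Rmult_assoc; apply: Rmult_le_compat; [left; exact: Rp_gt0 | exact: Cmod_ge_0 | by case: (B v Hv) | ].
apply: Rle_trans (HL u v Hu Hv) _; apply: Rmult_le_compat_r; [exact: Rabs_pos | exact: Rmax_l].
Qed.

Lemma Wt_le : exists M, 0 <= M /\ forall u, 0 < u -> Cmod (Wt u) <= M / sqrt u.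
Proof.
have [M [M0 HM]] := b_bd nf; exists M; split => // u u0.
rewrite /Wtf Cmod_mult Cmod_R (Rabs_pos_eq (Rpower u _)); last by left; exact: Rp_gt0.
have -> : Rpower u ex = / sqrt u * Rpower u (INR k / 2).
  rewrite -Rp_half // -Rpower_Ropp -Rpower_plus; congr Rpower; lra.
have := HM 1%Z u u0 => H.
have s0 : 0 < / sqrt u by apply: Rinv_0_lt_compat; exact: sqrt_lt_R0.
by rewrite /Rdiv (Rmult_comm M); rewrite Rmult_assoc; apply: Rmult_le_compat_l; lra.
Qed.

Lemma bWt n y : (0 < n)%N -> 0 < y -> b (Z.of_nat n) y = (lam n * RtoC (Rpower y (- ex)) * Wt (INR n * y))%C.
Proof.
move=> n0 y0; have nR := INR_pos n0; rewrite (n_pos nf) // /Wtf.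
have -> : Rpower (INR n) ex = Rpower y (- ex) * Rpower (INR n * y) ex.
  rewrite Rp_mul //; transitivity (Rpower (INR n) ex * (Rpower y ex * Rpower y (- ex))); last by ring.
  by rewrite Rp_addV Rmult_1_r.
by rewrite RtoC_mult; ring.
Qed.

(** The additive characters modulo d project f onto the frequencies congruent to r; see [Phi_fc]. *)
Definition Phi (r d : nat) (y x : R) : C :=
  \csum_(0 <= a < d) (ec (- (INR r * (INR a / INR d))) * f (pt (INR a / INR d + x) y)).

Lemma Cc_Phi r d y x : 0 < y -> Cc (Phi r d y) x.
Proof.
move=> y0; apply: Cc_sum => a _; apply: Cc_mult; first exact: Cc_const.
apply: (Cc_ext (f := fun t => f (pt (1 * t + INR a / INR d) y))) => [t|]; first by congr f; congr pair; ring.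
by apply: (Cc_affine (f := fun t => f (t, y))); exact: (Cc_F nf).
Qed.

Lemma Phi_fc r d y n : (0 < d)%N -> 0 < y ->
  fc (Phi r d y) (Z.of_nat n) = if (n == r %[mod d])%N then (RtoC (INR d) * b (Z.of_nat n) y)%C else RtoC 0.
Proof.
move=> d0 y0; have dR := INR_pos d0.
have cF x : Cc (fun t => f (t, y)) x by exact: (Cc_F nf).
have pF x : f (x + 1, y) = f (x, y) by exact: modular_T (n_mod nf) y0.
have -> : fc (Phi r d y) (Z.of_nat n) = \csum_(0 <= a < d) (ec (- (INR r * (INR a / INR d))) *
    fc (fun x => f (pt (INR a / INR d + x) y)) (Z.of_nat n)).
  rewrite /fc (CI_ext half_le (g := fun x => \csum_(0 <= a < d) (ec (- (INR r * (INR a / INR d))) *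
    (f (pt (INR a / INR d + x) y) * ec (- IZR (Z.of_nat n) * x))))); last first.
    by move=> x _; rewrite /Phi big_distrl /=; apply: eq_bigr => a _; rewrite Cmult_assoc.
  have cS a : Con (fun x => f (pt (INR a / INR d + x) y) * ec (- IZR (Z.of_nat n) * x))%C (- (1/2)) (1/2).
    apply: Con_mult; last exact: Con_ec.
    move=> z _; apply: (Cc_ext (f := fun t => f (pt (1 * t + INR a / INR d) y))) => [t|]; first by congr f; congr pair; ring.
    by apply: (Cc_affine (f := fun t => f (t, y))).
  rewrite (CI_sum half_le); last by move=> a _; apply: Con_mult => // z _; exact: Cc_const.
  by apply: eq_bigr => a _; rewrite (CI_scal half_le).
rewrite (eq_bigr (fun a => (b (Z.of_nat n) y * ec (IZR (Z.of_nat n - Z.of_nat r) * (INR a / INR d)))%C)); last first.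
  move=> a _; rewrite (fc_shift (INR a / INR d) (Z.of_nat n) cF pF) -/(b (Z.of_nat n) y).
  rewrite minus_IZR -!INR_IZR_INZ.
  have -> : (INR n - INR r) * (INR a / INR d) = - (INR r * (INR a / INR d)) + INR n * (INR a / INR d) by ring.
  by rewrite ec_plus; ring.
rewrite csum_scal root_sum // modZ //; case: ifP => _; ring.
Qed.

(** Here Bd c stands for a bound on the Kloosterman sums modulo c: by [G_bound] the fractions of
    reduced denominator c contribute c Bd c to [Phi]. *)
Definition sg (d : nat) (Bd : nat -> R) := \rsum_(1 <= c < d.+1 | c %| d) (INR c * Bd c).

Lemma sg_ge0 d Bd : (forall c, 0 <= Bd c) -> 0 <= sg d Bd.
Proof. by move=> H; apply: rsum_ge0 => c _; apply: Rmult_le_pos; [exact: pos_INR | exact: H]. Qed.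

Lemma Phi_le : exists C0, 0 <= C0 /\ forall r d y x Bd, (0 < d)%N -> 0 < y -> (forall c, 0 <= Bd c) ->
  (forall c m, (0 < c)%N -> (c %| d)%N -> Cmod (klc r m c) <= Bd c) ->
  Cmod (Phi r d y x) <= C0 * sg d Bd * sqrt (x ^ 2 + y ^ 2) * Rpower y (- ((INR k + 1) / 2)).
Proof.
have [C0 [C00 HC]] := G_bound nf; exists C0; split => // r d y x Bd d0 y0 B0 HB.
rewrite /Phi (frac_sum (fun t => (ec (- (INR r * t)) * f (pt (t + x) y))%C)) //.
apply: Rle_trans (Cmod_sum _ _ _) _.
have -> : C0 * sg d Bd * sqrt (x ^ 2 + y ^ 2) * Rpower y (- ((INR k + 1) / 2)) =
  (C0 * sqrt (x ^ 2 + y ^ 2) * Rpower y (- ((INR k + 1) / 2))) * sg d Bd by ring.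
rewrite /sg -rsum_scal big_nat_cond [X in _ <= X]big_nat_cond; apply: rsum_le => c /andP [/andP [c0 _] cd].
have := HC r c (Bd c) x y c0 y0 (B0 c) (fun m => HB c m c0 cd).
have -> : \csum_(0 <= a < c | coprime a c) (ec (- (INR r * (INR a / INR c))) * f (pt (INR a / INR c + x) y)) =
  \csum_(0 <= a < c) \csum_(0 <= b' < c | (a * b' == 1 %[mod c])%N)
     (ec (- (INR (r * a) / INR c)) * f (pt (INR a / INR c + x) y)).
  rewrite big_mkcond; apply: eq_bigr => a _; case: ifP => cop.
    by rewrite inv_mod_sum //; congr (ec _ * _)%C; rewrite mult_INR /Rdiv; ring.
  rewrite big1 // => b' /eqP H; move/negP: cop; case.
  have : coprime (a * b') c by rewrite -coprime_modl H coprime_modl coprime1n.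
  by rewrite coprimeMl => /andP [].
by lra.
Qed.

(* The ends of the summation are shifted by j and the result averaged over j < Y:
    the Dirichlet kernel is replaced by one of L^1 norm at most 2 + ln Y, at the
    cost of Y / d + 1 terms estimated by Lm. *)
Lemma block_bound : exists C0 de, [/\ 0 <= C0, 0 < de &
  forall lo hi d r Y (Bd : nat -> R) Lm, block de lo hi -> (0 < d)%N -> (0 < Y)%N -> (forall c, 0 <= Bd c) ->
  (forall c m, (0 < c)%N -> (c %| d)%N -> Cmod (klc r m c) <= Bd c) -> 0 <= Lm ->
  (forall n, (0 < n <= hi + Y)%N -> Cmod (lam n) <= Lm) ->
  Cmod (\csum_(lo <= n < hi | (n == r %[mod d])%N) lam n) <=
  C0 * (INR lo / (INR d * INR Y) * (2 + ln (INR Y)) * sg d Bd + (INR Y / INR d + 1) * Lm)].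
Proof.
have [u0 [de [w [L [u00 d0 [w0 L0] Hw HL]]]]] := low2.
have [M [M0 HM]] := Wt_le; have [C1 [C10 HC]] := Phi_le.
have su : 0 < sqrt u0 by exact: sqrt_lt_R0.
set A1 := C1 * (2 + u0 * (1 + de)) * 5 / u0.
set A2 := 2 * (M / sqrt u0).
set V := / w + (1 + de) * (u0 * L / w ^ 2).
have V0 : 0 <= V.
  apply: Rplus_le_le_0_compat; first by left; exact: Rinv_0_lt_compat.
  apply: Rmult_le_pos; first lra.
  by apply: Rmult_le_pos; [nra | left; apply: Rinv_0_lt_compat; exact: pow_lt].
have A10 : 0 <= A1.
  apply: Rmult_le_pos; last by left; exact: Rinv_0_lt_compat.
  by apply: Rmult_le_pos; [apply: Rmult_le_pos; nra | lra].
have A20 : 0 <= A2.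
  by apply: Rmult_le_pos; [lra | apply: Rmult_le_pos => //; left; exact: Rinv_0_lt_compat].
exists ((A1 + A2) * V), de; split => //; first by apply: Rmult_le_pos; lra.
move=> lo hi d r Y Bd Lm [l0 Hb] d0' Y0 B0 HB Lm0 HLm.
have lR := INR_pos l0; have dR := INR_pos d0'; have YR := INR_pos Y0; have Y1 := INR_ge1 Y0.
have sg0 := sg_ge0 d B0.
set y := u0 / INR lo; have y0 : 0 < y by apply: Rdiv_lt_0_compat.
have lny : 0 <= ln (INR Y) by rewrite -ln_1; apply: ln_le; lra.
case: (leqP hi lo) => [hl|lh].
  rewrite big_geq // Cmod_0; apply: Rmult_le_pos; first by apply: Rmult_le_pos; lra.
  apply: Rplus_le_le_0_compat.
    apply: Rmult_le_pos => //; apply: Rmult_le_pos; last lra.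
    by apply: Rmult_le_pos; [lra | left; apply: Rinv_0_lt_compat; nra].
  apply: Rmult_le_pos => //; have : 0 <= INR Y / INR d; last lra.
  by apply: Rmult_le_pos; [lra | left; exact: Rinv_0_lt_compat].
pose be n := if (n == r %[mod d])%N then b (Z.of_nat n) y else RtoC 0.
set Mx := Lm * Rpower y (- ex) * (M / sqrt u0).
have pe := Rp_gt0 y (- ex).
have i0 : 0 <= M / sqrt u0 by apply: Rmult_le_pos => //; left; exact: Rinv_0_lt_compat.
have Mx0 : 0 <= Mx by apply: Rmult_le_pos => //; apply: Rmult_le_pos; lra.
have nyE n : INR n * y = INR n / INR lo * u0 by rewrite /y; field; lra.
have Hbe n : (lo <= n <= hi + Y)%N -> Cmod (b (Z.of_nat n) y) <= Mx.
  move=> /andP [n1 n2]; have n0 : (0 < n)%N by lia.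
  rewrite bWt // Cmod_mult (Cmod_mult (lam n)) Cmod_R (Rabs_pos_eq (Rpower y _)); last lra.
  have u0n : u0 <= INR n * y.
    rewrite nyE; have : 1 <= INR n / INR lo; last nra.
    by apply: (Rmult_le_reg_r (INR lo)) => //; field_simplify; [have := INR_leq n1; lra | lra].
  rewrite /Mx; apply: Rmult_le_compat; [by apply: Rmult_le_pos; [exact: Cmod_ge_0 | lra] | exact: Cmod_ge_0 | | ].
    by apply: Rmult_le_compat_r; [lra | apply: HLm; rewrite n0].
  apply: Rle_trans (HM _ _) _; first lra.
  apply: Rmult_le_compat_l => //; apply: Rinv_le_contravar => //; exact: sqrt_le_1_alt.
have Win P j : (lo <= P)%N -> (P + j <= hi + Y)%N -> Cmod (\csum_(P <= n < P + j) be n) <= (INR j / INR d + 1) * Mx.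
  move=> lP PY; apply: Rle_trans (Cmod_sum _ _ _) _.
  apply: (Rle_trans _ (\rsum_(P <= n < P + j | (n == r %[mod d])%N) Mx)).
    rewrite [X in _ <= X]big_mkcond big_nat [X in _ <= X]big_nat; apply: rsum_le => n Hn; rewrite /be.
    by case: ifP => _; [apply: Hbe; lia | rewrite Cmod_0; lra].
  rewrite rsum_const /index_iota addKn; apply: Rmult_le_compat_r => //; exact: ap_count.
set Av := A1 * Rpower y ex ^ 0 * (INR lo / (INR d * INR Y) * (2 + ln (INR Y)) * sg d Bd) * Rpower y (- ex).
have Av0 : 0 <= Av.
  apply: Rmult_le_pos; last lra.
  rewrite /= Rmult_1_r; apply: Rmult_le_pos => //; apply: Rmult_le_pos => //; apply: Rmult_le_pos; last lra.
  by apply: Rmult_le_pos; [lra | left; apply: Rinv_0_lt_compat; nra].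
have HU m : (lo <= m <= lo + (hi - lo))%N -> Cmod (\csum_(lo <= n < m) be n) <= Av + 2 * ((INR Y / INR d + 1) * Mx).
  move=> Hm.
  (* Shifting both ends by j changes the sum by two windows of length j, which are estimated
     trivially by [Win]. *)
  have Dj j : (j < Y)%N -> Cmod (\csum_(lo <= n < m) be n - \csum_(lo + j <= n < m + j) be n) <= 2 * ((INR Y / INR d + 1) * Mx).
    move=> jY.
    have -> : (\csum_(lo <= n < m) be n - \csum_(lo + j <= n < m + j) be n =
        \csum_(lo <= n < lo + j) be n + - \csum_(m <= n < m + j) be n)%C.
      have E1 := @csum_split be lo m (m + j) ltac:(lia); have E2 := @csum_split be lo (lo + j) (m + j) ltac:(lia).
      move: E1; rewrite E2; set s1 := (\csum_(lo <= _ < m) _); set s2 := (\csum_(lo + j <= _ < _) _).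
      set s3 := (\csum_(lo <= _ < lo + j) _); set s4 := (\csum_(m <= _ < _) _) => E.
      by apply: (eq_trans (y := ((s3 + s2) - s2 - s4)%C)); [rewrite E; ring | ring].
    apply: Rle_trans (Cmod_triangle _ _) _; rewrite Cmod_opp.
    have jj : (INR j / INR d + 1) * Mx <= (INR Y / INR d + 1) * Mx.
      apply: Rmult_le_compat_r => //; apply: Rplus_le_compat_r; apply: Rmult_le_compat_r.
        by left; exact: Rinv_0_lt_compat.
      by apply: INR_leq; lia.
    by have := Win lo j ltac:(lia) ltac:(lia); have := Win m j ltac:(lia) ltac:(lia); lra.
  pose S := \csum_(0 <= j < Y) \csum_(lo + j <= n < m + j) be n.
  have HS : Cmod S <= INR Y * Av.
    have SE : (RtoC (INR d) * S)%C = CI (fun x => Phi r d y x * (geo Y x * (ec (- INR lo * x) * geo (m - lo) x)))%C (- (1/2)) (1/2).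
      rewrite (CI_ext half_le (g := fun x => \csum_(0 <= j < Y) \csum_(0 <= l < m - lo) (Phi r d y x * ec (- IZR (Z.of_nat (l + (lo + j))) * x)))); last first.
        move=> x _; rewrite (_ : forall a b c d : C, a * (b * (c * d)) = b * (a * (c * d)))%C; last by move=> *; ring.
        rewrite {1}/geo big_distrl /=; apply: eq_bigr => j _.
        rewrite (_ : forall a b c d : C, a * (b * (c * d)) = (b * (a * c)) * d)%C; last by move=> *; ring.
        rewrite /geo big_distrr /=; apply: eq_bigr => l _; rewrite -Cmult_assoc; congr Cmult.
        rewrite -INR_IZR_INZ !plus_INR.
        have -> : - (INR l + (INR lo + INR j)) * x = - INR j * x + (- INR lo * x + - INR l * x) by ring.
        by rewrite !ec_plus; ring.
      have cP n : Con (fun x => Phi r d y x * ec (- IZR (Z.of_nat n) * x))%C (- (1/2)) (1/2).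
        by apply: Con_mult; [move=> z _; exact: Cc_Phi | exact: Con_ec].
      rewrite (CI_sum half_le); last by move=> j _ z Hz; apply: Cc_sum => l _; apply: cP.
      rewrite /S -csum_scal; apply: eq_bigr => j _.
      rewrite (CI_sum half_le) // -{1}[(lo + j)%N]add0n big_addn (_ : m + j - (lo + j) = m - lo)%N; last by lia.
      rewrite -csum_scal; apply: eq_bigr => l _; rewrite -[CI _ _ _]/(fc (Phi r d y) (Z.of_nat (l + (lo + j)))) Phi_fc // /be.
      by case: ifP => _ //; rewrite Cmult_0_r.
    set K := C1 * sg d Bd * Rpower y (- ((INR k + 1) / 2)) * ((2 + u0 * (1 + de)) * 5).
    have K0 : 0 <= K.
      repeat apply: Rmult_le_pos => //; try lra; try (by left; exact: Rp_gt0).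
      by nra.
    have I : Cmod (RtoC (INR d) * S)%C <= K * (2 + ln (INR Y)).
      rewrite SE; apply: Rle_trans (@CI_norm _ _ half_le _ (fun x => K * (INR Y * / sqrt ((2 * INR Y * x) ^ 2 + 1))) _ _ _) _.
      - move=> z _; apply: Cc_mult; first exact: Cc_Phi.
        have cg N : Cc (geo N) z by apply: Cc_sum => j _; exact: Cc_ecM.
        by apply: Cc_mult => //; apply: Cc_mult => //; exact: Cc_ecM.
      - by move=> z _; apply: cont_mult; [exact: cont_const | exact: ker_cont].
      - move=> x Hx; have Hx' : Rabs x <= 1 / 2 by apply: Rabs_le; lra.
        rewrite !Cmod_mult Cmod_ec Rmult_1_l.
        have P1 := HC r d y x Bd d0' y0 B0 HB.
        have P2 := geo_sqrt Y0 Hx'.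
        (* The kernel of length m - lo is spent against the growth of |z| <= |x| + y: |x| times it
           is at most 2, and y times it at most u0 (1 + de). The kernel of length Y is left to be
           integrated. *)
        have P3 : sqrt (x ^ 2 + y ^ 2) * Cmod (geo (m - lo) x) <= 2 + u0 * (1 + de).
          have z0 : sqrt (x ^ 2 + y ^ 2) <= Rabs x + y.
            have ax := Rabs_pos x; rewrite -[Rabs x + y]sqrt_pow2; last lra.
            by apply: sqrt_le_1_alt; have := pow2_abs x; nra.
          have g0 := Cmod_ge_0 (geo (m - lo) x).
          apply: Rle_trans (Rmult_le_compat_r _ _ _ g0 z0) _; rewrite Rmult_plus_distr_r.
          apply: Rplus_le_compat; first exact: geo_x.
          apply: (Rle_trans _ (y * ((1 + de) * INR lo))); last by right; rewrite /y; field; lra.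
          apply: Rmult_le_compat_l; first lra.
          apply: Rle_trans (geo_le _ _) _.
          have := Hb hi.-1 ltac:(lia) => Q; apply: Rle_trans Q; apply: INR_leq; lia.
        have g0 := Cmod_ge_0 (geo (m - lo) x); have g1 := Cmod_ge_0 (geo Y x).
        have q0 : 0 <= C1 * sg d Bd * Rpower y (- ((INR k + 1) / 2)).
          by repeat apply: Rmult_le_pos => //; left; exact: Rp_gt0.
        apply: (Rle_trans _ (C1 * sg d Bd * sqrt (x ^ 2 + y ^ 2) * Rpower y (- ((INR k + 1) / 2)) * (Cmod (geo Y x) * Cmod (geo (m - lo) x)))).
          by apply: Rmult_le_compat_r => //; apply: Rmult_le_pos.
        have -> : C1 * sg d Bd * sqrt (x ^ 2 + y ^ 2) * Rpower y (- ((INR k + 1) / 2)) * (Cmod (geo Y x) * Cmod (geo (m - lo) x)) =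
          (C1 * sg d Bd * Rpower y (- ((INR k + 1) / 2))) * ((sqrt (x ^ 2 + y ^ 2) * Cmod (geo (m - lo) x)) * Cmod (geo Y x)) by ring.
        rewrite /K; move: q0; set q := (C1 * sg d Bd * Rpower _ _) => q0.
        rewrite (Rmult_assoc q); apply: Rmult_le_compat_l => //.
        rewrite (Rmult_assoc (2 + _)); apply: Rmult_le_compat => //; apply: Rmult_le_pos => //; exact: sqrt_pos.
      rewrite (RInt_scal (V := R_CompleteNormedModule) (fun x => INR Y * / sqrt ((2 * INR Y * x) ^ 2 + 1))); last first.
        by apply: cont_ex => [|z _]; [exact: half_le | exact: ker_cont].
      by apply: Rmult_le_compat_l => //; exact: ker_int.
    rewrite Cmod_mult Cmod_R Rabs_pos_eq in I; last lra.
    apply: (Rmult_le_reg_l (INR d)) => //; apply: Rle_trans I _; right.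
    rewrite /K /Av /A1 /=.
    have -> : Rpower y (- ((INR k + 1) / 2)) = INR lo / u0 * Rpower y (- ex).
      have -> : INR lo / u0 = Rpower y (- 1).
        rewrite Rpower_Ropp Rpower_1 // /y; field; lra.
      by rewrite -Rpower_plus; congr Rpower; field.
    by field; lra.
  have T : Cmod (RtoC (INR Y) * \csum_(lo <= n < m) be n)%C <= INR Y * (Av + 2 * ((INR Y / INR d + 1) * Mx)).
    have -> : (RtoC (INR Y) * (\csum_(lo <= n < m) be n) = S + (\csum_(0 <= j < Y) ((\csum_(lo <= n < m) be n) - (\csum_(lo + j <= n < m + j) be n))))%C.
      rewrite /S -big_split /=; set s := (\csum_(lo <= n < m) _).
      rewrite (eq_bigr (fun _ => s)) => [|j _]; last by ring.
      elim: (Y) => [|N IH]; first by rewrite big_nil /=; ring.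
      by rewrite csum_recr // -IH S_INR RtoC_plus; ring.
    apply: Rle_trans (Cmod_triangle _ _) _; rewrite Rmult_plus_distr_l; apply: Rplus_le_compat => //.
    apply: Rle_trans (Cmod_sum _ _ _) _.
    apply: (Rle_trans _ (\rsum_(0 <= j < Y) (2 * ((INR Y / INR d + 1) * Mx)))).
      by rewrite big_nat [X in _ <= X]big_nat; apply: rsum_le => j /andP [_ jY]; apply: Dj.
    by rewrite rsum_const count_predT size_iota subn0; lra.
  rewrite Cmod_mult Cmod_R Rabs_pos_eq in T; last lra.
  exact: (Rmult_le_reg_l (INR Y)).
(* [be n] is lam n times a factor depending smoothly on n y and bounded away from 0 on the block;
   [abel_C] divides this factor out. *)
pose v n := (/ (RtoC (Rpower y (- ex)) * Wt (INR n * y)))%C.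
have inI n : (lo <= n < hi)%N -> u0 <= INR n * y <= (1 + de) * u0.
  move=> Hn; rewrite nyE; have Q := Hb n Hn; have := INR_leq (proj1 (andP Hn)) => Q2.
  have : 1 <= INR n / INR lo <= 1 + de; last by nra.
  by split; apply: (Rmult_le_reg_r (INR lo)) => //; field_simplify; lra.
have Wn n : (lo <= n < hi)%N -> Wt (INR n * y) <> RtoC 0.
  by move=> Hn E; have := Hw _ (inI n Hn); rewrite E Cmod_0; lra.
have pn : RtoC (Rpower y (- ex)) <> RtoC 0 by move=> [E]; lra.
have -> : \csum_(lo <= n < hi | (n == r %[mod d])%N) lam n = \csum_(lo <= n < lo + (hi - lo)) (v n * be n).
  rewrite subnKC; last exact: ltnW.
  rewrite big_mkcond big_nat [RHS]big_nat; apply: eq_bigr => n Hn; rewrite /be; case: ifP => _; last by ring.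
  rewrite bWt //; last by lia.
  by rewrite /v; field; split => //; exact: Wn.
have Um0 : 0 <= Av + 2 * ((INR Y / INR d + 1) * Mx).
  have : 0 <= INR Y / INR d by apply: Rmult_le_pos; [lra | left; exact: Rinv_0_lt_compat].
  by move=> h; apply: Rplus_le_le_0_compat => //; apply: Rmult_le_pos; [lra | apply: Rmult_le_pos; lra].
have pp : 0 < Rpower y ex by exact: Rp_gt0.
have pinv : / Rpower y (- ex) = Rpower y ex by rewrite Rpower_Ropp Rinv_inv.
have Hvn n : (lo <= n < hi)%N -> Cmod (v n) <= Rpower y ex * / w.
  move=> Hn; rewrite /v Cmod_inv; last by apply: Cmult_neq_0 => //; exact: Wn.
  rewrite Cmod_mult Cmod_R (Rabs_pos_eq (Rpower y _)); last lra.
  rewrite Rinv_mult pinv; apply: Rmult_le_compat_l; first lra.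
  by apply: Rinv_le_contravar => //; apply: Hw; apply: inI.
have := @abel_C v be lo _ (hi - lo) (Rpower y ex * / w) (Rpower y ex * (L * y / w ^ 2)) Um0 _ _ HU _ _.
move=> AB; apply: Rle_trans (AB _ _ _ _) _.
- by apply: Rmult_le_pos; [lra | left; exact: Rinv_0_lt_compat].
- apply: Rmult_le_pos; first lra.
  by apply: Rmult_le_pos; [nra | left; apply: Rinv_0_lt_compat; exact: pow_lt].
- by move=> n Hn; apply: Hvn; lia.
- move=> n n1 n2; have h1 : (lo <= n < hi)%N by lia.
  have h2 : (lo <= n.+1 < hi)%N by lia.
  have W1 := Wn _ h1; have W2 := Wn _ h2.
  have -> : (v n - v n.+1 = RtoC (Rpower y ex) * ((Wt (INR n.+1 * y) - Wt (INR n * y)) * / (Wt (INR n * y) * Wt (INR n.+1 * y))))%C.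
    rewrite /v -pinv RtoC_inv; last lra.
    by field.
  have nn : (Wt (INR n * y) * Wt (INR n.+1 * y))%C <> RtoC 0 by apply: Cmult_neq_0.
  rewrite Cmod_mult (Cmod_mult (_ - _)%C) Cmod_R (Rabs_pos_eq (Rpower y _)); last lra.
  apply: Rmult_le_compat_l; first lra.
  rewrite Cmod_inv // Cmod_mult; apply: Rmult_le_compat; [exact: Cmod_ge_0 | | | ].
  + left; apply: Rinv_0_lt_compat; apply: Rmult_lt_0_compat; [exact (proj1 (Cmod_gt_0 _) W1) | exact (proj1 (Cmod_gt_0 _) W2)].
  + apply: Rle_trans (HL _ _ (inI _ h2) (inI _ h1)) _.
    by rewrite S_INR (_ : (INR n + 1) * y - INR n * y = y); [rewrite Rabs_pos_eq; lra | ring].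
  + apply: Rinv_le_contravar; first exact: pow_lt.
    by rewrite /= Rmult_1_r; apply: Rmult_le_compat; try lra; apply: Hw; (exact: (inI _ h1) || exact: (inI _ h2)).
have LL : INR (hi - lo) <= (1 + de) * INR lo.
  have := Hb hi.-1 ltac:(lia) => Q; apply: Rle_trans Q; apply: INR_leq; lia.
have dv0 : 0 <= Rpower y ex * (L * y / w ^ 2).
  apply: Rmult_le_pos; first lra.
  by apply: Rmult_le_pos; [nra | left; apply: Rinv_0_lt_compat; exact: pow_lt].
apply: (Rle_trans _ ((Av + 2 * ((INR Y / INR d + 1) * Mx)) * (Rpower y ex * V))).
  apply: Rmult_le_compat_l => //.
  apply: Rle_trans (Rplus_le_compat_l _ _ _ (Rmult_le_compat_r _ _ _ dv0 LL)) _.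
  by right; rewrite /V /y; field; lra.
set Q1 := INR lo / (INR d * INR Y) * (2 + ln (INR Y)) * sg d Bd.
have Q10 : 0 <= Q1.
  apply: Rmult_le_pos => //; apply: Rmult_le_pos; last lra.
  by apply: Rmult_le_pos; [lra | left; apply: Rinv_0_lt_compat; nra].
set Q2 := (INR Y / INR d + 1) * Lm.
have Q20 : 0 <= Q2.
  have : 0 <= INR Y / INR d by apply: Rmult_le_pos; [lra | left; exact: Rinv_0_lt_compat].
  by move=> h; apply: Rmult_le_pos; lra.
have -> : (Av + 2 * ((INR Y / INR d + 1) * Mx)) * (Rpower y ex * V) =
  (A1 * Q1 + A2 * Q2) * V * (Rpower y ex * Rpower y (- ex)).
  by rewrite /Av -/Q1 /Mx /Q2 /A2 /=; ring.
rewrite Rp_addV Rmult_1_r (Rmult_comm (A1 + A2)) Rmult_assoc Rmult_comm; apply: Rmult_le_compat_l => //.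
by nra.
Qed.
End Block.
End ProgressionSums.

(** * Analytic properties of Hecke cusp forms *)

Module CuspForms.
Import Reals Lra Lia Psatz ZArith Coquelicot.
Import ssreflect ssrfun ssrbool eqtype ssrnat seq choice fintype bigop div prime.
Import zify ssrZ.
Import Defs.
Import Fourier ProgressionSums.
Set Implicit Arguments. Unset Strict Implicit. Unset Printing Implicit Defensive.
Open Scope R_scope.

Lemma Ccancel (z a b : C) : z <> RtoC 0 -> (a * z = b * z)%C -> a = b.
Proof.
move=> z0 E; rewrite -(Cmult_1_r a) -(Cinv_r z z0) Cmult_assoc E -Cmult_assoc Cinv_r //.
by rewrite Cmult_1_r.
Qed.

Lemma natdivE n d : (0 < d)%N -> Nat.div n d = (n %/ d)%N.
Proof.
move=> d0; symmetry; apply: (Nat.div_unique n d (n %/ d)%N (n %% d)%N).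
  by apply/ltP; rewrite ltn_mod.
by rewrite {1}(divn_eq n d) mulnC.
Qed.

Lemma natmodE n d : (0 < d)%N -> Nat.modulo n d = (n %% d)%N.
Proof.
move=> d0; symmetry; apply: (Nat.mod_unique n d (n %/ d)%N (n %% d)%N).
  by apply/ltP; rewrite ltn_mod.
by rewrite {1}(divn_eq n d) mulnC.
Qed.

Lemma csum_const N (c : C) : \csum_(0 <= i < N) c = (RtoC (INR N) * c)%C.
Proof.
elim: N => [|n IH]; first by rewrite big_nil Cmult_0_l.
by rewrite csum_recr // IH S_INR RtoC_plus; ring.
Qed.

Lemma CI_stretch (G : R -> C) q : (0 < q)%N -> (forall x, Cc G x) -> (forall x, G (x + 1) = G x) ->
  CI (fun x => G (INR q * x)) (- (1/2)) (1/2) = CI G (- (1/2)) (1/2).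
Proof.
move=> q0 cG pG; have qR := INR_pos q0.
have H a n : CI G a (a + INR n) = (RtoC (INR n) * CI G (- (1/2)) (1/2))%C.
  elim: n => [|n IH].
    by rewrite Rplus_0_r Cmult_0_l /CI !RInt_point.
  have n0 := pos_INR n; rewrite S_INR -(@CI_Chasles G a (a + INR n)); [|lra|lra|exact: Con_all].
  rewrite IH -Rplus_assoc (CI_periodic (a + INR n) (- (1/2)) cG pG) RtoC_plus.
  have -> : - (1/2) + 1 = 1/2 by lra.
  by ring.
have E := @CI_affine G (INR q) 0 (- (1/2)) (1/2) half_le qR (Con_all cG).
rewrite (CI_ext half_le (g := fun x => G (INR q * x + 0))) => [|x _]; last by rewrite Rplus_0_r.
have qC : RtoC (INR q) <> RtoC 0 by move=> [h]; lra.
rewrite -[LHS]Cmult_1_l -(Cinv_l _ qC) -Cmult_assoc E.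
have -> : INR q * (1 / 2) + 0 = INR q * - (1 / 2) + 0 + INR q by field.
by rewrite H; field.
Qed.

(** * Hecke operators and Fourier coefficients *)

Section Hecke.
Variables (k : nat) (f : C -> C) (lam : nat -> C).
Hypothesis cF : forall y x, 0 < y -> Cc (fun t => f (t, y)) x.
Hypothesis pF : forall y x, 0 < y -> f (x + 1, y) = f (x, y).
Hypothesis hf : hecke_eigen k f lam.
Notation b := (bf f).
Notation ex := ((INR k - 1) / 2).

Let T (d : nat) (y t : R) : C := \csum_(0 <= j < d) f (pt ((t + INR j) / INR d) y).

Lemma T_cont d y t : 0 < y -> Cc (T d y) t.
Proof.
move=> y0; apply: Cc_sum => j _.
apply: (Cc_ext (f := fun t => f (pt (/ INR d * t + INR j / INR d) y))) => [u|]; first by congr f; congr pair; rewrite /Rdiv; ring.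
by apply: (Cc_affine (f := fun t => f (t, y))); exact: cF.
Qed.

Lemma T_per d y t : (0 < d)%N -> 0 < y -> T d y (t + 1) = T d y t.
Proof.
case: d => [//|d] _ y0; rewrite /T [in RHS]big_nat_recl // [in LHS]csum_recr // Cplus_comm.
have dR : 0 < INR d.+1 by exact: INR_pos.
congr Cplus.
  have -> : (t + 1 + INR d) / INR d.+1 = (t + INR 0) / INR d.+1 + 1 by rewrite S_INR in dR *; simpl (INR 0); field; lra.
  exact: pF.
by apply: eq_bigr => j _; congr f; congr pair; rewrite [in RHS]S_INR /Rdiv; ring.
Qed.

(** The average over the translates by j / d keeps only the frequencies divisible by d. *)
Lemma T_fc d q y (m : Z) : (0 < d)%N -> (0 < q)%N -> 0 < y ->
  fc (fun x => T d y (INR q * x)) (Z.of_nat q * m) = (RtoC (INR d) * b (m * Z.of_nat d) y)%C.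
Proof.
move=> d0 q0 y0; have dR := INR_pos d0.
pose P t := (T d y t * ec (- IZR m * t))%C.
have cP t : Cc P t by apply: Cc_mult; [exact: T_cont | exact: Cc_ecM].
have pP t : P (t + 1) = P t.
  by rewrite /P T_per //; congr Cmult; rewrite -[RHS](ec_per _ (- m)); congr ec; rewrite opp_IZR; ring.
rewrite /fc (CI_ext half_le (g := fun x => P (INR q * x))); last first.
  by move=> x _; rewrite /P mult_IZR -INR_IZR_INZ; congr (_ * ec _)%C; ring.
rewrite CI_stretch // -(CI_stretch d0) //.
pose p t := (f (t, y) * ec (- IZR (m * Z.of_nat d) * t))%C.
have cp t : Cc p t by apply: Cc_mult; [exact: cF | exact: Cc_ecM].
have pp t : p (t + 1) = p t.
  by rewrite /p pF //; congr Cmult; rewrite -[RHS](ec_per _ (- (m * Z.of_nat d))); congr ec; rewrite opp_IZR; ring.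
rewrite (CI_ext half_le (g := fun x => \csum_(0 <= j < d) p (x + INR j / INR d)%R)); last first.
  move=> x _; rewrite /P /T big_distrl /=; apply: eq_bigr => j _; rewrite /p; congr Cmult.
    by congr f; congr pair; field; lra.
  rewrite -[RHS](ec_per _ (m * Z.of_nat j)); congr ec.
  by rewrite !mult_IZR -!INR_IZR_INZ; field; lra.
rewrite (CI_sum half_le); last first.
  by move=> j _ z _; apply: (Cc_ext (f := fun t => p (1 * t + INR j / INR d)%R)) => [u|]; [rewrite Rmult_1_l | apply: Cc_affine].
rewrite (eq_bigr (fun _ => b (m * Z.of_nat d) y)) => [|j _]; last by rewrite CI_shift.
exact: csum_const.
Qed.

(** As a function of x this has period 1 / q, so its coefficient at m is multiplied by ec (m / q),
    which is not 1 for m = 1 or -1 and q > 1. *)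
Lemma T_fc0 d q y (m : Z) : (0 < d)%N -> (1 < q)%N -> 0 < y -> (m = 1 \/ m = -1)%Z ->
  fc (fun x => T d y (INR q * x)) m = RtoC 0.
Proof.
move=> d0 q1 y0 Hm; have qR : 2 <= INR q by apply: (INR_leq q1).
pose G x := T d y (INR q * x).
have cG t : Cc G t.
  apply: (Cc_ext (f := fun t => T d y (INR q * t + 0))) => [u|]; first by rewrite Rplus_0_r.
  by apply: Cc_affine; exact: T_cont.
have tq n t : T d y (t + INR n) = T d y t.
  by elim: n => [|n IH]; [rewrite Rplus_0_r | rewrite S_INR -Rplus_assoc T_per].
have pG t : G (t + 1) = G t by rewrite /G Rmult_plus_distr_l Rmult_1_r tq.
have := fc_shift (/ INR q) m cG pG.
have -> : fc (fun x => G (/ INR q + x)) m = fc G m.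
  rewrite /fc; apply: CI_ext => [|x _]; first exact: half_le.
  rewrite /G; congr Cmult; rewrite Rmult_plus_distr_l Rinv_r; last lra.
  by rewrite Rplus_comm T_per.
move=> E; have n1 : ec (IZR m * / INR q) <> RtoC 1.
  have i0 : 0 < / INR q by apply: Rinv_0_lt_compat; lra.
  have i1 : / INR q <= / 2 by apply: Rinv_le_contravar; lra.
  by apply: ec_neq1; case: Hm => ->; lra.
have n2 : (1 - ec (IZR m * / INR q))%C <> RtoC 0.
  move=> h; apply: n1; apply: (eq_trans (y := (1 - (1 - ec (IZR m * / INR q)))%C)); [ring | rewrite h; ring].
change (fc G m = RtoC 0); rewrite -[LHS]Cmult_1_l -(Cinv_l _ n2) -Cmult_assoc.
have -> : ((1 - ec (IZR m * / INR q)) * fc G m = fc G m - ec (IZR m * / INR q) * fc G m)%C by ring.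
by rewrite -E; ring.
Qed.

Lemma hecke_fc n y m : (0 < n)%N -> 0 < y ->
  (lam n * b m y = RtoC (Rpower (INR n) ex) *
   \csum_(1 <= d < n.+1) (if (d %| n)%N then
     RtoC (/ INR d ^ k) * fc (fun x => T d (INR (n %/ d) * y / INR d) (INR (n %/ d) * x)) m else RtoC 0))%C.
Proof.
move=> n0 y0; rewrite /bf /fc -(CI_scal half_le); last first.
  by apply: Con_mult; [move=> z _; exact: cF | exact: Con_ec].
have Y0 d : (0 < d)%N -> (d %| n)%N -> 0 < INR (n %/ d) * y / INR d.
  move=> d0 dn; apply: Rdiv_lt_0_compat; last exact: INR_pos.
  by apply: Rmult_lt_0_compat => //; apply: INR_pos; rewrite divn_gt0 // dvdn_leq.
rewrite (CI_ext half_le (g := fun x => RtoC (Rpower (INR n) ex) *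
   \csum_(1 <= d < n.+1) (if (d %| n)%N then
     RtoC (/ INR d ^ k) * (T d (INR (n %/ d) * y / INR d) (INR (n %/ d) * x) * ec (- IZR m * x)) else RtoC 0))%C); last first.
  move=> x _; rewrite Cmult_assoc -(@hf n (elimT leP n0) (x, y) y0).
  rewrite /hecke -Cmult_assoc; congr Cmult; rewrite sum_n_m_big big_distrl /=.
  rewrite big_nat [RHS]big_nat; apply: eq_bigr => d /andP [d0 _].
  have -> : Nat.eqb (Nat.modulo n d) 0 = (d %| n)%N by rewrite natmodE //; apply/Nat.eqb_spec/eqP.
  case: ifP => dn; last by ring.
  rewrite -Cmult_assoc; congr Cmult; congr Cmult; rewrite sum_n_m_big (_ : (d - 1).+1 = d)%N; last by lia.
  apply: eq_bigr => j _; have dR := INR_pos d0; congr f.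
  rewrite natdivE //; by apply: C_eq; rewrite /Cdiv /Cinv /=; field; lra.
have cT d : (0 < d)%N -> (d %| n)%N ->
  Con (fun x => T d (INR (n %/ d) * y / INR d) (INR (n %/ d) * x) * ec (- IZR m * x))%C (- (1/2)) (1/2).
  move=> d0 dn; apply: Con_mult; last exact: Con_ec.
  move=> z _; apply: (Cc_ext (f := fun t => T d (INR (n %/ d) * y / INR d) (INR (n %/ d) * t + 0))) => [u|]; first by rewrite Rplus_0_r.
  by apply: Cc_affine; apply: T_cont; apply: Y0.
have cS d : (0 < d)%N -> Con (fun x => if (d %| n)%N then
     RtoC (/ INR d ^ k) * (T d (INR (n %/ d) * y / INR d) (INR (n %/ d) * x) * ec (- IZR m * x)) else RtoC 0)%C (- (1/2)) (1/2).
  move=> d0; case dn: (d %| n)%N => z Hz; last exact: Cc_const.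
  by apply: Cc_mult; [exact: Cc_const | exact: cT].
rewrite (CI_scal half_le); last first.
  move=> z Hz; apply: (Cc_ext (f := fun x => \csum_(0 <= d < n) (if (d.+1 %| n)%N then
     RtoC (/ INR d.+1 ^ k) * (T d.+1 (INR (n %/ d.+1) * y / INR d.+1) (INR (n %/ d.+1) * x) * ec (- IZR m * x)) else RtoC 0))).
    by move=> x; rewrite big_add1.
  by apply: Cc_sum => d _; exact: cS.
congr Cmult.
rewrite (CI_ext half_le (g := fun x => \csum_(0 <= d < n) (if (d.+1 %| n)%N then
     RtoC (/ INR d.+1 ^ k) * (T d.+1 (INR (n %/ d.+1) * y / INR d.+1) (INR (n %/ d.+1) * x) * ec (- IZR m * x)) else RtoC 0))); last first.
  by move=> x _; rewrite big_add1.
rewrite (CI_sum half_le) ?big_add1 /= => [|d _]; last exact: cS.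
apply: eq_bigr => d _; case: ifP => dn; last by rewrite CI_const; ring.
by rewrite (CI_scal half_le) //; exact: cT.
Qed.

(** Compare the coefficients of index m = 1 or -1 in the eigenvalue equation on the line of height n
    y: by [T_fc0] only the term d = n survives. *)
Lemma hecke_one n y m : (0 < n)%N -> 0 < y -> (m = 1 \/ m = -1)%Z ->
  b (m * Z.of_nat n) y = (lam n * RtoC (Rpower (INR n) ex) * b m (INR n * y))%C.
Proof.
move=> n0 y0 Hm; have nR := INR_pos n0; have ny : 0 < INR n * y by nra.
have := hecke_fc m n0 ny.
rewrite (@csum_single _ _ _ n) //=; last 3 first.
- exact: iota_uniq.
- by rewrite mem_index_iota n0 ltnSn.
- move=> d; rewrite mem_index_iota => /andP [d0 dn] _ dn'; case: ifP => // dv.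
  rewrite T_fc0 // ?Cmult_0_r //.
    have E := divnK dv; case: (n %/ d)%N E => [|[|q]] // E; first by rewrite -E in n0.
    by rewrite -E mul1n eqxx in dn'.
  apply: Rdiv_lt_0_compat; last exact: INR_pos.
  by apply: Rmult_lt_0_compat => //; apply: INR_pos; rewrite divn_gt0 // dvdn_leq.
rewrite dvdnn divnn n0 /=.
have := @T_fc n 1 (1 * (INR n * y) / INR n) m n0 isT; rewrite Z.mul_1_l => -> //; last first.
  by rewrite (_ : 1 * (INR n * y) / INR n = y) //; field; lra.
have -> : 1 * (INR n * y) / INR n = y by field; lra.
move=> E; apply: esym; rewrite (_ : forall a b c : C, a * b * c = b * (a * c))%C; last by move=> *; ring.
rewrite E -Rpower_pow // -Rpower_Ropp.
rewrite (_ : forall a b c d e : C, a * (b * (c * (d * e))) = (a * b * c * d) * e)%C; last by move=> *; ring.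
rewrite -!RtoC_mult.
have -> : Rpower (INR n) ex * Rpower (INR n) ex * Rpower (INR n) (- INR k) * INR n = 1.
  rewrite -{4}(Rpower_1 (INR n)) // -!Rpower_plus (_ : ex + ex + - INR k + 1 = 0); last by field.
  by rewrite Rpower_O.
by rewrite Cmult_1_l.
Qed.

(** Compare the coefficients of index 2 s n in the eigenvalue equation of the second Hecke operator,
    at height u / (2n). By [hecke_one] all three terms become multiples of the same nonzero value
    [b s u], and the powers of 2 and n cancel. *)
Lemma hecke_two n u s : (0 < n)%N -> 0 < u -> (s = 1 \/ s = -1)%Z -> b s u <> RtoC 0 ->
  (lam 2%N * lam (2 * n)%N = lam n + lam (4 * n)%N)%C.
Proof.
move=> n0 u0 Hs bu; have nR := INR_pos n0.
set y := u / (2 * INR n); have y0 : 0 < y by apply: Rdiv_lt_0_compat; lra.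
have := @hecke_fc 2 y (2 * (s * Z.of_nat n)) isT y0.
rewrite csum_recr // csum_recr // big_geq // dvd1n dvdnn Cplus_0_l.
have y1 : 0 < INR (2 %/ 1) * y / INR 1 by rewrite divn1 /=; lra.
have y2 : 0 < INR (2 %/ 2) * y / INR 2 by rewrite divnn /=; lra.
have T1 := @T_fc 1 2 _ (s * Z.of_nat n) isT isT y1.
have T2 := @T_fc 2 1 _ (2 * (s * Z.of_nat n)) isT isT y2.
have E21 : (2 %/ 1 = 2)%N by []. have E22 : (2 %/ 2 = 1)%N by [].
have Z1 : (Z.of_nat 1 * (2 * (s * Z.of_nat n)) = 2 * (s * Z.of_nat n))%Z by lia.
have Z2 : (Z.of_nat 2 * (s * Z.of_nat n) = 2 * (s * Z.of_nat n))%Z by lia.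
rewrite E21 Z2 in T1; rewrite E22 Z1 in T2; rewrite E21 E22 T1 T2.
have P j v : (0 < j)%N -> 0 < v -> b (s * Z.of_nat j) v = (lam j * RtoC (Rpower (INR j) ex) * b s (INR j * v))%C.
  by move=> j0 v0; apply: hecke_one.
have -> : (s * Z.of_nat n * Z.of_nat 1)%Z = (s * Z.of_nat n)%Z by lia.
have -> : (2 * (s * Z.of_nat n) * Z.of_nat 2)%Z = (s * Z.of_nat (4 * n))%Z by lia.
have -> : (2 * (s * Z.of_nat n))%Z = (s * Z.of_nat (2 * n))%Z by lia.
rewrite !P //; try lra; try lia.
rewrite !mult_INR.
have -> : INR 1 = 1 by [].
have -> : INR 2 = 2 by rewrite /=; lra.
have -> : INR 4 = 4 by rewrite /=; lra.
have -> : 2 * INR n * y = u by rewrite /y; field; lra.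
have -> : 4 * INR n * (1 * y / 2) = u by rewrite /y; field; lra.
have -> : INR n * (2 * y / 1) = u by rewrite /y; field; lra.
rewrite !Rp_mul //; try lra.
change (R1 + R1) with 2.
have -> : / 2 ^ k = / (Rpower 2 ex * Rpower 2 ex * 2).
  rewrite -Rpower_pow; last lra.
  congr Rinv; transitivity (Rpower 2 ex * Rpower 2 ex * Rpower 2 1); last by rewrite Rpower_1; lra.
  by rewrite -!Rpower_plus; congr Rpower; field.
rewrite pow1 Rinv_1.
have p2 := Rp_gt0 2 ex; have pn := Rp_gt0 (INR n) ex.
rewrite RtoC_inv; last by nra.
rewrite !RtoC_mult.
have c2 : RtoC 2 <> RtoC 0 by move=> [h]; lra.
have cp2 : RtoC (Rpower 2 ex) <> RtoC 0 by move=> [h]; lra.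
have cpn : RtoC (Rpower (INR n) ex) <> RtoC 0 by move=> [h]; lra.
move: (RtoC (Rpower 2 ex)) (RtoC (Rpower (INR n) ex)) cp2 cpn (b s u) bu => p q cp2 cpn B bu.
move=> E; have : ((lam 2 * lam (2 * n)%N) * (p * q * B) = (lam n + lam (4 * n)%N) * (p * q * B))%C.
  apply: (eq_trans (y := (lam 2%N * (lam (2 * n)%N * (p * q) * B))%C)); first ring.
  by rewrite E; field.
by apply: Ccancel; do 2 apply: Cmult_neq_0 => //.
Qed.
End Hecke.

(* With x_j = lam (2^j), the relation x_j^2 - x_(j-1) x_(j+1) = 1 propagates, so
    that x_j cannot tend to 0. *)
Lemma theta_ge0 (lam : nat -> C) : lam 1%N = RtoC 1 ->
  (forall n, (0 < n)%N -> (lam 2%N * lam (2 * n)%N = lam n + lam (4 * n)%N)%C) ->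
  forall t, eigenvalue_bound lam t -> 0 <= t.
Proof.
move=> l1 H t Ht; apply: Rnot_lt_le => t0.
pose x j := lam (2 ^ j)%N.
have xr j : (x 1%N * x j.+1 = x j + x j.+2)%C.
  by rewrite /x expn1 !expnS H ?expn_gt0 // mulnA.
have I j : (x j.+1 * x j.+1 - x j * x j.+2 = 1)%C.
  elim: j => [|j IH].
    have := xr 0%N; rewrite {1 2 3}/x expn0 l1 expn1 => E.
    apply: (eq_trans (y := (lam 2%N * lam 2%N - (1 * x 2%N))%C)); first by rewrite /x expn0 l1 expn1.
    by rewrite E; ring.
  have E := xr j.+1; have E' := xr j.
  have -> : x j.+3 = (x 1%N * x j.+2 - x j.+1)%C by rewrite E; ring.
  apply: (eq_trans (y := (x j.+2 * x j.+2 - x j.+2 * (x 1%N * x j.+1) + x j.+1 * x j.+1)%C)); first ring.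
  by rewrite E' -IH; ring.
have [A HA] := Ht (- t / 2) ltac:(lra).
set r := Rpower 2 (t + - t / 2).
have r0 : 0 < r by exact: Rp_gt0.
have r1 : r < 1.
  by rewrite /r -(Rpower_O 2); [apply: Rpower_lt; lra | lra].
have B j : Cmod (x j) <= A * r ^ j.
  have p0 : (0 < 2 ^ j)%N by rewrite expn_gt0.
  apply: Rle_trans (HA _ (elimT leP p0)) _; right; congr Rmult.
  elim: j {p0} => [|j IH]; first by rewrite expn0 Rp_1.
  rewrite expnS mult_INR Rp_mul; [ | by rewrite /=; lra | by apply: INR_pos; rewrite expn_gt0].
  by rewrite IH /= /r; congr (Rpower _ _ * _); rewrite /=; lra.
have A0 : 0 <= A by have := B 0%N; have := Cmod_ge_0 (x 0%N); rewrite /= Rmult_1_r; lra.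
have e0 : 0 < / (2 * A ^ 2 + 1) by apply: Rinv_0_lt_compat; nra.
have [N HN] := pow_lt_1_zero r ltac:(rewrite Rabs_pos_eq; lra) _ e0.
have rN := HN N (Nat.le_refl N); rewrite Rabs_pos_eq in rN; last by apply: pow_le; lra.
have P : 1 <= 2 * A ^ 2 * (r ^ N).
  have := Cmod_triangle (x N.+1 * x N.+1)%C (- (x N * x N.+2))%C.
  rewrite -/(Cminus _ _) I Cmod_1 Cmod_opp !Cmod_mult.
  have B0 := B N; have B1 := B N.+1; have B2 := B N.+2; rewrite /= in B1 B2.
  have rn0 : 0 < r ^ N by apply: pow_lt.
  have rn1 : r ^ N <= 1 by rewrite -(pow1 N); apply: pow_incr; lra.
  have C0 := Cmod_ge_0 (x N); have C1 := Cmod_ge_0 (x N.+1); have C2 := Cmod_ge_0 (x N.+2).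
  set rn := r ^ N in B0 B1 B2 rn0 rn1 *.
  have ra : r * rn <= rn by nra.
  have D1 : Cmod (x N.+1) <= A * rn by apply: Rle_trans B1 _; apply: Rmult_le_compat_l.
  have D2 : Cmod (x N.+2) <= A by apply: Rle_trans B2 _; rewrite -{2}(Rmult_1_r A); apply: Rmult_le_compat_l => //; nra.
  have D3 : Cmod (x N.+1) <= A by apply: Rle_trans D1 _; rewrite -{2}(Rmult_1_r A); apply: Rmult_le_compat_l.
  have F1 : Cmod (x N.+1) * Cmod (x N.+1) <= A * rn * A by apply: Rmult_le_compat.
  have F2 : Cmod (x N) * Cmod (x N.+2) <= A * rn * A by apply: Rmult_le_compat.
  by rewrite /=; lra.
have : 2 * A ^ 2 * r ^ N <= 2 * A ^ 2 * / (2 * A ^ 2 + 1) by apply: Rmult_le_compat_l; [nra | lra].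
have : 2 * A ^ 2 * / (2 * A ^ 2 + 1) < 1.
  by apply: (Rmult_lt_reg_r (2 * A ^ 2 + 1)); [nra | rewrite Rmult_assoc Rinv_l; nra].
by lra.
Qed.

(** * Reduction towards the fundamental domain, and convergence of series *)

Lemma modular_S k f x y : modular k f -> 0 < y ->
  f (- x / (x ^ 2 + y ^ 2), y / (x ^ 2 + y ^ 2)) = (Cpow (x, y) k * f (x, y))%C.
Proof.
move=> mf y0; have s0 : 0 < x ^ 2 + y ^ 2 by nra.
have := mf 0%Z (-1)%Z 1%Z 0%Z erefl (x, y) y0.
have -> : ((0 * (x, y) + -1) / (1 * (x, y) + 0))%C = (- x / (x ^ 2 + y ^ 2), y / (x ^ 2 + y ^ 2)).
  by apply: C_eq; rewrite /Cdiv /Cinv /=; field; nra.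
move=> ->; congr (Cpow _ _ * _)%C.
by apply: C_eq => /=; ring.
Qed.

Lemma near_int x : exists (x' : R) (n : Z), Rabs x' <= 1 / 2 /\ x = x' + IZR n.
Proof.
exists (x - IZR (Int_part (x + 1 / 2))), (Int_part (x + 1 / 2)); split; last by ring.
by have [H1 H2] := base_Int_part (x + 1 / 2); apply: Rabs_le; lra.
Qed.

Lemma per_Z (T : Type) (f : R -> T) : (forall x, f (x + 1) = f x) -> forall x n, f (x + IZR n) = f x.
Proof.
move=> pf; have P x n : f (x + INR n) = f x.
  by elim: n => [|n IH]; [rewrite Rplus_0_r | rewrite S_INR -Rplus_assoc pf].
move=> x n; case: (Z.le_ge_cases 0 n) => Hn.
  by rewrite -(Z2Nat.id n Hn) -INR_IZR_INZ P.
rewrite -(P _ (Z.to_nat (- n))) INR_IZR_INZ Z2Nat.id; last by lia.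
by rewrite opp_IZR; congr f; ring.
Qed.

(* When |x| <= 1/2 and y < 1/2 the map z -> -1/z at least doubles the height. *)
Lemma reduction (phi : R -> R -> R) (h : R -> R) :
  (forall x y, 0 < y -> phi (x + 1) y = phi x y) ->
  (forall x y, 0 < y -> phi (- x / (x ^ 2 + y ^ 2)) (y / (x ^ 2 + y ^ 2)) = phi x y) ->
  (forall x y, Rabs x <= 1 / 2 -> 1 / 2 <= y -> phi x y <= h y) ->
  (forall y y', 0 < y -> y < 1 / 2 -> 2 * y <= y' -> y' <= 1 / y -> h y' <= h y) ->
  forall x y, 0 < y -> phi x y <= h y.
Proof.
move=> pT pS H hh.
suff P n : forall x y, (1 / 2) ^ n <= y -> phi x y <= h y.
  move=> x y y0; have [n Hn] := pow_lt_1_zero (1 / 2) ltac:(rewrite Rabs_pos_eq; lra) y y0.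
  apply: (P n); have := Hn n (Nat.le_refl n); rewrite Rabs_pos_eq; first lra.
  by apply: pow_le; lra.
have R x y : 0 < y -> exists x', Rabs x' <= 1 / 2 /\ phi x y = phi x' y.
  move=> y0; have [x' [m [Hx ->]]] := near_int x; exists x'; split => //.
  by apply: (per_Z (f := fun x => phi x y)) => t; apply: pT.
elim: n => [|n IH] x y Hy.
  have y0 : 0 < y by move: Hy => /=; lra.
  by have [x' [Hx ->]] := R x y y0; apply: H => //; move: Hy => /=; lra.
have y0 : 0 < y by apply: Rlt_le_trans Hy; apply: pow_lt; lra.
have [x' [Hx ->]] := R x y y0.
case: (Rle_lt_dec (1 / 2) y) => y2; first exact: H.
have x2 : x' ^ 2 <= 1 / 4 by rewrite -pow2_abs; have := Rabs_pos x'; nra.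
have s0 : 0 < x' ^ 2 + y ^ 2 by nra.
have y1 : 2 * y <= y / (x' ^ 2 + y ^ 2).
  apply: (Rmult_le_reg_r (x' ^ 2 + y ^ 2)) => //.
  have -> : y / (x' ^ 2 + y ^ 2) * (x' ^ 2 + y ^ 2) = y by field; lra.
  by nra.
rewrite -pS //; apply: Rle_trans (IH _ _ _) _; first by rewrite /= in Hy; lra.
apply: hh => //.
apply: (Rmult_le_reg_r (y * (x' ^ 2 + y ^ 2))); first nra.
have -> : y / (x' ^ 2 + y ^ 2) * (y * (x' ^ 2 + y ^ 2)) = y ^ 2 by field; lra.
have -> : 1 / y * (y * (x' ^ 2 + y ^ 2)) = x' ^ 2 + y ^ 2 by field; lra.
by nra.
Qed.

Lemma phi_T k f x y : modular k f -> 0 < y ->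
  Cmod (f (x + 1, y)) * Rpower y (INR k / 2) = Cmod (f (x, y)) * Rpower y (INR k / 2).
Proof. by move=> mf y0; rewrite (modular_T x mf y0). Qed.

Lemma phi_S k f x y : modular k f -> 0 < y ->
  Cmod (f (- x / (x ^ 2 + y ^ 2), y / (x ^ 2 + y ^ 2))) * Rpower (y / (x ^ 2 + y ^ 2)) (INR k / 2) =
  Cmod (f (x, y)) * Rpower y (INR k / 2).
Proof.
move=> mf y0; rewrite (modular_S x mf y0) Cmod_mult Cmod_pow.
have s0 : 0 < x ^ 2 + y ^ 2 by nra.
have -> : Cmod (x, y) = Rpower (x ^ 2 + y ^ 2) (/ 2) by rewrite Rp_half //.
rewrite -Rpower_pow; last exact: Rp_gt0.
rewrite Rpower_mult Rp_div //.
rewrite (_ : forall a b c d, a * b * (c * d) = (b * c) * (a * d)); last by move=> *; ring.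
by rewrite (_ : / 2 * INR k = INR k / 2) ?Rp_addV ?Rmult_1_r //; field.
Qed.

Lemma pow_exp n : exists C0, 0 < C0 /\ forall x, 0 <= x -> x ^ n <= C0 * exp x.
Proof.
case: n => [|n].
  by exists 1; split; [lra | move=> x x0; rewrite /=; have := exp_ineq1_le x; lra].
have nR : 0 < INR n.+1 by exact: INR_pos.
exists (INR n.+1 ^ n.+1); split; first exact: pow_lt.
move=> x x0.
have -> : exp x = exp (x / INR n.+1) ^ n.+1.
  rewrite -Rpower_pow; last exact: exp_pos.
  by rewrite /Rpower ln_exp; congr exp; field; lra.
have q0 : 0 <= x / INR n.+1 by apply: Rmult_le_pos => //; left; exact: Rinv_0_lt_compat.
have {1}-> : x = INR n.+1 * (x / INR n.+1) by field; lra.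
rewrite Rpow_mult_distr; apply: Rmult_le_compat_l; first by left; exact: pow_lt.
by apply: pow_incr; split => //; have := exp_ineq1_le (x / INR n.+1); lra.
Qed.

Lemma Rp_half_pow k y : 0 < y -> Rpower y (INR k / 2) <= (1 + y) ^ k.
Proof.
move=> y0; have k0 := pos_INR k.
apply: (Rle_trans _ (Rpower (1 + y) (INR k / 2))); first by apply: Rle_Rpower_l; lra.
rewrite -Rpower_pow; last lra.
by apply: Rle_Rpower; lra.
Qed.

Lemma series_conv (F : nat -> C) l :
  is_series (K := C_AbsRing) (V := C_NormedModule) F l ->
  conv (fun N => \csum_(0 <= m < N) F m) l.
Proof.
move=> H e e0.
have := H _ (locally_ball_norm (V := C_NormedModule) l (mkposreal e e0)) => -[N HN].
exists N.+1 => n Hn.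
case: n Hn => [//|n] Hn.
have := HN n ltac:(lia); rewrite /ball_norm /=.
have -> : sum_n F n = \csum_(0 <= m < n.+1) F m by rewrite /sum_n sum_n_m_big.
by move=> h; left.
Qed.

Lemma conv_term F l : conv (fun N => \csum_(0 <= m < N) F m) l ->
  exists A, 0 <= A /\ forall m, Cmod (F m) <= A.
Proof.
move=> H; have [N HN] := H 1 Rlt_0_1.
have S0 : 0 <= \rsum_(0 <= m < N) Cmod (F m) by apply: rsum_ge0 => m _; exact: Cmod_ge_0.
exists (2 + \rsum_(0 <= m < N) Cmod (F m)); split; first lra.
move=> m; case: (ltnP m N) => mN.
  have : Cmod (F m) <= \rsum_(0 <= m < N) Cmod (F m); last lra.
  rewrite (bigD1_seq m) //= ?iota_uniq ?mem_index_iota //.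
  have : 0 <= \rsum_(0 <= i < N | i != m) Cmod (F i); last lra.
  by apply: rsum_ge0 => i _; exact: Cmod_ge_0.
have A := HN m mN; have B := HN m.+1 (leqW mN).
have -> : F m = (((\csum_(0 <= i < m.+1) F i) - l) + - ((\csum_(0 <= i < m) F i) - l))%C.
  by rewrite csum_recr //; ring.
by apply: Rle_trans (Cmod_triangle _ _) _; rewrite Cmod_opp; lra.
Qed.

Lemma geom_tail (F : nat -> C) l A r : 0 <= A -> 0 <= r < 1 ->
  conv (fun N => \csum_(0 <= m < N) F m) l ->
  (forall m, Cmod (F m) <= A * r ^ m.+1) ->
  forall N, Cmod (l - \csum_(0 <= m < N) F m) <= A * r ^ N.+1 / (1 - r).
Proof.
move=> A0 [r0 r1] H HF N.
have T j : Cmod (\csum_(N <= m < N + j) F m) <= A * r ^ N.+1 * (1 - r ^ j) / (1 - r).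
  elim: j => [|j IH]; first by rewrite addn0 big_geq // Cmod_0 /=; right; field; lra.
  rewrite addnS csum_recr ?leq_addr //; apply: Rle_trans (Cmod_triangle _ _) _.
  apply: Rle_trans (Rplus_le_compat _ _ _ _ IH (HF _)) _; right.
  rewrite -addSn pow_add /=; field; lra.
have C1 : conv (fun n => \csum_(N <= m < N + n) F m) (l - \csum_(0 <= m < N) F m).
  move=> e e0; have [M HM] := H e e0; exists M => n Hn.
  have := HM (N + n)%N ltac:(lia); rewrite (@csum_split F 0 N (N + n)) ?leq_addr //.
  by congr (Cmod _ <= _); ring.
apply: (conv_bound C1) => n; apply: Rle_trans (T n) _.
rewrite /Rdiv; apply: Rmult_le_compat_r; first by left; apply: Rinv_0_lt_compat; lra.
rewrite -{2}(Rmult_1_r (A * r ^ N.+1)); apply: Rmult_le_compat_l.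
  by apply: Rmult_le_pos => //; apply: pow_le.
by have := pow_le r n r0; lra.
Qed.

Lemma conv_geom (u : nat -> C) l B r : 0 <= B -> 0 <= r < 1 ->
  (forall N, Cmod (u N - l) <= B * r ^ N) -> conv u l.
Proof.
move=> B0 [r0 r1] H e e0.
have q0 : 0 < e / (B + 1) by apply: Rdiv_lt_0_compat; lra.
have [N HN] := pow_lt_1_zero r ltac:(rewrite Rabs_pos_eq; lra) _ q0.
exists N => n Hn; apply: Rle_trans (H n) _.
have := HN n ltac:(lia); rewrite Rabs_pos_eq; last exact: pow_le.
move=> h; apply: (Rle_trans _ ((B + 1) * (e / (B + 1)))); last by right; field; lra.
by have := pow_le r n r0; nra.
Qed.

Lemma Re_quot (a b l : C) (h : R) : h <> 0 -> (Re a - Re b) / h - Re l = Re (a - b - RtoC h * l)%C / h.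
Proof. by move=> h0 /=; rewrite /Re; field. Qed.

Lemma Im_quot (a b l : C) (h : R) : h <> 0 -> (Im a - Im b) / h - Im l = Im (a - b - RtoC h * l)%C / h.
Proof. by move=> h0 /=; rewrite /Im; field. Qed.

Lemma C_derive_x f x y : ex_derive (K := C_AbsRing) (V := C_NormedModule) f (x, y) ->
  ex_derive (fun t => Re (f (t, y))) x /\ ex_derive (fun t => Im (f (t, y))) x.
Proof.
move=> [l [_ D]].
have {D}D := D (x, y) (fun P H => H).
have E e : 0 < e -> exists d, 0 < d /\ forall h, h <> 0 -> Rabs h < d ->
    Cmod (f (pt (x + h) y) - f (x, y) - RtoC h * l)%C < e * Rabs h.
  move=> e0; have e2 : 0 < e / 2 by lra.
  have [d Hd] := D (mkposreal _ e2); exists d; split; first exact: cond_pos.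
  move=> h h0 hd; have := Hd (x + h, y).
  have hE : Cmod (pt (x + h) y - (x, y))%C = Rabs h.
    rewrite -Cmod_R; congr Cmod; apply: C_eq => /=; ring.
  have B : ball (M := AbsRing_UniformSpace C_AbsRing) (x, y) d (x + h, y).
    rewrite /ball /= /AbsRing_ball /= /abs /= /minus /plus /opp /=.
    by rewrite -[Cplus _ _]/(pt (x + h) y - (x, y))%C hE.
  move=> /(_ B); rewrite /minus /plus /opp /scal /mult /= /norm /= => K.
  have hp := Rabs_pos_lt _ h0.
  apply: Rle_lt_trans (_ : _ <= e / 2 * Rabs h) _; last nra.
  apply: Rle_trans (Rle_trans _ _ _ _ K) _.
    right; congr Cmod; apply: C_eq => /=; ring.
  by apply: Rmult_le_compat_l; [lra | right; exact: hE].
split.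
- exists (Re l); apply/is_derive_Reals => e e0.
  have [d [d0 Hd]] := E e e0; exists (mkposreal _ d0) => h h0 hd.
  have := Hd h h0 hd; set z := (_ - _ - _)%C => K.
  have hp := Rabs_pos_lt _ h0.
  have -> : (Re (f (x + h, y)) - Re (f (x, y))) / h - Re l = Re z / h by exact: Re_quot.
  rewrite /Rdiv Rabs_mult Rabs_inv.
  apply: (Rmult_lt_reg_r (Rabs h)) => //; rewrite Rmult_assoc Rinv_l ?Rmult_1_r; last lra.
  by apply: Rle_lt_trans K; have := Rmax_Cmod z; have := Rmax_l (Rabs (fst z)) (Rabs (snd z)); rewrite /Re; lra.
- exists (Im l); apply/is_derive_Reals => e e0.
  have [d [d0 Hd]] := E e e0; exists (mkposreal _ d0) => h h0 hd.
  have := Hd h h0 hd; set z := (_ - _ - _)%C => K.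
  have hp := Rabs_pos_lt _ h0.
  have -> : (Im (f (x + h, y)) - Im (f (x, y))) / h - Im l = Im z / h by exact: Im_quot.
  rewrite /Rdiv Rabs_mult Rabs_inv.
  apply: (Rmult_lt_reg_r (Rabs h)) => //; rewrite Rmult_assoc Rinv_l ?Rmult_1_r; last lra.
  by apply: Rle_lt_trans K; have := Rmax_Cmod z; have := Rmax_r (Rabs (fst z)) (Rabs (snd z)); rewrite /Im; lra.
Qed.

(** * Holomorphic cusp forms *)

Section Holomorphic.
Variables (k : nat) (f : C -> C) (lam : nat -> C) (c : C).
Hypothesis df : forall z : C, upper z -> ex_derive (K := C_AbsRing) (V := C_NormedModule) f z.
Hypothesis mf : modular k f.
Hypothesis hf : hecke_eigen k f lam.
Hypothesis l1 : lam 1%N = RtoC 1.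
Hypothesis sf : forall z : C, upper z -> is_series (K := C_AbsRing) (V := C_NormedModule)
  (fun m : nat => (c * (lam m.+1 * RtoC (Rpower (INR m.+1) ((INR k - 1) / 2)) * e2pi (RtoC (INR m.+1) * z)))%C) (f z).
Notation ex := ((INR k - 1) / 2).

Let A m := (c * (lam m * RtoC (Rpower (INR m) ex)))%C.
Let qy y := exp (- (2 * PI * y)).

Lemma qy_pow y m : exp (- (2 * PI * (INR m * y))) = qy y ^ m.
Proof.
rewrite -Rpower_pow; last exact: exp_pos.
by rewrite /Rpower /qy ln_exp; congr exp; ring.
Qed.

Lemma qy_lt1 y : 0 < y -> 0 <= qy y < 1.
Proof.
move=> y0; split; first by left; exact: exp_pos.
by rewrite -exp_0; apply: exp_increasing; have := PI_RGT_0; nra.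
Qed.

Lemma hol_conv x y : 0 < y ->
  conv (fun N => \csum_(0 <= m < N) (A m.+1 * RtoC (qy y ^ m.+1) * ec (INR m.+1 * x))%C) (f (x, y)).
Proof.
move=> y0; have := series_conv (sf (z := (x, y)) y0).
apply: conv_ext => N; apply: eq_bigr => m _.
rewrite /A -qy_pow /e2pi.
have IE a : Im (RtoC a * (x, y))%C = a * y by rewrite /=; ring.
have RE a : Re (RtoC a * (x, y))%C = a * x by rewrite /=; ring.
rewrite IE RE.
by rewrite -/(ec _); ring.
Qed.

Lemma hol_term y0 : 0 < y0 -> exists B, 0 <= B /\ forall m, Cmod (A m.+1) * qy y0 ^ m.+1 <= B.
Proof.
move=> H; have [B [B0 HB]] := conv_term (hol_conv 0 H); exists B; split => // m.
have := HB m; rewrite Cmod_mult (Cmod_mult (A _)) Cmod_ec Rmult_1_r Cmod_R (Rabs_pos_eq (qy _ ^ _)) //.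
by apply: pow_le; left; exact: exp_pos.
Qed.

(** At height y0 the terms are bounded, being those of a convergent series; the surplus y - y0 turns
    this into a geometric majorant, uniform in x. *)
Lemma hol_tail y0 : 0 < y0 -> exists B, 0 <= B /\ forall x y N, y0 < y ->
  Cmod (f (x, y) - \csum_(0 <= m < N) (A m.+1 * RtoC (qy y ^ m.+1) * ec (INR m.+1 * x))%C) <=
  B * qy (y - y0) ^ N.+1 / (1 - qy (y - y0)).
Proof.
move=> H; have [B [B0 HB]] := hol_term H; exists B; split => // x y N Hy.
have yy : 0 < y - y0 by lra.
apply: geom_tail => //; [exact: qy_lt1 | by apply: hol_conv; lra | ] => m.
rewrite Cmod_mult (Cmod_mult (A _)) Cmod_ec Rmult_1_r Cmod_R (Rabs_pos_eq (qy _ ^ _)); last by apply: pow_le; left; exact: exp_pos.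
have -> : qy y = qy y0 * qy (y - y0) by rewrite /qy -exp_plus; congr exp; ring.
rewrite Rpow_mult_distr -Rmult_assoc; apply: Rmult_le_compat_r => //.
by apply: pow_le; left; exact: exp_pos.
Qed.

Lemma hol_cF y x : 0 < y -> Cc (fun t => f (t, y)) x.
Proof.
move=> y0; have [d1 d2] := C_derive_x (df (z := (x, y)) y0).
by split; apply: (ex_derive_continuous (K := R_AbsRing) (V := R_NormedModule)).
Qed.

Lemma hol_bf (n : Z) y : 0 < y ->
  bf f n y = if Z.leb 1 n then (A (Z.to_nat n) * RtoC (qy y ^ Z.to_nat n))%C else RtoC 0.
Proof.
move=> y0; have y2 : 0 < y / 2 by lra.
pose S N x := \csum_(0 <= m < N) (A m.+1 * RtoC (qy y ^ m.+1) * ec (INR m.+1 * x))%C.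
have cS N x : Cc (S N) x by apply: Cc_sum => m _; apply: Cc_mult; [exact: Cc_const | exact: Cc_ecM].
have cf x : Cc (fun t => f (t, y)) x by exact: hol_cF.
have C1 : conv (fun N => fc (S N) n) (bf f n y).
  have [B [B0 HB]] := hol_tail y2.
  have q := qy_lt1 y2; have i0 : 0 < / (1 - qy (y / 2)) by apply: Rinv_0_lt_compat; lra.
  apply: (@conv_geom _ _ (B * qy (y / 2) / (1 - qy (y / 2))) (qy (y / 2))) => //.
    by apply: Rmult_le_pos; [apply: Rmult_le_pos; lra | lra].
  move=> N.
  have -> : (fc (S N) n - bf f n y = CI (fun x => (S N x - f (x, y)) * ec (- IZR n * x)) (- (1/2)) (1/2))%C.
    rewrite (_ : forall a b : C, a - b = a + RtoC (-1) * b)%C; last by move=> a b; apply: C_eq => /=; ring.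
    rewrite /bf /fc -(CI_scal half_le); last by apply: Con_mult; [move=> z _; exact: cf | exact: Con_ec].
    rewrite -(CI_plus half_le).
    - by apply: CI_ext => [|x _]; [exact: half_le | apply: C_eq => /=; ring].
    - by apply: Con_mult; [move=> z _; exact: cS | exact: Con_ec].
    - by move=> z _; apply: Cc_mult; [exact: Cc_const | apply: Cc_mult => //; exact: Cc_ecM].
  apply: Rle_trans (@CI_norm _ _ half_le _ (fun _ => B * qy (y / 2) ^ N.+1 / (1 - qy (y / 2))) _ _ _) _.
  - by move=> z _; apply: Cc_mult; [apply: Cc_minus | exact: Cc_ecM].
  - by move=> *; exact: cont_const.
  - move=> x _; rewrite Cmod_mult Cmod_ec Rmult_1_r -Cmod_opp.
    have -> : (- (S N x - f (x, y)))%C = (f (x, y) - S N x)%C by ring.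
    by have := HB x y N ltac:(lra); rewrite (_ : y - y / 2 = y / 2) //; field.
  by rewrite RInt_const /scal /= /mult /=; right; field; lra.
have fS N : fc (S N) n = \csum_(0 <= m < N) (A m.+1 * RtoC (qy y ^ m.+1) * (if Z.eqb (Z.of_nat m.+1) n then RtoC 1 else RtoC 0)).
  rewrite /fc (CI_ext half_le (g := fun x => \csum_(0 <= m < N) (A m.+1 * RtoC (qy y ^ m.+1) * (ec (IZR (Z.of_nat m.+1) * x) * ec (- IZR n * x))))); last first.
    by move=> x _; rewrite /S big_distrl; apply: eq_bigr => m _; rewrite -INR_IZR_INZ !Cmult_assoc.
  have ce j : Con (fun x => ec (IZR (Z.of_nat j) * x) * ec (- IZR n * x))%C (- (1/2)) (1/2).
    by apply: Con_mult; exact: Con_ec.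
  rewrite (CI_sum half_le); last by move=> m _ z Hz; apply: Cc_mult; [exact: Cc_const | exact: ce].
  apply: eq_bigr => m _; rewrite (CI_scal half_le) //; congr Cmult; exact: (fc_ec (Z.of_nat m.+1) n).
apply: conv_unique C1 _.
case: Z.leb_spec => Hn.
  move=> e e0; exists (Z.to_nat n) => N HN; rewrite fS.
  rewrite (@csum_single _ _ _ (Z.to_nat n).-1) ?iota_uniq ?mem_index_iota //.
  - rewrite prednK; last by lia.
    rewrite Z2Nat.id; last by lia.
    by rewrite Z.eqb_refl (_ : forall a : C, a * 1 - a = 0)%C ?Cmod_0; [lra | move=> a; ring].
  - by lia.
  - by move=> i _ _ /eqP ni; case: Z.eqb_spec => [E|_]; [lia | rewrite Cmult_0_r].
apply: (conv_ext (u := fun _ => RtoC 0)) => [N|]; last exact: conv_const.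
rewrite fS big1 // => m _; case: Z.eqb_spec => [E|_]; [lia | by rewrite Cmult_0_r].
Qed.

Lemma hol_bf1 u : 0 < u -> bf f 1 u = (c * RtoC (qy u))%C.
Proof. by move=> u0; rewrite hol_bf //= /A l1 Rp_1 Rmult_1_r; apply: C_eq => /=; ring. Qed.

Hypothesis fn : nonzero_on_upper f.

Lemma hol_c : c <> RtoC 0.
Proof.
move=> c0; case: fn => -[x y] [y0]; apply.
apply: conv_unique (hol_conv x y0) _.
apply: (conv_ext (u := fun _ => RtoC 0)) => [N|]; last exact: conv_const.
by rewrite big1 // => m _; rewrite /A c0; ring.
Qed.

Lemma hol_decay j : exists B, 0 <= B /\ forall u, 0 < u -> qy u * (1 + u) ^ j <= B.
Proof.
have [B [B0 HB]] := pow_exp j; exists (B * exp 1); split; first by have := exp_pos 1; nra.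
move=> u u0; have := HB (1 + u) ltac:(lra); rewrite exp_plus => H.
have P : 1 <= PI by have := PI2_1; lra.
have q : qy u * exp u <= 1.
  by rewrite /qy -exp_plus -exp_0; apply: exp_leq; nra.
have q0 : 0 < qy u by exact: exp_pos.
have : qy u * (1 + u) ^ j <= qy u * (B * (exp 1 * exp u)) by apply: Rmult_le_compat_l; lra.
have := exp_pos 1; have : 0 <= B * exp 1 by have := exp_pos 1; nra.
have -> : qy u * (B * (exp 1 * exp u)) = B * exp 1 * (qy u * exp u) by ring.
by nra.
Qed.

Lemma hol_nice : nice k f lam.
Proof.
have c0 := hol_c; have cp := Cmod_gt_0 c; have {}cp : 0 < Cmod c by apply/cp.
have pF y x : 0 < y -> f (x + 1, y) = f (x, y) by exact: (modular_T x mf).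
have b1u u : 0 < u -> bf f 1 u <> RtoC 0.
  move=> u0; rewrite hol_bf1 //; apply: Cmult_neq_0 => // -[h].
  by have := exp_pos (- (2 * PI * u)); rewrite -/(qy u); lra.
have mu u : 0 < u -> Cmod (bf f 1 u) = Cmod c * qy u.
  move=> u0; rewrite hol_bf1 // Cmod_mult Cmod_R Rabs_pos_eq //; left; exact: exp_pos.
split.
- by move=> x y y0; apply: C_derive_x; apply: df.
- exact: mf.
(* [reduction] only asks for y >= 1/2, where the series whose terms are bounded at height 1/4 decays
   geometrically. Since |f| y^(k/2) is invariant, a constant majorant can be used. *)
- have y4 : 0 < 1 / 4 by lra.
  have [B [B0 HB]] := hol_tail y4; have [D [D0 HD]] := hol_decay k.
  set q4 := qy (1 / 4); have q41 : 0 <= q4 < 1 by apply: qy_lt1.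
  have q4p : 0 < q4 by exact: exp_pos.
  have i4 : 0 < / (1 - q4) by apply: Rinv_0_lt_compat; lra.
  exists (B * / q4 * / (1 - q4) * D) => x y y0.
  apply: (@reduction (fun x y => Cmod (f (x, y)) * Rpower y (INR k / 2)) (fun _ => B * / q4 * / (1 - q4) * D)) => //.
  + by move=> *; exact: phi_T.
  + by move=> *; exact: phi_S.
  + move=> {y0} {}x {}y _ Hy; have yp : 0 < y by lra.
    have := HB x y 0%N ltac:(lra); rewrite big_nil (_ : forall z : C, z - 0 = z)%C; last by move=> z; ring.
    rewrite /= Rmult_1_r => H.
    have p0 := Rp_gt0 y (INR k / 2).
    have qE : qy (y - 1 / 4) = / q4 * qy y.
      rewrite /q4 /qy -exp_Ropp -exp_plus; congr exp; field.
    have qle : qy (y - 1 / 4) <= q4 by apply: exp_leq; have := PI_RGT_0; nra.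
    have i1 : / (1 - qy (y - 1 / 4)) <= / (1 - q4) by apply: Rinv_le_contravar; lra.
    have q0 : 0 < qy y by exact: exp_pos.
    have iq : 0 < / q4 by exact: Rinv_0_lt_compat.
    apply: (Rle_trans _ (B * (/ q4 * qy y) * / (1 - q4) * (1 + y) ^ k)).
      apply: Rmult_le_compat; [exact: Cmod_ge_0 | lra | | exact: Rp_half_pow].
      apply: Rle_trans H _; rewrite -qE; apply: Rmult_le_compat_l => //.
      by apply: Rmult_le_pos => //; rewrite qE; left; apply: Rmult_lt_0_compat.
    have -> : B * (/ q4 * qy y) * / (1 - q4) * (1 + y) ^ k = (B * / q4 * / (1 - q4)) * (qy y * (1 + y) ^ k) by ring.
    apply: Rmult_le_compat_l; last exact: HD.
    by repeat apply: Rmult_le_pos => //; lra.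
  + by move=> *; lra.
- by move=> y y0; rewrite hol_bf.
- move=> n y n0 y0; have nR := INR_pos n0.
  have ny : 0 < INR n * y by nra.
  rewrite hol_bf1 // hol_bf // Nat2Z.id; case: Z.leb_spec => Hn; last by lia.
  by rewrite /A -qy_pow /qy; ring.
- move=> n y n0 y0; have nR := INR_pos n0; have ny : 0 < INR n * y by nra.
  rewrite !hol_bf //; case: Z.leb_spec => Hn; first by lia.
  by rewrite /= Cmult_0_r.
- have [D [D0 HD]] := hol_decay k.+1.
  exists (Cmod c * D) => u u1; have u0 : 0 < u by lra.
  rewrite (hol_bf (-1) u0) /= Cmod_0 Rplus_0_r mu //.
  apply: (Rmult_le_reg_r u) => //.
  have -> : Cmod c * D / u * u = Cmod c * D by field; lra.
  have -> : Cmod c * qy u * Rpower u (INR k / 2) * u = Cmod c * (qy u * (Rpower u (INR k / 2) * u)) by ring.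
  apply: Rmult_le_compat_l; first lra.
  apply: Rle_trans (HD u u0); apply: Rmult_le_compat_l; first by left; exact: exp_pos.
  rewrite /= Rmult_comm; apply: Rmult_le_compat; [lra | left; exact: Rp_gt0 | lra | exact: Rp_half_pow].
- exists 1, 1, (Cmod c * qy 2), (Cmod c * (2 * PI)); split; try lra.
  + by apply: Rmult_lt_0_compat => //; exact: exp_pos.
  + move=> u Hu; rewrite mu; last lra.
    by apply: Rmult_le_compat_l; [lra | apply: exp_leq; have := PI_RGT_0; nra].
  have W u v : u < v -> 1 <= u -> qy u - qy v <= 2 * PI * (v - u).
    move=> uv u1.
    have q : qy v = qy u * exp (- (2 * PI * (v - u))) by rewrite /qy -exp_plus; congr exp; ring.
    have := exp_ineq1_le (- (2 * PI * (v - u))).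
    have := qy_lt1 (y := u) ltac:(lra); have := PI_RGT_0; rewrite q => P [Q0 Q1] E.
    have : 0 < 2 * PI * (v - u) by nra.
    by nra.
  have M u v : u < v -> qy v <= qy u by move=> uv; apply: exp_leq; have := PI_RGT_0; nra.
  move=> u v Hu Hv; rewrite !hol_bf1; [|lra|lra].
  have -> : (c * RtoC (qy u) - c * RtoC (qy v) = c * RtoC (qy u - qy v))%C by rewrite RtoC_minus; ring.
  rewrite Cmod_mult Cmod_R Rmult_assoc; apply: Rmult_le_compat_l; first lra.
  case: (Rtotal_order u v) => [L|[->|L]].
  + have := W u v L ltac:(lra); have := M u v L => m w.
    by rewrite (Rabs_minus_sym u) !Rabs_pos_eq; lra.
  + by rewrite !Rminus_diag Rabs_R0; lra.
  + have := W v u L ltac:(lra); have := M v u L => m w.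
    by rewrite (Rabs_minus_sym (qy u)) !Rabs_pos_eq; lra.
- apply: theta_ge0 => // n n0.
  apply: (hecke_two hol_cF pF hf n0 Rlt_0_1 (s := 1)); [by left | exact: (b1u 1 Rlt_0_1)].
Qed.
End Holomorphic.

Lemma holomorphic_nice k f lam : holomorphic_hecke_cusp_form k f lam -> nice k f lam.
Proof.
move=> [[df [mf _]] [nf [hf [l1 [c sf]]]]].
exact: (hol_nice df mf hf l1 sf nf).
Qed.

(** * Differentiation of Fourier coefficients, decay and compactness *)

Definition Dx (g : R -> R -> R) (x y : R) : R := Derive (fun z => g z y) x.
Definition Dy (g : R -> R -> R) (x y : R) : R := Derive (fun z => g x z) y.
Definition Sm n (g : R -> R -> R) := forall x y, 0 < y -> ex_diff_n g n x y.

Lemma Sm_cont n g x y : Sm n g -> 0 < y -> continuity_2d_pt g x y.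
Proof. by move=> H y0; have := H x y y0; case: n {H} => [|n] []. Qed.

Lemma Sm_S n g : Sm n.+1 g -> [/\ Sm n (Dx g), Sm n (Dy g),
  (forall x y, 0 < y -> ex_derive (fun z => g z y) x) & (forall x y, 0 < y -> ex_derive (fun z => g x z) y)].
Proof. by move=> H; split => x y y0; have [_ [A [B [D E]]]] := H x y y0. Qed.

Lemma cont_2d_x g x y : continuity_2d_pt g x y -> continuous (fun x => g x y) x.
Proof.
move=> H; apply/continuity_pt_filterlim => e e0; have [d Hd] := H (mkposreal e e0).
exists d; split; first exact: cond_pos.
move=> t [_ td]; apply: Hd => //; by rewrite Rminus_diag Rabs_R0; exact: cond_pos.
Qed.

Lemma cont_2d_swap g x y : continuity_2d_pt g x y -> continuity_2d_pt (fun v u => g u v) y x.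
Proof. by move=> H e; have [d Hd] := H e; exists d => u v Hu Hv; apply: Hd. Qed.

Lemma cont_2d_snd (w : R -> R) x y : continuous w y -> continuity_2d_pt (fun _ v => w v) x y.
Proof.
move=> /continuity_pt_filterlim H e; have [d [d0 Hd]] := H e (cond_pos e).
exists (mkposreal d d0) => u v _ Hv; case: (Req_EM_T y v) => [->|n].
  by rewrite Rminus_diag Rabs_R0; exact: cond_pos.
by apply: Hd.
Qed.

Lemma locally_gt0 y : 0 < y -> locally y (fun u => 0 < u).
Proof.
move=> y0; exists (mkposreal y y0) => u; rewrite /ball /= /AbsRing_ball /abs /minus /plus /opp /= => H.
by have := Rle_abs (- (u + - y)); rewrite Rabs_Ropp; lra.
Qed.

Lemma der_int g (w : R -> R) y : Sm 1 g -> (forall x, continuous w x) -> 0 < y ->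
  is_derive (fun y => RInt (fun x => g x y * w x) (- (1/2)) (1/2)) y
    (RInt (fun x => Dy g x y * w x) (- (1/2)) (1/2)).
Proof.
move=> S1 cw y0; have [_ SD _ dy] := Sm_S S1.
have E t u : Derive (fun u => g t u * w t) u = Dy g t u * w t by rewrite Derive_scal_l.
have -> : RInt (fun x => Dy g x y * w x) (- (1/2)) (1/2) =
    RInt (fun t => Derive (fun u => g t u * w t) y) (- (1/2)) (1/2).
  by apply: RInt_ext => t _; rewrite E.
apply: (is_derive_RInt_param (fun u t => g t u * w t)).
- apply: filter_imp (locally_gt0 y0) => u u0 t _.
  by apply: ex_derive_mult; [exact: dy | exact: ex_derive_const].
- move=> t _; apply: (continuity_2d_pt_ext (fun u v => Dy g v u * w v)) => [u v|]; first by rewrite E.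
  apply: continuity_2d_pt_mult; last exact: cont_2d_snd.
  exact: (cont_2d_swap (Sm_cont _ SD y0)).
- apply: filter_imp (locally_gt0 y0) => u u0.
  apply: cont_ex => [|z _]; first exact: half_le.
  by apply: cont_mult => //; apply: cont_2d_x; exact: (Sm_cont _ S1 u0).
Qed.

Definition cder (B : R -> C) (y : R) (l : C) :=
  is_derive (fun t => Re (B t)) y (Re l) /\ is_derive (fun t => Im (B t)) y (Im l).

Definition SmC n (F : R -> R -> C) := Sm n (fun x y => Re (F x y)) /\ Sm n (fun x y => Im (F x y)).
Definition DxC (F : R -> R -> C) (x y : R) : C := (Dx (fun x y => Re (F x y)) x y, Dx (fun x y => Im (F x y)) x y).
Definition DyC (F : R -> R -> C) (x y : R) : C := (Dy (fun x y => Re (F x y)) x y, Dy (fun x y => Im (F x y)) x y).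

Lemma SmC_S n F : SmC n.+1 F -> SmC n (DxC F) /\ SmC n (DyC F).
Proof. by move=> [/Sm_S [A1 B1 _ _] /Sm_S [A2 B2 _ _]]. Qed.

Lemma SmC_Cc n F x y : SmC n F -> 0 < y -> Cc (fun t => F t y) x.
Proof.
by move=> [S1 S2] y0; split; [apply: (cont_2d_x (g := fun x y => Re (F x y))); exact: (Sm_cont _ S1 y0) |
  apply: (cont_2d_x (g := fun x y => Im (F x y))); exact: (Sm_cont _ S2 y0)].
Qed.

Lemma cder_fc F m y : SmC 1 F -> 0 < y ->
  cder (fun y => fc (fun x => F x y) m) y (fc (fun x => DyC F x y) m).
Proof.
move=> SF y0; have [S1 S2] := SF; have [_ SD] := SmC_S SF; have [SD1 SD2] := SD.
pose w1 x := Re (ec (- IZR m * x)); pose w2 x := Im (ec (- IZR m * x)).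
have c1 x : continuous w1 x by have [] := Cc_ecM (- IZR m) x.
have c2 x : continuous w2 x by have [] := Cc_ecM (- IZR m) x.
have exi (g : R -> R -> R) n w u : Sm n g -> (forall x, continuous w x) -> 0 < u -> ex_RInt (fun x => g x u * w x) (- (1/2)) (1/2).
  move=> Sg cw u0; apply: cont_ex => [|z _]; first exact: half_le.
  by apply: cont_mult => //; apply: cont_2d_x; exact: (Sm_cont _ Sg u0).
have ER n (G : R -> R -> C) u : SmC n G -> 0 < u -> Re (fc (fun x => G x u) m) =
   RInt (fun x => Re (G x u) * w1 x) (- (1/2)) (1/2) - RInt (fun x => Im (G x u) * w2 x) (- (1/2)) (1/2).
  move=> [G1 G2] u0; apply: (RInt_minus (V := R_CompleteNormedModule)).
    exact: (exi (fun x y => Re (G x y)) n w1 u G1 c1 u0).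
  exact: (exi (fun x y => Im (G x y)) n w2 u G2 c2 u0).
have EI n (G : R -> R -> C) u : SmC n G -> 0 < u -> Im (fc (fun x => G x u) m) =
   RInt (fun x => Re (G x u) * w2 x) (- (1/2)) (1/2) + RInt (fun x => Im (G x u) * w1 x) (- (1/2)) (1/2).
  move=> [G1 G2] u0; apply: (RInt_plus (V := R_CompleteNormedModule)).
    exact: (exi (fun x y => Re (G x y)) n w2 u G1 c2 u0).
  exact: (exi (fun x y => Im (G x y)) n w1 u G2 c1 u0).
split.
- rewrite (ER _ _ _ SD y0).
  apply: (is_derive_ext_loc (fun u => RInt (fun x => Re (F x u) * w1 x) (- (1/2)) (1/2) - RInt (fun x => Im (F x u) * w2 x) (- (1/2)) (1/2))).
    by apply: filter_imp (locally_gt0 y0) => u u0; rewrite (ER _ _ _ SF u0).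
  apply: (is_derive_minus (K := R_AbsRing) (V := R_NormedModule)); [exact: (der_int S1 c1 y0) | exact: (der_int S2 c2 y0)].
- rewrite (EI _ _ _ SD y0).
  apply: (is_derive_ext_loc (fun u => RInt (fun x => Re (F x u) * w2 x) (- (1/2)) (1/2) + RInt (fun x => Im (F x u) * w1 x) (- (1/2)) (1/2))).
    by apply: filter_imp (locally_gt0 y0) => u u0; rewrite (EI _ _ _ SF u0).
  apply: (is_derive_plus (K := R_AbsRing) (V := R_NormedModule)); [exact: (der_int S1 c2 y0) | exact: (der_int S2 c1 y0)].
Qed.

Lemma CI_ftc H H' a b : a <= b -> (forall x, cder H x (H' x)) -> (forall x, Cc H' x) -> CI H' a b = (H b - H a)%C.
Proof.
move=> ab dH cH; apply: C_eq => /=; apply: is_RInt_unique.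
  by apply: (is_RInt_derive (fun x => Re (H x)) (fun x => Re (H' x))) => x _; [case: (dH x) | case: (cH x)].
by apply: (is_RInt_derive (fun x => Im (H x)) (fun x => Im (H' x))) => x _; [case: (dH x) | case: (cH x)].
Qed.

Lemma cder_mult f g x f' g' : cder f x f' -> cder g x g' -> cder (fun t => f t * g t)%C x (f' * g x + f x * g')%C.
Proof.
move=> [f1 f2] [g1 g2]; split.
  have -> : Re (f' * g x + f x * g')%C = (Re f' * Re (g x) + Re (f x) * Re g') - (Im f' * Im (g x) + Im (f x) * Im g').
    by rewrite /=/Re/Im; ring.
  apply: (is_derive_minus (K := R_AbsRing) (V := R_NormedModule)); apply: (is_derive_mult (K := R_AbsRing)) => //; exact: Rmult_comm.
have -> : Im (f' * g x + f x * g')%C = (Re f' * Im (g x) + Re (f x) * Im g') + (Im f' * Re (g x) + Im (f x) * Re g').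
  by rewrite /=/Re/Im; ring.
apply: (is_derive_plus (K := R_AbsRing) (V := R_NormedModule)); apply: (is_derive_mult (K := R_AbsRing)) => //; exact: Rmult_comm.
Qed.

Lemma cder_ec c x : cder (fun t => ec (c * t)) x (pt 0 (2 * PI * c) * ec (c * x))%C.
Proof. by split; rewrite /ec /=; auto_derive => //; ring. Qed.

Lemma Derive_per (g : R -> R) x : (forall x, g (x + 1) = g x) -> Derive g (x + 1) = Derive g x.
Proof.
move=> pg; rewrite /Derive; congr real; apply: Lim_ext => h.
by rewrite pg (_ : x + 1 + h = x + h + 1) ?pg //; ring.
Qed.

(** Integration by parts; the boundary terms cancel by periodicity. *)
Lemma fc_Dx F m y : SmC 1 F -> (forall x, F (x + 1) y = F x y) -> 0 < y ->
  fc (fun x => DxC F x y) m = ((0, (2 * PI * IZR m)%R) * fc (fun x => F x y) m)%C.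
Proof.
move=> SF pF y0; have [SD _] := SmC_S SF; have [/Sm_S [_ _ d1 _] /Sm_S [_ _ d2 _]] := SF.
have cF x : Cc (fun x => F x y) x by exact: (SmC_Cc _ SF y0).
have cD x : Cc (fun x => DxC F x y) x by exact: (SmC_Cc _ SD y0).
pose H x := (F x y * ec (- IZR m * x))%C.
pose H' x := (DxC F x y * ec (- IZR m * x) + (0, (- (2 * PI * IZR m))%R) * (F x y * ec (- IZR m * x)))%C.
have dH x : cder H x (H' x).
  have dF : cder (fun t => F t y) x (DxC F x y).
    by split; apply: Derive_correct; [exact: (d1 x y y0) | exact: (d2 x y y0)].
  have := cder_mult dF (cder_ec (- IZR m) x).
  rewrite (_ : (_ + _)%C = H' x) // /H'; congr Cplus.
  rewrite (_ : forall a b c : C, a * (b * c) = b * (a * c))%C; last by move=> *; ring.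
  by congr (_ * _)%C; congr pair; ring.
have cFe x : Cc (fun x => F x y * ec (- IZR m * x))%C x by apply: Cc_mult => //; exact: Cc_ecM.
have cDe x : Cc (fun x => DxC F x y * ec (- IZR m * x))%C x by apply: Cc_mult => //; exact: Cc_ecM.
have cH' x : Cc H' x by apply: Cc_plus => //; apply: Cc_mult => //; exact: Cc_const.
have := CI_ftc half_le dH cH'.
have -> : (H (1/2)%R - H (- (1/2))%R = 0)%C.
  rewrite /H; have -> : 1/2 = - (1/2) + 1 by lra.
  rewrite pF; have -> : - IZR m * (- (1/2) + 1) = - IZR m * - (1/2) + IZR (- m) by rewrite opp_IZR; ring.
  have -> : - (- (1/2) + 1) = - (1/2) by lra.
  by rewrite ec_per; ring.
rewrite (CI_plus half_le); [|by move=> z _|by move=> z _; apply: Cc_mult => //; exact: Cc_const].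
rewrite (CI_scal half_le); last by move=> z _.
rewrite -/(fc (fun x => DxC F x y) m) -/(fc (fun x => F x y) m) => E.
apply: (eq_trans (y := (0 - (0, (- (2 * PI * IZR m))%R) * fc (fun x => F x y) m)%C)).
  by rewrite -E; ring.
by apply: C_eq => /=; ring.
Qed.

Lemma mono (g g' : R -> R) a : (forall u, a <= u -> is_derive g u (g' u)) -> (forall u, a <= u -> 0 <= g' u) ->
  forall u v, a <= u -> u <= v -> g u <= g v.
Proof.
move=> dg g0 u v au [uv|->]; last by lra.
have [c [E [c0 c1]]] : exists c, g v - g u = g' c * (v - u) /\ u < c < v.
  by apply: MVT_cor2 => // c Hc; apply/is_derive_Reals; apply: dg; lra.
by have := g0 c ltac:(lra); nra.
Qed.

(* v'' >= v makes (v' + v) e^(-u) nondecreasing; polynomial growth of v forces it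
    to be nonpositive. *)
Lemma exp_decay (v v1 v2 : R -> R) a A P : 0 < a ->
  (forall u, a <= u -> is_derive v u (v1 u)) -> (forall u, a <= u -> is_derive v1 u (v2 u)) ->
  (forall u, a <= u -> v u <= v2 u) -> (forall u, a <= u -> 0 <= v u) ->
  (forall u, a <= u -> v u <= A * u ^ P) ->
  exists B, 0 <= B /\ forall u, a <= u -> v u <= B * exp (- u).
Proof.
move=> a0 d1 d2 v2v v0 vA.
have de c u : is_derive (fun t => exp (c * t)) u (c * exp (c * u)) by auto_derive => //; ring.
pose psi u := (v1 u + v u) * exp (-1 * u).
have Mpsi u w : a <= u -> u <= w -> psi u <= psi w.
  apply: (@mono psi (fun u => (v2 u - v u) * exp (-1 * u))) => t Ht; last first.
    by apply: Rmult_le_pos; [have := v2v t Ht; lra | left; exact: exp_pos].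
  have -> : (v2 t - v t) * exp (-1 * t) = (v2 t + v1 t) * exp (-1 * t) + (v1 t + v t) * (-1 * exp (-1 * t)) by ring.
  apply: (is_derive_mult (K := R_AbsRing)); last exact: Rmult_comm.
    by apply: (is_derive_plus (K := R_AbsRing) (V := R_NormedModule)); [exact: d2 | exact: d1].
  exact: de.
have psi0 u : a <= u -> psi u <= 0.
  move=> au; apply: Rnot_lt_le => c0; set c := psi u in c0.
  (* If psi u = c > 0, then (v e^t)' = psi e^(2t) >= c e^(2t) beyond u, so [chi] is nondecreasing
     there and v would grow at least like e^t. *)
  pose chi t := v t * exp (1 * t) - c / 2 * exp (2 * t).
  have Mchi s w : u <= s -> s <= w -> chi s <= chi w.
    apply: (@mono chi (fun t => (v1 t + v t) * exp (1 * t) - c * exp (2 * t))) => t Ht; last first.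
      have := Mpsi u t au Ht; rewrite -/c /psi => H.
      have E2 : exp (2 * t) = exp (1 * t) * exp (1 * t) by rewrite -exp_plus; congr exp; ring.
      have E1 : exp (-1 * t) * exp (1 * t) = 1 by rewrite -exp_plus (_ : _ + _ = 0) ?exp_0 //; ring.
      have e0 := exp_pos (1 * t).
      have : c * exp (1 * t) <= v1 t + v t.
        have : c * exp (1 * t) <= (v1 t + v t) * exp (-1 * t) * exp (1 * t) by apply: Rmult_le_compat_r; lra.
        by rewrite Rmult_assoc E1 Rmult_1_r.
      by rewrite E2; nra.
    have -> : (v1 t + v t) * exp (1 * t) - c * exp (2 * t) =
      (v1 t * exp (1 * t) + v t * (1 * exp (1 * t))) - c / 2 * (2 * exp (2 * t)) by field.
    apply: (is_derive_minus (K := R_AbsRing) (V := R_NormedModule)).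
      apply: (is_derive_mult (K := R_AbsRing)); [apply: d1; lra | exact: de | exact: Rmult_comm].
    by apply: (is_derive_scal (fun t => exp (2 * t))).
  have [C0 [C00 HC]] := pow_exp P.
  have A0 : 0 <= A.
    by have := v0 a ltac:(lra); have := vA a ltac:(lra); have := pow_lt a P a0; nra.
  pose D := A * 2 ^ P * C0; pose K := Rabs (chi u).
  have D0 : 0 <= D by apply: Rmult_le_pos; [apply: Rmult_le_pos => //; apply: pow_le; lra | lra].
  have K0 : 0 <= K by exact: Rabs_pos.
  (* Far enough for t = exp (w / 2) to satisfy c t > 2 (D + K), which contradicts the bound v w <= D
     t coming from polynomial growth. *)
  pose w := u + 4 * (D + K) / c.
  have q0 : 0 <= 4 * (D + K) / c by apply: Rmult_le_pos; [lra | left; exact: Rinv_0_lt_compat].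
  have uw : u <= w by rewrite /w; lra.
  have X := Mchi u w (Rle_refl u) uw.
  pose t := exp (w / 2).
  have t1 : 1 + w / 2 <= t by exact: exp_ineq1_le.
  have tt : t * t = exp (1 * w) by rewrite /t -exp_plus; congr exp; field.
  have t4 : exp (2 * w) = (t * t) * (t * t) by rewrite tt -exp_plus; congr exp; ring.
  have vw : v w <= D * t.
    apply: Rle_trans (vA w ltac:(lra)) _.
    have -> : w ^ P = 2 ^ P * (w / 2) ^ P by rewrite -Rpow_mult_distr; congr pow; field.
    rewrite /D -(Rmult_assoc A) (Rmult_assoc (A * _)).
    by apply: Rmult_le_compat_l; [apply: Rmult_le_pos => //; apply: pow_le; lra | apply: HC; lra].
  have tc : 2 * (D + K) < c * t.
    have : 2 * (D + K) = c * (4 * (D + K) / c / 2) by field; lra.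
    by rewrite /w in t1; nra.
  have XK : - K <= chi w by have := Rle_abs (- chi u); rewrite Rabs_Ropp -/K; lra.
  rewrite /chi -tt t4 in XK.
  have tp : 1 <= t by lra.
  have : v w * (t * t) <= D * t * (t * t) by apply: Rmult_le_compat_r; nra.
  move=> Y; have : c / 2 * (t * t * (t * t)) <= D * t * (t * t) + K by lra.
  have T3 : 1 <= t * (t * t) by nra.
  have K3 : K <= K * (t * (t * t)) by rewrite -{1}(Rmult_1_r K); apply: Rmult_le_compat_l.
  have : 0 < (c * t - 2 * (D + K)) * (t * (t * t)) by apply: Rmult_lt_0_compat; lra.
  by lra.
exists (v a * exp a); split; first by apply: Rmult_le_pos; [apply: v0; lra | left; exact: exp_pos].
move=> u au.
have M3 : - (v a * exp (1 * a)) <= - (v u * exp (1 * u)).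
  apply: (@mono (fun t => - (v t * exp (1 * t))) (fun t => - ((v1 t + v t) * exp (1 * t))) a) => //; try lra.
    move=> t Ht; apply: (is_derive_opp (K := R_AbsRing) (V := R_NormedModule)).
    have -> : (v1 t + v t) * exp (1 * t) = v1 t * exp (1 * t) + v t * (1 * exp (1 * t)) by ring.
    by apply: (is_derive_mult (K := R_AbsRing)); [exact: d1 | exact: de | exact: Rmult_comm].
  move=> t Ht; have := psi0 t Ht; rewrite /psi => H.
  have e1 := exp_pos (1 * t); have e2 := exp_pos (-1 * t).
  have : v1 t + v t <= 0 by apply: Rnot_lt_le => L; nra.
  by nra.
rewrite !Rmult_1_l in M3.
have E : exp u * exp (- u) = 1 by rewrite -exp_plus -exp_0; congr exp; ring.
have e2 := exp_pos (- u).
have -> : v u = v u * exp u * exp (- u) by rewrite Rmult_assoc E Rmult_1_r.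
by apply: Rmult_le_compat_r; lra.
Qed.

(** Uniform continuity with tolerance 1: the segment from the corner (a, c) to any point is cut into
    N steps shorter than the modulus of continuity, and g changes by at most 1 along each. *)
Lemma bounded_2d g a b c d : (forall x y, a <= x <= b -> c <= y <= d -> continuity_2d_pt g x y) ->
  exists B, 0 <= B /\ forall x y, a <= x <= b -> c <= y <= d -> Rabs (g x y) <= B.
Proof.
move=> H; have [de Hde] := uniform_continuity_2d g a b c d H (mkposreal 1 Rlt_0_1).
have [N HN] := INR_unbounded (((b - a) + (d - c)) / de).
have dp := cond_pos de.
exists (Rabs (g a c) + INR N); split; first by have := Rabs_pos (g a c); have := pos_INR N; lra.
move=> x y Hx Hy.
have NR : 0 < INR N.
  have : 0 <= ((b - a) + (d - c)) / de by apply: Rmult_le_pos; [lra | left; exact: Rinv_0_lt_compat].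
  by lra.
pose px i := a + (x - a) * (INR i / INR N); pose py i := c + (y - c) * (INR i / INR N).
have K i : (i <= N)%N -> 0 <= INR i / INR N <= 1.
  move=> iN; split; first by apply: Rmult_le_pos; [exact: pos_INR | left; exact: Rinv_0_lt_compat].
  by apply: (Rmult_le_reg_r (INR N)) => //; have := INR_leq iN; rewrite /Rdiv Rmult_assoc Rinv_l; lra.
have Kx i : (i <= N)%N -> a <= px i <= b.
  by move=> /K; rewrite /px; move: (INR i / INR N) => q Hq; clear -Hq Hx; nra.
have Ky i : (i <= N)%N -> c <= py i <= d.
  by move=> /K; rewrite /py; move: (INR i / INR N) => q Hq; clear -Hq Hy; nra.
have st : 0 < / INR N by exact: Rinv_0_lt_compat.
have sm : (b - a + (d - c)) * / INR N < de.
  apply: (Rmult_lt_reg_r (INR N)) => //; rewrite Rmult_assoc Rinv_l ?Rmult_1_r; last lra.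
  have : (b - a + (d - c)) = (b - a + (d - c)) / de * de by field; lra.
  by nra.
have P i : (i <= N)%N -> Rabs (g (px i) (py i)) <= Rabs (g a c) + INR i.
  elim: i => [|i IH] iN.
    by rewrite /px /py /= /Rdiv !Rmult_0_l !Rmult_0_r !Rplus_0_r; lra.
  have K1 := K _ iN; have K2 := K _ (ltnW iN).
  have S j : px j.+1 - px j = (x - a) * / INR N by rewrite /px S_INR; field; lra.
  have S' j : py j.+1 - py j = (y - c) * / INR N by rewrite /py S_INR; field; lra.
  have := Hde (px i) (py i) (px i.+1) (py i.+1).
  have qx : 0 <= (x - a) * / INR N by apply: Rmult_le_pos; lra.
  have qy : 0 <= (y - c) * / INR N by apply: Rmult_le_pos; lra.
  rewrite S S' (Rabs_pos_eq _ qx) (Rabs_pos_eq _ qy).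
  move=> /(_ (Kx _ (ltnW iN)) (Ky _ (ltnW iN)) (Kx _ iN) (Ky _ iN)).
  move=> /(_ ltac:(nra) ltac:(nra)) /= Q.
  have := Rabs_triang (g (px i.+1) (py i.+1) - g (px i) (py i)) (g (px i) (py i)).
  rewrite (_ : g (px i.+1) (py i.+1) - g (px i) (py i) + g (px i) (py i) = g (px i.+1) (py i.+1)); last by ring.
  by have := IH (ltnW iN); rewrite -/(INR i.+1) S_INR; lra.
have := P N (leqnn N); rewrite /px /py.
have -> : INR N / INR N = 1 by field; lra.
by rewrite !Rmult_1_r !(Rplus_comm _ (_ - _)) /Rminus !Rplus_assoc !Rplus_opp_l !Rplus_0_r.
Qed.

Lemma fc_lin (P Q : R -> C) (al be : C) m : (forall x, Cc P x) -> (forall x, Cc Q x) ->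
  fc (fun x => al * P x + be * Q x)%C m = (al * fc P m + be * fc Q m)%C.
Proof.
move=> cP cQ.
have c1 : Con (fun x => P x * ec (- IZR m * x))%C (- (1/2)) (1/2) by apply: Con_mult; [exact: Con_all | exact: Con_ec].
have c2 : Con (fun x => Q x * ec (- IZR m * x))%C (- (1/2)) (1/2) by apply: Con_mult; [exact: Con_all | exact: Con_ec].
rewrite /fc -!(CI_scal half_le) // -(CI_plus half_le).
- by apply: CI_ext => [|x _]; [exact: half_le | ring].
- by apply: Con_mult => // z _; exact: Cc_const.
- by apply: Con_mult => // z _; exact: Cc_const.
Qed.

Definition refl (f : C -> C) (z : C) : C := f (- Re z, Im z).

Lemma RInt_refl (g : R -> R) : (forall x, continuous g x) ->
  RInt (fun x => g (- x)) (- (1/2)) (1/2) = RInt g (- (1/2)) (1/2).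
Proof.
move=> cg; have ex a b : ex_RInt g a b by apply: ex_RInt_continuous => z _; exact: cg.
have ex' : ex_RInt (fun x => g (- x)) (- (1/2)) (1/2).
  apply: ex_RInt_continuous => z _; apply: (continuous_comp (fun x => - x) g); last exact: cg.
  by apply: (continuous_opp (V := R_NormedModule)); exact: continuous_id.
have := RInt_comp_lin g (-1) 0 (- (1/2)) (1/2) (ex _ _).
rewrite (RInt_ext _ (fun x => scal (-1) (g (- x)))) => [|x _]; last by congr (scal _ (g _)); ring.
rewrite (RInt_scal (V := R_CompleteNormedModule)) //.
have -> : -1 * - (1 / 2) + 0 = 1 / 2 by field.
have -> : -1 * (1 / 2) + 0 = - (1 / 2) by field.
have := opp_RInt_swap (V := R_CompleteNormedModule) g (1 / 2) (- (1 / 2)) (ex _ _).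
by rewrite /scal /opp /= /mult /=; lra.
Qed.

Lemma bf_refl f m y : (forall x, Cc (fun t => f (t, y)) x) -> bf (refl f) m y = bf f (- m) y.
Proof.
move=> cF; rewrite /bf /fc /refl.
have cG x : Cc (fun x => f (x, y) * ec (- IZR (- m) * x))%C x by apply: Cc_mult => //; exact: Cc_ecM.
apply: C_eq; rewrite /CI [LHS]/= [RHS]/=.
  rewrite -(RInt_refl (fun x => proj1 (cG x))); apply: RInt_ext => x _.
  by rewrite opp_IZR (_ : - - IZR m * - x = - IZR m * x) //; ring.
rewrite -(RInt_refl (fun x => proj2 (cG x))); apply: RInt_ext => x _.
by rewrite opp_IZR (_ : - - IZR m * - x = - IZR m * x) //; ring.
Qed.

Lemma Cconj_inv (v : C) : Cconj (/ v)%C = (/ Cconj v)%C.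
Proof.
case: v => p q; rewrite /Cinv /Cconj /=.
have -> : - q * (- q * 1) = q * (q * 1) by ring.
by congr pair; rewrite /Rdiv; ring.
Qed.

Lemma modular_refl f : modular 0 f -> modular 0 (refl f).
Proof.
move=> mf a b c d det [x y] y0.
have H := mf a (- b)%Z (- c)%Z d ltac:(lia) (- x, y) y0.
transitivity (f ((RtoC (IZR a) * pt (- x) y + RtoC (IZR (- b))) / (RtoC (IZR (- c)) * pt (- x) y + RtoC (IZR d)))%C); last by rewrite H.
rewrite /refl; congr f.
have E (z : C) : (- Re z, Im z) = (- Cconj z)%C by case: z => p q; apply: C_eq => /=; ring.
rewrite E /Cdiv CconjM Cconj_inv.
have -> : (- (Cconj (RtoC (IZR a) * (x, y) + RtoC (IZR b)) * / Cconj (RtoC (IZR c) * (x, y) + RtoC (IZR d))) =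
  (- Cconj (RtoC (IZR a) * (x, y) + RtoC (IZR b))) * / Cconj (RtoC (IZR c) * (x, y) + RtoC (IZR d)))%C by ring.
by congr (_ * / _)%C; rewrite opp_IZR; apply: C_eq => /=; ring.
Qed.

(* [nice] asks for a nonzero coefficient of index 1; if only the one of index -1 is
    nonzero, the reflection z -> - conj z of f is used instead. *)
Lemma mk_nice f lam (s : Z) : (s = 1 \/ s = -1)%Z ->
  (forall x y, 0 < y -> ex_derive (fun t => Re (f (t, y))) x /\ ex_derive (fun t => Im (f (t, y))) x) ->
  modular 0 f ->
  (exists M, forall x y, 0 < y -> Cmod (f (x, y)) <= M) ->
  (forall y, 0 < y -> bf f 0 y = RtoC 0) ->
  (forall n y m, (0 < n)%N -> 0 < y -> (m = 1 \/ m = -1)%Z ->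
    bf f (m * Z.of_nat n) y = (lam n * RtoC (Rpower (INR n) ((INR 0 - 1) / 2)) * bf f m (INR n * y))%C) ->
  (exists C0, forall u, 1 <= u -> Cmod (bf f 1 u) + Cmod (bf f (-1) u) <= C0 / u) ->
  (exists u0 de w L, [/\ 0 < u0, 0 < de, 0 < w,
    (forall u, u0 <= u <= (1 + de) * u0 -> w <= Cmod (bf f s u)) &
    (forall u v, u0 <= u <= (1 + de) * u0 -> u0 <= v <= (1 + de) * u0 ->
       Cmod (bf f s u - bf f s v) <= L * Rabs (u - v))]) ->
  (forall t, eigenvalue_bound lam t -> 0 <= t) ->
  exists g, nice 0 g lam.
Proof.
have R0 y : Rpower y (INR 0 / 2) = 1 by rewrite /= /Rdiv Rmult_0_l /Rpower Rmult_0_l exp_0.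
move=> Hs H1 H2 [M HM] H4 H5 [C0 HC] H8 H9.
case: Hs => -> in H8.
  exists f; split => //.
  - by exists M => x y y0; rewrite R0 Rmult_1_r; exact: HM.
  - by move=> n y n0 y0; rewrite -H5 ?Z.mul_1_l //; left.
  - by move=> n y n0 y0; rewrite -H5 //; right.
  - by exists C0 => u u1; rewrite R0 Rmult_1_r; exact: HC.
have cF y x : 0 < y -> Cc (fun t => f (t, y)) x.
  by move=> y0; have [? ?] := H1 x y y0; split; apply: (ex_derive_continuous (K := R_AbsRing) (V := R_NormedModule)).
exists (refl f); split => //.
- move=> x y y0; have [[l1 d1] [l2 d2]] := H1 (- x) y y0.
  split; rewrite /refl /=.
    by apply: (ex_derive_comp (fun t => Re (f (t, y))) (fun t => - t)); [exists l1 | auto_derive].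
  by apply: (ex_derive_comp (fun t => Im (f (t, y))) (fun t => - t)); [exists l2 | auto_derive].
- exact: modular_refl.
- by exists M => x y y0; rewrite R0 Rmult_1_r; exact: HM.
- by move=> y y0; rewrite bf_refl; [exact: H4 | move=> x; exact: cF].
- move=> n y n0 y0; have ny : 0 < INR n * y by apply: Rmult_lt_0_compat => //; exact: INR_pos.
  rewrite !bf_refl -?H5 //; try (by move=> x; exact: cF); try (by right).
- move=> n y n0 y0; have ny : 0 < INR n * y by apply: Rmult_lt_0_compat => //; exact: INR_pos.
  rewrite !bf_refl; try (by move=> x; exact: cF).
  by rewrite -[(- -1)%Z]/(1%Z) -H5 //; [congr bf; lia | left].
- exists C0 => u u1; have u0 : 0 < u by lra.
  by rewrite R0 Rmult_1_r !bf_refl; try (by move=> x; exact: cF); rewrite Rplus_comm; exact: HC.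
- have [u0 [de [w [L [A1 A2 A3 A4 A5]]]]] := H8; exists u0, de, w, L; split => // u.
    by move=> Hu; rewrite bf_refl; [exact: A4 | move=> x; apply: cF; lra].
  by move=> v Hu Hv; rewrite !bf_refl; [exact: A5 | move=> x; apply: cF; lra | move=> x; apply: cF; lra].
Qed.

Lemma Cmod_le_ReIm (z : C) : Cmod z <= Rabs (Re z) + Rabs (Im z).
Proof.
have A := Rabs_pos (Re z); have B := Rabs_pos (Im z).
rewrite -[X in _ <= X]sqrt_pow2; last lra.
apply: sqrt_le_1_alt; have := pow2_abs (Re z); have := pow2_abs (Im z).
rewrite /Re /Im in A B *; nra.
Qed.

(** To the right of [us], continuity keeps W above half of its value there, and W1 close to its own
    value, which bounds the difference quotients of both parts of W. *)
Lemma low_of_C1 (W W1 : R -> C) us : 0 < us -> (forall u, 0 < u -> cder W u (W1 u)) ->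
  (forall u, 0 < u -> Cc W1 u) -> W us <> RtoC 0 ->
  exists u0 de w L, [/\ 0 < u0, 0 < de, 0 < w,
    (forall u, u0 <= u <= (1 + de) * u0 -> w <= Cmod (W u)) &
    (forall u v, u0 <= u <= (1 + de) * u0 -> u0 <= v <= (1 + de) * u0 ->
       Cmod (W u - W v) <= L * Rabs (u - v))].
Proof.
move=> us0 dW cW1 Wn; have wp : 0 < Cmod (W us) by apply Cmod_gt_0.
have near (g : R -> R) e : 0 < e -> continuous g us -> exists d, 0 < d /\ forall u, us <= u < us + d -> Rabs (g u - g us) <= e.
  move=> e0 /continuity_pt_filterlim H; have [d [d0 Hd]] := H e e0; exists d; split => // u Hu.
  case: (Req_EM_T us u) => [<-|n]; first by rewrite Rminus_diag Rabs_R0; lra.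
  left; apply: Hd; split; first by split.
  by rewrite /dist /= /R_dist Rabs_pos_eq; lra.
have [dr di] := dW us us0; have [cr ci] := cW1 us us0.
have e4 : 0 < Cmod (W us) / 4 by lra.
have kr : continuous (fun t => Re (W t)) us by apply: (ex_derive_continuous (K := R_AbsRing) (V := R_NormedModule)); exists (Re (W1 us)).
have ki : continuous (fun t => Im (W t)) us by apply: (ex_derive_continuous (K := R_AbsRing) (V := R_NormedModule)); exists (Im (W1 us)).
have [d1 [p1 N1]] := near _ _ e4 kr; have [d2 [p2 N2]] := near _ _ e4 ki.
have [d3 [p3 N3]] := near _ _ Rlt_0_1 cr; have [d4 [p4 N4]] := near _ _ Rlt_0_1 ci.
pose d := Rmin (Rmin d1 d2) (Rmin d3 d4).
have dp : 0 < d by repeat apply: Rmin_glb_lt.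
have [D1 D2] : d <= d1 /\ d <= d2.
  by split; apply: Rle_trans (Rmin_l _ _) _; [exact: Rmin_l | exact: Rmin_r].
have [D3 D4] : d <= d3 /\ d <= d4.
  by split; apply: Rle_trans (Rmin_r _ _) _; [exact: Rmin_l | exact: Rmin_r].
have de0 : 0 < d / (2 * us) by apply: Rdiv_lt_0_compat; lra.
have rng u : us <= u <= (1 + d / (2 * us)) * us -> us <= u < us + d.
  by have -> : (1 + d / (2 * us)) * us = us + d / 2 by [field; lra]; lra.
exists us, (d / (2 * us)), (Cmod (W us) / 2), ((Rabs (Re (W1 us)) + 1) + (Rabs (Im (W1 us)) + 1)); split => //; first lra.
- move=> u /rng Hu; have A := N1 u ltac:(lra); have B := N2 u ltac:(lra).
  have := Cmod_le_ReIm (W u - W us)%C.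
  rewrite (_ : Re (W u - W us)%C = Re (W u) - Re (W us)) // (_ : Im (W u - W us)%C = Im (W u) - Im (W us)) // => K.
  have := Cmod_triangle (W u) (- (W u - W us))%C.
  by rewrite (_ : W u + - (W u - W us) = W us)%C ?Cmod_opp; [lra | ring].
have lip (g g' : R -> R) : (forall u, 0 < u -> is_derive g u (g' u)) ->
    (forall u, us <= u < us + d -> Rabs (g' u - g' us) <= 1) ->
    forall u v, us <= u < us + d -> us <= v < us + d -> Rabs (g u - g v) <= (Rabs (g' us) + 1) * Rabs (u - v).
  move=> dg Hg.
  have W2 u v : u < v -> us <= u < us + d -> us <= v < us + d -> Rabs (g u - g v) <= (Rabs (g' us) + 1) * Rabs (u - v).
    move=> uv Hu Hv.
    have [c [E [c0 c1]]] : exists c, g v - g u = g' c * (v - u) /\ u < c < v.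
      by apply: MVT_cor2 => // c Hc; apply/is_derive_Reals; apply: dg; lra.
    rewrite Rabs_minus_sym E (Rabs_minus_sym u) Rabs_mult; apply: Rmult_le_compat_r; first exact: Rabs_pos.
    have := Hg c ltac:(lra); have := Rabs_triang (g' us) (g' c - g' us).
    by rewrite (_ : g' us + (g' c - g' us) = g' c); [lra | ring].
  move=> u v Hu Hv; case: (Rtotal_order u v) => [L|[->|L]]; first exact: W2.
    by rewrite !Rminus_diag Rabs_R0 Rmult_0_r; lra.
  by rewrite Rabs_minus_sym (Rabs_minus_sym u); apply: W2.
move=> u v /rng Hu /rng Hv; apply: Rle_trans (Cmod_le_ReIm _) _.
rewrite (_ : Re (W u - W v)%C = Re (W u) - Re (W v)) // (_ : Im (W u - W v)%C = Im (W u) - Im (W v)) //.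
rewrite Rmult_plus_distr_r; apply: Rplus_le_compat.
  apply: (lip (fun t => Re (W t)) (fun t => Re (W1 t))) => // [t t0|t Ht]; first by case: (dW t t0).
  by apply: N3; lra.
apply: (lip (fun t => Im (W t)) (fun t => Im (W1 t))) => // [t t0|t Ht]; first by case: (dW t t0).
by apply: N4; lra.
Qed.

(** * Maass cusp forms *)

Section Maass.
Variables (s : C) (f : C -> C) (lam : nat -> C).
Hypothesis sm : smooth_on_upper f.
Hypothesis mf : modular 0 f.
Hypothesis lap : forall z : C, upper z -> hyp_laplacian f z = (s * f z)%C.
Hypothesis mg : moderate_growth f.
Hypothesis cu : forall y : R, 0 < y -> is_RInt (V := C_R_NormedModule) (fun x => f (x, y)) 0 1 (RtoC 0).
Hypothesis nz : nonzero_on_upper f.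
Hypothesis hf : hecke_eigen 0 f lam.

Let F x y := f (x, y).
Notation B := (bf f).

Lemma SF n : SmC n F.
Proof. by split => x y y0; have [] := sm n x y0. Qed.

Lemma mcF y x : 0 < y -> Cc (fun t => f (t, y)) x.
Proof. by move=> y0; exact: (SmC_Cc x (SF 0) y0). Qed.

Lemma mpF y x : 0 < y -> f (x + 1, y) = f (x, y).
Proof. exact: (modular_T x mf). Qed.

Lemma lin_Re (p q t : R) (w v : C) : Re (RtoC (-1) * (p, q) + (RtoC t * w) * v)%C = - p + t * Re (w * v)%C.
Proof. by rewrite /= /Re; ring. Qed.

Lemma lin_Im (p q t : R) (w v : C) : Im (RtoC (-1) * (p, q) + (RtoC t * w) * v)%C = - q + t * Im (w * v)%C.
Proof. by rewrite /= /Im; ring. Qed.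

Lemma lap_point x y : 0 < y ->
  DyC (DyC F) x y = (RtoC (-1) * DxC (DxC F) x y + (RtoC (- / y ^ 2) * s) * F x y)%C.
Proof.
move=> y0; have L := lap (z := (x, y)) y0.
have y2 : y ^ 2 <> 0 by apply: Rgt_not_eq; nra.
have sol a c q : - y ^ 2 * (a + c) = q -> c = - a - / y ^ 2 * q by move=> <-; field; lra.
have DE : DxC (DxC F) x y = (Dx (Dx (fun x y => Re (F x y))) x y, Dx (Dx (fun x y => Im (F x y))) x y) by [].
have rr (p q t : R) : - p - t * q = - p + - t * q by ring.
apply: C_eq; rewrite DE.
  by rewrite lin_Re -rr; exact: (sol _ _ _ (congr1 Re L)).
by rewrite lin_Im -rr; exact: (sol _ _ _ (congr1 Im L)).
Qed.

Definition B1 m y := fc (fun x => DyC F x y) m.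
Definition B2 m y := fc (fun x => DyC (DyC F) x y) m.

Lemma dB m y : 0 < y -> cder (B m) y (B1 m y).
Proof. by move=> y0; exact: (cder_fc m (SF 1) y0). Qed.

Lemma dB1 m y : 0 < y -> cder (B1 m) y (B2 m y).
Proof. by move=> y0; apply: cder_fc => //; have [] := SmC_S (SF 2). Qed.

(** The Laplace equation integrated against e(-m x): this is Whittaker's equation B'' = (4 PI^2 - s
    / y^2) B, used only through its sign for large y. *)
Lemma ode m y : (m * m = 1)%Z -> 0 < y ->
  B2 m y = (RtoC (4 * PI ^ 2) * B m y + (RtoC (- / y ^ 2) * s) * B m y)%C.
Proof.
move=> mm y0; have [SX _] := SmC_S (SF 2); have [SXX _] := SmC_S SX.
rewrite /B2 (_ : fc (fun x => DyC (DyC F) x y) m =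
   fc (fun x => RtoC (-1) * DxC (DxC F) x y + (RtoC (- / y ^ 2) * s) * F x y)%C m); last first.
  by apply: CI_ext => [|x _]; [exact: half_le | rewrite lap_point].
rewrite (@fc_lin (fun x => DxC (DxC F) x y) (fun x => F x y)); last 2 first.
- by move=> x; exact: (SmC_Cc x SXX y0).
- by move=> x; exact: mcF.
rewrite (fc_Dx m SX _ y0); last first.
  move=> x; apply: C_eq => /=.
    by apply: (Derive_per (g := fun t => Re (F t y))) => t; rewrite /F mpF.
  by apply: (Derive_per (g := fun t => Im (F t y))) => t; rewrite /F mpF.
rewrite (fc_Dx m (SF 1) _ y0); last by move=> x; exact: mpF.
have M : IZR m * IZR m = 1 by rewrite -mult_IZR mm.
rewrite Cmult_assoc Cmult_assoc; congr (_ * _ + _)%C.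
apply: C_eq => /=; last by ring.
rewrite (_ : PI * (PI * 1) = PI * PI * (IZR m * IZR m)); last by rewrite M; ring.
by ring.
Qed.

Lemma mg_pos : exists N A, 0 <= A /\ forall x y, 1 <= y -> Cmod (f (x, y)) <= A * y ^ N.
Proof.
have [N [A HA]] := mg; exists N, A; split => //.
by have := HA 0 1 (Rle_refl 1); have := Cmod_ge_0 (f (0, 1)); rewrite pow1; lra.
Qed.

Lemma B_le m y M : 0 < y -> (forall x, Cmod (f (x, y)) <= M) -> Cmod (B m y) <= M.
Proof.
move=> y0 H; apply: Rle_trans (@CI_norm _ _ half_le _ (fun _ => M) _ _ _) _.
- by move=> z _; apply: Cc_mult; [exact: mcF | exact: Cc_ecM].
- by move=> *; exact: cont_const.
- by move=> x _; rewrite Cmod_mult Cmod_ec Rmult_1_r.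
by rewrite RInt_const /scal /= /mult /=; lra.
Qed.

(** [exp_decay] is applied to |B|^2, whose second derivative is at least 2 (4 PI^2 - Re s / u^2)
    |B|^2; for u >= a = 1 + |Re s| the bracket exceeds 1/2. Moderate growth gives the polynomial
    bound, and taking the square root halves the exponent. *)
Lemma maass_decay m : (m * m = 1)%Z -> exists a D, [/\ 1 <= a, 0 <= D &
  forall u, a <= u -> Cmod (B m u) <= D * exp (- (u / 2))].
Proof.
move=> mm; have [N [A [A0 HA]]] := mg_pos.
pose a := 1 + Rabs (Re s); have a1 : 1 <= a by have := Rabs_pos (Re s); rewrite /a; lra.
pose r u := Re (B m u); pose i u := Im (B m u).
pose r1 u := Re (B1 m u); pose i1 u := Im (B1 m u).
pose r2 u := Re (B2 m u); pose i2 u := Im (B2 m u).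
have dr u : a <= u -> is_derive r u (r1 u) by move=> au; have [] := @dB m u ltac:(lra).
have di u : a <= u -> is_derive i u (i1 u) by move=> au; have [] := @dB m u ltac:(lra).
have dr1 u : a <= u -> is_derive r1 u (r2 u) by move=> au; have [] := @dB1 m u ltac:(lra).
have di1 u : a <= u -> is_derive i1 u (i2 u) by move=> au; have [] := @dB1 m u ltac:(lra).
have dm (g h g' h' : R -> R) u : is_derive g u (g' u) -> is_derive h u (h' u) -> is_derive (fun t => g t * h t) u (g' u * h u + g u * h' u).
  by move=> dg dh; apply: (is_derive_mult (K := R_AbsRing)) => //; exact: Rmult_comm.
have dp (g h : R -> R) u lg lh : is_derive g u lg -> is_derive h u lh -> is_derive (fun t => g t + h t) u (lg + lh).
  by move=> dg dh; apply: (is_derive_plus (K := R_AbsRing) (V := R_NormedModule)).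
pose v u := r u * r u + i u * i u.
pose v2 u := ((r2 u * r u + r1 u * r1 u) + (r1 u * r1 u + r u * r2 u)) + ((i2 u * i u + i1 u * i1 u) + (i1 u * i1 u + i u * i2 u)).
have V2 u : a <= u -> 0 <= v u by move=> _; rewrite /v; nra.
have V1 : forall u, a <= u -> v u <= v2 u.
  move=> u au; rewrite /v2 /v; have u0 : 0 < u by lra.
  have O := ode mm u0.
  have Er : r2 u = 4 * PI ^ 2 * r u + - / u ^ 2 * (Re s * r u - Im s * i u).
    by rewrite /r2 O /r /i /= /Re /Im; ring.
  have Ei : i2 u = 4 * PI ^ 2 * i u + - / u ^ 2 * (Re s * i u + Im s * r u).
    by rewrite /i2 O /r /i /= /Re /Im; ring.
  rewrite Er Ei; have P1 : 1 <= PI by have := PI2_1; lra.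
  have S1 : / u ^ 2 * Re s <= 1.
    have u2 : 0 < u ^ 2 by apply: pow_lt.
    apply: (Rmult_le_reg_l (u ^ 2)) => //; rewrite -Rmult_assoc Rinv_r; last lra.
    have := Rle_abs (Re s); rewrite /a in au a1; have : u <= u ^ 2 by nra.
    by lra.
  have : 1 / 2 * (r u * r u + i u * i u) <= (4 * PI ^ 2 - / u ^ 2 * Re s) * (r u * r u + i u * i u).
    by apply: Rmult_le_compat_r; nra.
  by nra.
have V3 : forall u, a <= u -> v u <= A * A * u ^ (N + N).
  move=> u au; rewrite /v; have := @B_le m u _ ltac:(lra) (fun x => HA x u ltac:(lra)) => H.
  have E : r u * r u + i u * i u = Cmod (B m u) ^ 2 by rewrite Cmod2 /r /i; ring.
  rewrite E pow_add; have := Cmod_ge_0 (B m u); have p0 : 0 <= u ^ N by apply: pow_le; lra.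
  move=> c0; have -> : A * A * (u ^ N * u ^ N) = (A * u ^ N) ^ 2 by ring.
  by apply: pow_incr.
have a0 : 0 < a by lra.
have [C0 [C00 HC]] := @exp_decay v
  (fun u => (r1 u * r u + r u * r1 u) + (i1 u * i u + i u * i1 u)) v2 a (A * A) (N + N)%N a0
  (fun u au => dp _ _ _ _ _ (dm _ _ _ _ _ (dr u au) (dr u au)) (dm _ _ _ _ _ (di u au) (di u au)))
  (fun u au => dp _ _ _ _ _ (dp _ _ _ _ _ (dm _ _ _ _ _ (dr1 u au) (dr u au)) (dm _ _ _ _ _ (dr u au) (dr1 u au)))
    (dp _ _ _ _ _ (dm _ _ _ _ _ (di1 u au) (di u au)) (dm _ _ _ _ _ (di u au) (di1 u au)))) V1 V2 V3.
exists a, (sqrt C0); split => //; first exact: sqrt_pos.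
move=> u au; have := HC u au; rewrite /v.
have -> : r u * r u + i u * i u = Cmod (B m u) ^ 2 by rewrite Cmod2 /r /i; ring.
have e0 := exp_pos (- (u / 2)); have s0 := sqrt_pos C0.
have -> : C0 * exp (- u) = (sqrt C0 * exp (- (u / 2))) ^ 2.
  rewrite Rpow_mult_distr pow2_sqrt //; congr Rmult; rewrite /= Rmult_1_r -exp_plus; congr exp; field.
move=> H; apply: Rnot_lt_le => L.
have : 0 <= sqrt C0 * exp (- (u / 2)) by nra.
by have := Cmod_ge_0 (B m u); nra.
Qed.

Lemma b0_zero y : 0 < y -> B 0 y = RtoC 0.
Proof.
move=> y0; rewrite /bf /fc (CI_ext half_le (g := fun x => f (x, y))); last first.
  by move=> x _; rewrite Ropp_0 Rmult_0_l ec_0 Cmult_1_r.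
have := @CI_periodic (fun x => f (x, y)) (- (1/2)) 0 (fun x => mcF x y0) (fun x => mpF x y0).
have -> : - (1/2) + 1 = 1/2 by lra.
rewrite Rplus_0_l => ->; have H := cu y0; apply: C_eq => /=; apply: is_RInt_unique.
  exact: (is_RInt_fct_extend_fst _ _ _ _ H).
exact: (is_RInt_fct_extend_snd _ _ _ _ H).
Qed.

Lemma hecke_B n y m : (0 < n)%N -> 0 < y -> (m = 1 \/ m = -1)%Z ->
    B (m * Z.of_nat n) y = (lam n * RtoC (Rpower (INR n) ((INR 0 - 1) / 2)) * B m (INR n * y))%C.
Proof. by move=> n0 y0 Hm; apply: (hecke_one mcF mpF hf). Qed.

Lemma maass_fourier x y : 0 < y -> conv (symsum (fun m => B m y * ec (IZR m * x))%C) (f (x, y)).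
Proof.
move=> y0; have [/Sm_S [_ _ d1 _] /Sm_S [_ _ d2 _]] := SF 1.
apply: (fourier_pointwise (G := fun x => f (x, y))).
- by move=> t; exact: mcF.
- by move=> t; exact: mpF.
- exact: (d1 x y y0).
- exact: (d2 x y y0).
Qed.

(** If both coefficients of index 1 and -1 vanished identically, [hecke_B] would annihilate all the
    others, cuspidality the zeroth, and the Fourier expansion would give f = 0. *)
Lemma nonzero_coef : exists sg us, [/\ (sg = 1 \/ sg = -1)%Z, 0 < us & B sg us <> RtoC 0].
Proof.
apply: Classical_Prop.NNPP => H.
have Z0 sg u : (sg = 1 \/ sg = -1)%Z -> 0 < u -> B sg u = RtoC 0.
  by move=> Hs u0; apply: Classical_Prop.NNPP => n; apply: H; exists sg, u.
case: nz => -[x y] [y0']; apply; have y0 : 0 < y := y0'.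
apply: conv_unique (maass_fourier x y0) _.
apply: (conv_ext (u := fun _ => RtoC 0)) => [N|]; last exact: conv_const.
have E n : (0 < n)%N -> B (Z.of_nat n) y = RtoC 0 /\ B (- Z.of_nat n) y = RtoC 0.
  move=> n0; have nR := INR_pos n0; have ny : 0 < INR n * y by nra.
  split.
    by rewrite -[Z.of_nat n]Z.mul_1_l (hecke_B n0 y0 (or_introl erefl)) Z0 ?Cmult_0_r //; left.
  have -> : (- Z.of_nat n = -1 * Z.of_nat n)%Z by lia.
  by rewrite (hecke_B n0 y0 (or_intror erefl)) Z0 ?Cmult_0_r //; right.
elim: N => [|N IH]; first by rewrite symsum0 b0_zero // Cmult_0_l.
by rewrite symsumS -IH; have [-> ->] := E N.+1 isT; ring.
Qed.

Lemma rect_bound : exists M, 0 <= M /\ forall x y, Rabs x <= 1 / 2 -> 1 / 2 <= y <= 1 -> Cmod (f (x, y)) <= M.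
Proof.
have [S1 S2] := SF 0.
have c1 x y : - (1/2) <= x <= 1/2 -> 1/2 <= y <= 1 -> continuity_2d_pt (fun x y => Re (f (x, y))) x y.
  by move=> _ Hy; apply: (Sm_cont x S1); lra.
have c2 x y : - (1/2) <= x <= 1/2 -> 1/2 <= y <= 1 -> continuity_2d_pt (fun x y => Im (f (x, y))) x y.
  by move=> _ Hy; apply: (Sm_cont x S2); lra.
have [M1 [M10 H1]] := bounded_2d c1; have [M2 [M20 H2]] := bounded_2d c2.
exists (M1 + M2); split; first lra.
move=> x y /Rabs_le_between Hx Hy; apply: Rle_trans (Cmod_le_ReIm _) _.
by have := H1 x y ltac:(lra) Hy; have := H2 x y ltac:(lra) Hy; lra.
Qed.

Lemma maass_reduction (h : R -> R) :
  (forall x y, Rabs x <= 1 / 2 -> 1 / 2 <= y -> Cmod (f (x, y)) <= h y) ->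
  (forall y y', 0 < y -> y < 1 / 2 -> 2 * y <= y' -> y' <= 1 / y -> h y' <= h y) ->
  forall x y, 0 < y -> Cmod (f (x, y)) <= h y.
Proof.
move=> H hh; apply: reduction => // x y y0; first by rewrite mpF.
by have := phi_S x mf y0; rewrite /= /Rdiv Rmult_0_l !Rpower_O ?Rmult_1_r //; apply: Rdiv_lt_0_compat => //; nra.
Qed.

(** The function y + 1/y dominates y high up and does not increase along the reduction: y < y' <=
    1/y implies y' + 1/y' <= y + 1/y. *)
Lemma maass_poly : exists A N, 0 <= A /\ forall x y, 0 < y -> Cmod (f (x, y)) <= A * (y + / y) ^ N.
Proof.
have [N [A [A0 HA]]] := mg_pos; have [M [M0 HM]] := rect_bound.
exists (A + M), N; split; first lra.
apply: maass_reduction => [x y Hx Hy|y y' y0 yh H1 H2].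
  have i0 : 0 < / y by apply: Rinv_0_lt_compat; lra.
  case: (Rle_lt_dec 1 y) => y1.
    have : y ^ N <= (y + / y) ^ N by apply: pow_incr; lra.
    have : 0 <= y ^ N by apply: pow_le; lra.
    by have := HA x y y1; nra.
  have i1 : 1 <= / y by rewrite -Rinv_1; apply: Rinv_le_contravar; lra.
  have : 1 <= (y + / y) ^ N by rewrite -(pow1 N); apply: pow_incr; lra.
  by have := HM x y Hx ltac:(lra); nra.
apply: Rmult_le_compat_l; first lra.
have y'0 : 0 < y' by lra.
have i' : 0 < / y' by exact: Rinv_0_lt_compat.
apply: pow_incr; split; first lra.
apply: (Rmult_le_reg_r (y' * y)); first nra.
have -> : (y' + / y') * (y' * y) = y' * y' * y + y by field; lra.
have -> : (y + / y) * (y' * y) = y * y * y' + y' by field; lra.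
have : 0 <= 1 - y * y'.
  have : y * y' <= y * (1 / y) by apply: Rmult_le_compat_l; lra.
  by have -> : y * (1 / y) = 1 by [field; lra]; lra.
by nra.
Qed.

(** A preliminary bound with some exponent, read off on the line of height us / n; it serves to sum
    the Fourier expansion in [maass_bounded]. *)
Lemma lam_poly : exists D P, 0 <= D /\ forall n, (0 < n)%N -> Cmod (lam n) <= D * INR n ^ P.
Proof.
have [sg [us [Hsg us0 Bn]]] := nonzero_coef; have [A [N [A0 HA]]] := maass_poly.
have bp : 0 < Cmod (B sg us) by apply Cmod_gt_0.
exists (A * (us + / us) ^ N / Cmod (B sg us)), N.+1.
have iu : 0 < / us by exact: Rinv_0_lt_compat.
have q0 : 0 <= A * (us + / us) ^ N by apply: Rmult_le_pos => //; apply: pow_le; lra.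
split; first by apply: Rmult_le_pos => //; left; exact: Rinv_0_lt_compat.
move=> n n0; have nR := INR_pos n0; have n1 := INR_ge1 n0.
have un : 0 < us / INR n by apply: Rdiv_lt_0_compat.
have := hecke_B n0 un Hsg.
have -> : INR n * (us / INR n) = us by field; lra.
move=> E; have := congr1 Cmod E; rewrite !Cmod_mult Cmod_R Rabs_pos_eq; last by left; exact: Rp_gt0.
move=> {}E; have := @B_le (sg * Z.of_nat n) (us / INR n) _ un (fun x => HA x _ un).
rewrite E => H.
have T : (us / INR n + / (us / INR n)) ^ N <= (us + / us) ^ N * INR n ^ N.
  rewrite -Rpow_mult_distr; apply: pow_incr.
  have -> : / (us / INR n) = / us * INR n by field; lra.
  have : us / INR n <= us * INR n.
    have : / INR n <= 1 by rewrite -Rinv_1; apply: Rinv_le_contravar; lra.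
    by move=> h; apply: Rmult_le_compat_l; lra.
  by split; nra.
have Pn : / INR n <= Rpower (INR n) ((INR 0 - 1) / 2).
  rewrite -{1}(Rpower_1 (INR n)) // -Rpower_Ropp; apply: Rle_Rpower => //; rewrite /=; lra.
have in0 : 0 < / INR n by exact: Rinv_0_lt_compat.
apply: (Rmult_le_reg_r (/ INR n * Cmod (B sg us))); first nra.
have -> : A * (us + / us) ^ N / Cmod (B sg us) * INR n ^ N.+1 * (/ INR n * Cmod (B sg us)) =
  A * ((us + / us) ^ N * INR n ^ N) by rewrite /=; field; split; lra.
apply: Rle_trans (Rle_trans _ _ _ H (Rmult_le_compat_l _ _ _ A0 T)).
rewrite -Rmult_assoc; apply: Rmult_le_compat_r; first lra.
by apply: Rmult_le_compat_l; [exact: Cmod_ge_0 | lra].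
Qed.

Lemma geom_sum_le r N : 0 <= r < 1 -> \rsum_(1 <= n < N.+1) r ^ n <= / (1 - r).
Proof.
move=> [r0 r1]; have i0 : 0 < / (1 - r) by apply: Rinv_0_lt_compat; lra.
suff -> : \rsum_(1 <= n < N.+1) r ^ n = (r - r ^ N.+1) * / (1 - r).
  by have := pow_le r N.+1 r0; nra.
elim: N => [|N IH]; first by rewrite big_nil /=; ring.
by rewrite rsum_recr // IH /=; field; lra.
Qed.

(** Above height a the Fourier expansion bounds f, between 1 and a moderate growth does, and on the
    rest of the region |x| <= 1/2, y >= 1/2 compactness does; invariance carries the bound
    everywhere. *)
Lemma maass_bounded : exists M, 0 <= M /\ forall x y, 0 < y -> Cmod (f (x, y)) <= M.
Proof.
have [a1 [D1 [a11 D10 H1]]] := @maass_decay 1 erefl.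
have [a2 [D2 [a21 D20 H2]]] := @maass_decay (-1) erefl.
have [D [P [D0 HD]]] := lam_poly; have [C0 [C00 HC]] := pow_exp P.
have [N [A [A0 HA]]] := mg_pos; have [M [M0 HM]] := rect_bound.
pose a := a1 + a2; pose K := D * (4 ^ P * C0) * (D1 + D2).
have K0 : 0 <= K.
  by apply: Rmult_le_pos; [apply: Rmult_le_pos => //; apply: Rmult_le_pos; [apply: pow_le; lra | lra] | lra].
pose r := exp (- (1 / 4)).
have r01 : 0 <= r < 1 by split; [left; exact: exp_pos | rewrite -exp_0; apply: exp_increasing; lra].
have ir : 0 < / (1 - r) by apply: Rinv_0_lt_compat; lra.
have big x y : a <= y -> Cmod (f (x, y)) <= K * / (1 - r).
  move=> ay; have y1 : 1 <= y by rewrite /a in ay; lra.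
  have y0 : 0 < y by lra.
  apply: (conv_bound (maass_fourier x y0)) => J.
  apply: Rle_trans (symsum_le _ _) _.
  rewrite b0_zero // Cmult_0_l Cmod_0 Rplus_0_l.
  apply: Rle_trans _ (Rmult_le_compat_l _ _ _ K0 (geom_sum_le J r01)).
  rewrite -rsum_scal big_nat [X in _ <= X]big_nat; apply: rsum_le => n /andP [n0 _].
  have nR := INR_pos n0; have n1 := INR_ge1 n0.
  rewrite !Cmod_mult !Cmod_ec !Rmult_1_r.
  have ny : a <= INR n * y by nra.
  have -> : (- Z.of_nat n = -1 * Z.of_nat n)%Z by lia.
  rewrite -{1}[Z.of_nat n]Z.mul_1_l (hecke_B n0 y0 (or_introl erefl)) (hecke_B n0 y0 (or_intror erefl)).
  rewrite !Cmod_mult Cmod_R Rabs_pos_eq; last by left; exact: Rp_gt0.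
  have p1 : Rpower (INR n) ((INR 0 - 1) / 2) <= 1.
    apply: (Rle_trans _ (Rpower (INR n) 0)); last by rewrite Rpower_O //; lra.
    by apply: Rle_Rpower => //; rewrite /=; lra.
  have p0 := Rp_gt0 (INR n) ((INR 0 - 1) / 2).
  have Q1 := H1 (INR n * y) ltac:(rewrite /a in ny; lra).
  have Q2 := H2 (INR n * y) ltac:(rewrite /a in ny; lra).
  have en : exp (- (INR n * y / 2)) <= exp (- (INR n / 2)) by apply: exp_leq; nra.
  (* The power n^P is absorbed by e^(n/4); against the decay e^(-n/2) this leaves r^n with r =
     e^(-1/4). *)
  have LN : Cmod (lam n) <= D * (4 ^ P * C0 * exp (INR n / 4)).
    apply: Rle_trans (HD n n0) _; apply: Rmult_le_compat_l => //.
    have -> : INR n ^ P = 4 ^ P * (INR n / 4) ^ P by rewrite -Rpow_mult_distr; congr pow; field.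
    rewrite Rmult_assoc; apply: Rmult_le_compat_l; first by apply: pow_le; lra.
    by apply: HC; lra.
  have l0 := Cmod_ge_0 (lam n).
  rewrite -Rmult_plus_distr_l.
  apply: (Rle_trans _ ((D * (4 ^ P * C0 * exp (INR n / 4))) * ((D1 + D2) * exp (- (INR n / 2))))).
    apply: Rmult_le_compat.
    - by apply: Rmult_le_pos; lra.
    - by apply: Rplus_le_le_0_compat; exact: Cmod_ge_0.
    - by rewrite -[X in _ <= X]Rmult_1_r; apply: Rmult_le_compat; lra.
    - rewrite Rmult_plus_distr_r; apply: Rplus_le_compat.
        by apply: Rle_trans Q1 _; apply: Rmult_le_compat_l.
      by apply: Rle_trans Q2 _; apply: Rmult_le_compat_l.
  right; rewrite /K /r -(Rpower_pow n (exp (- (1 / 4)))); last exact: exp_pos.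
  rewrite /Rpower ln_exp.
  have -> : INR n * - (1 / 4) = INR n / 4 + - (INR n / 2) by field.
  by rewrite exp_plus; ring.
exists (K * / (1 - r) + A * a ^ N + M).
have X0 : 0 <= K * / (1 - r) by nra.
have X1 : 0 <= A * a ^ N by apply: Rmult_le_pos => //; apply: pow_le; rewrite /a; lra.
split; first lra.
apply: maass_reduction => [x y Hx Hy|y y' *]; last lra.
case: (Rle_lt_dec a y) => [ay|ya]; first by have := big x y ay; lra.
case: (Rle_lt_dec 1 y) => [y1|y1]; last by have := HM x y Hx ltac:(lra); lra.
have : A * y ^ N <= A * a ^ N by apply: Rmult_le_compat_l => //; apply: pow_incr; lra.
by have := HA x y y1; lra.
Qed.

Lemma maass_nice : exists g, nice 0 g lam.
Proof.
have [sg [us [Hsg us0 Bn]]] := nonzero_coef.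
apply: (@mk_nice f lam sg Hsg) => //.
- by move=> x y y0; have [/Sm_S [_ _ d1 _] /Sm_S [_ _ d2 _]] := SF 1; split; [exact: (d1 x y y0) | exact: (d2 x y y0)].
- by have [M [_ HM]] := maass_bounded; exists M.
- exact: b0_zero.
- exact: hecke_B.
- have [a1 [D1 [a11 D10 H1]]] := @maass_decay 1 erefl.
  have [a2 [D2 [a21 D20 H2]]] := @maass_decay (-1) erefl.
  have [M [M0 HM]] := maass_bounded.
  exists (2 * (D1 + D2) + 2 * M * (a1 + a2)) => u u1; have u0 : 0 < u by lra.
  apply: (Rmult_le_reg_r u) => //; rewrite /Rdiv Rmult_assoc Rinv_l ?Rmult_1_r; last lra.
  have M1 := @B_le 1 u M u0 (fun x => HM x u u0); have M2 := @B_le (-1) u M u0 (fun x => HM x u u0).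
  case: (Rle_lt_dec (a1 + a2) u) => L; last by nra.
  have Q1 := H1 u ltac:(lra); have Q2 := H2 u ltac:(lra).
  have e : exp (- (u / 2)) * u <= 2.
    have := exp_ineq1_le (u / 2) => E.
    have EE : exp (- (u / 2)) * exp (u / 2) = 1 by rewrite -exp_plus -exp_0; congr exp; ring.
    have e0 := exp_pos (- (u / 2)); nra.
  have : (D1 + D2) * (exp (- (u / 2)) * u) <= (D1 + D2) * 2 by apply: Rmult_le_compat_l; lra.
  have : 0 <= 2 * M * (a1 + a2) by nra.
  by nra.
- apply: (low_of_C1 us0 (W1 := B1 sg)) => // u u0; first exact: dB.
  have [d1 d2] := dB1 sg u0; split; apply: (ex_derive_continuous (K := R_AbsRing) (V := R_NormedModule)).
    by exists (Re (B2 sg u)).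
  by exists (Im (B2 sg u)).
- apply: theta_ge0.
    have := hecke_B (n := 1) isT us0 Hsg; rewrite Z.mul_1_r Rmult_1_l Rp_1 Cmult_1_r.
    by rewrite -{1}(Cmult_1_l (B sg us)) => /(Ccancel Bn).
  by move=> n n0; apply: (hecke_two mcF mpF hf n0 us0 Hsg).
Qed.
End Maass.

Lemma form_nice (f : C -> C) lam :
  (exists kappa : nat, holomorphic_hecke_cusp_form kappa f lam) \/
  (exists mu : C, maass_hecke_cusp_form mu f lam) -> exists k g, nice k g lam.
Proof.
case=> [[k H]|[mu [[sm [mf [lap [mg cu]]]] [nz hf]]]].
  by exists k, f; exact: holomorphic_nice.
have [g Hg] := maass_nice sm mf lap mg cu nz hf.
by exists 0%N, g.
Qed.
End CuspForms.

(** * Primes and sums of two squares *)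

Module SumsOfTwoSquares.
Import ZArith Lia.
Import all_boot all_order all_algebra all_field.
Import zify.
Set Implicit Arguments. Unset Strict Implicit. Unset Printing Implicit Defensive.
Import GRing.Theory.

Lemma fp_exp (p : nat) (x : 'F_p) : prime p -> x != 0%R -> (x ^+ p.-1 = 1)%R.
Proof.
move=> pp x0; have := expf_card x; rewrite card_Fp // => E.
by apply: (mulfI x0); rewrite -exprS prednK ?prime_gt0 // E mulr1.
Qed.

Lemma fp_nat0 (p a : nat) : prime p -> ((a%:R == 0 :> 'F_p)%R = (p %| a)%N).
Proof. by move=> pp; rewrite -(dvdn_pcharf (pchar_Fp pp)). Qed.

(** Otherwise a^2 = - b^2 with a, b nonzero modulo p; raising to the odd power (p - 1) / 2 gives 1 =
    -1 by Fermat's theorem. *)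
Lemma three_mod4_dvd (p a b : nat) : prime p -> (p %% 4 = 3)%N -> (p %| a ^ 2 + b ^ 2)%N -> (p %| a)%N.
Proof.
move=> pp p3 H; rewrite -fp_nat0 //; apply/negPn/negP => a0.
have pn : odd p by rewrite (divn_eq p 4) p3 oddD oddM andbF.
have E : ((a%:R : 'F_p) ^+ 2 = - (b%:R) ^+ 2)%R.
  by apply/eqP; rewrite -addr_eq0 -!natrX -natrD fp_nat0.
have b0 : (b%:R != 0 :> 'F_p)%R.
  by apply: contraNneq a0 => b0; move/eqP: E; rewrite b0 expr0n oppr0 expf_eq0 /= => /eqP ->.
have h : p.-1 = (2 * (p %/ 4 * 2 + 1))%N by have := divn_eq p 4; rewrite p3; lia.
have := fp_exp pp a0; rewrite h exprM E exprNn -exprM -h (fp_exp pp b0) mulr1.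
rewrite -signr_odd oddD oddM andbF /= expr1 => /eqP; rewrite -subr_eq0 -opprD oppr_eq0 -(natrD _ 1 1) fp_nat0 //.
move/(dvdn_leq (ltn0Sn 1)); have := prime_gt1 pp; case: p pp p3 {H a0 pn E b0 h} => [|[|[|p]]] //.
Qed.

(** The polynomial X^((p-1)/2) - 1 has too few roots to vanish at all units; for a unit x where it
    does not vanish, x^((p-1)/4) is a square root of -1. *)
Lemma sqrt_neg1 (p : nat) : prime p -> (p %% 4 = 1)%N -> exists x : nat, (p %| x ^ 2 + 1)%N.
Proof.
move=> pp p1.
have [x /andP [x0 xn]] : exists x : 'F_p, (x != 0%R) && (x ^+ (p.-1)./2 != 1)%R.
  case: (boolP [exists x : 'F_p, (x != 0%R) && ((x ^+ (p.-1)./2)%R != 1%R)]) => [/existsP //|/existsPn H].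
  have h0 : (0 < (p.-1)./2)%N by have := prime_gt1 pp; have := divn_eq p 4; rewrite p1; lia.
  have S : (size ('X^((p.-1)./2) - 1 : {poly 'F_p})%R = ((p.-1)./2).+1)%N by rewrite size_XnsubC.
  have nz : ('X^((p.-1)./2) - 1 : {poly 'F_p})%R != 0%R by rewrite -size_poly_eq0 S.
  have := max_poly_roots nz (rs := [seq x <- enum 'F_p | x != 0%R]).
  rewrite filter_uniq ?enum_uniq // => /(_ _ isT).
  have -> : all (root ('X^((p.-1)./2) - 1)%R) [seq x <- enum 'F_p | x != 0%R].
    apply/allP => x; rewrite mem_filter => /andP [x0 _].
    have := H x; rewrite x0 /= negbK => /eqP E.
    by rewrite rootE !hornerE E subrr.
  rewrite S => /(_ isT); rewrite size_filter.
  have : (count (fun x : 'F_p => x != 0%R) (enum 'F_p) = p.-1)%N.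
    have E1 : count (fun x : 'F_p => x == 0%R) (enum 'F_p) = 1%N.
      by rewrite (count_uniq_mem 0%R (enum_uniq _)) mem_enum.
    have := count_predC (fun x : 'F_p => x == 0%R) (enum 'F_p).
    rewrite E1 -cardE card_Fp // add1n => E2; rewrite -[p in RHS]E2 /=; exact: eq_count.
  move=> ->; have := prime_gt1 pp; lia.
exists (nat_of_ord (x ^+ (p.-1 %/ 4))%R).
rewrite -fp_nat0 // natrD natrX natr_Zp; set y := (x ^+ _)%R.
have y2 : (y ^+ 2 = x ^+ (p.-1)./2)%R.
  by rewrite -exprM; congr (x ^+ _)%R; have := divn_eq p 4; rewrite p1; lia.
have : ((x ^+ (p.-1)./2) ^+ 2 == 1)%R.
  rewrite -exprM (_ : (p.-1)./2 * 2 = p.-1)%N ?fp_exp //.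
  by have := divn_eq p 4; rewrite p1; lia.
by rewrite sqrf_eq1 (negbTE xn) /= -y2 => /eqP ->; rewrite addNr.
Qed.

Delimit Scope Z_scope with ZZ.

(** Thue's argument: with k the integer part of sqrt p, two of the (k+1)^2 > p values i + x j agree
    modulo p. The differences of the coordinates have a sum of squares divisible by p, positive, and
    less than 2 p. *)
Lemma prime_two_squares (p : nat) : prime p -> (p %% 4 = 1)%N -> exists u v : nat, p = (u ^ 2 + v ^ 2)%N.
Proof.
move=> pp p1; have [x px] := sqrt_neg1 pp p1; have p0 := prime_gt0 pp.
have [k k1 k2] : exists2 k, (k * k <= p)%N & (p < k.+1 * k.+1)%N.
  have ex : exists k, (p < k.+1 * k.+1)%N by exists p; nia.
  case: (ex_minnP ex) => k Hk min; exists k => //.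
  case: k Hk min => [|k] Hk min //; rewrite leqNgt; apply/negP => L.
  by have := min k L; rewrite ltnn.
have kp : (k * k)%N <> p.
  move=> E; have kd : (k %| p)%N by rewrite -E dvdn_mulr.
  by have := prime_gt1 pp; case/primeP: pp => _ /(_ _ kd) /orP [] /eqP; nia.
pose g (ij : 'I_k.+1 * 'I_k.+1) : 'I_p := Ordinal (ltn_pmod (ij.1 + x * ij.2) p0).
have : ~~ injectiveb g.
  apply/negP => /injectiveP gi; have := leq_card g gi.
  by rewrite card_prod !card_ord leqNgt k2.
move/injectivePn => [[i j] [[i' j'] ne]] /(congr1 val) /= E.
have ik := ltn_ord i; have ik' := ltn_ord i'; have jk := ltn_ord j; have jk' := ltn_ord j'.
have [q Hq] := dvdnP px.
have E1 := divn_eq (i + x * j) p; have := divn_eq (i' + x * j') p; rewrite -E => E2.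
have {}ne : nat_of_ord i <> i' \/ nat_of_ord j <> j'.
  by case: (eqVneq (nat_of_ord i) i') => [/val_inj ei|/eqP]; [right=> /val_inj ej; rewrite ei ej eqxx in ne | left].
move: ((i + x * j) %/ p)%N ((i' + x * j') %/ p)%N ((i + x * j) %% p)%N E1 E2 => s t r E1 E2.
(* With truncated subtraction this is the distance |i - i'|. *)
exists ((i - i') + (i' - i))%N, ((j - j') + (j' - j))%N.
move: (nat_of_ord i) (nat_of_ord i') (nat_of_ord j) (nat_of_ord j') ik ik' jk jk' ne E1 E2 => {i i' j j' g E} i i' j j' ik ik' jk jk' ne E1 E2.
have key : ((Z.of_nat i - Z.of_nat i') * (Z.of_nat i - Z.of_nat i') + (Z.of_nat j - Z.of_nat j') * (Z.of_nat j - Z.of_nat j') =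
   (Z.of_nat q * (Z.of_nat j' - Z.of_nat j) * (Z.of_nat j' - Z.of_nat j) +
    2 * Z.of_nat x * (Z.of_nat j' - Z.of_nat j) * (Z.of_nat s - Z.of_nat t) +
    (Z.of_nat s - Z.of_nat t) * (Z.of_nat s - Z.of_nat t) * Z.of_nat p) * Z.of_nat p)%ZZ.
  have EU : (Z.of_nat i - Z.of_nat i' = Z.of_nat x * (Z.of_nat j' - Z.of_nat j) + (Z.of_nat s - Z.of_nat t) * Z.of_nat p)%ZZ.
    by clear -E1 E2; nia.
  have EQ : (Z.of_nat x * Z.of_nat x + 1 = Z.of_nat q * Z.of_nat p)%ZZ by clear -Hq; rewrite expnS expn1 in Hq; nia.
  rewrite EU; rewrite (_ : forall a b : Z, (a - b) * (a - b) = (b - a) * (b - a))%ZZ; last by move=> *; ring.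
  move: (Z.of_nat j' - Z.of_nat j)%ZZ (Z.of_nat s - Z.of_nat t)%ZZ => V T.
  have -> : ((Z.of_nat x * V + T * Z.of_nat p) * (Z.of_nat x * V + T * Z.of_nat p) + V * V =
    (Z.of_nat x * Z.of_nat x + 1) * V * V + 2 * Z.of_nat x * V * T * Z.of_nat p + T * T * Z.of_nat p * Z.of_nat p)%ZZ by ring.
  by rewrite EQ; ring.
move: key; set W := (_ * _ + 2 * _ * _ * _ + _)%ZZ => key.
have SQ a b : (Z.of_nat ((a - b) + (b - a)) * Z.of_nat ((a - b) + (b - a)) = (Z.of_nat a - Z.of_nat b) * (Z.of_nat a - Z.of_nat b))%ZZ.
  by case/orP: (leq_total a b) => L; clear -L; nia.
have B a b : (a < k.+1)%N -> (b < k.+1)%N -> ((Z.of_nat a - Z.of_nat b) * (Z.of_nat a - Z.of_nat b) <= Z.of_nat k * Z.of_nat k)%ZZ.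
  by clear; nia.
have P a b : a <> b -> (0 < (Z.of_nat a - Z.of_nat b) * (Z.of_nat a - Z.of_nat b))%ZZ by clear; nia.
have N a b : (0 <= (Z.of_nat a - Z.of_nat b) * (Z.of_nat a - Z.of_nat b))%ZZ by exact: Z.square_nonneg.
have W1 : W = 1%ZZ.
  have L1 : (W * Z.of_nat p < 2 * Z.of_nat p)%ZZ.
    by have := B _ _ ik ik'; have := B _ _ jk jk'; rewrite -key; clear -k1 kp; nia.
  have L2 : (0 < W * Z.of_nat p)%ZZ.
    by rewrite -key; have := N i i'; have := N j j'; case: ne => /P; lia.
  by clear -L1 L2; nia.
apply: Nat2Z.inj; move: key; rewrite W1 -!SQ; move: (_ + _)%N (_ + _)%N => u v; clear; rewrite !expnS !expn0 !muln1; lia.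
Qed.
End SumsOfTwoSquares.

(** * Jacobi's formula for the number of representations *)

Module Jacobi.
Import Reals Lra Lia Psatz ZArith List Coquelicot.
Import ssreflect ssrfun ssrbool eqtype ssrnat seq choice fintype bigop div prime.
Import zify ssrZ.
Import Defs.
Import Fourier SumsOfTwoSquares.
Set Implicit Arguments. Unset Strict Implicit. Unset Printing Implicit Defensive.
Open Scope R_scope.

Definition chi (d : nat) : R := if (d %% 4 == 1)%N then 1 else if (d %% 4 == 3)%N then -1 else 0.

Lemma chiM d e : chi (d * e) = chi d * chi e.
Proof.
rewrite /chi -modnMm; have := ltn_pmod d (isT : 0 < 4)%N; have := ltn_pmod e (isT : 0 < 4)%N.
move: (d %% 4)%N (e %% 4)%N => [|[|[|[|a]]]] [|[|[|[|b]]]] //= _ _; ring.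
Qed.

Definition dchi (n : nat) : R := \rsum_(d <- divisors n) chi d.

(** The divisors of p n that do not divide n are the p e with e | n and p e not dividing n. The next
    lemmas prove the same recurrence for [r2], according to p modulo 4, so that [jacobi] follows by
    induction on n, without factorisation in the Gaussian integers. *)
Lemma dchi_rec p n : prime p -> (0 < n)%N ->
  dchi (p * n) = dchi n + chi p * (dchi n - if (p %| n)%N then dchi (n %/ p) else 0).
Proof.
move=> pp n0; have p0 := prime_gt0 pp.
have pn0 : (0 < p * n)%N by rewrite muln_gt0 p0.
have -> : dchi (p * n) = \rsum_(d <- divisors (p * n) | (d %| n)%N) chi d + \rsum_(d <- divisors (p * n) | ~~ (d %| n)%N) chi d.
  by rewrite /dchi (bigID (fun d => (d %| n)%N)).
congr Rplus.
  rewrite -big_filter; apply: perm_big; apply: uniq_perm; rewrite ?filter_uniq ?divisors_uniq // => d.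
  rewrite mem_filter -!dvdn_divisors //; case dn: (d %| n)%N => //=; exact: dvdn_mull.
have -> : \rsum_(d <- divisors (p * n) | ~~ (d %| n)%N) chi d = \rsum_(e <- divisors n | ~~ (p * e %| n)%N) (chi p * chi e).
  rewrite -big_filter -[RHS]big_filter.
  rewrite (perm_big [seq (p * e)%N | e <- divisors n & ~~ (p * e %| n)%N]) /=.
    by rewrite big_map; apply: eq_bigr => e _; rewrite chiM.
  apply: uniq_perm; first by rewrite filter_uniq ?divisors_uniq.
    rewrite map_inj_uniq ?filter_uniq ?divisors_uniq // => u v /eqP.
    by rewrite eqn_pmul2l // => /eqP.
  move=> d; rewrite mem_filter -dvdn_divisors //; apply/andP/mapP.
    move=> [dn dpn]; have pd : (p %| d)%N.
      apply: contraR dn => pd; rewrite -(@Gauss_dvdr _ p) //.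
      by rewrite coprime_sym prime_coprime.
    exists (d %/ p)%N; last by rewrite mulnC divnK.
    have dE : (p * (d %/ p) = d)%N by rewrite mulnC divnK.
    by rewrite mem_filter dE dn -dvdn_divisors //= -(dvdn_pmul2l p0) dE.
  move=> [e]; rewrite mem_filter -dvdn_divisors // => /andP [h en] ->.
  by rewrite h dvdn_pmul2l.
rewrite rsum_scal; congr Rmult.
have -> : dchi n = \rsum_(e <- divisors n | (p * e %| n)%N) chi e + \rsum_(e <- divisors n | ~~ (p * e %| n)%N) chi e.
  by rewrite /dchi (bigID (fun e => (p * e %| n)%N)).
have -> : \rsum_(e <- divisors n | (p * e %| n)%N) chi e = if (p %| n)%N then dchi (n %/ p) else 0.
  case: ifP => pn.
    have np0 : (0 < n %/ p)%N by rewrite divn_gt0 // dvdn_leq.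
    rewrite -big_filter; apply: perm_big; apply: uniq_perm; rewrite ?filter_uniq ?divisors_uniq // => e.
    rewrite mem_filter -!dvdn_divisors // -{1}(divnK pn) (mulnC (n %/ p)%N) dvdn_pmul2l //.
    case en: (e %| n %/ p)%N => //=.
    by rewrite -(divnK pn) dvdn_mulr.
  rewrite big1 // => e pe; case/negP: (negbT pn); exact: dvdn_trans (dvdn_mulr _ (dvdnn p)) pe.
by ring.
Qed.

Lemma In_mem (T : eqType) (x : T) (s : seq T) : In x s <-> x \in s.
Proof.
elim: s => [|y s IH]; first by split.
rewrite inE /=; split; first by case=> [->|/IH ->]; rewrite ?eqxx ?orbT.
by case/orP => [/eqP ->|/IH]; [left | right].
Qed.

Lemma NoDup_uniq (T : eqType) (s : seq T) : NoDup s -> uniq s.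
Proof. by elim=> //= x l nx _ ->; rewrite andbT; apply/negP => /In_mem. Qed.

Definition sol (n : nat) : seq (Z * Z) := two_squares n.

Lemma sol_uniq n : uniq (sol n).
Proof. by apply: NoDup_uniq; have [] := two_squares_spec n. Qed.

Lemma mem_sol n (z : Z * Z) : (z \in sol n) = Z.eqb (z.1 * z.1 + z.2 * z.2) (Z.of_nat n).
Proof.
case: z => a b; have [_ H] := two_squares_spec n.
by apply/idP/Z.eqb_spec => [/In_mem /H|/H /In_mem].
Qed.

Lemma r2_size n : r2 n = size (sol n).
Proof. by []. Qed.

Lemma size_bij (A : eqType) (s t : seq A) (g h : A -> A) : uniq s -> uniq t ->
  (forall x, x \in s -> g x \in t) -> (forall x, x \in t -> h x \in s) ->
  (forall x, x \in s -> h (g x) = x) -> (forall x, x \in t -> g (h x) = x) -> size s = size t.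
Proof.
move=> us ut gs ht hg gh; rewrite -(size_map g s); apply: perm_size; apply: uniq_perm => //.
  by rewrite map_inj_in_uniq // => x y xs ys E; rewrite -(hg x xs) E hg.
move=> x; apply/mapP/idP => [[y ys ->]|xt]; first exact: gs.
by exists (h x); [exact: ht | rewrite gh].
Qed.

(** The bijection is division by 1 + i. *)
Lemma r2_two n : r2 (2 * n) = r2 n.
Proof.
rewrite !r2_size; apply: (size_bij (g := fun z => ((z.1 + z.2) / 2, (z.2 - z.1) / 2)%Z) (h := fun z => (z.1 - z.2, z.1 + z.2)%Z)); try exact: sol_uniq.
- move=> [a b]; rewrite !mem_sol /= => /Z.eqb_spec E; apply/Z.eqb_spec.
  have [q Hq] : exists q, (a + b = 2 * q)%Z.
    exists ((a + b) / 2)%Z; have := Z.mod_pos_bound (a + b) 2 ltac:(lia); have := Z_div_mod_eq_full (a + b) 2.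
    case: (Z.eq_dec ((a + b) mod 2) 0) => [-> //|n1]; first by lia.
    move=> H1 H2; have m1 : ((a + b) mod 2 = 1)%Z by lia.
    rewrite m1 in H1; move: ((a + b) / 2)%Z H1 => t H1; exfalso.
    have bE : b = (2 * t + 1 - a)%Z by lia. 
    by rewrite bE in E; lia.
  have -> : (b - a = (q - a) * 2)%Z by lia.
  rewrite Hq (Z.mul_comm 2 q) !Z_div_mult //; have bE : b = (2 * q - a)%Z by lia.
  by rewrite bE in E; lia.
- by move=> [a b]; rewrite !mem_sol /= => /Z.eqb_spec E; apply/Z.eqb_spec; lia.
- move=> [a b]; rewrite !mem_sol /= => /Z.eqb_spec E.
  have [q Hq] : exists q, (a + b = 2 * q)%Z.
    exists ((a + b) / 2)%Z; have := Z.mod_pos_bound (a + b) 2 ltac:(lia); have := Z_div_mod_eq_full (a + b) 2.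
    case: (Z.eq_dec ((a + b) mod 2) 0) => [-> //|n1]; first by lia.
    move=> H1 H2; have m1 : ((a + b) mod 2 = 1)%Z by lia.
    rewrite m1 in H1; move: ((a + b) / 2)%Z H1 => t H1; exfalso.
    have bE : b = (2 * t + 1 - a)%Z by lia. 
    by rewrite bE in E; lia.
  have -> : (b - a = (q - a) * 2)%Z by lia.
  by rewrite Hq (Z.mul_comm 2 q) !Z_div_mult //; congr pair; lia.
- move=> [a b] _ /=.
  have -> : (a - b + (a + b) = a * 2)%Z by lia.
  have -> : (a + b - (a - b) = b * 2)%Z by lia.
  by rewrite !Z_div_mult.
Qed.

Lemma Zdvd_nat (p : nat) (a : Z) : (Z.of_nat p | a)%Z <-> (p %| Z.abs_nat a)%N.
Proof.
split; first by move=> [q ->]; apply/dvdnP; exists (Z.abs_nat q); lia.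
move/dvdnP => [q Hq]; exists (Z.sgn a * Z.of_nat q)%Z.
have : a = (Z.sgn a * Z.of_nat (Z.abs_nat a))%Z by rewrite Zabs2Nat.id_abs Z.mul_comm Z.abs_sgn.
by rewrite Hq => E; rewrite {1}E Nat2Z.inj_mul; lia.
Qed.

Lemma nat_mul_abs (n p : nat) (q : Z) : (0 <= q)%Z -> Z.of_nat n = (q * Z.of_nat p)%Z -> n = (Z.abs_nat q * p)%N.
Proof. by move=> q0 E; apply: Nat2Z.inj; rewrite Nat2Z.inj_mul Zabs2Nat.id_abs Z.abs_eq. Qed.

Lemma Zprime_dvd (p : nat) (a b : Z) : prime p -> (Z.of_nat p | a * b)%Z -> (Z.of_nat p | a)%Z \/ (Z.of_nat p | b)%Z.
Proof.
move=> pp /Zdvd_nat; rewrite Zabs2Nat.inj_mul Euclid_dvdM // => /orP [] h; [left | right]; exact/Zdvd_nat.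
Qed.

(** By [three_mod4_dvd] the prime p divides both coordinates of a solution, which is divided by
    p. *)
Lemma r2_three p n : prime p -> (p %% 4 = 3)%N -> (0 < n)%N ->
  r2 (p * n) = if (p %| n)%N then r2 (n %/ p) else 0%N.
Proof.
move=> pp p3 n0; have p0 := prime_gt0 pp; have pZ : (0 < Z.of_nat p)%Z by lia.
have D a b : (a * a + b * b = Z.of_nat (p * n))%Z -> (Z.of_nat p | a)%Z.
  move=> E; apply/Zdvd_nat; apply: (three_mod4_dvd (b := Z.abs_nat b) pp p3).
  apply/dvdnP; exists n; apply: Nat2Z.inj; rewrite (mulnC n) -E; rewrite !expnS !expn0 !muln1; lia.
case: ifP => pn; last first.
  rewrite r2_size; case E: (sol (p * n)) => [|[a b] l] //.
  have : (a, b) \in sol (p * n) by rewrite E mem_head.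
  rewrite mem_sol /= => /Z.eqb_spec H; have [u Hu] := D a b H.
  have [v Hv] := D b a ltac:(lia).
  case/negP: (negbT pn); apply/dvdnP; exists (Z.abs_nat (u * u + v * v)).
  apply: nat_mul_abs; first by apply: Z.add_nonneg_nonneg; exact: Z.square_nonneg.
  apply: (Z.mul_reg_l _ _ (Z.of_nat p)); first lia.
  by rewrite -Nat2Z.inj_mul -H Hu Hv; ring.
have nE := divnK pn; have nZ : (Z.of_nat n = Z.of_nat (n %/ p) * Z.of_nat p)%Z by rewrite -Nat2Z.inj_mul; congr Z.of_nat.
rewrite !r2_size; apply: (size_bij (g := fun z => (z.1 / Z.of_nat p, z.2 / Z.of_nat p)%Z) (h := fun z => (z.1 * Z.of_nat p, z.2 * Z.of_nat p)%Z)); try exact: sol_uniq.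
- move=> [a b]; rewrite !mem_sol /= => /Z.eqb_spec H; apply/Z.eqb_spec.
  have [u Hu] := D a b H; have [v Hv] := D b a ltac:(lia).
  rewrite Hu Hv !Z_div_mult; [|lia|lia].
  apply: (Z.mul_reg_l _ _ (Z.of_nat p * Z.of_nat p)); first nia.
  by have := H; rewrite Nat2Z.inj_mul nZ Hu Hv; lia.
- move=> [a b]; rewrite !mem_sol /= => /Z.eqb_spec H; apply/Z.eqb_spec.
  by rewrite Nat2Z.inj_mul nZ -H; ring.
- move=> [a b]; rewrite !mem_sol /= => /Z.eqb_spec H.
  have [u Hu] := D a b H; have [v Hv] := D b a ltac:(lia).
  by rewrite Hu Hv !Z_div_mult //; lia.
- by move=> [a b] _ /=; rewrite !Z_div_mult //; lia.
Qed.

Lemma Zmod0 (a : Z) (p : nat) : (0 < p)%N -> Z.eqb (a mod Z.of_nat p) 0 <-> (Z.of_nat p | a)%Z.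
Proof.
move=> p0; have pn : Z.of_nat p <> 0%Z by lia.
by split => [/Z.eqb_spec /(Z.mod_divide _ _ pn)|/(Z.mod_divide _ _ pn) /Z.eqb_spec].
Qed.

(** For pi = u + i v of norm p, the filter says that p divides the real part of z times the
    conjugate of pi. Since p divides the norm of that product, it divides the imaginary part too, so
    z is divisible by pi; the bijection is division by pi. *)
Lemma sol_gauss p n (u v : Z) : prime p -> (0 < n)%N -> (u * u + v * v = Z.of_nat p)%Z ->
  size [seq z <- sol (p * n) | Z.eqb ((u * z.1 + v * z.2) mod Z.of_nat p) 0] = r2 n.
Proof.
move=> pp n0 PE; have p0 := prime_gt0 pp; have pZ : (0 < Z.of_nat p)%Z by lia.
have D2 a b : (a * a + b * b = Z.of_nat (p * n))%Z -> (Z.of_nat p | u * a + v * b)%Z -> (Z.of_nat p | u * b - v * a)%Z.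
  move=> E [q Hq]; suff /(Zprime_dvd pp) [] : (Z.of_nat p | (u * b - v * a) * (u * b - v * a))%Z by [].
  exists (Z.of_nat (p * n) - q * q * Z.of_nat p)%Z.
  have -> : ((u * b - v * a) * (u * b - v * a) = (u * u + v * v) * (a * a + b * b) - (u * a + v * b) * (u * a + v * b))%Z by ring.
  by rewrite E PE Hq; ring.
rewrite r2_size; apply: (size_bij (g := fun z => ((u * z.1 + v * z.2) / Z.of_nat p, (u * z.2 - v * z.1) / Z.of_nat p)%Z)
  (h := fun z => (u * z.1 - v * z.2, u * z.2 + v * z.1)%Z)).
- by rewrite filter_uniq // sol_uniq.
- exact: sol_uniq.
- move=> [a b]; rewrite mem_filter !mem_sol /= => /andP [/(Zmod0 _ p0) H1 /Z.eqb_spec E]; apply/Z.eqb_spec.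
  have [c Hc] := H1; have [d Hd] := D2 a b E H1; rewrite Hc Hd !Z_div_mult; try lia.
  apply: (Z.mul_reg_l _ _ (Z.of_nat p * Z.of_nat p)); first nia.
  have -> : (Z.of_nat p * Z.of_nat p * (c * c + d * d) = (u * a + v * b) * (u * a + v * b) + (u * b - v * a) * (u * b - v * a))%Z by rewrite Hc Hd; ring.
  have -> : ((u * a + v * b) * (u * a + v * b) + (u * b - v * a) * (u * b - v * a) = (u * u + v * v) * (a * a + b * b))%Z by ring.
  by rewrite E PE Nat2Z.inj_mul; ring.
- move=> [c d]; rewrite mem_sol /= => /Z.eqb_spec E; rewrite mem_filter mem_sol /=; apply/andP; split.
    apply/(Zmod0 _ p0); exists c.
    by rewrite -PE; ring.
  apply/Z.eqb_spec; rewrite Nat2Z.inj_mul -PE -E; ring.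
- move=> [a b]; rewrite mem_filter !mem_sol /= => /andP [/(Zmod0 _ p0) H1 /Z.eqb_spec E].
  have [c Hc] := H1; have [d Hd] := D2 a b E H1; rewrite Hc Hd !Z_div_mult; try lia.
  congr pair; apply: (Z.mul_reg_l _ _ (Z.of_nat p)); try lia.
    have -> : (Z.of_nat p * (u * c - v * d) = u * (c * Z.of_nat p) - v * (d * Z.of_nat p))%Z by ring.
    by rewrite -Hc -Hd -PE; ring.
  have -> : (Z.of_nat p * (u * d + v * c) = u * (d * Z.of_nat p) + v * (c * Z.of_nat p))%Z by ring.
  by rewrite -Hc -Hd -PE; ring.
- move=> [c d] _ /=.
  have -> : (u * (u * c - v * d) + v * (u * d + v * c) = c * Z.of_nat p)%Z by rewrite -PE; ring.
  have -> : (u * (u * d + v * c) - v * (u * c - v * d) = d * Z.of_nat p)%Z by rewrite -PE; ring.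
  by rewrite !Z_div_mult //; lia.
Qed.

Lemma sum_sq_ndvd p u v : prime p -> p = (u ^ 2 + v ^ 2)%N -> ~~ (p %| u)%N.
Proof.
move=> pp E; apply/negP => pu.
have pv : (p %| v)%N.
  have : (p %| v ^ 2)%N by rewrite -(dvdn_addr (m := u ^ 2)) -?E // expnS dvdn_mulr.
  by rewrite Euclid_dvdX // => /andP [].
have : (p ^ 2 %| p)%N by rewrite {2}E dvdn_add // dvdn_exp2r.
by move/(dvdn_leq (prime_gt0 pp)); have := prime_gt1 pp; rewrite expnS expn1; nia.
Qed.

(** Inclusion and exclusion: every solution for p n is divisible by u + i v or by its conjugate, and
    those divisible by both are the multiples of p. *)
Lemma r2_one p n : prime p -> (p %% 4 = 1)%N -> (0 < n)%N ->
  (r2 (p * n) + (if (p %| n)%N then r2 (n %/ p) else 0) = 2 * r2 n)%N.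
Proof.
move=> pp p1 n0; have p0 := prime_gt0 pp; have pZ : (0 < Z.of_nat p)%Z by lia.
have [u0 [v0 Huv]] := prime_two_squares pp p1.
pose u := Z.of_nat u0; pose v := Z.of_nat v0.
have PE : (u * u + v * v = Z.of_nat p)%Z by rewrite Huv !expnS !expn0 !muln1 Nat2Z.inj_add !Nat2Z.inj_mul.
have up : ~ (Z.of_nat p | u)%Z.
  by move=> /Zdvd_nat; rewrite Zabs2Nat.id; apply/negP; exact: (sum_sq_ndvd pp Huv).
have vp : ~ (Z.of_nat p | v)%Z.
  move=> /Zdvd_nat; rewrite Zabs2Nat.id; apply/negP; apply: (sum_sq_ndvd pp (v := u0)).
  by rewrite addnC.
have tp : ~ (Z.of_nat p | 2)%Z.
  move=> /Zdvd_nat /= /(dvdn_leq (isT : 0 < 2)%N) p2; move: p1 (prime_gt1 pp).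
  by case: (p) p2 => [|[|[|q]]].
pose a1 (z : Z * Z) := Z.eqb ((u * z.1 + v * z.2) mod Z.of_nat p) 0.
pose a2 (z : Z * Z) := Z.eqb ((u * z.1 + - v * z.2) mod Z.of_nat p) 0.
have C1 : count a1 (sol (p * n)) = r2 n by rewrite -size_filter; exact: sol_gauss.
have C2 : count a2 (sol (p * n)) = r2 n by rewrite -size_filter; apply: sol_gauss => //; rewrite -PE; ring.
have CU : count (predU a1 a2) (sol (p * n)) = r2 (p * n).
  rewrite r2_size -(count_predT (sol (p * n))); apply: eq_in_count => -[a b].
  rewrite mem_sol /= => /Z.eqb_spec E.
  have : (Z.of_nat p | (u * a + v * b) * (u * a + - v * b))%Z.
    exists (a * a - v * v * Z.of_nat n)%Z.
    have -> : ((u * a + v * b) * (u * a + - v * b) = (u * u + v * v) * (a * a) - v * v * (a * a + b * b))%Z by ring.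
    by rewrite E PE Nat2Z.inj_mul; ring.
  by case/(Zprime_dvd pp) => /(Zmod0 _ p0) h; rewrite /a1 /a2 /= h ?orbT.
have := count_predUI a1 a2 (sol (p * n)); rewrite C1 C2 CU mul2n -addnn => <-; congr addn.
symmetry.
have D a b : a1 (a, b) -> a2 (a, b) -> (Z.of_nat p | a)%Z /\ (Z.of_nat p | b)%Z.
  move=> /(Zmod0 _ p0) [s Hs] /(Zmod0 _ p0) [t Ht]; rewrite /= in Hs Ht.
  have H1 : (Z.of_nat p | 2 * (u * a))%Z by exists (s + t)%Z; lia.
  have H2 : (Z.of_nat p | 2 * (v * b))%Z by exists (s - t)%Z; lia.
  split.
    by case: (Zprime_dvd pp H1) => // /(Zprime_dvd pp) [].
  by case: (Zprime_dvd pp H2) => // /(Zprime_dvd pp) [].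
rewrite -size_filter; case: ifP => pn; last first.
  case E: (filter _ _) => [|[a b] l] //.
  have : (a, b) \in [seq x <- sol (p * n) | predI a1 a2 x] by rewrite E mem_head.
  rewrite mem_filter mem_sol => /andP [/andP [h1 h2] /Z.eqb_spec H].
  have [[x Hx] [y Hy]] := D _ _ h1 h2; rewrite /= in H.
  case/negP: (negbT pn); apply/dvdnP; exists (Z.abs_nat (x * x + y * y)).
  apply: nat_mul_abs; first by apply: Z.add_nonneg_nonneg; exact: Z.square_nonneg.
  apply: (Z.mul_reg_l _ _ (Z.of_nat p)); first lia.
  by rewrite -Nat2Z.inj_mul -H Hx Hy; ring.
have nE := divnK pn; have nZ : (Z.of_nat n = Z.of_nat (n %/ p) * Z.of_nat p)%Z by rewrite -Nat2Z.inj_mul; congr Z.of_nat.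
rewrite r2_size; apply: (size_bij (g := fun z => (z.1 / Z.of_nat p, z.2 / Z.of_nat p)%Z) (h := fun z => (z.1 * Z.of_nat p, z.2 * Z.of_nat p)%Z)).
- by rewrite filter_uniq // sol_uniq.
- exact: sol_uniq.
- move=> [a b]; rewrite mem_filter !mem_sol => /andP [/andP [h1 h2] /Z.eqb_spec H]; apply/Z.eqb_spec.
  have [[x Hx] [y Hy]] := D _ _ h1 h2; rewrite /= in H *.
  rewrite Hx Hy !Z_div_mult; [|lia|lia].
  apply: (Z.mul_reg_l _ _ (Z.of_nat p * Z.of_nat p)); first nia.
  by have := H; rewrite Nat2Z.inj_mul nZ Hx Hy; lia.
- move=> [a b]; rewrite mem_sol => /Z.eqb_spec H; rewrite mem_filter mem_sol; apply/andP; split; last first.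
    by apply/Z.eqb_spec; rewrite Nat2Z.inj_mul nZ -H /=; ring.
  apply/andP; split; apply/(Zmod0 _ p0) => /=.
    by exists (u * a + v * b)%Z; ring.
  by exists (u * a - v * b)%Z; ring.
- move=> [a b]; rewrite mem_filter => /andP [/andP [h1 h2] _].
  have [[x Hx] [y Hy]] := D _ _ h1 h2; rewrite /=.
  by rewrite Hx Hy !Z_div_mult //; lia.
- by move=> [a b] _ /=; rewrite !Z_div_mult //; lia.
Qed.

Lemma jacobi n : (0 < n)%N -> INR (r2 n) = 4 * dchi n.
Proof.
elim/ltn_ind: n => n IH n0.
have [n1|n1] := leqP n 1.
  have -> : n = 1%N by lia.
  have -> : r2 1 = 4%N by [].
  by rewrite /dchi (_ : divisors 1 = [:: 1%N]) // big_cons big_nil /chi /=; lra.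
have pp := pdiv_prime n1; set p := pdiv n in pp; have p1 := prime_gt1 pp.
have [m mE] : exists m, n = (p * m)%N by exists (n %/ p)%N; rewrite mulnC divnK // pdiv_dvd.
have m0 : (0 < m)%N by move: n0; rewrite mE muln_gt0 => /andP [].
have IHm : INR (r2 m) = 4 * dchi m by apply: IH => //; nia.
have IHp : (p %| m)%N -> INR (r2 (m %/ p)) = 4 * dchi (m %/ p).
  move=> pm; apply: IH; last by rewrite divn_gt0 ?prime_gt0 // dvdn_leq.
  by have := leq_div m p; nia.
rewrite mE dchi_rec //.
have : (p %% 4 < 4)%N by rewrite ltn_mod.
case E: (p %% 4)%N => [|[|[|[|q]]]] // _.
- have : (2 %| p)%N by apply: (@dvdn_trans 4) => //; rewrite /dvdn E.
  by rewrite dvdn_prime2 // => /eqP E2; rewrite -E2 in E.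
- have := r2_one pp E m0 => H; have {}H := congr1 INR H.
  rewrite plus_INR mult_INR IHm in H.
  have -> : chi p = 1 by rewrite /chi E.
  move: H; case: ifP => pm; rewrite ?IHp // /=; lra.
- have p2 : p = 2%N.
    have : (2 %| p)%N by rewrite /dvdn -(@modn_dvdm 4) // E.
    by rewrite dvdn_prime2 // => /eqP.
  have -> : chi p = 0 by rewrite /chi E.
  by rewrite p2 r2_two IHm; ring.
- have -> : chi p = -1 by rewrite /chi E.
  rewrite r2_three //; case: ifP => pm; rewrite ?IHp //=; ring.
Qed.
End Jacobi.

(** * Passage between the two models of the complex numbers *)

Module KloostermanTransfer.
Import Reals.
Import Coquelicot.
Import all_boot all_order all_algebra all_field.
Import mathcomp.algebra_tactics.ring mathcomp.algebra_tactics.lra zify.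
Import mathcomp.real_closed.complex.
Import Rstruct.
Import KloostermanSums Fourier ProgressionSums.
Set Implicit Arguments. Unset Strict Implicit. Unset Printing Implicit Defensive.
Import Order.TTheory GRing.Theory Num.Theory.
Local Open Scope ring_scope.

Definition CofRi (z : R[i]) : C := (complex.Re z, complex.Im z).

Lemma CofRi_sum (I : Type) (s : seq I) (P : pred I) (F : I -> R[i]) :
  CofRi (\sum_(i <- s | P i) F i) = \big[Cplus/RtoC (IZR Z0)]_(i <- s | P i) CofRi (F i).
Proof.
apply: (big_morph CofRi) => [[a b] [c d]|]; first by [].
by [].
Qed.

Lemma Cmod_CofRi z : (Cmod (CofRi z))%:C%C = `|z|.
Proof.
case: z => a b; rewrite normc_def /Cmod RsqrtE.
by rewrite RplusE !RpowE.
Qed.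

Lemma klc_kl r m c : klc r m c = CofRi (kl r m c).
Proof.
rewrite /klc /kl CofRi_sum; apply: eq_bigr => x _; rewrite CofRi_sum; apply: eq_bigr => y _.
by rewrite /Ec /E /CofRi /ec /= two_R INRE INRE RdivE !RmultE.
Qed.

(** The weight K is hidden behind an existential: the final estimate uses its positivity, the bound
    that it gives for each modulus, and its average over moduli. *)
Lemma klc_weight (e : R) : Rlt (IZR Z0) e -> exists (C0 : R) (K : nat -> nat -> R),
  [/\ Rle (IZR Z0) C0, forall h c, Rle (IZR Z0) (K h c),
  forall h c r m : nat, (0 < h)%N -> (0 < c)%N ->
    (forall p, prime p -> (2 < p)%N -> (p %| c)%N -> ~~ (p %| h)%N -> ~~ (p %| r)%N) ->
    Rle (Cmod (klc r m c)) (Rmult (Rmult (Rpower (INR c) e) (sqrt (INR c))) (K h c)),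
  forall h D : nat, (0 < h)%N -> (0 < D)%N ->
    Rle (\big[Rplus/IZR Z0]_(1 <= c < D.+1) K h c)
      (Rmult (Rmult (Rmult C0 (INR D)) (Rpower (INR h) e)) (Rpower (INR D) (Rplus e e))) &
  forall D : nat, (0 < D)%N ->
    Rle (\big[Rplus/IZR Z0]_(1 <= c < D.+1) Rinv (INR c)) (Rmult C0 (Rpower (INR D) e))].
Proof.
move=> /RltP e0; have [C1 [C10 H1]] := kl_bound e0; have [C2 [C20 H2]] := kl_weight_sum e0.
have [C3 [C30 H3]] := harmonic_le e0.
have kw0 h c : 0 <= kl_weight h c.
  rewrite /kl_weight; apply: sumr_ge0 => k _; apply: sumr_ge0 => l _; apply: sumr_ge0 => g _.
  by case: ifP => // _; rewrite mulr_ge0 ?ler0n ?sqrtr_ge0.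
exists (C1 * C2 + C3), (fun h c => C1 * kl_weight h c); split.
- by apply/RleP; rewrite addr_ge0 ?mulr_ge0 ?ltW.
- by move=> h c; apply/RleP; rewrite mulr_ge0 // ltW.
- move=> h c r m h0 c0 Hr; apply/RleP; rewrite -lecR klc_kl Cmod_CofRi.
  apply: le_trans (H1 h c r m h0 c0 Hr) _; rewrite lecR RsqrtE !INRE !RmultE /pw.
  by rewrite le_eqVlt; apply/orP; left; apply/eqP; ring.
- move=> h D h0 D0; apply/RleP; have -> : \big[Rplus/IZR Z0]_(1 <= c < D.+1) (C1 * kl_weight h c) = C1 * \sum_(1 <= c < D.+1) kl_weight h c.
    by rewrite mulr_sumr.
  have := H2 h D h0 D0; rewrite !INRE !RmultE RplusE /pw => L.
  apply: le_trans (_ : C1 * (C2 * D%:R * Rpower h%:R e * Rpower D%:R (e + e)) <= _); first by rewrite ler_wpM2l // ltW.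
  rewrite !mulrA !ler_wpM2r ?ler0n //; try by apply/ltW/RltP; exact: exp_pos.
  by rewrite lerDl ltW.
- move=> D D0; apply/RleP; have := H3 D D0; rewrite !INRE RmultE /pw => L.
  have -> : \big[Rplus/IZR Z0]_(1 <= c < D.+1) Rinv (INR c) = \sum_(1 <= c < D.+1) c%:R^-1.
    by apply: eq_bigr => c _; rewrite INRE.
  apply: le_trans L _; rewrite ler_wpM2r //; first by apply/ltW/RltP; exact: exp_pos.
  by rewrite lerDr mulr_ge0 ?ltW.
Qed.
End KloostermanTransfer.

(** * The hyperbola method and the final estimate *)

Module ShiftedSum.
Import Reals Lra Lia Psatz ZArith Coquelicot.
Import ssreflect ssrfun ssrbool eqtype ssrnat seq choice fintype bigop div prime.
Import zify ssrZ.
Import Defs.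
Import Fourier ProgressionSums CuspForms Jacobi KloostermanTransfer.
Set Implicit Arguments. Unset Strict Implicit. Unset Printing Implicit Defensive.
Open Scope R_scope.

Lemma Rp_base x y e : 0 < x -> x <= y -> 0 <= e -> Rpower x e <= Rpower y e.
Proof.
move=> x0 xy e0; rewrite /Rpower; apply: exp_leq; apply: Rmult_le_compat_l => //; exact: ln_le.
Qed.

Lemma Rp_expo x s t : 1 <= x -> s <= t -> Rpower x s <= Rpower x t.
Proof.
move=> x1 st; rewrite /Rpower; apply: exp_leq; apply: Rmult_le_compat_r => //.
by rewrite -ln_1; apply: ln_le; lra.
Qed.

Lemma Rp_ge1 x e : 1 <= x -> 0 <= e -> 1 <= Rpower x e.
Proof. by move=> x1 e0; rewrite -(Rp_1 e); apply: Rp_base; lra. Qed.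

Lemma ln_le_Rp x e : 0 < e -> ln x <= Rpower x e / e.
Proof.
move=> e0; apply: (Rmult_le_reg_l e) => //; have := exp_ineq1_le (e * ln x); rewrite -/(Rpower x e).
have -> : e * (Rpower x e / e) = Rpower x e by field; lra.
lra.
Qed.

Lemma prefix_diff (P : pred nat) (F : nat -> C) a b B : (a <= b)%N ->
  Cmod (\csum_(1 <= n < a.+1 | P n) F n) <= B -> Cmod (\csum_(1 <= n < b.+1 | P n) F n) <= B ->
  Cmod (\csum_(a.+1 <= n < b.+1 | P n) F n) <= 2 * B.
Proof.
move=> ab Ha Hb.
have -> : \csum_(a.+1 <= n < b.+1 | P n) F n = (\csum_(1 <= n < b.+1 | P n) F n - \csum_(1 <= n < a.+1 | P n) F n)%C.
  by rewrite [X in _ = (X - _)%C](@big_cat_nat _ _ _ a.+1) //=; ring.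
apply: Rle_trans (Cmod_triangle _ _) _; rewrite Cmod_opp; lra.
Qed.

Section APBound.
Variables (k : nat) (g : C -> C) (lam : nat -> C) (th e : R) (K : nat -> nat -> R).
Hypotheses (nf : nice k g lam) (Hth : eigenvalue_bound lam th) (th0 : 0 <= th) (e0 : 0 < e).
Hypothesis K0 : forall h c, 0 <= K h c.
Hypothesis HK : forall h c r m : nat, (0 < h)%N -> (0 < c)%N ->
    (forall p, prime p -> (2 < p)%N -> (p %| c)%N -> ~~ (p %| h)%N -> ~~ (p %| r)%N) ->
    Cmod (klc r m c) <= Rpower (INR c) e * sqrt (INR c) * K h c.

Definition wsg h d := sg d (fun c => sqrt (INR c) * K h c).

Lemma wsg_ge0 h d : 0 <= wsg h d.
Proof. by apply: sg_ge0 => c; apply: Rmult_le_pos; [exact: sqrt_pos | exact: K0]. Qed.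

(** The bound of [block_bound] for the modulus d, freed of constants, logarithms and epsilon powers.
    All indices and moduli that occur are at most 8 N. *)
Definition ap_term (N h Y d : nat) : R :=
  INR (8 * N) / (INR d * INR Y) * wsg h d + (INR Y / INR d + 1) * Rpower (INR (8 * N)) th.

Lemma ap_term_ge0 N h Y d : (0 < N)%N -> (0 < d)%N -> (0 < Y)%N -> 0 <= ap_term N h Y d.
Proof.
move=> N0 d0 Y0; have := INR_pos d0; have := INR_pos Y0; have N8 : (0 < 8 * N)%N by lia.
have := INR_pos N8 => ? ? ?; apply: Rplus_le_le_0_compat; apply: Rmult_le_pos.
- by apply: Rmult_le_pos; [lra | left; apply: Rinv_0_lt_compat; nra].
- exact: wsg_ge0.
- by apply: Rplus_le_le_0_compat; [apply: Rmult_le_pos; [lra | left; exact: Rinv_0_lt_compat] | lra].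
- by left; exact: Rp_gt0.
Qed.

Lemma ap_prefix : exists C1, 0 <= C1 /\ forall N h d r b Y, (0 < h)%N -> (0 < N)%N -> (0 < d <= 8 * N)%N ->
  (0 < Y <= 2 * N)%N -> (b <= 2 * N)%N ->
  (forall p, prime p -> (2 < p)%N -> (p %| d)%N -> ~~ (p %| h)%N -> ~~ (p %| r)%N) ->
  Cmod (\csum_(1 <= n < b.+1 | (n == r %[mod d])%N) lam n) <=
  C1 * Rpower (INR (8 * N)) e ^ 3 * ap_term N h Y d.
Proof.
have [A HA] := Hth e0; have [C0 [de [c0 d0 HB]]] := block_bound nf.
pose A' := Rmax A 0; have A0 : 0 <= A' by exact: Rmax_r.
have ld : 0 < ln (1 + de) by rewrite -ln_1; apply: ln_increasing; lra.
have il := Rinv_0_lt_compat _ ld; have ie := Rinv_0_lt_compat _ e0.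
exists (C0 * (2 + / e) * (1 + A') * (1 + / e * / ln (1 + de))); split.
  have : 0 < / e * / ln (1 + de) by exact: Rmult_lt_0_compat.
  by move=> ?; do 3 (try apply: Rmult_le_pos); lra.
move=> N h d r b Y h0 N0 /andP [d1 dN] /andP [Y0 YN] bN Hr.
set T := INR (8 * N); set P := Rpower T e.
have T1 : 1 <= T by apply: INR_ge1; lia.
have P1 : 1 <= P by apply: Rp_ge1; lra.
have up n : (0 < n <= 8 * N)%N -> Rpower (INR n) e <= P.
  by move=> /andP [n0 nN]; apply: Rp_base; [exact: INR_pos | exact: INR_leq | lra].
have lnP n : (0 < n <= 8 * N)%N -> ln (INR n) <= / e * P.
  move=> Hn; apply: Rle_trans (ln_le_Rp _ e0) _; rewrite /Rdiv Rmult_comm.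
  by apply: Rmult_le_compat_l; [lra | exact: up].
case: (posnP b) => [->|b0].
  rewrite big_geq // Cmod_0; apply: Rmult_le_pos; last exact: ap_term_ge0.
  have : 0 < / e * / ln (1 + de) by exact: Rmult_lt_0_compat.
  by move=> ?; do 4 (try apply: Rmult_le_pos); try (apply: pow_le); lra.
have t0 := ap_term_ge0 h N0 d1 Y0.
set u := T / (INR d * INR Y) * wsg h d; set v := (INR Y / INR d + 1) * Rpower T th.
have dR := INR_pos d1; have YR := INR_pos Y0.
have u0 : 0 <= u.
  apply: Rmult_le_pos; last exact: wsg_ge0.
  by apply: Rmult_le_pos; [lra | left; apply: Rinv_0_lt_compat; nra].
have v0 : 0 <= v.
  apply: Rmult_le_pos; last by left; exact: Rp_gt0.
  by apply: Rplus_le_le_0_compat; [apply: Rmult_le_pos; [lra | left; exact: Rinv_0_lt_compat] | lra].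
have tE : ap_term N h Y d = u + v by [].
rewrite tE.
(* One power of P pays for ln Y and one for the factor c^e in Weil's bound; the number of blocks
   will take a third. *)
pose B := C0 * (2 + / e) * (1 + A') * P ^ 2 * (u + v).
have B0 : 0 <= B by do 4 (try apply: Rmult_le_pos); try (apply: pow_le); lra.
rewrite big_mkcond /=.
have BL lo hi : (hi <= b.+1)%N -> block de lo hi ->
    Cmod (\csum_(lo <= n < hi) (if (n == r %[mod d])%N then lam n else RtoC 0)) <= B.
  move=> hb bl; rewrite -big_mkcond.
  case: (leqP hi lo) => hl; first by rewrite big_geq // Cmod_0.
  have W0 := wsg_ge0 h d.
  have h1 c : 0 <= P * (sqrt (INR c) * K h c).
    by apply: Rmult_le_pos; [lra | apply: Rmult_le_pos; [exact: sqrt_pos | exact: K0]].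
  have h2 c m : (0 < c)%N -> (c %| d)%N -> Cmod (klc r m c) <= P * (sqrt (INR c) * K h c).
    move=> cp cd; apply: Rle_trans (HK m h0 cp _) _.
      by move=> p pp p2 pc; apply: Hr => //; exact: dvdn_trans pc cd.
    rewrite Rmult_assoc; apply: Rmult_le_compat_r; first by apply: Rmult_le_pos; [exact: sqrt_pos | exact: K0].
    by apply: up; rewrite cp; apply: leq_trans (dvdn_leq d1 cd) dN.
  have h3 : 0 <= A' * (Rpower T th * P).
    by apply: Rmult_le_pos => //; apply: Rmult_le_pos; [left; exact: Rp_gt0 | lra].
  have h4 n : (0 < n <= hi + Y)%N -> Cmod (lam n) <= A' * (Rpower T th * P).
    move=> /andP [n0 nh]; have := HA n ltac:(lia); have nR := INR_pos n0 => L; apply: Rle_trans L _.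
    apply: (Rle_trans _ (A' * Rpower (INR n) (th + e))).
      by apply: Rmult_le_compat_r; [left; exact: Rp_gt0 | exact: Rmax_l].
    apply: Rmult_le_compat_l => //; rewrite -Rpower_plus; apply: Rp_base => //; last lra.
    by apply: INR_leq; lia.
  have := HB lo hi d r Y _ _ bl d1 Y0 h1 h2 h3 h4.
  move=> L; apply: Rle_trans L _.
  have -> : sg d (fun c => P * (sqrt (INR c) * K h c)) = P * wsg h d.
    rewrite /wsg /sg -rsum_scal; apply: eq_bigr => c _; ring.
  have l1 : 2 + ln (INR Y) <= (2 + / e) * P.
    by have := lnP Y ltac:(lia); nra.
  have l2 : INR lo / (INR d * INR Y) <= T / (INR d * INR Y).
    apply: Rmult_le_compat_r; first by left; apply: Rinv_0_lt_compat; nra.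
    by apply: INR_leq; lia.
  have l3 : 0 <= INR lo / (INR d * INR Y).
    by apply: Rmult_le_pos; [exact: pos_INR | left; apply: Rinv_0_lt_compat; nra].
  have l4 : INR lo / (INR d * INR Y) * (2 + ln (INR Y)) * (P * wsg h d) <= u * ((2 + / e) * P ^ 2).
    have -> : u * ((2 + / e) * P ^ 2) = T / (INR d * INR Y) * ((2 + / e) * P) * (P * wsg h d) by rewrite /u; ring.
    apply: Rmult_le_compat_r; first by apply: Rmult_le_pos; lra.
    apply: Rmult_le_compat => //.
    have : 0 <= ln (INR Y) by rewrite -ln_1; apply: ln_le; [lra | exact: INR_ge1].
    lra.
  have l5 : (INR Y / INR d + 1) * (A' * (Rpower T th * P)) <= v * (A' * P ^ 2).
    have -> : (INR Y / INR d + 1) * (A' * (Rpower T th * P)) = v * (A' * P) by rewrite /v; ring.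
    apply: Rmult_le_compat_l => //; apply: Rmult_le_compat_l => //; nra.
  have -> : B = C0 * ((2 + / e) * (1 + A') * P ^ 2 * (u + v)) by rewrite /B; ring.
  apply: Rmult_le_compat_l => //; apply: Rle_trans (Rplus_le_compat _ _ _ _ l4 l5) _.
  have P2 : 0 <= P ^ 2 by apply: pow_le; lra.
  have a1 : u * ((2 + / e) * P ^ 2) <= (2 + / e) * (1 + A') * P ^ 2 * u.
    have : 0 <= (2 + / e) * P ^ 2 * u * A' by do 3 (try apply: Rmult_le_pos); lra.
    by nra.
  have a2 : v * (A' * P ^ 2) <= (2 + / e) * (1 + A') * P ^ 2 * v.
    have : 0 <= P ^ 2 * v * ((2 + / e) * (1 + A') - A') by apply: Rmult_le_pos; [exact: Rmult_le_pos | nra].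
    by nra.
  by rewrite Rmult_plus_distr_l; apply: Rplus_le_compat.
apply: Rle_trans (block_log d0 B0 BL b0) _.
have -> : C0 * (2 + / e) * (1 + A') * (1 + / e * / ln (1 + de)) * P ^ 3 * (u + v) = B * ((1 + / e * / ln (1 + de)) * P) by rewrite /B; ring.
apply: Rmult_le_compat_l => //.
have := lnP b ltac:(lia) => L.
have : ln (INR b) / ln (1 + de) <= / e * P * / ln (1 + de) by apply: Rmult_le_compat_r; lra.
by lra.
Qed.
End APBound.

Lemma rsum_exch (N M : nat) (F : nat -> nat -> R) (Q : nat -> nat -> bool) :
  \rsum_(1 <= d < N.+1) \rsum_(1 <= c < M.+1 | Q d c) F d c =
  \rsum_(1 <= c < M.+1) \rsum_(1 <= d < N.+1 | Q d c) F d c.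
Proof.
rewrite (eq_bigr (fun d => \rsum_(1 <= c < M.+1) (if Q d c then F d c else 0))) => [|d _]; last by rewrite big_mkcond.
by rewrite exchange_big /=; apply: eq_bigr => c _; rewrite -big_mkcond.
Qed.

Lemma multiples_sum Q c (F : nat -> R) : (0 < c)%N -> (forall d, 0 <= F d) ->
  \rsum_(1 <= d < Q.+1 | (c %| d)%N) F (d %/ c)%N <= \rsum_(1 <= j < Q.+1) F j.
Proof.
move=> c0 F0.
have -> : \rsum_(1 <= d < Q.+1 | (c %| d)%N) F (d %/ c)%N = \rsum_(j <- [seq (d %/ c)%N | d <- index_iota 1 Q.+1 & (c %| d)%N]) F j.
  by rewrite big_map big_filter.
rewrite (_ : \rsum_(j <- _) F j = \rsum_(1 <= j < Q.+1 | j \in [seq (d %/ c)%N | d <- index_iota 1 Q.+1 & (c %| d)%N]) F j).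
  exact: rsum_filter_le.
rewrite -[RHS]big_filter; apply: perm_big; apply: uniq_perm; rewrite ?filter_uniq ?iota_uniq //.
  rewrite map_inj_in_uniq ?filter_uniq ?iota_uniq // => x y.
  rewrite !mem_filter => /andP [cx _] /andP [cy _] E.
  by rewrite -(divnK cx) E divnK.
move=> j; rewrite mem_filter; case: (boolP (j \in map _ _)) => //= /mapP [d].
rewrite mem_filter mem_index_iota => /andP [cd /andP [d0 dQ]] ->.
rewrite mem_index_iota divn_gt0 // dvdn_leq //=.
by rewrite (leq_ltn_trans (leq_div d c) dQ).
Qed.

(** Writing d = c j turns the weight c^(3/2) / d into c^(1/2) / j. The sum over j is harmonic, and
    the one over c is at most sqrt Q times the sum of K, that is about Q^(3/2), which is of order
    N^(3/4) as Q <= 4 sqrt N. The condition Q <= 4 Y absorbs the 1 in Y / d + 1. *)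
Lemma ap_term_sum (e th : R) (K : nat -> nat -> R) C0 : 0 < e -> 0 <= th -> 0 <= C0 -> (forall h c, 0 <= K h c) ->
  (forall h D : nat, (0 < h)%N -> (0 < D)%N ->
     \rsum_(1 <= c < D.+1) K h c <= C0 * INR D * Rpower (INR h) e * Rpower (INR D) (e + e)) ->
  (forall D : nat, (0 < D)%N -> \rsum_(1 <= c < D.+1) / INR c <= C0 * Rpower (INR D) e) ->
  exists C1, 0 <= C1 /\ forall N h Y Q, (0 < h <= N)%N -> (0 < Y)%N -> (0 < Q <= 4 * Y)%N -> (Q * Q <= 16 * N)%N ->
    \rsum_(1 <= d < Q.+1) ap_term th K N h Y d <=
    C1 * Rpower (INR (8 * N)) e ^ 4 *
      (INR (8 * N) * Rpower (INR N) (3 / 4) / INR Y + INR Y * Rpower (INR (8 * N)) th).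
Proof.
move=> e0 th0 C00 K0 HK HH.
pose c4 := Rpower 4 (3 / 2); have c40 : 0 < c4 by exact: Rp_gt0.
exists (C0 * C0 * c4 + C0 + 4); split; first by nra.
move=> N h Y Q /andP [h0 hN] Y0 /andP [Q0 QY] QN.
have N0 : (0 < N)%N by lia.
set T := INR (8 * N); set P := Rpower T e.
have T1 : 1 <= T by apply: INR_ge1; lia.
have P1 : 1 <= P by apply: Rp_ge1; lra.
have up n : (0 < n <= 8 * N)%N -> Rpower (INR n) e <= P.
  by move=> /andP [n0 nN]; apply: Rp_base; [exact: INR_pos | exact: INR_leq | lra].
have QN' : (Q <= 8 * N)%N by nia.
have YR := INR_pos Y0; have QR := INR_pos Q0; have NR := INR_pos N0.
have iY := Rinv_0_lt_compat _ YR.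
have Hh := HH Q Q0; set H := \rsum_(1 <= c < Q.+1) / INR c in Hh.
have H0 : 0 <= H.
  by rewrite /H big_seq; apply: rsum_ge0 => c; rewrite mem_index_iota => /andP [c0 _]; left; apply: Rinv_0_lt_compat; exact: INR_pos.
have HP : H <= C0 * P.
  by apply: Rle_trans Hh _; apply: Rmult_le_compat_l => //; apply: up; lia.
have KP : \rsum_(1 <= c < Q.+1) K h c <= C0 * INR Q * P ^ 3.
  apply: Rle_trans (HK h Q h0 Q0) _; rewrite Rpower_plus.
  have a1 : Rpower (INR h) e <= P by apply: up; lia.
  have a2 : Rpower (INR Q) e <= P by apply: up; lia.
  have b1 := Rp_gt0 (INR h) e; have b2 := Rp_gt0 (INR Q) e.
  rewrite !Rmult_assoc; apply: Rmult_le_compat_l => //; apply: Rmult_le_compat_l; first lra.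
  have -> : P ^ 3 = P * (P * P) by ring.
  by apply: Rmult_le_compat => //; [lra | nra | apply: Rmult_le_compat; lra].
have S1 : \rsum_(1 <= d < Q.+1) (/ INR d * wsg K h d) <= H * (sqrt (INR Q) * (C0 * INR Q * P ^ 3)).
  have -> : \rsum_(1 <= d < Q.+1) (/ INR d * wsg K h d) =
    \rsum_(1 <= d < Q.+1) \rsum_(1 <= c < Q.+1 | (c %| d)%N) (/ INR (d %/ c) * (sqrt (INR c) * K h c)).
    rewrite big_seq [RHS]big_seq; apply: eq_bigr => d; rewrite mem_index_iota => /andP [d0 dQ].
    rewrite /wsg /sg -rsum_scal.
    rewrite [RHS](@big_cat_nat _ _ _ d.+1) //= [X in _ = _ + X]big_nat_cond [X in _ = _ + X]big1 ?Rplus_0_r; last first.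
      by move=> c /andP [/andP [dc _] /(dvdn_leq d0)]; lia.
    rewrite big_nat_cond [RHS]big_nat_cond; apply: eq_bigr => c /andP [/andP [c0 _] cd].
    have q0 : (0 < d %/ c)%N by rewrite divn_gt0 // dvdn_leq.
    rewrite -{1}(divnK cd) mult_INR; have := INR_pos q0; have := INR_pos c0 => ? ?.
    by field; lra.
  rewrite rsum_exch.
  apply: (Rle_trans _ (\rsum_(1 <= c < Q.+1) (H * (sqrt (INR Q) * K h c)))).
    rewrite big_seq [X in _ <= X]big_seq; apply: rsum_le => c; rewrite mem_index_iota => /andP [c0 cQ].
    have -> : \rsum_(1 <= d < Q.+1 | (c %| d)%N) (/ INR (d %/ c) * (sqrt (INR c) * K h c)) =
       (sqrt (INR c) * K h c) * \rsum_(1 <= d < Q.+1 | (c %| d)%N) (/ INR (d %/ c)).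
      by rewrite -rsum_scal; apply: eq_bigr => d _; ring.
    rewrite Rmult_comm; apply: Rmult_le_compat.
    - by apply: rsum_ge0 => d _; case: (posnP (d %/ c)) => [->|q0]; [rewrite /= Rinv_0; right | left; apply: Rinv_0_lt_compat; exact: INR_pos].
    - by apply: Rmult_le_pos; [exact: sqrt_pos | exact: K0].
    - apply: (@multiples_sum Q c (fun j => / INR j) c0) => j.
      by case: (posnP j) => [->|q0]; [rewrite /= Rinv_0; right | left; apply: Rinv_0_lt_compat; exact: INR_pos].
    - by apply: Rmult_le_compat_r; [exact: K0 | apply: sqrt_le_1_alt; apply: INR_leq].
  rewrite !rsum_scal; apply: Rmult_le_compat_l => //; apply: Rmult_le_compat_l => //; exact: sqrt_pos.
have Q4 : sqrt (INR Q) * INR Q <= c4 * Rpower (INR N) (3 / 4).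
  have Qs : INR Q <= 4 * sqrt (INR N).
    have -> : 4 * sqrt (INR N) = sqrt (16 * INR N).
      by rewrite sqrt_mult; [rewrite (_ : 16 = 4 * 4) ?sqrt_square; lra | lra | lra].
    rewrite -(sqrt_square (INR Q)); last lra.
    by apply: sqrt_le_1_alt; rewrite -mult_INR; have -> : 16 * INR N = INR (16 * N); [rewrite mult_INR /=; ring | exact: INR_leq].
  have -> : sqrt (INR Q) * INR Q = Rpower (INR Q) (3 / 2).
    rewrite -Rp_half // -{2}(Rpower_1 (INR Q)) // -Rpower_plus; congr Rpower; field.
  apply: Rle_trans (Rp_base QR Qs _) _; first lra.
  have sN := sqrt_lt_R0 _ NR.
  rewrite Rp_mul; [|lra|lra]; right; congr Rmult; rewrite -Rp_half // Rpower_mult; congr Rpower; field.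
have th1 : 0 < Rpower T th by exact: Rp_gt0.
have P4 : P <= P ^ 4 by have : 1 <= P ^ 3; [apply: pow_R1_Rle | move=> ?; rewrite (_ : P ^ 4 = P * P ^ 3); [nra | ring]].
have P41 : 1 <= P ^ 4 by lra.
have QYR : INR Q <= 4 * INR Y by have -> : 4 * INR Y = INR (4 * Y); [rewrite mult_INR /=; ring | exact: INR_leq].
have -> : \rsum_(1 <= d < Q.+1) ap_term th K N h Y d =
  T / INR Y * (\rsum_(1 <= d < Q.+1) (/ INR d * wsg K h d)) + Rpower T th * (INR Y * H + INR Q).
  have -> : INR Q = \rsum_(1 <= d < Q.+1) 1 by rewrite rsum_const count_predT size_iota subn1 /=; ring.
  rewrite /H -[T / INR Y * _]rsum_scal -[INR Y * _]rsum_scal -big_split -[Rpower T th * _]rsum_scal -big_split /=.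
  rewrite big_seq [RHS]big_seq; apply: eq_bigr => d; rewrite mem_index_iota => /andP [d0 _].
  have dR := INR_pos d0; rewrite /ap_term -/T; field; lra.
set Z := Rpower (INR N) (3 / 4) in Q4 *; have Z0 : 0 < Z by exact: Rp_gt0.
have TY : 0 <= T / INR Y by apply: Rmult_le_pos; lra.
have p1 : T / INR Y * (\rsum_(1 <= d < Q.+1) (/ INR d * wsg K h d)) <= C0 * C0 * c4 * P ^ 4 * (T * Z / INR Y).
  have -> : C0 * C0 * c4 * P ^ 4 * (T * Z / INR Y) = T / INR Y * (C0 * P * ((c4 * Z) * (C0 * P ^ 3))) by rewrite /Rdiv; ring.
  apply: Rmult_le_compat_l => //; apply: Rle_trans S1 _.
  have P3 : 0 <= C0 * P ^ 3 by apply: Rmult_le_pos => //; apply: pow_le; lra.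
  have sQ := sqrt_pos (INR Q).
  apply: Rmult_le_compat => //.
    by apply: Rmult_le_pos => //; rewrite (_ : C0 * INR Q * P ^ 3 = C0 * P ^ 3 * INR Q); [nra | ring].
  have -> : sqrt (INR Q) * (C0 * INR Q * P ^ 3) = (sqrt (INR Q) * INR Q) * (C0 * P ^ 3) by ring.
  exact: Rmult_le_compat_r.
have p2 : Rpower T th * (INR Y * H + INR Q) <= (C0 + 4) * P ^ 4 * (INR Y * Rpower T th).
  have -> : (C0 + 4) * P ^ 4 * (INR Y * Rpower T th) = Rpower T th * (INR Y * ((C0 + 4) * P ^ 4)) by ring.
  apply: Rmult_le_compat_l; first lra.
  apply: (Rle_trans _ (INR Y * (C0 * P + 4))); first by nra.
  by apply: Rmult_le_compat_l; [lra | nra].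
have g1 : 0 <= T * Z / INR Y by do 2 (try apply: Rmult_le_pos); lra.
have g2 : 0 <= INR Y * Rpower T th by nra.
set X1 := T * Z / INR Y in p1 g1 *; set X2 := INR Y * Rpower T th in p2 g2 *; set P' := P ^ 4 in P41 p1 p2 *.
apply: Rle_trans (Rplus_le_compat _ _ _ _ p1 p2) _.
have c1 : 0 <= C0 * C0 * c4 by nra.
have : 0 <= (C0 + 4) * P' * X1 by apply: Rmult_le_pos => //; apply: Rmult_le_pos; lra.
have : 0 <= C0 * C0 * c4 * P' * X2 by apply: Rmult_le_pos => //; apply: Rmult_le_pos; lra.
by move=> ? ?; rewrite !Rmult_plus_distr_r !Rmult_plus_distr_l; lra.
Qed.

Lemma chi_abs d : Rabs (chi d) <= 1.
Proof. by rewrite /chi; case: ifP => _; [|case: ifP => _]; rewrite ?Rabs_Ropp ?Rabs_R1 ?Rabs_R0; lra. Qed.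

Lemma ap_shift (lam : nat -> C) a b d r h :
  \csum_(a.+1 <= n < b.+1 | (n == r %[mod d])%N) lam (n + h)%N =
  \csum_((a + h).+1 <= n < (b + h).+1 | (n == r + h %[mod d])%N) lam n.
Proof.
rewrite -!addSn big_addn addnK; apply: eq_bigl => n.
by rewrite eqn_modDr.
Qed.

Lemma csum_exch (A B N : nat) (F : nat -> nat -> C) (Q : nat -> nat -> bool) :
  \csum_(1 <= n < N.+1) \csum_(A <= d < B | Q n d) F n d =
  \csum_(A <= d < B) \csum_(1 <= n < N.+1 | Q n d) F n d.
Proof.
rewrite (eq_bigr (fun n => \csum_(A <= d < B) (if Q n d then F n d else RtoC 0))) => [|d _]; last by rewrite big_mkcond.
by rewrite exchange_big /=; apply: eq_bigr => c _; rewrite -big_mkcond.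
Qed.

(** A divisor d > D of n is n / m with m <= D, because n < (D + 1)^2; the condition d > D reads m D
    < n. *)
Lemma complement_divisors (F : nat -> C) n N D : (0 < n <= N)%N -> (N < D.+1 * D.+1)%N ->
  \csum_(D.+1 <= d < N.+1 | (d %| n)%N) F d =
  \csum_(1 <= m < D.+1 | (m %| n)%N && (m * D < n)%N) F (n %/ m)%N.
Proof.
move=> /andP [n0 nN] ND.
rewrite -big_filter -[RHS]big_filter.
rewrite (perm_big [seq (n %/ m)%N | m <- index_iota 1 D.+1 & (m %| n)%N && (m * D < n)%N]) /=; first by rewrite big_map.
have dvK m : (m %| n)%N -> (n %/ (n %/ m) = m)%N by move=> mn; rewrite divnA // mulKn.
apply: uniq_perm; first by rewrite filter_uniq ?iota_uniq.
  rewrite map_inj_in_uniq ?filter_uniq ?iota_uniq // => x y.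
  rewrite !mem_filter => /andP [/andP [cx _] _] /andP [/andP [cy _] _] E.
  by rewrite -(dvK x) // E dvK.
move=> d; rewrite mem_filter mem_index_iota; apply/idP/mapP.
  move=> /andP [dn /andP [Dd dN]]; exists (n %/ d)%N; last by rewrite dvK.
  have d0 : (0 < d)%N := leq_ltn_trans (leq0n D) Dd.
  have dl := dvdn_leq n0 dn; have q0 : (0 < n %/ d)%N by rewrite divn_gt0.
  have E := divnK dn.
  rewrite mem_filter mem_index_iota q0 /=.
  have -> : (n %/ d %| n)%N by apply/dvdnP; exists d; rewrite mulnC.
  by apply/andP; split; nia.
move=> [m]; rewrite mem_filter mem_index_iota => /andP [/andP [mn mD] /andP [m0 mD']] ->.
have E := divnK mn; have -> : (n %/ m %| n)%N by apply/dvdnP; exists m; rewrite mulnC.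
by move: (n %/ m)%N E => q E; apply/and3P; split => //; nia.
Qed.

(** The character of the complementary divisor becomes a difference of two classes modulo 4 m; hence
    the moduli up to 4 D. *)
Lemma chi_quot n m (z : C) : (0 < m)%N ->
  (if (m %| n)%N then RtoC (chi (n %/ m)) * z else RtoC 0)%C =
  ((if (n == m %[mod 4 * m])%N then z else RtoC 0) - (if (n == 3 * m %[mod 4 * m])%N then z else RtoC 0))%C.
Proof.
move=> m0.
have Q j q : (j < 4)%N -> ((q * m) == j * m %[mod 4 * m])%N = (q %% 4 == j)%N.
  by move=> j4; rewrite -!muln_modl eqn_pmul2r // (modn_small j4).
case: ifP => mn.
  have -> : (n == m %[mod 4 * m])%N = ((n %/ m) %% 4 == 1)%N by rewrite -(Q 1%N) // divnK // mul1n.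
  have -> : (n == 3 * m %[mod 4 * m])%N = ((n %/ m) %% 4 == 3)%N by rewrite -(Q 3%N) // divnK.
  rewrite /chi.
  by case: eqP => [->|_] /=; [|case: eqP => _]; ring.
have ND j : (n == j * m %[mod 4 * m])%N = false.
  apply/negP => /eqP E; case/negP: (negbT mn).
  by rewrite /dvdn -(@modn_dvdm (4 * m)) ?dvdn_mull // E modn_dvdm ?dvdn_mull // modnMl.
by rewrite -{2}(mul1n m) !ND; ring.
Qed.

Lemma hyperbola (lam : nat -> C) N D h : (D * D <= N)%N -> (N < D.+1 * D.+1)%N ->
  \csum_(1 <= n < N.+1) (lam (n + h)%N * RtoC (INR (r2 n))) =
  (RtoC 4 * (\csum_(1 <= d < D.+1) (RtoC (chi d) * \csum_(h.+1 <= n < (N + h).+1 | (n == h %[mod d])%N) lam n) +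
     \csum_(1 <= m < D.+1)
       (\csum_((m * D + h).+1 <= n < (N + h).+1 | (n == m + h %[mod 4 * m])%N) lam n -
        \csum_((m * D + h).+1 <= n < (N + h).+1 | (n == 3 * m + h %[mod 4 * m])%N) lam n)))%C.
Proof.
move=> DN ND.
have DlN : (D <= N)%N by nia.
have -> : \csum_(1 <= n < N.+1) (lam (n + h)%N * RtoC (INR (r2 n))) =
  (RtoC 4 * (\csum_(1 <= n < N.+1) (\csum_(1 <= d < D.+1 | (d %| n)%N) (RtoC (chi d) * lam (n + h)%N) +
     \csum_(1 <= m < D.+1 | (m %| n)%N && (m * D < n)%N) (RtoC (chi (n %/ m)) * lam (n + h)%N))))%C.
  rewrite -csum_scal big_seq [RHS]big_seq; apply: eq_bigr => n; rewrite mem_index_iota => /andP [n0 nN].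
  have -> : \csum_(1 <= m < D.+1 | (m %| n)%N && (m * D < n)%N) (RtoC (chi (n %/ m)) * lam (n + h)%N) =
     \csum_(D.+1 <= d < N.+1 | (d %| n)%N) (RtoC (chi d) * lam (n + h)%N).
    by rewrite -(@complement_divisors (fun d => RtoC (chi d) * lam (n + h)%N)%C n N D) // n0.
  rewrite -[X in (RtoC 4 * X)%C](@big_cat_nat _ _ _ D.+1) //.
  rewrite jacobi // /dchi RtoC_mult.
  have -> : RtoC (\rsum_(d <- divisors n) chi d) = \csum_(1 <= d < N.+1 | (d %| n)%N) RtoC (chi d).
    rewrite (big_morph RtoC (id1 := RtoC 0) (op1 := Cplus)) //; last exact: RtoC_plus.
    rewrite -[RHS]big_filter; apply: perm_big; apply: uniq_perm; rewrite ?filter_uniq ?divisors_uniq ?iota_uniq // => d.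
    rewrite mem_filter mem_index_iota -dvdn_divisors //; case dn: (d %| n)%N => //=.
    by have := dvdn_leq n0 dn; have := dvdn_gt0 n0 dn; lia.
  have -> : \csum_(1 <= d < N.+1 | (d %| n)%N) (RtoC (chi d) * lam (n + h)%N) = (lam (n + h)%N * \csum_(1 <= d < N.+1 | (d %| n)%N) RtoC (chi d))%C.
    by rewrite -csum_scal; apply: eq_bigr => d _; rewrite Cmult_comm.
  by ring.
congr Cmult; rewrite big_split /=; congr Cplus.
  rewrite csum_exch; apply: eq_bigr => d _; rewrite csum_scal; congr Cmult.
  have := ap_shift lam 0 N d 0 h; rewrite !add0n => <-; apply: eq_bigl => n.
  by rewrite mod0n.
rewrite csum_exch big_seq [RHS]big_seq; apply: eq_bigr => m; rewrite mem_index_iota => /andP [m0 mD].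
have mDN : (m * D <= N)%N by nia.
rewrite (@big_cat_nat _ _ _ (m * D).+1) //= big_nat_cond big1 ?Cplus_0_l; last first.
  by move=> n /andP [/andP [_ h1] /andP [_ h2]]; lia.
rewrite -!ap_shift !(big_mkcond (fun n => n == _ %[mod _])%N) /=.
have -> (x y : C) : (x - y = x + RtoC (-1) * y)%C by ring.
rewrite -csum_scal -big_split /= big_mkcond big_seq [RHS]big_seq; apply: eq_bigr => n.
rewrite mem_index_iota => /andP [mn _]; rewrite mn andbT (chi_quot _ _ m0); ring.
Qed.

Lemma sum_4 D (F : nat -> R) : (forall d, (0 < d)%N -> 0 <= F d) ->
  \rsum_(1 <= m < D.+1) F (4 * m)%N <= \rsum_(1 <= d < (4 * D).+1) F d.
Proof.
move=> F0; elim: D => [|D IH]; first by rewrite !big_geq //; lra.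
rewrite rsum_recr // [X in _ <= X](@rsum_split _ _ (4 * D).+1); last by lia.
apply: Rplus_le_compat => //.
rewrite (_ : (4 * D.+1) = (4 * D).+4)%N; last by lia.
have := F0 (4 * D).+1 isT; have := F0 (4 * D).+2 isT; have := F0 (4 * D).+3 isT.
do 4 (rewrite rsum_recr; last by lia).
by rewrite big_geq //; lra.
Qed.

Lemma natural_bound (k : nat) (g : C -> C) (lam : nat -> C) (th eps : R) : nice k g lam ->
  eigenvalue_bound lam th -> th <= 1 / 2 -> 0 < eps ->
  exists A, 0 <= A /\ forall N h, (0 < h <= N)%N ->
    Cmod (\csum_(1 <= n < N.+1) (lam (n + h)%N * RtoC (INR (r2 n)))) <=
    A * Rpower (INR N) (1 - (1 - 4 * th) / 8 + eps).
Proof.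
move=> nf Hth th2 eps0; have th0 := n_theta nf Hth.
(* Seven powers of P = (8 N)^e are spent: three in [ap_prefix] and four in [ap_term_sum]. *)
pose e := eps / 7; have e0 : 0 < e by rewrite /e; lra.
have [C0 [K [C00 K0 HK HS HH]]] := klc_weight e0.
have [C1 [C10 HA]] := ap_prefix nf Hth th0 e0 K0 HK.
have [C2 [C20 HT]] := ap_term_sum e0 th0 C00 K0 HS HH.
pose c8 := Rpower 8 e ^ 7 * (8 + 2 * Rpower 8 th).
exists (4 * (C1 * 6 * C2 * c8)); split.
  have : 0 <= c8.
    have := Rp_gt0 8 th; have : 0 <= Rpower 8 e ^ 7 by apply: pow_le; left; exact: Rp_gt0.
    by rewrite /c8; nra.
  by move=> c80; apply: Rmult_le_pos; [lra | apply: Rmult_le_pos => //; apply: Rmult_le_pos => //; lra].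
move=> N h /andP [h0 hN]; have N0 : (0 < N)%N by exact: leq_trans h0 hN.
have NR := INR_pos N0; have N1 := INR_ge1 N0.
pose D := Nat.sqrt N.
have [DN ND] : (D * D <= N)%N /\ (N < D.+1 * D.+1)%N.
  by have := Nat.sqrt_spec N ltac:(lia); rewrite /D; lia.
have D0 : (0 < D)%N by case: (posnP D) => // E; move: ND; rewrite E; lia.
(* This balances the two terms of [X0]. As th <= 1/2 the exponent is at least 5/8, so that D <= sqrt
   N <= y <= Y. *)
pose y := Rpower (INR N) (7 / 8 - th / 2).
have y1 : 1 <= y by apply: Rp_ge1; lra.
pose Y := Z.to_nat (up y).
have [u1 u2] := archimed y.
have upos : (0 < up y)%Z by apply: lt_IZR; lra.
have YE : INR Y = IZR (up y) by rewrite INR_IZR_INZ Z2Nat.id //; lia.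
have Y1 : y <= INR Y by rewrite YE; lra.
have Y2 : INR Y <= 2 * y by rewrite YE; lra.
have Y0 : (0 < Y)%N by rewrite /Y; lia.
have YR := INR_pos Y0.
have YN : (Y <= 2 * N)%N.
  apply: leINR; rewrite mult_INR; apply: Rle_trans Y2 _.
  rewrite (_ : INR 2 = 2) //; apply: Rmult_le_compat_l; first lra.
  by rewrite -[X in _ <= X]Rpower_1 //; apply: Rp_expo => //; lra.
have DY : (4 * D <= 4 * Y)%N.
  rewrite leq_pmul2l //; apply: leINR; apply: Rle_trans Y1.
  apply: (Rle_trans _ (sqrt (INR N))).
    rewrite -(sqrt_square (INR D)); last exact: pos_INR.
    by apply: sqrt_le_1_alt; rewrite -mult_INR; exact: INR_leq.
  by rewrite -Rp_half //; apply: Rp_expo => //; lra.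
set T := INR (8 * N) in HA HT *.
pose P := Rpower T e.
have T8 : T = 8 * INR N by rewrite /T mult_INR /=; ring.
pose phi := ap_term th K N h Y.
have phi0 d : (0 < d)%N -> 0 <= phi d by move=> d0; exact: ap_term_ge0.
have P0 : 0 < P by exact: Rp_gt0.
have CP : 0 <= C1 * P ^ 3 by apply: Rmult_le_pos => //; apply: pow_le; lra.
have inner d r a : (0 < d <= 8 * N)%N -> (a + h <= 2 * N)%N -> (a <= N)%N ->
    (forall p, prime p -> (2 < p)%N -> (p %| d)%N -> ~~ (p %| h)%N -> ~~ (p %| r)%N) ->
    Cmod (\csum_((a + h).+1 <= n < (N + h).+1 | (n == r %[mod d])%N) lam n) <= 2 * (C1 * P ^ 3 * phi d).
  move=> Hd ah aN Hr; apply: prefix_diff; first by rewrite leq_add2r.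
    by apply: (HA N h d r) => //; rewrite Y0.
  by apply: (HA N h d r) => //; rewrite ?Y0 //; lia.
have B1 : Cmod (\csum_(1 <= d < D.+1) (RtoC (chi d) * \csum_(h.+1 <= n < (N + h).+1 | (n == h %[mod d])%N) lam n)) <=
    2 * (C1 * P ^ 3) * \rsum_(1 <= d < D.+1) phi d.
  apply: Rle_trans (Cmod_sum _ _ _) _; rewrite -rsum_scal big_seq [X in _ <= X]big_seq.
  apply: rsum_le => d; rewrite mem_index_iota => /andP [d0 dD].
  rewrite Cmod_mult Cmod_R; have := chi_abs d; have := inner d h 0%N => I.
  have {}I := I ltac:(nia) ltac:(lia) isT _; rewrite add0n in I.
  have {}I := I (fun p _ _ _ H => H); have c0 := Cmod_ge_0 (\csum_(h.+1 <= n < (N + h).+1 | (n == h %[mod d])%N) lam n).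
  by have := Rabs_pos (chi d); nra.
have B2 : Cmod (\csum_(1 <= m < D.+1)
       (\csum_((m * D + h).+1 <= n < (N + h).+1 | (n == m + h %[mod 4 * m])%N) lam n -
        \csum_((m * D + h).+1 <= n < (N + h).+1 | (n == 3 * m + h %[mod 4 * m])%N) lam n)%C) <=
    4 * (C1 * P ^ 3) * \rsum_(1 <= m < D.+1) phi (4 * m)%N.
  apply: Rle_trans (Cmod_sum _ _ _) _; rewrite -rsum_scal big_seq [X in _ <= X]big_seq.
  apply: rsum_le => m; rewrite mem_index_iota => /andP [m0 mD].
  (* An odd prime dividing 4 m divides m; if it also divided j m + h it would divide h. *)
  have co j p : prime p -> (2 < p)%N -> (p %| 4 * m)%N -> ~~ (p %| h)%N -> ~~ (p %| j * m + h)%N.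
    move=> pp p2; rewrite Euclid_dvdM // => /orP [p4|pm]; last by rewrite dvdn_addr // dvdn_mull.
    by move: p4; rewrite (_ : 4 = 2 ^ 2)%N // Euclid_dvdX // => /andP [] /(dvdn_leq (isT : 0 < 2)%N); lia.
  have I1 := inner (4 * m)%N (m + h)%N (m * D)%N ltac:(nia) ltac:(nia) ltac:(nia) _.
  have {}I1 := I1 (fun p pp p2 p4 ph => eq_ind (1 * m)%N (fun z => ~~ (p %| z + h)%N) (co 1%N p pp p2 p4 ph) m (mul1n m)).
  have I3 := inner (4 * m)%N (3 * m + h)%N (m * D)%N ltac:(nia) ltac:(nia) ltac:(nia) (co 3%N).
  apply: Rle_trans (Cmod_triangle _ _) _; rewrite Cmod_opp.
  by move: I1 I3; set s1 := Cmod _; set s3 := Cmod _; lra.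
have B3 : \rsum_(1 <= d < D.+1) phi d <= \rsum_(1 <= d < (4 * D).+1) phi d.
  rewrite [X in _ <= X](@rsum_split _ _ D.+1); last by lia.
  have : 0 <= \rsum_(D.+1 <= d < (4 * D).+1) phi d; last by lra.
  by rewrite big_seq; apply: rsum_ge0 => d; rewrite mem_index_iota => /andP [d0 _]; apply: phi0; lia.
have B4 := sum_4 D phi0.
have Q0 : (0 < 4 * D <= 4 * Y)%N by rewrite DY andbT; lia.
have QQ : (4 * D * (4 * D) <= 16 * N)%N by nia.
have B5 := HT N h Y (4 * D)%N ltac:(by rewrite h0) Y0 Q0 QQ.
rewrite -/phi -/P in B5; set S := \rsum_(1 <= d < (4 * D).+1) phi d in B3 B4 B5.
rewrite (hyperbola lam h DN ND) Cmod_mult Cmod_R Rabs_pos_eq; last lra.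
rewrite Rmult_assoc; apply: Rmult_le_compat_l; first lra.
apply: Rle_trans (Cmod_triangle _ _) _; apply: Rle_trans (Rplus_le_compat _ _ _ _ B1 B2) _.
set X0 := T * Rpower (INR N) (3 / 4) / INR Y + INR Y * Rpower T th in B5.
have XB : X0 <= (8 + 2 * Rpower 8 th) * Rpower (INR N) (7 / 8 + th / 2).
  rewrite Rmult_plus_distr_r; apply: Rplus_le_compat.
    have -> : 8 * Rpower (INR N) (7 / 8 + th / 2) = T * Rpower (INR N) (3 / 4) * / y.
      rewrite -Rpower_Ropp T8 Rmult_assoc Rmult_assoc -Rpower_plus -{2}(Rpower_1 (INR N)) // -Rpower_plus.
      by congr Rmult; congr Rpower; field.
    apply: Rmult_le_compat_l; last by apply: Rinv_le_contravar; lra.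
    by apply: Rmult_le_pos; [exact: pos_INR | left; exact: Rp_gt0].
  rewrite T8 Rp_mul //; last lra.
  have -> : 2 * Rpower 8 th * Rpower (INR N) (7 / 8 + th / 2) = 2 * y * (Rpower 8 th * Rpower (INR N) th).
    have -> : 7 / 8 + th / 2 = (7 / 8 - th / 2) + th by field.
    by rewrite Rpower_plus -/y; ring.
  apply: Rmult_le_compat_r => //; have := Rp_gt0 8 th; have := Rp_gt0 (INR N) th; nra.
have PE : P ^ 7 = Rpower 8 e ^ 7 * Rpower (INR N) eps.
  rewrite /P T8 Rp_mul //; last lra.
  rewrite Rpow_mult_distr; congr Rmult; rewrite -Rpower_pow; last exact: Rp_gt0.
  by rewrite Rpower_mult; congr Rpower; rewrite /e /=; field.
have -> : C1 * 6 * C2 * c8 * Rpower (INR N) (1 - (1 - 4 * th) / 8 + eps) =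
   6 * (C1 * P ^ 3) * (C2 * P ^ 4 * ((8 + 2 * Rpower 8 th) * Rpower (INR N) (7 / 8 + th / 2))).
  have -> : 1 - (1 - 4 * th) / 8 + eps = eps + (7 / 8 + th / 2) by field.
  rewrite Rpower_plus /c8.
  have -> : 6 * (C1 * P ^ 3) * (C2 * P ^ 4 * ((8 + 2 * Rpower 8 th) * Rpower (INR N) (7 / 8 + th / 2))) = 
    P ^ 7 * (6 * C1 * C2 * ((8 + 2 * Rpower 8 th) * Rpower (INR N) (7 / 8 + th / 2))) by ring.
  by rewrite PE; ring.
apply: (Rle_trans _ (6 * (C1 * P ^ 3) * S)).
  move: B3 B4 => /= B3 B4; set s1 := \rsum_(1 <= d < D.+1) phi d in B3 *.
  set s2 := \rsum_(1 <= m < D.+1) phi (4 * m)%N in B4 *.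
  by nra.
apply: Rmult_le_compat_l; first lra.
apply: Rle_trans B5 _; apply: Rmult_le_compat_l => //.
by apply: Rmult_le_pos => //; apply: pow_le; lra.
Qed.

Lemma bound_weaken (lam : nat -> C) s t : s <= t ->
  (exists A, forall n, (1 <= n)%coq_nat -> Cmod (lam n) <= A * Rpower (INR n) s) ->
  exists A, forall n, (1 <= n)%coq_nat -> Cmod (lam n) <= A * Rpower (INR n) t.
Proof.
move=> st [A HA]; exists (Rabs A) => n n0; apply: Rle_trans (HA n n0) _.
have n1 : 1 <= INR n by apply: INR_ge1; lia.
have := Rp_expo n1 st; have := Rle_abs A; have := Rabs_pos A; have := Rp_gt0 (INR n) s; nra.
Qed.

(* The constant of the theorem must not depend on theta, so the estimate is proved
    for the least admissible one. *)
Lemma optimal_theta (k : nat) (g : C -> C) (lam : nat -> C) : nice k g lam ->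
  exists th, [/\ eigenvalue_bound lam th, th <= 1 / 2 & forall t, eigenvalue_bound lam t -> th <= t].
Proof.
move=> nf.
have half : eigenvalue_bound lam (1 / 2).
  move=> e e0; apply: (@bound_weaken _ (1 / 2)); first lra.
  have [C0 [C00 H]] := lam_sq nf; exists (sqrt C0) => n n0.
  have n1 : (0 < n)%N by lia.
  have nR := INR_pos n1; rewrite (_ : 1 / 2 = / 2); last field.
  rewrite Rp_half // -sqrt_mult; [|lra|lra].
  rewrite -(sqrt_square (Cmod (lam n))); last exact: Cmod_ge_0.
  by apply: sqrt_le_1_alt; have := H n n1; rewrite /= Rmult_1_r.
(* The infimum of the admissible exponents, taken as the supremum of their opposites. *)
have [s [ub lub]] : { s | is_lub (fun s => eigenvalue_bound lam (- s)) s }.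
  apply: completeness; last by exists (- (1 / 2)); rewrite Ropp_involutive.
  by exists 0 => s /(n_theta nf); lra.
exists (- s); split.
(* The epsilon in [eigenvalue_bound] makes the infimum itself admissible: an exponent within e / 2
   of it is used with e / 2. *)
- move=> e e0; have [s' [Es' ss']] : exists s', eigenvalue_bound lam (- s') /\ s - e / 2 < s'.
    apply: Classical_Prop.NNPP => H; have : s <= s - e / 2; last lra.
    apply: lub => s' Es'; apply: Rnot_lt_le => L; apply: H; exists s'; split => //.
  by apply: (@bound_weaken _ (- s' + e / 2)); [lra | apply: Es'; lra].
- by have := ub (- (1 / 2)); rewrite Ropp_involutive => H; have := H half; lra.
- by move=> t Ht; have := ub (- t); rewrite Ropp_involutive => H; have := H Ht; lra.
Qed.

Lemma shifted_sum_bound (f : C -> C) (lam : nat -> C) :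
  (exists kappa : nat, holomorphic_hecke_cusp_form kappa f lam) \/
  (exists mu : C, maass_hecke_cusp_form mu f lam) ->
  forall eps : R, 0 < eps -> exists A : R, forall theta : R, eigenvalue_bound lam theta ->
  forall X : R, 1 < X -> forall h : nat, (1 <= h)%coq_nat -> INR h <= X ->
    Cmod (shifted_sum lam X h) <= A * Rpower X (1 - (1 - 4 * theta) / 8 + eps).
Proof.
move=> /form_nice [k [g nf]] eps eps0.
have [th [Hth th2 opt]] := optimal_theta nf.
have [A [A0 HA]] := natural_bound nf Hth th2 eps0.
have th0 := n_theta nf Hth.
exists A => t Ht X X1 h h1 hX.
rewrite /shifted_sum sum_n_m_big; set N := Z.to_nat (Int_part X).
have [I1 I2] := base_Int_part X.
have hI : (Z.of_nat h < Int_part X + 1)%Z.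
  by apply: lt_IZR; rewrite plus_IZR -INR_IZR_INZ; lra.
have hN : (0 < h <= N)%N by rewrite /N; lia.
apply: Rle_trans (HA N h hN) _; apply: Rmult_le_compat_l => //.
have NX : INR N <= X by rewrite /N INR_IZR_INZ Z2Nat.id //; lia.
have N0 : (0 < N)%N by lia.
(* The exponent of X increases with theta and X > 1, so the estimate for the least exponent implies
   it for every admissible one with the same constant. *)
have tt := opt t Ht.
apply: (Rle_trans _ (Rpower X (1 - (1 - 4 * th) / 8 + eps))).
  by apply: Rp_base => //; [exact: INR_pos | lra].
by apply: Rp_expo; lra.
Qed.
End ShiftedSum.

Require Import Defs.
From Stdlib Require Import Reals.
From Coquelicot Require Import Coquelicot.

Theorem corollary1 :
  forall (f : C -> C) (lam : nat -> C),
    (exists kappa : nat, holomorphic_hecke_cusp_form kappa f lam) \/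
    (exists mu : C, maass_hecke_cusp_form mu f lam) ->
  forall eps : R, 0 < eps ->
  exists A : R,
  forall theta : R, eigenvalue_bound lam theta ->
  forall X : R, 1 < X ->
  forall h : nat, (1 <= h)%nat -> INR h <= X ->
    Cmod (shifted_sum lam X h)
      <= A * Rpower X (1 - (1 - 4 * theta) / 8 + eps).
Proof. exact ShiftedSum.shifted_sum_bound. Qed.
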